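(* Let $q,q'\in\mathrm{D}^-(1,1)$ be not $p$-power roots of unity, and let $r\in\mathbb{R}$ satisfy $\max(|q-1|,|q'-1|)<r\le1$. Then one has an equivalence $$\mathrm{Def}^{\mathrm{Tay}}_{q,q'}:\ \sigma_q\text{-}\mathrm{Mod}(\mathcal{R}_K)^{[r]}\xrightarrow{\ \sim\ }\sigma_{q'}\text{-}\mathrm{Mod}(\mathcal{R}_K)^{[r]}.$$ The same equivalence holds between $(\sigma_q,\delta_q)\text{-}\mathrm{Mod}(\mathcal{R}_K)^{[r]}$ and $(\sigma_{q'},\delta_{q'})\text{-}\mathrm{Mod}(\mathcal{R}_K)^{[r]}$, without assuming that $q$ and $q'$ are not $p$-power roots of unity. Moreover, if $q$ is not a $p$-power root of unity and $|q-1|<r$, then the functor forgetting the connection is an equivalence $$\mathrm{Forget}\ \delta_q:\ (\sigma_q,\delta_q)\text{-}\mathrm{Mod}(\mathcal{R}_K)^{[r]}\xrightarrow{\ \sim\ }\sigma_q\text{-}\mathrm{Mod}(\mathcal{R}_K)^{[r]}.$$ The analogous statement holds with $\mathcal{R}_K$ replaced by $\mathcal{H}^\dagger_K$.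
   Context: $K$ is a complete ultrametric valued field of mixed characteristic $(0,p)$. $\mathcal{A}_K(I)$ is the ring of Laurent series $\sum_{i\in\mathbb{Z}}a_iT^i$, $a_i\in K$, convergent for $|T|\in I$, with norms $|\sum a_iT^i|_\rho=\sup_i|a_i|\rho^i$. $\mathcal{R}_K=\bigcup_{\varepsilon>0}\mathcal{A}_K(]1-\varepsilon,1[)$, $\mathcal{H}^\dagger_K=\bigcup_{\varepsilon>0}\mathcal{A}_K(]1-\varepsilon,1+\varepsilon[)$. $\sigma_q:f(T)\mapsto f(qT)$, $\delta_1=T\frac{d}{dT}$. For $\mathrm{B}=\mathcal{R}_K$ or $\mathcal{H}_K^\dagger$ a $\sigma_q$-module is a finite free $\mathrm{B}$-module $\mathrm{M}$ with a continuous $\sigma_q$-semilinear automorphism $\sigma_q^{\mathrm{M}}$; a $(\sigma_q,\delta_q)$-module has in addition a connection $\delta_1^{\mathrm{M}}$ (Leibniz rule for $\delta_1$). Morphisms are $\mathrm{B}$-linear maps commuting with the operators. In a basis $(e_i)$ the associated equations are $\sigma_q(Y)=A(q,T)Y$, $\delta_1(Y)=G(1,T)Y$, where $\sigma_q^{\mathrm{M}}(e_i)=\sum_ja_{ij}(q,T)e_j$, $\delta_1^{\mathrm{M}}(e_i)=\sum_jg_{ij}e_j$. For $q$ not a root of unity: $d_q=\frac{\sigma_q-1}{(q-1)T}$, $H_0=\mathrm{Id}$, $H_1=\frac{A(q,T)-\mathrm{Id}}{(q-1)T}$, $H_{n+1}=d_q(H_n)+\sigma_q(H_n)H_1$, $Y_{A(q,T)}(x,y)=\sum_nH_n(y)\frac{(x-y)_{q,n}}{[n]^!_q}$,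 with $(x-y)_{q,n}=\prod_{i=0}^{n-1}(x-q^iy)$, $[n]^!_q=\prod_{i=1}^n\frac{q^i-1}{q-1}$. The module comes from an annulus $|T|\in I_\varepsilon$ ($I_\varepsilon=]1-\varepsilon,1[$ for $\mathcal{R}_K$, $]1-\varepsilon,1+\varepsilon[$ for $\mathcal{H}^\dagger_K$); for $\rho\in I_\varepsilon$, $Ray(\mathrm{M},\rho):=\min(\rho,\liminf_n(|H_n|_\rho/|[n]^!_q|)^{-1/n})$, defined when $\liminf_n(\cdots)>|q-1|\rho$. For $|q-1|<r\leq1$, $\sigma_q\text{-}\mathrm{Mod}(\mathcal{R}_K)^{[r]}$ is the full subcategory of $\sigma_q$-modules with $\lim_{\rho\to1^-}Ray(\mathrm{M},\rho)\ge r$ (the radius being defined for $\rho$ close to $1$), and $\sigma_q\text{-}\mathrm{Mod}(\mathcal{H}_K^\dagger)^{[r]}$ is defined by $Ray(\mathrm{M},1)\ge r$. For $(\sigma_q,\delta_q)$-modules ($q$ possibly a root of unity), put $G_{[0]}=\mathrm{Id}$, $G_{[1]}=G(1,T)/T$, $G_{[n+1]}=G'_{[n]}+G_{[n]}G_{[1]}$, $Y_{G(1,T)}(x,y)=\sum_nG_{[n]}(y)\frac{(x-y)^n}{n!}$, $Ray(\mathrm{M},\rho)=\min(\rho,\liminf_n(|G_{[n]}|_\rho/|n!|)^{-1/n})$; $(\sigma_q,\delta_q)\text{-}\mathrm{Mod}(\mathrm{B})^{[r]}$ is defined by the same radius conditions together with the requirement that, for $\rho$ close to $1$ in $I_\varepsilon$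 and $t_\rho$ a generic point of $|T|=\rho$, $Y_{G(1,T)}(T,t_\rho)$ is also a solution of $\sigma_q(Y)=A(q,T)Y$. $\mathrm{Def}^{\mathrm{Tay}}_{q,q'}$ keeps the underlying $\mathrm{B}$-module (and the connection, for $(\sigma,\delta)$-modules) and replaces $\sigma_q^{\mathrm{M}}$ by the operator $\sigma_{q'}^{\mathrm{M}}$ whose matrix is $A(q',T):=Y(q'T,T)$, where $Y(x,y)$ is the generic Taylor solution of $\mathrm{M}$; that is, it sends a module to the one having the same generic Taylor solution; it is the identity on morphisms. *)

(* Defs.v *)
Set Warnings "-all".
From HB Require Import structures.
From mathcomp Require Import all_boot all_order all_algebra.
From mathcomp Require Import all_classical all_reals all_analysis.
From mathcomp Require Import zify ring lra.
Set Implicit Arguments.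
Unset Strict Implicit.
Unset Printing Implicit Defensive.
Import Order.TTheory GRing.Theory Num.Theory.
Import numFieldNormedType.Exports.
Local Open Scope classical_set_scope.
Local Open Scope ring_scope.

Definition abs_cvg (R : realType) (K : zmodType) (v : K -> R) (u : nat -> K)
    (l : K) : Prop :=
  forall e : R, 0 < e -> exists N : nat, forall n, (N <= n)%N -> v (u n - l) < e.

Definition abs_cauchy (R : realType) (K : zmodType) (v : K -> R)
    (u : nat -> K) : Prop :=
  forall e : R, 0 < e ->
    exists N : nat, forall m n, (N <= m)%N -> (N <= n)%N -> v (u m - u n) < e.

(* As [p] is prime, [cu_p_lt1] says that the residue field has
   characteristic [p]. *)
Record cufield (R : realType) (p : nat) := CUField {
  cu_sort :> fieldType;
  vabs : cu_sort -> R;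
  vabs_ge0 : forall x, 0 <= vabs x;
  vabs_eq0 : forall x, vabs x = 0 <-> x = 0;
  vabsM : forall x y, vabs (x * y) = vabs x * vabs y;
  vabsD : forall x y, vabs (x + y) <= Num.max (vabs x) (vabs y);
  cu_complete : forall u, abs_cauchy vabs u -> exists l, abs_cvg vabs u l;
  cu_char0 : [pchar cu_sort] =i pred0;
  cu_p_prime : prime p;
  cu_p_lt1 : vabs p%:R < 1
}.

Section Summation.
Variables (R : realType) (p : nat) (K : cufield R p).
Implicit Types (x y z : K) (u v : nat -> K) (a b f g h : int -> K).

(* Sums of series; both are junk when the series does not converge. *)
Definition vlim u : K := xget 0 [set l | abs_cvg (@vabs R p K) u l].
Definition sumN u : K := vlim (fun N => \sum_(n < N) u n).
Definition psumZ a (N : nat) : K := \sum_(i < N.*2.+1) a (i%:Z - N%:Z).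
Definition sumZ a : K := vlim (psumZ a).

Lemma vabs0 : vabs (0 : K) = 0. Proof. exact/vabs_eq0. Qed.

Lemma vabs1 : vabs (1 : K) = 1.
Proof.
have := vabsM (1 : K) 1; rewrite mulr1 => /esym/eqP.
rewrite -subr_eq0 -{3}[vabs _]mulr1 -mulrBr mulf_eq0 => /orP[] /eqP H.
  by have /eqP := (vabs_eq0 (1 : K)).1 H; rewrite oner_eq0.
by apply/eqP; rewrite -subr_eq0 H.
Qed.

Lemma vabsN x : vabs (- x) = vabs x.
Proof.
have H1 : vabs (-1 : K) = 1.
  have : vabs (-1 : K) ^+ 2 = 1 by rewrite expr2 -vabsM mulrNN mulr1 vabs1.
  by move=> /eqP; rewrite sqrf_eq1 => /orP[/eqP//|/eqP E];
     have := vabs_ge0 (-1 : K); rewrite E; lra.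
by rewrite -mulN1r vabsM H1 mul1r.
Qed.

Lemma vabsB x y : vabs (x - y) = vabs (y - x).
Proof. by rewrite -vabsN opprB. Qed.

Lemma vabsD_le x y c : vabs x <= c -> vabs y <= c -> vabs (x + y) <= c.
Proof. by move=> ? ?; apply: le_trans (vabsD _ _) _; rewrite ge_max; apply/andP. Qed.

Lemma vabsD_lt x y c : vabs x < c -> vabs y < c -> vabs (x + y) < c.
Proof. by move=> ? ?; apply: le_lt_trans (vabsD _ _) _; rewrite gt_max; apply/andP. Qed.

Lemma vabsX x n : vabs (x ^+ n) = vabs x ^+ n.
Proof. by elim: n => [|n IH]; rewrite ?expr0 ?vabs1// !exprS vabsM IH. Qed.

Lemma vabsV x : vabs x^-1 = (vabs x)^-1.
Proof.
have [->|x0] := eqVneq x 0; first by rewrite invr0 vabs0 invr0.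
have := vabsM x x^-1; rewrite mulfV// vabs1 => E.
have nz : vabs x != 0 by apply/eqP => /vabs_eq0/eqP; rewrite (negPf x0).
by rewrite -[LHS](mulKf nz) -E mulr1.
Qed.

Lemma vabsXz x (i : int) : vabs (x ^ i) = vabs x ^ i.
Proof. by case: i => n; rewrite ?NegzE -?exprnN -?exprnP ?vabsV vabsX. Qed.

Lemma vabs_nat_le1 n : vabs (n%:R : K) <= 1.
Proof. by elim: n => [|n IH]; rewrite ?vabs0// -natr1 vabsD_le// vabs1. Qed.

Lemma vabs_int_le1 (i : int) : vabs (i%:~R : K) <= 1.
Proof. by case: i => n; rewrite ?NegzE ?mulrNz ?vabsN; apply: vabs_nat_le1. Qed.

Lemma abs_cvg_uniq u x y :
  abs_cvg (@vabs R p K) u x -> abs_cvg (@vabs R p K) u y -> x = y.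
Proof.
move=> cx cy; apply/eqP; rewrite -subr_eq0; apply/eqP/vabs_eq0.
apply/eqP; rewrite eq_le vabs_ge0 andbT leNgt; apply/negP => e0.
have [N1 H1] := cx _ e0; have [N2 H2] := cy _ e0.
pose z := u (maxn N1 N2).
have : vabs ((x - z) + (z - y)) < vabs (x - y).
  apply: vabsD_lt; last by apply: H2; rewrite leq_maxr.
  by rewrite vabsB; apply: H1; rewrite leq_maxl.
by rewrite subrKA ltxx.
Qed.

Lemma vlimE u x : abs_cvg (@vabs R p K) u x -> vlim u = x.
Proof.
move=> cx; apply: (@abs_cvg_uniq u) => //.
by apply: (@xgetPex _ 0 [set l | abs_cvg (@vabs R p K) u l]); exists x.
Qed.

Definition nullZ a := forall e : R, 0 < e ->
  exists N : nat, forall i : int, (N <= `|i|)%N -> vabs (a i) < e.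

Lemma psumZ0 a : psumZ a 0 = a 0.
Proof. by rewrite /psumZ big_ord_recl big_ord0 addr0 subr0. Qed.

Lemma psumZS a N :
  psumZ a N.+1 = psumZ a N + (a N.+1%:Z + a (- N.+1%:Z)).
Proof.
rewrite /psumZ doubleS big_ord_recl big_ord_recr /=.
rewrite [LHS]addrC -addrA; congr (_ + (_ + _)).
- by apply: eq_bigr => i _; congr a; rewrite /bump /=; lia.
- by congr a; rewrite /bump /=; lia.
- by congr a; lia.
Qed.

Lemma sumZ_cvg a : nullZ a -> abs_cvg (@vabs R p K) (psumZ a) (sumZ a).
Proof.
move=> na; have [l cl] : exists l, abs_cvg (@vabs R p K) (psumZ a) l.
  apply: cu_complete => e e0; have [N HN] := na _ e0.
  have HD k : vabs (psumZ a (N + k) - psumZ a N) < e.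
    elim: k => [|k IH]; first by rewrite addn0 subrr vabs0.
    rewrite addnS psumZS addrAC; apply: vabsD_lt => //.
    by apply: vabsD_lt; apply: HN; lia.
  exists N => m n Nm Nn.
  rewrite -(subrKA (psumZ a N)); apply: vabsD_lt.
    by rewrite -(subnKC Nm).
  by rewrite vabsB -(subnKC Nn).
by rewrite /sumZ (vlimE cl).
Qed.

Lemma sumZD a b : nullZ a -> nullZ b ->
  sumZ (fun i => a i + b i) = sumZ a + sumZ b.
Proof.
move=> na nb; apply: vlimE => e e0.
have [N1 H1] := sumZ_cvg na e0; have [N2 H2] := sumZ_cvg nb e0.
exists (maxn N1 N2) => n; rewrite geq_max => /andP[n1 n2].
rewrite /psumZ big_split /= opprD addrACA.
by apply: vabsD_lt; [apply: H1|apply: H2].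
Qed.

Lemma sumZ_le a c : nullZ a -> (forall i, vabs (a i) <= c) -> vabs (sumZ a) <= c.
Proof.
move=> na ac; have c0 : 0 <= c := le_trans (vabs_ge0 _) (ac 0).
apply/ler_addgt0Pr => e e0.
have [N HN] := sumZ_cvg na e0.
rewrite -[sumZ a](subrK (psumZ a N)); apply: vabsD_le.
  by rewrite vabsB; apply: le_trans (ltW (HN _ (leqnn _))) _; rewrite lerDr.
have : vabs (psumZ a N) <= c.
  rewrite /psumZ; apply: (big_ind (fun x => vabs x <= c)) => //.
    by rewrite vabs0.
  by move=> x y; exact: vabsD_le.
by move=> /le_trans; apply; rewrite lerDl ltW.
Qed.

Lemma sumZ_supp a k : (forall i, i != k -> a i = 0) -> sumZ a = a k.
Proof.
move=> ak; have E N : psumZ a N = if (`|k| <= N)%N then a k else 0.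
  elim: N => [|N IH].
    rewrite psumZ0; case: ifPn => H; first by congr a; lia.
    by apply: ak; lia.
  rewrite psumZS IH; have [kN|kN] := leqP `|k| N.
    by rewrite leqW// (ak N.+1%:Z) ?(ak (- N.+1%:Z)) ?addr0//; lia.
  rewrite add0r; have [kN'|kN'] := leqP `|k| N.+1; last first.
    by rewrite (ak N.+1%:Z) ?(ak (- N.+1%:Z)) ?addr0//; lia.
  have [kE|kE] : k = N.+1%:Z \/ k = - N.+1%:Z by lia.
    by rewrite -{1}kE (ak (- _)) ?addr0//; lia.
  by rewrite -kE (ak N.+1%:Z) ?add0r//; lia.
apply: vlimE => e e0; exists `|k|%N => n kn.
by rewrite E kn subrr vabs0.
Qed.

(* Convergence on the circle |T| = rho. *)
Definition cvg_at (rho : R) a := forall e : R, 0 < e ->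
  exists N : nat, forall i : int, (N <= `|i|)%N -> vabs (a i) * rho ^ i < e.

Definition lmono x (k : int) : int -> K := fun i => if i == k then x else 0.
Definition lmul a b : int -> K := fun n => sumZ (fun i => a i * b (n - i)).

Section At.
Variables (rho : R) (rho0 : 0 < rho).
Let rhoz (i : int) : 0 < rho ^ i. Proof. exact: exprz_gt0. Qed.
Let rhoD (i j : int) : rho ^ (i + j) = rho ^ i * rho ^ j.
Proof. by rewrite expfzDr// gt_eqF. Qed.
Let w a (i : int) := vabs (a i) * rho ^ i.
Let w_ge0 a i : 0 <= w a i.
Proof. by rewrite mulr_ge0 ?vabs_ge0 ?ltW. Qed.

Lemma cvg_at_bounded a : cvg_at rho a ->
  exists2 C : R, 0 < C & forall i, vabs (a i) * rho ^ i <= C.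
Proof.
move=> /(_ _ ltr01)[N HN].
have [C C0 HC] : exists2 C : R, 0 < C &
    forall i : int, (`|i| < N)%N -> w a i <= C.
  elim: N {HN} => [|N [C C0 IH]]; first by exists 1.
  exists (C + w a N%:Z + w a (- N%:Z)).
    by rewrite ltr_wpDr// ltr_wpDr.
  move=> i iN; have [/IH H|H] := ltnP `|i| N.
    by rewrite (le_trans H)// -addrA lerDl addr_ge0.
  have [->|->] : i = N%:Z \/ i = - N%:Z by lia.
    by rewrite addrAC lerDr addr_ge0// ltW.
  by rewrite lerDr addr_ge0// ltW.
exists (C + 1); first by rewrite ltr_wpDr.
move=> i; have [H|H] := leqP N `|i|.
  by apply: le_trans (ltW (HN _ H)) _; rewrite lerDr ltW.
by apply: le_trans (HC _ H) _; rewrite lerDl.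
Qed.

Let wM a b n i : vabs (a i * b (n - i)) * rho ^ n = w a i * w b (n - i).
Proof.
rewrite vabsM /w mulrACA; congr (_ * _).
by rewrite -rhoD; congr (_ ^ _); lia.
Qed.

Lemma lmul_null a b n : cvg_at rho a -> cvg_at rho b ->
  nullZ (fun i => a i * b (n - i)).
Proof.
move=> ca cb e e0; have [C C0 HC] := cvg_at_bounded cb.
have d0 : 0 < e * rho ^ n / C by rewrite divr_gt0// mulr_gt0.
have [N HN] := ca _ d0; exists N => i iN.
rewrite -(ltr_pM2r (rhoz n)) wM.
apply: (@le_lt_trans _ _ (w a i * C)).
  exact: ler_wpM2l (w_ge0 a i) _ _ (HC _).
by rewrite -ltr_pdivlMr//; apply: HN.
Qed.

Lemma lmul_le a b c d : cvg_at rho a -> cvg_at rho b ->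
  (forall i, vabs (a i) * rho ^ i <= c) ->
  (forall i, vabs (b i) * rho ^ i <= d) ->
  forall n, vabs (lmul a b n) * rho ^ n <= c * d.
Proof.
move=> ca cb ac bd n; rewrite -ler_pdivlMr//.
apply: sumZ_le; first exact: lmul_null.
by move=> i; rewrite ler_pdivlMr// wM ler_pM ?w_ge0 ?ac ?bd.
Qed.

Lemma lmul_cvg a b : cvg_at rho a -> cvg_at rho b -> cvg_at rho (lmul a b).
Proof.
move=> ca cb e e0.
have [C C0 HC] := cvg_at_bounded ca; have [D D0 HD] := cvg_at_bounded cb.
have [N1 H1] : exists N : nat, forall i : int, (N <= `|i|)%N -> w a i < e / 2 / D.
  by apply: ca; rewrite !divr_gt0.
have [N2 H2] : exists N : nat, forall i : int, (N <= `|i|)%N -> w b i < e / 2 / C.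
  by apply: cb; rewrite !divr_gt0.
exists (N1 + N2)%N => n nN; apply: (@le_lt_trans _ _ (e / 2)); last by lra.
rewrite -ler_pdivlMr//; apply: sumZ_le; first exact: lmul_null.
move=> i; rewrite ler_pdivlMr// wM.
have [iN|iN] := leqP N1 `|i|.
  apply: (@le_trans _ _ (e / 2 / D * D)); last by rewrite divfK// gt_eqF.
  by apply: ler_pM; rewrite ?w_ge0// ?HD// ltW// H1.
apply: (@le_trans _ _ (C * (e / 2 / C))); last first.
  by rewrite mulrC divfK// gt_eqF.
by apply: ler_pM; rewrite ?w_ge0// ?HC// ltW// H2//; lia.
Qed.

Lemma cvg_atD a b : cvg_at rho a -> cvg_at rho b -> cvg_at rho (fun i => a i + b i).
Proof.
move=> ca cb e e0; have [N1 H1] := ca _ e0; have [N2 H2] := cb _ e0.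
exists (maxn N1 N2) => i; rewrite geq_max => /andP[i1 i2].
rewrite -ltr_pdivlMr//; apply: vabsD_lt; rewrite ltr_pdivlMr//.
  exact: H1.
exact: H2.
Qed.

Lemma cvg_at_le a b : (forall i, vabs (b i) <= vabs (a i)) ->
  cvg_at rho a -> cvg_at rho b.
Proof.
move=> ba ca e e0; have [N H] := ca _ e0; exists N => i iN.
by apply: le_lt_trans (H _ iN); rewrite ler_wpM2r// ltW.
Qed.

Lemma cvg_at_supp a (N : nat) : (forall i : int, (N <= `|i|)%N -> a i = 0) ->
  cvg_at rho a.
Proof. by move=> aN e e0; exists N => i iN; rewrite aN// vabs0 mul0r. Qed.

Lemma cvg_at_lmono x k : cvg_at rho (lmono x k).
Proof.
apply: (@cvg_at_supp _ `|k|.+1) => i ik; rewrite /lmono; case: eqP => // ?; lia.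
Qed.

Lemma cvg_at_shift a (k : int) :
  cvg_at rho a -> cvg_at rho (fun i => a (i + k)).
Proof.
move=> ca e e0.
have [N H] := ca (e * rho ^ k) (mulr_gt0 e0 (rhoz k)).
exists (N + `|k|)%N => i iN.
by rewrite -(ltr_pM2r (rhoz k)) -mulrA -rhoD; apply: H; lia.
Qed.

Lemma lmulDl a b c : cvg_at rho a -> cvg_at rho b -> cvg_at rho c ->
  lmul (fun i => a i + b i) c = (fun i => lmul a c i + lmul b c i).
Proof.
move=> ca cb cc; apply/funext => n; rewrite /lmul -sumZD.
- by congr sumZ; apply/funext => i; rewrite mulrDl.
- exact: lmul_null.
- exact: lmul_null.
Qed.

Lemma lmulDr a b c : cvg_at rho a -> cvg_at rho b -> cvg_at rho c ->
  lmul c (fun i => a i + b i) = (fun i => lmul c a i + lmul c b i).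
Proof.
move=> ca cb cc; apply/funext => n; rewrite /lmul -sumZD.
- by congr sumZ; apply/funext => i; rewrite mulrDr.
- exact: lmul_null.
- exact: lmul_null.
Qed.

Lemma cvg_at_ext (Phi : (int -> K) -> K) (D : R) : 0 < D ->
  (forall a b, cvg_at rho a -> cvg_at rho b ->
     Phi (fun i => a i + b i) = Phi a + Phi b) ->
  (forall a c, cvg_at rho a -> (forall i, vabs (a i) * rho ^ i <= c) ->
     vabs (Phi a) <= D * c) ->
  (forall x k, Phi (lmono x k) = 0) ->
  forall a, cvg_at rho a -> Phi a = 0.
Proof.
move=> D0 PhiD Phib Phim a ca.
pose tr N : int -> K := fun i => if (`|i| <= N)%N then a i else 0.
have ctr N : cvg_at rho (tr N).
  by apply: (@cvg_at_supp _ N.+1) => i iN; rewrite /tr leqNgt iN.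
have Ptr N : Phi (tr N) = 0.
  elim: N => [|N IH].
    suff -> : tr 0 = lmono (a 0) 0 by [].
    apply/funext => i; rewrite /tr /lmono.
    by case: eqP => [->//|ni]; case: ifP => //; lia.
  have -> : tr N.+1 = (fun i => tr N i +
     (lmono (a N.+1%:Z) N.+1%:Z i + lmono (a (- N.+1%:Z)) (- N.+1%:Z) i)).
    apply/funext => i; rewrite /tr /lmono.
    have [iN|iN] := leqP `|i| N.
      rewrite leqW// ifF ?ifF ?addr0//; lia.
    have [->|n1] := eqVneq i N.+1%:Z.
      by rewrite ifT ?add0r ?ifF ?addr0//; lia.
    have [->|n2] := eqVneq i (- N.+1%:Z).
      by rewrite ifT ?add0r//; lia.
    by rewrite ifF ?addr0//; lia.
  rewrite !PhiD ?IH ?Phim ?addr0//; try exact: cvg_at_lmono.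
  by apply: cvg_atD; exact: cvg_at_lmono.
apply/vabs_eq0/eqP; rewrite eq_le vabs_ge0 andbT.
apply/ler_addgt0Pr => e e0; rewrite add0r.
have [N HN] := ca _ (divr_gt0 e0 D0).
pose rest i := if (`|i| <= N)%N then 0 else a i.
have crest : cvg_at rho rest.
  apply: (@cvg_at_le a) => // i; rewrite /rest.
  by case: ifP; rewrite // vabs0 vabs_ge0.
have aE : a = (fun i => tr N i + rest i).
  by apply/funext => i; rewrite /tr /rest; case: ifP; rewrite ?addr0 ?add0r.
rewrite aE PhiD// Ptr add0r.
apply: le_trans (Phib _ (e / D) crest _) _; last by rewrite mulrC divfK// gt_eqF.
move=> i; rewrite /rest; case: ifP => iN.
  by rewrite vabs0 mul0r ltW// divr_gt0.
by apply/ltW/HN; lia.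
Qed.

End At.

Lemma lmul_mono x y k l : lmul (lmono x k) (lmono y l) = lmono (x * y) (k + l).
Proof.
apply/funext => n; rewrite /lmul (@sumZ_supp _ k).
  rewrite /lmono eqxx (_ : (n - k == l) = (n == k + l)); last by lia.
  by case: ifP; rewrite ?mulr0.
by move=> i /negPf ik; rewrite /lmono ik mul0r.
Qed.

Lemma lmul1 a : lmul (lmono 1 0) a = a.
Proof.
apply/funext => n; rewrite /lmul (@sumZ_supp _ 0).
  by rewrite /lmono eqxx mul1r subr0.
by move=> i /negPf ik; rewrite /lmono ik mul0r.
Qed.

Lemma lmulC rho a b : 0 < rho -> cvg_at rho a -> cvg_at rho b ->
  lmul a b = lmul b a.
Proof.
move=> r0.
have bnd c d n (C : R) : cvg_at rho c -> cvg_at rho d -> forall s,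
    (forall i, vabs (c i) * rho ^ i <= s) ->
    (forall i, vabs (d i) * rho ^ i <= C) ->
    vabs (lmul c d n) <= C / rho ^ n * s.
  move=> cc cd s Hs HC.
  rewrite mulrAC ler_pdivlMr ?exprz_gt0// [C * s]mulrC.
  exact: lmul_le.
have step b' : cvg_at rho b' ->
    (forall x k, lmul (lmono x k) b' = lmul b' (lmono x k)) ->
    forall a', cvg_at rho a' -> lmul a' b' = lmul b' a'.
  move=> cb Hm a' ca; apply/funext => n; apply/eqP; rewrite -subr_eq0; apply/eqP.
  have [C C0 HC] := cvg_at_bounded r0 cb.
  apply: (@cvg_at_ext _ r0 (fun a0 => lmul a0 b' n - lmul b' a0 n)
             (C / rho ^ n)) => //.
  - by rewrite divr_gt0 ?exprz_gt0.
  - move=> a1 a2 c1 c2; rewrite (lmulDl r0)// (lmulDr r0)//; ring.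
  - move=> a0 c ca0 Hc; apply: vabsD_le; first exact: bnd.
    rewrite vabsN mulrAC ler_pdivlMr ?exprz_gt0//.
    exact: lmul_le.
  - by move=> x k; rewrite Hm subrr.
move=> ca cb; apply: (step) => // x k; apply/esym; move: b cb; apply: step.
  exact: cvg_at_lmono.
by move=> y l; rewrite !lmul_mono mulrC addrC.
Qed.

Lemma lmulA rho a b c : 0 < rho ->
  cvg_at rho a -> cvg_at rho b -> cvg_at rho c ->
  lmul a (lmul b c) = lmul (lmul a b) c.
Proof.
move=> r0.
pose T a b c n := lmul a (lmul b c) n - lmul (lmul a b) c n.
have cM := lmul_cvg r0.
have Tb (a0 b0 c0 : int -> K) (n : int) (s t d : R) : cvg_at rho a0 -> cvg_at rho b0 -> cvg_at rho c0 ->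
    (forall i, vabs (a0 i) * rho ^ i <= s) ->
    (forall i, vabs (b0 i) * rho ^ i <= t) ->
    (forall i, vabs (c0 i) * rho ^ i <= d) ->
    vabs (T a0 b0 c0 n) <= s * t * d / rho ^ n.
  move=> ca cb cc Ha Hb Hc; apply: vabsD_le; rewrite ?vabsN.
    rewrite ler_pdivlMr ?exprz_gt0// -mulrA.
    apply: (lmul_le r0) => //; [exact: cM|exact: lmul_le].
  rewrite ler_pdivlMr ?exprz_gt0//.
  apply: (lmul_le r0) => //; [exact: cM|exact: lmul_le].
have T0 (a0 b0 c0 : int -> K) (n : int) : cvg_at rho a0 -> cvg_at rho b0 -> cvg_at rho c0 ->
    T a0 b0 c0 n = 0.
  move=> ca cb cc.
  have [A A0 HA] := cvg_at_bounded r0 ca.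
  have [B B0 HB] := cvg_at_bounded r0 cb.
  have [C C0 HC] := cvg_at_bounded r0 cc.
  have rn : 0 < rho ^ n by rewrite exprz_gt0.
  apply: (@cvg_at_ext _ r0 (fun a0 => T a0 b0 c0 n) (B * C / rho ^ n)) => //.
  - by rewrite divr_gt0// mulr_gt0.
  - move=> a1 a2 c1 c2; rewrite /T !(lmulDl r0)//; try exact: cM.
    by ring.
  - move=> a1 s c1 H; apply: le_trans (Tb _ _ _ n _ _ _ c1 cb cc H HB HC) _.
    by rewrite le_eqVlt; apply/orP; left; apply/eqP; ring.
  move=> x k; have cx := cvg_at_lmono r0 x k.
  have [X X0 HX] := cvg_at_bounded r0 cx.
  apply: (@cvg_at_ext _ r0 (fun b0 => T (lmono x k) b0 c0 n)
            (X * C / rho ^ n)) => //.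
  - by rewrite divr_gt0// mulr_gt0.
  - move=> a1 a2 c1 c2.
    rewrite /T (lmulDl r0 c1 c2)// !(lmulDr r0)//; try exact: cM.
    by rewrite (lmulDl r0)//; [ring|exact: cM|exact: cM].
  - move=> a1 s c1 H; apply: le_trans (Tb _ _ _ n _ _ _ cx c1 cc HX H HC) _.
    by rewrite le_eqVlt; apply/orP; left; apply/eqP; ring.
  move=> y l; have cy := cvg_at_lmono r0 y l.
  have [Y Y0 HY] := cvg_at_bounded r0 cy.
  apply: (@cvg_at_ext _ r0 (fun c0 => T (lmono x k) (lmono y l) c0 n)
            (X * Y / rho ^ n)) => //.
  - by rewrite divr_gt0// mulr_gt0.
  - move=> a1 a2 c1 c2.
    rewrite /T (lmulDr r0 c1 c2)// !(lmulDr r0)//; try exact: cM.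
    by ring.
  - move=> a1 s c1 H; apply: le_trans (Tb _ _ _ n _ _ _ cx cy c1 HX HY H) _.
    by rewrite le_eqVlt; apply/orP; left; apply/eqP; ring.
  by move=> z m; rewrite /T !lmul_mono mulrA addrA subrr.
move=> ca cb cc; apply/funext => n; apply/eqP; rewrite -subr_eq0.
by apply/eqP; exact: T0.
Qed.

End Summation.

Inductive germ_kind := Robba | Overconvergent.

Definition annulus (R : realType) (B : germ_kind) (eps : R) : set R :=
  match B with
  | Robba => `]1 - eps, 1[
  | Overconvergent => `]1 - eps, 1 + eps[
  end.

(* Filter of the radii close to 1 in I_eps. *)
Definition near_one (R : realType) (B : germ_kind) : set_system R :=
  match B with
  | Robba => (1 : R)^'-
  | Overconvergent => nbhs (1 : R)
  end.

Definition cvg_on (R : realType) (p : nat) (K : cufield R p) (I : set R)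
    (a : int -> K) : Prop :=
  forall rho, I rho -> cvg_at rho a.

(* [germ K Robba] is R_K and [germ K Overconvergent] is H_K^dagger.  The bound
   [eps < 1] keeps all radii positive; since A_K(I) decreases with I it does
   not change the union. *)
Record germ (R : realType) (p : nat) (K : cufield R p) (B : germ_kind) := Germ {
  coef : int -> K;
  germP : exists2 eps : R, 0 < eps < 1 & cvg_on (annulus B eps) coef
}.

Section GermRing.
Variables (R : realType) (p : nat) (K : cufield R p) (B : germ_kind).
Local Notation G := (germ K B).
Implicit Types (f g h : G) (x : K) (I : set R).

Lemma germ_eq f g : coef f = coef g -> f = g.
Proof.
case: f g => [a Ha] [b Hb] /= E; rewrite -E in Hb *.
by congr Germ; exact: Prop_irrelevance.
Qed.

Lemma annulus_gt0 (eps rho : R) : 0 < eps < 1 -> annulus B eps rho -> 0 < rho.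
Proof. by case: B => /andP[_ e1] /=; rewrite in_itv/= => /andP[]; lra. Qed.

Lemma annulus_le (e1 e2 : R) : e1 <= e2 -> annulus B e1 `<=` annulus B e2.
Proof.
case: B => e12 x /=; rewrite !in_itv/= => /andP[H1 H2]; apply/andP; split; lra.
Qed.

Lemma annulus_mem (eps : R) : 0 < eps -> annulus B eps (1 - eps / 2).
Proof. by move=> e0; case: B => /=; rewrite in_itv /=; apply/andP; split; lra. Qed.

Lemma germ_common f g : exists2 eps : R, 0 < eps < 1 &
  cvg_on (annulus B eps) (coef f) /\ cvg_on (annulus B eps) (coef g).
Proof.
have [e1 /andP[e10 e11] H1] := germP f; have [e2 /andP[e20 e21] H2] := germP g.
exists (Num.min e1 e2).
  by rewrite lt_min e10 e20 /= gt_min e11.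
by split=> rho Hr; [apply: H1|apply: H2]; apply: annulus_le Hr;
  rewrite ge_min lexx ?orbT.
Qed.

Lemma germ_lift1 f (a : int -> K) :
  (forall rho, 0 < rho -> cvg_at rho (coef f) -> cvg_at rho a) ->
  exists2 eps : R, 0 < eps < 1 & cvg_on (annulus B eps) a.
Proof.
move=> H; have [e e01 He] := germP f; exists e => // rho Hr.
by apply: H; [exact: annulus_gt0 Hr|exact: He].
Qed.

Lemma germ_lift2 f g (a : int -> K) :
  (forall rho, 0 < rho -> cvg_at rho (coef f) -> cvg_at rho (coef g) ->
     cvg_at rho a) ->
  exists2 eps : R, 0 < eps < 1 & cvg_on (annulus B eps) a.
Proof.
move=> H; have [e e01 [He1 He2]] := germ_common f g; exists e => // rho Hr.
by apply: H; [exact: annulus_gt0 Hr|exact: He1|exact: He2].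
Qed.

Lemma germ_supp (a : int -> K) :
  (forall rho : R, 0 < rho -> cvg_at rho a) ->
  exists2 eps : R, 0 < eps < 1 & cvg_on (annulus B eps) a.
Proof.
move=> H; have h01 : 0 < (2^-1 : R) < 1 by apply/andP; split; lra.
by exists 2^-1 => // rho Hr; apply: H; exact: annulus_gt0 Hr.
Qed.

Definition gmono (x : K) (n : int) : G :=
  Germ (germ_supp (fun rho r0 => cvg_at_lmono r0 x n)).

Definition gadd f g : G :=
  Germ (@germ_lift2 f g _ (fun rho r0 => @cvg_atD _ _ _ _ r0 _ _)).

Lemma gopp_subproof f : exists2 eps : R, 0 < eps < 1 &
  cvg_on (annulus B eps) (fun i => - coef f i).
Proof.
apply: (@germ_lift1 f) => rho r0; apply: cvg_at_le => // i; by rewrite vabsN.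
Qed.
Definition gopp f : G := Germ (gopp_subproof f).

Definition gmul f g : G :=
  Germ (@germ_lift2 f g _ (fun rho r0 => @lmul_cvg _ _ _ _ r0 _ _)).

HB.instance Definition _ := gen_eqMixin G.
HB.instance Definition _ := gen_choiceMixin G.

Fact gaddA : associative gadd.
Proof. by move=> f g h; apply/germ_eq/funext => i /=; rewrite addrA. Qed.
Fact gaddC : commutative gadd.
Proof. by move=> f g; apply/germ_eq/funext => i /=; rewrite addrC. Qed.
Fact gadd0 : left_id (gmono 0 0) gadd.
Proof.
by move=> f; apply/germ_eq/funext => i /=; rewrite /lmono; case: eqP; rewrite add0r.
Qed.
Fact gaddN : left_inverse (gmono 0 0) gopp gadd.
Proof.
by move=> f; apply/germ_eq/funext => i /=; rewrite /lmono addNr; case: eqP.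
Qed.
HB.instance Definition _ := GRing.isZmodule.Build G gaddA gaddC gadd0 gaddN.

Fact gmulA : associative gmul.
Proof.
move=> f g h; apply/germ_eq => /=.
have [e1 /andP[e10 e11] H1] := germP f.
have [e2 e201 [H2 H3]] := germ_common g h; case/andP: e201 => e20 e21.
pose e := Num.min e1 e2.
have e0 : 0 < e by rewrite lt_min e10.
have r := annulus_mem e0; set rho := (X in annulus B e X) in r.
have r1 : annulus B e1 rho by apply: annulus_le r; rewrite ge_min lexx.
have r2 : annulus B e2 rho by apply: annulus_le r; rewrite ge_min lexx orbT.
apply: (@lmulA _ _ _ rho); [|exact: H1|exact: H2|exact: H3].
by apply: annulus_gt0 r1; rewrite e10.
Qed.
Fact gmulC : commutative gmul.
Proof.
move=> f g; apply/germ_eq => /=.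
have [e e01 [H1 H2]] := germ_common f g; have [e0 _] := andP e01.
have r := annulus_mem e0.
by apply: (lmulC (annulus_gt0 e01 r)); [exact: H1|exact: H2].
Qed.
Fact gmul1 : left_id (gmono 1 0) gmul.
Proof. by move=> f; apply/germ_eq; rewrite /= lmul1. Qed.
Fact gmulDl : left_distributive gmul gadd.
Proof.
move=> f g h; apply/germ_eq => /=.
have [e1 /andP[e10 e11] H1] := germP f.
have [e2 e201 [H2 H3]] := germ_common g h; case/andP: e201 => e20 e21.
pose e := Num.min e1 e2.
have e0 : 0 < e by rewrite lt_min e10.
have r := annulus_mem e0; set rho := (X in annulus B e X) in r.
have r1 : annulus B e1 rho by apply: annulus_le r; rewrite ge_min lexx.
have r2 : annulus B e2 rho by apply: annulus_le r; rewrite ge_min lexx orbT.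
apply: (@lmulDl _ _ _ rho); [|exact: H1|exact: H2|exact: H3].
by apply: annulus_gt0 r1; rewrite e10.
Qed.
Fact gone_neq0 : gmono 1 0 != 0 :> G.
Proof.
apply/eqP => /(congr1 (fun f => coef f 0)); rewrite /= /lmono eqxx.
by move/eqP; rewrite oner_eq0.
Qed.
HB.instance Definition _ := GRing.Zmodule_isComNzRing.Build G
  gmulA gmulC gmul1 gmulDl gone_neq0.

Definition gcst (x : K) : G := gmono x 0.
Definition gT : G := gmono 1 1.
Definition gTinv : G := gmono 1 (-1).

Lemma deriv_subproof f : exists2 eps : R, 0 < eps < 1 &
  cvg_on (annulus B eps) (fun i => (i + 1)%:~R * coef f (i + 1)).
Proof.
apply: (@germ_lift1 f) => rho r0 cf.
apply: (@cvg_at_le _ _ _ _ r0 (fun i => coef f (i + 1))).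
  by move=> i; rewrite vabsM ler_piMl ?vabs_ge0 ?vabs_int_le1.
exact: cvg_at_shift.
Qed.
Definition gderiv f : G := Germ (deriv_subproof f).
Definition delta1 f : G := gT * gderiv f.

End GermRing.

(* The open disk D^-(1,1). *)
Record disk11 (R : realType) (p : nat) (K : cufield R p) := Disk11 {
  disk_val :> K;
  disk_valP : vabs (disk_val - 1) < 1
}.

Section Sigma.
Variables (R : realType) (p : nat) (K : cufield R p) (B : germ_kind).
Variable q : disk11 K.
Local Notation G := (germ K B).
Implicit Types (f g : G).

Lemma vabs_disk11 : vabs (q : K) = 1.
Proof.
have H1 := disk_valP q; apply/eqP; rewrite eq_le; apply/andP; split.
  by rewrite -[X in vabs X](subrK 1); apply: vabsD_le; rewrite ?vabs1// ltW.
rewrite leNgt; apply/negP => H.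
have : vabs (1 - (q : K) + (q : K)) < 1 by apply: vabsD_lt => //; rewrite vabsB.
by rewrite subrK vabs1 ltxx.
Qed.

Lemma sigma_subproof f : exists2 eps : R, 0 < eps < 1 &
  cvg_on (annulus B eps) (fun i => (q : K) ^ i * coef f i).
Proof.
apply: (@germ_lift1 _ _ _ _ f) => rho r0; apply: cvg_at_le => // i.
by rewrite vabsM vabsXz vabs_disk11 exp1rz mul1r.
Qed.
Definition sigma f : G := Germ (sigma_subproof f).

Definition dquot f : G := gmono B ((q : K) - 1)^-1 (-1) * (sigma f - f).

End Sigma.

Definition not_ppower_root (p : nat) (K : fieldType) (q : K) : Prop :=
  forall n : nat, q ^+ (p ^ n) != 1.

(* [n]^!_q *)
Definition qfact (K : fieldType) (q : K) (n : nat) : K :=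
  \prod_(1 <= i < n.+1) ((q ^+ i - 1) / (q - 1)).

Section Norms.
Variables (R : realType) (p : nat) (K : cufield R p) (B : germ_kind).
Local Notation G := (germ K B).

(* It is +oo when the terms are unbounded. *)
Definition gnorm (rho : R) (f : G) : \bar R :=
  ereal_sup [set (vabs (coef f i) * rho ^ i)%:E | i in [set: int]].

Definition mxnorm (rho : R) m n (M : 'M[G]_(m, n)) : \bar R :=
  \big[maxe/0%E]_(i < m) \big[maxe/0%E]_(j < n) gnorm rho (M i j).

(* liminf_n (|M_n|_rho / |c_n|)^(-1/n), where 0^(-1/n) = +oo *)
Definition rad_liminf n (M : nat -> 'M[G]_n) (c : nat -> K) (rho : R) : \bar R :=
  limn_einf (fun k : nat =>
    ((poweR (mxnorm rho (M k) * ((vabs (c k))^-1)%:E) (k%:R^-1))^-1)%E).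

Definition ray n (M : nat -> 'M[G]_n) (c : nat -> K) (rho : R) : \bar R :=
  Order.min rho%:E (rad_liminf M c rho).

(* "Ray at 1 is at least r": through the limit at 1^- over R_K. *)
Definition ray_at_one_ge (r : R) (F : R -> \bar R) : Prop :=
  match B with
  | Robba => exists2 l : \bar R, F x @[x --> (1 : R)^'-] --> l & (r%:E <= l)%E
  | Overconvergent => (r%:E <= F 1%R)%E
  end.

(* "the radius is defined": near 1^- over R_K, at 1 over H_K^dagger. *)
Definition ray_defined (q : K) n (M : nat -> 'M[G]_n) (c : nat -> K) : Prop :=
  let P (rho : R) := ((vabs (q - 1) * rho)%R%:E < rad_liminf M c rho)%E in
  match B with
  | Robba => \forall rho \near (1 : R)^'-, P rho
  | Overconvergent => P 1
  end.

(* Convergence in the Frechet space A_K(I_eps), for some eps. *)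
Definition is_series (u : nat -> G) (s : G) : Prop :=
  exists2 eps : R, 0 < eps < 1 &
    [/\ forall k, cvg_on (annulus B eps) (coef (u k)),
        cvg_on (annulus B eps) (coef s) &
        forall rho, annulus B eps rho ->
          gnorm rho (\sum_(k < N) u k - s) @[N --> \oo] --> 0%E].

(* Ultrametric seminorms, continuous for the inductive limit topology:
   the restriction to each Frechet space A_K(I_eps) is bounded by a multiple
   of a maximum of finitely many of the norms |.|_rho, rho in I_eps. *)
Definition continuous_seminorm (s : G -> R) : Prop :=
  [/\ forall f, 0 <= s f,
      forall f g, s (f + g) <= Num.max (s f) (s g),
      forall (x : K) f, s (gcst B x * f) = vabs x * s f &
      forall eps, 0 < eps < 1 -> exists (C : R) (rhos : seq R),
        (forall rho, rho \in rhos -> annulus B eps rho) /\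
        (forall f, cvg_on (annulus B eps) (coef f) ->
           exists2 rho, rho \in rhos & ((s f)%:E <= C%:E * gnorm rho f)%E)].

End Norms.

Section Taylor.
Variables (R : realType) (p : nat) (K : cufield R p) (B : germ_kind).
Local Notation G := (germ K B).
Variable n : nat.
Implicit Types (A M : 'M[G]_n).

Fixpoint Hseq (q : disk11 K) A (k : nat) : 'M[G]_n :=
  match k with
  | 0 => 1%:M
  | k'.+1 => map_mx (@dquot _ _ _ B q) (Hseq q A k')
      + map_mx (@sigma _ _ _ B q) (Hseq q A k')
        *m (gmono B ((q : K) - 1)^-1 (-1) *: (A - 1%:M))
  end.

(* [M] is the matrix of the connection, i.e. G(1,T). *)
Fixpoint Gseq M (k : nat) : 'M[G]_n :=
  match k with
  | 0 => 1%:M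
  | k'.+1 => map_mx (@gderiv _ _ _ B) (Gseq M k') + Gseq M k' *m (gTinv K B *: M)
  end.

(* (x - y)_{q,n} *)
Definition qshift (q : K) (x y : G) (k : nat) : G :=
  \prod_(i < k) (x - gcst B (q ^+ i) * y).

(* [S = Y(q'T, T)], for the generic q-Taylor solution Y of sigma_q(Y) = A Y. *)
Definition qTaylor_value (q q' : disk11 K) A S : Prop :=
  forall i j, is_series (fun k =>
    Hseq q A k i j * qshift q (gcst B (q' : K) * gT K B) (gT K B) k
      * gcst B (qfact (q : K) k)^-1) (S i j).

(* [S = Y(q'T, T)], for the generic Taylor solution Y of delta_1(Y) = M Y. *)
Definition Taylor_value (q' : disk11 K) M S : Prop :=
  forall i j, is_series (fun k =>
    Gseq M k i j * (gcst B (q' : K) * gT K B - gT K B) ^+ k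
      * gcst B (k`!%:R)^-1) (S i j).

End Taylor.

Record cu_extension (R : realType) (p : nat) (K : cufield R p) := CUExtension {
  ext_field :> cufield R p;
  ext_emb : {rmorphism K -> ext_field};
  ext_abs : forall x, vabs (ext_emb x) = vabs x
}.

Section GenericPoints.
Variables (R : realType) (p : nat) (K : cufield R p) (B : germ_kind).
Variable Om : cu_extension K.
Local Notation G := (germ K B).

Definition generic_point (rho : R) (t : Om) : Prop :=
  forall P : {poly K}, vabs (map_poly (@ext_emb _ _ _ Om) P).[t] =
    \big[Num.max/0]_(i < size P) (vabs P`_i * rho ^+ i).

Definition geval (f : G) (x : Om) : Om :=
  sumZ (fun i => ext_emb Om (coef f i) * x ^ i).

(* Y_{G(1,T)}(x, t) *)
Definition Taylor_sol n (M : 'M[G]_n) (x t : Om) : 'M[Om]_n :=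
  \matrix_(i, j) sumN (fun k => geval (Gseq M k i j) t * (x - t) ^+ k / k`!%:R).

(* Y_{G(1,T)}(T, t) satisfies sigma_q(Y) = A Y on its disk of convergence
   |T - t| < Ray(M, rho). *)
Definition Taylor_sol_solves n (q : disk11 K) (A M : 'M[G]_n) (rho : R)
    (t : Om) : Prop :=
  forall x : Om,
    ((vabs (x - t))%:E < ray (Gseq M) (fun k => k`!%:R : K) rho)%E ->
    Taylor_sol M (ext_emb Om (q : K) * x) t =
      map_mx (fun f => geval f x) A *m Taylor_sol M x t.

End GenericPoints.

Record category := Category {
  obj :> Type;
  hom : obj -> obj -> Type;
  idm : forall a, hom a a;
  comp : forall a b c, hom b c -> hom a b -> hom a c;
  compA : forall a b c d (f : hom c d) (g : hom b c) (h : hom a b),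
    comp f (comp g h) = comp (comp f g) h;
  comp1m : forall a b (f : hom a b), comp (idm b) f = f;
  compm1 : forall a b (f : hom a b), comp f (idm a) = f
}.

Record functor (C D : category) := Functor {
  fobj :> C -> D;
  fmap : forall a b : C, hom a b -> hom (fobj a) (fobj b);
  fmap1 : forall a : C, fmap (idm a) = idm (fobj a);
  fmapM : forall (a b c : C) (f : hom b c) (g : hom a b),
    fmap (comp f g) = comp (fmap f) (fmap g)
}.

Definition functor_id (C : category) : functor C C :=
  @Functor C C (fun a => a) (fun _ _ f => f) (fun _ => erefl)
    (fun _ _ _ _ _ => erefl).

Program Definition functor_comp (C D E : category) (F : functor D E)
    (F' : functor C D) : functor C E :=
  @Functor C E (fun a => F (F' a)) (fun _ _ f => fmap F (fmap F' f)) _ _.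
Next Obligation. by move=> C D E F G a /=; rewrite !fmap1. Qed.
Next Obligation. by move=> C D E F G a b c f g /=; rewrite !fmapM. Qed.

Definition is_iso (C : category) (a b : C) (f : hom a b) : Prop :=
  exists g : hom b a, comp g f = idm a /\ comp f g = idm b.

Definition nat_iso (C D : category) (F F' : functor C D) : Prop :=
  exists eta : forall a : C, hom (F a) (F' a),
    (forall (a b : C) (f : hom a b),
       comp (eta b) (fmap F f) = comp (fmap F' f) (eta a)) /\
    (forall a, is_iso (eta a)).

Definition is_equivalence (C D : category) (F : functor C D) : Prop :=
  exists F' : functor D C,
    nat_iso (functor_comp F' F) (functor_id C) /\
    nat_iso (functor_comp F F') (functor_id D).

(* Categories whose objects are left modules endowed with a structure and
   whose morphisms are the linear maps compatible with the structures. *)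
Record modcat (A : nzRingType) := ModCat {
  mstr : lmodType A -> Type;
  mmor : forall X Y : lmodType A, mstr X -> mstr Y -> (X -> Y) -> Prop;
  mmor_id : forall X (s : mstr X), mmor s s (fun x => x);
  mmor_comp : forall X Y Z (s : mstr X) (t : mstr Y) (u : mstr Z) f g,
    mmor t u f -> mmor s t g -> mmor s u (fun x => f (g x))
}.

Section ModCat.
Variable A : nzRingType.

Section Category.
Variable S : modcat A.

Definition mobj := {X : lmodType A & mstr S X}.
Definition mhom (a b : mobj) :=
  {f : tag a -> tag b | linear f /\ mmor (tagged a) (tagged b) f}.

Lemma mhom_eq a b (f g : mhom a b) : sval f = sval g -> f = g.
Proof.
case: f g => [f Hf] [g Hg] /= E; rewrite -E in Hg *.
by congr exist; exact: Prop_irrelevance.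
Qed.

Definition midm (a : mobj) : mhom a a :=
  exist _ (fun x => x) (conj (fun _ _ _ => erefl) (mmor_id (tagged a))).

Lemma mcomp_subproof a b c (f : mhom b c) (g : mhom a b) :
  linear (fun x => sval f (sval g x)) /\
  mmor (tagged a) (tagged c) (fun x => sval f (sval g x)).
Proof.
case: f g => [f [lf mf]] [g [lg mg]] /=; split; last exact: mmor_comp mf mg.
by move=> x u v; rewrite lg lf.
Qed.
Definition mcomp a b c (f : mhom b c) (g : mhom a b) : mhom a c :=
  exist _ _ (mcomp_subproof f g).

Program Definition cat_of_modcat : category :=
  @Category mobj mhom midm mcomp _ _ _.
Next Obligation. by move=> *; exact: mhom_eq. Qed.
Next Obligation. by move=> *; exact: mhom_eq. Qed.
Next Obligation. by move=> *; exact: mhom_eq. Qed.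

End Category.

(* The data of a functor which keeps the underlying modules and is the
   identity on morphisms. *)
Record over_functor (S S' : modcat A) := OverFunctor {
  over_str : forall X, mstr S X -> mstr S' X;
  over_mor : forall X Y (s : mstr S X) (t : mstr S Y) (f : X -> Y),
    linear f -> mmor s t f -> mmor (over_str s) (over_str t) f
}.

Section OverFunctor.
Variables (S S' : modcat A) (F : over_functor S S').

Definition over_obj (a : mobj S) : mobj S' :=
  existT _ (tag a) (over_str F (tagged a)).

Definition over_hom (a b : mobj S) (f : mhom a b) :
    mhom (over_obj a) (over_obj b) :=
  exist _ (sval f) (conj (svalP f).1 (over_mor F (svalP f).1 (svalP f).2)).

Program Definition functor_of_over :
    functor (cat_of_modcat S) (cat_of_modcat S') :=
  @Functor (cat_of_modcat S) (cat_of_modcat S') over_obj over_hom _ _.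
Next Obligation. by move=> *; exact: mhom_eq. Qed.
Next Obligation. by move=> *; exact: mhom_eq. Qed.

End OverFunctor.

Definition full_sub (S : modcat A) (P : forall X, mstr S X -> Prop) : modcat A :=
  @ModCat A (fun X => {s : mstr S X | P X s})
    (fun X Y s t f => mmor (sval s) (sval t) f)
    (fun X s => mmor_id (sval s))
    (fun X Y Z s t u f g => @mmor_comp _ S X Y Z (sval s) (sval t) (sval u) f g).

End ModCat.

Section Modules.
Variables (R : realType) (p : nat) (K : cufield R p) (B : germ_kind).
Local Notation G := (germ K B).
Implicit Types X Y : lmodType G.

Definition is_basis X n (e : 'I_n -> X) : Prop :=
  bijective (fun c : 'rV[G]_n => \sum_i c 0 i *: e i).

Definition is_matrix X n (e : 'I_n -> X) (phi : X -> X) (A : 'M[G]_n) : Prop :=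
  forall i, phi (e i) = \sum_j A i j *: e j.

(* The topology of a finite free module X is the finest locally convex one
   such that all the maps f |-> f x from the base ring to X are continuous. *)
Definition mod_continuous_seminorm X (s : X -> R) : Prop :=
  [/\ forall x, 0 <= s x,
      forall x y, s (x + y) <= Num.max (s x) (s y),
      forall (a : K) x, s (gcst B a *: x) = vabs a * s x &
      forall x, continuous_seminorm (fun f : G => s (f *: x))].

Definition mod_continuous X (phi : X -> X) : Prop :=
  forall s, mod_continuous_seminorm s ->
    mod_continuous_seminorm (fun x => s (phi x)).

Record sigma_module (q : disk11 K) X := SigmaModule {
  sg :> X -> X;
  sg_free : exists n (e : 'I_n -> X), is_basis e;
  sgD : {morph sg : x y / x + y};
  sgZ : forall f x, sg (f *: x) = sigma q f *: sg x;
  sg_bij : bijective sg;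
  sg_cont : mod_continuous sg
}.

Record sigma_delta_module (q : disk11 K) X := SigmaDeltaModule {
  sd_sigma : sigma_module q X;
  conn : X -> X;
  connD : {morph conn : x y / x + y};
  conn_leibniz : forall f x, conn (f *: x) = delta1 f *: x + f *: conn x
}.

Program Definition sigma_modcat (q : disk11 K) : modcat G :=
  @ModCat G (sigma_module q)
    (fun X Y s t f => forall x, f (s x) = t (f x)) _ _.
Next Obligation. by []. Qed.
Next Obligation. by move=> q X Y Z s t u f g Hf Hg x /=; rewrite Hg Hf. Qed.

Program Definition sigma_delta_modcat (q : disk11 K) : modcat G :=
  @ModCat G (sigma_delta_module q)
    (fun X Y s t f => (forall x, f (sd_sigma s x) = sd_sigma t (f x)) /\
                      (forall x, f (conn s x) = conn t (f x))) _ _.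
Next Obligation. by []. Qed.
Next Obligation.
by move=> q X Y Z s t u f g [Hf Hf'] [Hg Hg']; split=> x; rewrite ?Hg ?Hf ?Hg' ?Hf'.
Qed.

(* The conditions do not depend on the basis. *)
Definition sigma_radius_ge (q : disk11 K) (r : R) X (s : sigma_module q X) :=
  forall n (e : 'I_n -> X) A, is_basis e -> is_matrix e s A ->
    ray_defined (q : K) (Hseq q A) (qfact (q : K)) /\
    ray_at_one_ge B r (ray (Hseq q A) (qfact (q : K))).

Definition sigma_delta_radius_ge (q : disk11 K) (r : R) X
    (s : sigma_delta_module q X) :=
  forall n (e : 'I_n -> X) A M,
    is_basis e -> is_matrix e (sd_sigma s) A -> is_matrix e (conn s) M ->
    ray_at_one_ge B r (ray (Gseq M) (fun k => k`!%:R : K)) /\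
    \forall rho \near @near_one R B,
      forall (Om : cu_extension K) (t : Om), generic_point rho t ->
        Taylor_sol_solves q A M rho t.

Definition sigma_mod (q : disk11 K) (r : R) : modcat G :=
  full_sub (S := sigma_modcat q) (@sigma_radius_ge q r).

Definition sigma_delta_mod (q : disk11 K) (r : R) : modcat G :=
  full_sub (S := sigma_delta_modcat q) (@sigma_delta_radius_ge q r).

Definition is_sigma_DefTay (q q' : disk11 K) (r : R)
    (F : over_functor (sigma_mod q r) (sigma_mod q' r)) : Prop :=
  forall X (s : mstr (sigma_mod q r) X) n (e : 'I_n -> X) A S,
    is_basis e -> is_matrix e (sval s) A ->
    is_matrix e (sval (over_str F s)) S ->
    qTaylor_value q q' A S.

Definition is_sigma_delta_DefTay (q q' : disk11 K) (r : R)
    (F : over_functor (sigma_delta_mod q r) (sigma_delta_mod q' r)) : Prop :=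
  forall X (s : mstr (sigma_delta_mod q r) X),
    conn (sval (over_str F s)) = conn (sval s) /\
    forall n (e : 'I_n -> X) M S,
      is_basis e -> is_matrix e (conn (sval s)) M ->
      is_matrix e (sd_sigma (sval (over_str F s))) S ->
      Taylor_value q' M S.

Definition is_forget_delta (q : disk11 K) (r : R)
    (F : over_functor (sigma_delta_mod q r) (sigma_mod q r)) : Prop :=
  forall X (s : mstr (sigma_delta_mod q r) X),
    sval (over_str F s) = sd_sigma (sval s).

End Modules.

(* Main.v *)
(* On a module with connection let D = T^-1 conn.  The entries of T^k D^k / k!
   in a basis are the coefficients of the generic Taylor solution, and a radius
   greater than w rho at rho means that they are O(s^-k) for some s > w.  Hence,
   for |y| <= w, the series Y_y = \sum_k y^k T^k D^k / k! converges.  Evaluated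
   near a generic point, Y_y is the transport along the connection from T to
   (1 + y) T; this gives semilinearity over f(T) |-> f((1 + y) T) and the law
   Y_y Y_z = Y_((1 + y)(1 + z) - 1).  The sigma_q having the generic Taylor
   solution of the connection is Y_(q - 1), so that the connection alone
   determines the deformed module, and deforming back from q' to q is inverse.

   For the comparison with sigma_q-modules, let Theta_n = T^n d_q^n / [n]_q!.
   By Newton's interpolation formula
     sigma_q^m = \sum_n \prod_(i < n) (z - (q^i - 1)) Theta_n  at  z = q^m - 1.
   The triangular change of basis between the powers of z and the Newton
   polynomials has norm at most 1 for the radius w >= |q - 1|; it therefore
   transforms the families T^k D^k / k! and Theta_n into each other with the
   same bounds, and the two radii agree.  Starting from sigma_q, it produces
   operators N_k with sigma_q^m = \sum_k (q^m - 1)^k N_k; the connection is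
   N_1 = lim_j (sigma_q^(p^j) - 1) / (q^(p^j) - 1), and
   (k + 1) N_(k+1) = conn N_k - k N_k follows from the identity theorem for
   power series at the zeros q^(p^j) - 1 -> 0.

   The radius condition at 1 extends to an annulus by log-convexity of the
   norms in rho, and generic points exist in the completion of K(T) for a
   Gauss norm. *)
Require Import Defs.
From HB Require Import structures.
From mathcomp Require Import all_boot all_order all_algebra.
From mathcomp Require Import all_classical all_reals all_analysis.
From mathcomp Require Import zify ring lra.
Set Implicit Arguments.
Unset Strict Implicit.
Unset Printing Implicit Defensive.
Import Order.TTheory GRing.Theory Num.Theory.
Import numFieldNormedType.Exports.
Local Open Scope classical_set_scope.
Local Open Scope ring_scope.

(** * Ultrametric series *)

(** Every estimate bounds a norm by [C / s^k] with [s] strictly above a fixed [w >= |q - 1|], where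
    [C] and [s] may vary with the radius. The gap between [w] and [s] makes series with coefficients
    of size [w^k] converge geometrically and permits every exchange of summations. The changes of
    basis keep the pair [C], [s] itself, so they preserve the radius exactly. Two obstacles shape
    the rest. Germs have no common annulus: existence is proved on a whole annulus, but an identity
    between germs is tested at one radius, at a generic point of that circle. And the radius
    conditions quantify over all bases, whereas operators are built from one basis. Two descriptions
    remove this dependence: [sigma_q] as the sum of a series in the connection, and the connection
    as a limit of difference quotients of [sigma_q]. Linear maps are bounded, so these limits are
    independent of the basis and compatible with morphisms. *)

Section UltraSeries.
Variables (R : realType) (V : zmodType) (nle : V -> R -> Prop).

(** A norm is handled through the relation [nle x c], read as norm of [x] at most [c]: a germ need
    not have a finite norm at a radius outside its annulus, and in this form scalars, germs and
    module elements share the same summation lemmas. *)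
Record ultra_norm : Prop := UltraNorm {
  nle0 : forall c, 0 <= c -> nle 0 c;
  nleD : forall x y c, nle x c -> nle y c -> nle (x + y) c;
  nleN : forall x c, nle x c -> nle (- x) c;
  nleW : forall x c d, c <= d -> nle x c -> nle x d
}.

Definition ncvg (u : nat -> V) (l : V) : Prop :=
  forall e : R, 0 < e -> exists N : nat, forall n, (N <= n)%N -> nle (u n - l) e.

Definition nsum (u : nat -> V) (l : V) : Prop :=
  ncvg (fun N => \sum_(k < N) u k) l.

Hypothesis U : ultra_norm.

Lemma nleB x y c : nle x c -> nle y c -> nle (x - y) c.
Proof. by move=> Hx Hy; apply: (nleD U) => //; apply: (nleN U). Qed.

Lemma nle_sum (I : Type) (s : seq I) (P : pred I) (F : I -> V) c : 0 <= c ->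
  (forall i, P i -> nle (F i) c) -> nle (\sum_(i <- s | P i) F i) c.
Proof.
move=> c0 H; apply: (big_ind (fun x => nle x c)) => //; first exact: (nle0 U).
by move=> x y; apply: (nleD U).
Qed.

Lemma eq_ncvg u v l : (forall n, u n = v n) -> ncvg u l -> ncvg v l.
Proof. by move=> /funext ->. Qed.

Lemma eq_nsum u v l : (forall n, u n = v n) -> nsum u l -> nsum v l.
Proof. by move=> /funext ->. Qed.

Lemma ncvg_const l : ncvg (fun _ => l) l.
Proof. by move=> e e0; exists 0%N => n _; rewrite subrr; apply/(nle0 U)/ltW. Qed.

Lemma ncvgD u v x y : ncvg u x -> ncvg v y -> ncvg (fun n => u n + v n) (x + y).
Proof.
move=> ux vy e e0; have [N1 H1] := ux e e0; have [N2 H2] := vy e e0.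
exists (maxn N1 N2) => n; rewrite geq_max => /andP[n1 n2].
by rewrite opprD addrACA; apply: (nleD U); [exact: H1|exact: H2].
Qed.

Lemma ncvgN u x : ncvg u x -> ncvg (fun n => - u n) (- x).
Proof.
by move=> ux e /ux[N H]; exists N => n /H /(nleN U); rewrite opprD.
Qed.

Lemma ncvgB u v x y : ncvg u x -> ncvg v y -> ncvg (fun n => u n - v n) (x - y).
Proof. by move=> ux vy; apply: ncvgD => //; apply: ncvgN. Qed.

Lemma ncvg_sum (I : Type) (s : seq I) (u : I -> nat -> V) (l : I -> V) :
  (forall i, ncvg (u i) (l i)) ->
  ncvg (fun n => \sum_(i <- s) u i n) (\sum_(i <- s) l i).
Proof.
move=> H; elim: s => [|i s IH].
  by rewrite big_nil; apply: eq_ncvg (ncvg_const 0) => n; rewrite big_nil.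
rewrite big_cons; apply: eq_ncvg (ncvgD (H i) IH) => n; by rewrite big_cons.
Qed.

Lemma ncvg_le u l c : 0 < c ->
  (exists N : nat, forall n, (N <= n)%N -> nle (u n) c) -> ncvg u l -> nle l c.
Proof.
move=> c0 [N1 H1] /(_ _ c0)[N2 H2].
have -> : l = u (maxn N1 N2) - (u (maxn N1 N2) - l) by rewrite subKr.
by apply: nleB; [apply: H1|apply: H2]; rewrite ?leq_maxl ?leq_maxr.
Qed.

Lemma nsum_le u l c : 0 < c -> (forall n, nle (u n) c) -> nsum u l -> nle l c.
Proof.
move=> c0 H; apply: ncvg_le => //; exists 0%N => n _.
by apply: nle_sum => //; exact: ltW.
Qed.

Lemma nsum_shift u l (m : nat) :
  nsum u l -> nsum (fun n => u (m + n)%N) (l - \sum_(k < m) u k).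
Proof.
move=> H e /H[N HN]; exists N => n nN.
have /HN : (N <= m + n)%N by rewrite (leq_trans nN)// leq_addl.
by rewrite big_split_ord /= opprB addrCA addrA.
Qed.

Lemma nsum_unshift u l (m : nat) : nsum (fun n => u (m + n)%N) l ->
  nsum u (\sum_(k < m) u k + l).
Proof.
move=> H e /H[N HN]; exists (m + N)%N => n nN.
have /HN : (N <= n - m)%N by lia.
have : n = (m + (n - m))%N by lia.
by move: (n - m)%N => d -> Hd; rewrite big_split_ord /= opprD addrACA subrr add0r.
Qed.

Lemma nsum_fin u (m : nat) : (forall k, (m <= k)%N -> u k = 0) ->
  nsum u (\sum_(k < m) u k).
Proof.
move=> H e e0; exists m => n mn; rewrite -(subnKC mn) big_split_ord /=.
rewrite addrAC subrr add0r big1 => [|i _]; first exact/(nle0 U)/ltW.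
by rewrite H// leq_addr.
Qed.

Lemma nsumD u v x y : nsum u x -> nsum v y -> nsum (fun n => u n + v n) (x + y).
Proof.
move=> ux vy; apply: eq_ncvg (ncvgD ux vy) => n; by rewrite big_split.
Qed.

Lemma nsumB u v x y : nsum u x -> nsum v y -> nsum (fun n => u n - v n) (x - y).
Proof.
move=> ux vy; apply: eq_ncvg (ncvgB ux vy) => n; by rewrite sumrB.
Qed.

Lemma nsum_sum (I : Type) (s : seq I) (u : I -> nat -> V) (l : I -> V) :
  (forall i, nsum (u i) (l i)) ->
  nsum (fun n => \sum_(i <- s) u i n) (\sum_(i <- s) l i).
Proof.
move=> H; apply: eq_ncvg (ncvg_sum s H) => n; exact: exchange_big.
Qed.

(* Beyond finitely many rows both partial sums are negligible. *)
Lemma sum_exchange (t : nat -> nat -> V) (tau : nat -> R) (row col : nat -> V) S :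
  (forall n k, (n < k)%N -> t n k = 0) ->
  (forall n k, nle (t n k) (tau n)) ->
  (forall e : R, 0 < e -> exists N : nat, forall n, (N <= n)%N -> tau n <= e) ->
  (forall n, row n = \sum_(k < n.+1) t n k) ->
  nsum row S -> (forall k, nsum (fun n => t n k) (col k)) -> nsum col S.
Proof.
move=> tri ttau tau0 rowE rowS colk e e0.
have [N HN] := tau0 e e0; exists N => L NL.
have cL : nsum (fun n => \sum_(k < L) t n k) (\sum_(k < L) col k).
  exact: (@nsum_sum _ (index_enum 'I_L) (fun k n => t n k) (fun k => col k)).
have := nsumB cL rowS; set w := (X in nsum X _) => Hw.
apply: (nsum_le e0 _ Hw) => n; rewrite /w rowE.
have [nL|Ln] := ltnP n L.
  rewrite (_ : \sum_(k < L) t n k = \sum_(k < n.+1) t n k) ?subrr.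
    exact/(nle0 U)/ltW.
  rewrite -(subnKC nL) big_split_ord /= [X in _ + X]big1 ?addr0// => i _.
  by rewrite tri// ltnS leq_addr.
by apply: nleB; apply: nle_sum => [|i _]; rewrite ?ltW//;
  apply: (nleW U) (HN n (leq_trans NL Ln)) _; exact: ttau.
Qed.

End UltraSeries.

Lemma divr2_gt0 (R : realType) (e : R) : 0 < e -> 0 < e / 2.
Proof. by move=> e0; rewrite divr_gt0. Qed.

(** * Series in a complete ultrametric field *)

Section FieldSeries.
Variables (R : realType) (p : nat) (K : cufield R p).

Definition vle (x : K) (c : R) : Prop := vabs x <= c.

Lemma vle_ultra : ultra_norm vle.
Proof.
split; rewrite /vle.
- by move=> c; rewrite vabs0.
- by move=> x y c; apply: vabsD_le.
- by move=> x c; rewrite vabsN.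
- by move=> x c d cd /le_trans; apply.
Qed.

Lemma abs_cvgP (u : nat -> K) l : abs_cvg (@vabs R p K) u l <-> ncvg vle u l.
Proof.
split=> H e e0.
  by have [N HN] := H e e0; exists N => n /HN /ltW.
have [N HN] := H (e / 2) (divr2_gt0 e0); exists N => n /HN.
by move=> /le_lt_trans; apply; lra.
Qed.

Lemma ncvg_uniq (u : nat -> K) x y : ncvg vle u x -> ncvg vle u y -> x = y.
Proof. by move=> /abs_cvgP ux /abs_cvgP uy; exact: abs_cvg_uniq ux uy. Qed.

Lemma sumN_nsum (u : nat -> K) l : nsum vle u l -> sumN u = l.
Proof. by move=> /abs_cvgP; exact: vlimE. Qed.

Lemma nsum_ex (u : nat -> K) :
  (forall e : R, 0 < e -> exists N : nat, forall n, (N <= n)%N -> vabs (u n) <= e) ->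
  nsum vle u (sumN u).
Proof.
move=> H; have [l Hl] : exists l, abs_cvg (@vabs R p K) (fun N => \sum_(k < N) u k) l.
  apply: cu_complete => e e0.
  have [N HN] := H (e / 2) (divr2_gt0 e0); exists N => m n.
  wlog mn : m n / (m <= n)%N.
    move=> W Nm Nn; have [mn|/ltnW nm] := leqP m n; first exact: W.
    by rewrite vabsB; apply: W.
  move=> Nm _; rewrite vabsB -(subnKC mn) big_split_ord /= addrAC subrr add0r.
  apply: (@le_lt_trans _ _ (e / 2)); last by lra.
  apply: (nle_sum vle_ultra); first by lra.
  by move=> i _; apply: HN; lia.
by move/abs_cvgP: (Hl) => Hl'; rewrite (sumN_nsum Hl').
Qed.

Lemma nsumZl (u : nat -> K) l a : nsum vle u l -> nsum vle (fun n => a * u n) (a * l).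
Proof.
have [->|a0] := eqVneq a 0.
  move=> _; rewrite mul0r => e e0; exists 0%N => n _.
  by rewrite big1 ?subrr => [|i _]; rewrite ?mul0r// /vle vabs0 ltW.
have v0 : 0 < vabs a.
  by rewrite lt_def vabs_ge0 andbT; apply: contra a0 => /eqP/vabs_eq0 ->.
move=> H e e0; have [N HN] := H _ (divr_gt0 e0 v0); exists N => n /HN.
by rewrite /vle -mulr_sumr -mulrBr vabsM -ler_pdivlMl// mulrC.
Qed.

Lemma geo_small (C x : R) : 0 <= x < 1 ->
  forall e : R, 0 < e -> exists N : nat, forall n, (N <= n)%N -> C * x ^+ n <= e.
Proof.
move=> /andP[x0 x1] e e0.
have [C0|C0] := leP C 0.
  exists 0%N => n _; apply: (@le_trans _ _ 0); last exact: ltW.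
  by rewrite mulr_le0_ge0// exprn_ge0.
have : (fun n => x ^+ n) @ \oo --> (0 : R).
  by apply: cvg_expr; rewrite ger0_norm.
move=> /cvgrPdist_le /(_ (e / C) (divr_gt0 e0 C0)) [N _ HN].
exists N => n nN; have := HN n nN; rewrite sub0r normrN ger0_norm ?exprn_ge0//.
by rewrite ler_pdivlMr// mulrC.
Qed.

Lemma geo_ex (u : nat -> K) (C x : R) : 0 <= x < 1 ->
  (forall k, vabs (u k) <= C * x ^+ k) -> nsum vle u (sumN u).
Proof.
move=> x01 Hu; apply: nsum_ex => e e0; have [N HN] := geo_small C x01 e0.
by exists N => n /HN; apply: le_trans.
Qed.

(** The array [a k * b (n - k)] for [k <= n] is bounded by [A * B * x^n], uniformly in [k], so it
    may be summed by columns; column [k] starts at row [k] and sums to [a k * sumN b]. *)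
Lemma cauchy_product (a b : nat -> K) (A B x : R) :
  0 <= A -> 0 <= B -> 0 <= x < 1 ->
  (forall k, vabs (a k) <= A * x ^+ k) -> (forall k, vabs (b k) <= B * x ^+ k) ->
  sumN (fun n => \sum_(j < n.+1) a j * b (n - j)%N) = sumN a * sumN b.
Proof.
move=> A0 B0 x01 Ha Hb; have [x0 x1] := andP x01.
pose t n k := if (k <= n)%N then a k * b (n - k)%N else 0.
have tle n k : vle (t n k) (A * B * x ^+ n).
  rewrite /t /vle; case: ifP => kn; last by rewrite vabs0 !mulr_ge0// exprn_ge0.
  rewrite vabsM -{2}(subnKC kn) exprD mulrACA.
  by apply: ler_pM; rewrite ?vabs_ge0.
have rowE n : \sum_(j < n.+1) a j * b (n - j)%N = \sum_(k < n.+1) t n k.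
  by apply: eq_bigr => j _; rewrite /t -ltnS ltn_ord.
have rowle n : vabs (\sum_(j < n.+1) a j * b (n - j)%N) <= A * B * x ^+ n.
  rewrite rowE; apply: (nle_sum vle_ultra); first by rewrite !mulr_ge0// exprn_ge0.
  by move=> j _; exact: tle.
have Srow := geo_ex x01 rowle.
have Sb := geo_ex x01 Hb.
have Scol : nsum vle (fun k => a k * sumN b)
    (sumN (fun n => \sum_(j < n.+1) a j * b (n - j)%N)).
  apply: (sum_exchange vle_ultra _ tle (geo_small _ x01) rowE Srow).
    by move=> n k nk; rewrite /t leqNgt nk.
  move=> k; have := nsum_unshift (u := fun n => t n k) (m := k) (l := a k * sumN b).
  rewrite big1 => [|i _]; last by rewrite /t leqNgt ltn_ord.
  rewrite add0r; apply; apply: eq_nsum (nsumZl (a k) Sb) => n.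
  by rewrite /t leq_addr addKn.
have Sa := nsumZl (sumN b) (geo_ex x01 Ha).
apply: (ncvg_uniq Scol); rewrite mulrC.
exact: (eq_nsum (fun n => mulrC (sumN b) (a n)) Sa).
Qed.

End FieldSeries.

(** * Norms on germs *)

Section GermNorm.
Variables (R : realType) (p : nat) (K : cufield R p) (B : germ_kind).
Local Notation G := (germ K B).
Implicit Types (f g h : G).

(** Boundedness on the circle does not imply convergence there, and [lmul] is meaningful only for
    convergent factors; together the two clauses are stable under products. *)
Definition gle (rho : R) f (c : R) : Prop :=
  cvg_at rho (coef f) /\ forall i, vabs (coef f i) * rho ^ i <= c.

Lemma gcoefD f g i : coef (f + g) i = coef f i + coef g i. Proof. by []. Qed.
Lemma gcoefN f i : coef (- f) i = - coef f i. Proof. by []. Qed.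
Lemma gcoef0 i : coef (0 : G) i = 0.
Proof. by rewrite /= /lmono; case: eqP. Qed.
Lemma gcoefB f g i : coef (f - g) i = coef f i - coef g i. Proof. by []. Qed.
Lemma gcoef_sum (I : Type) (s : seq I) (P : pred I) (F : I -> G) i :
  coef (\sum_(j <- s | P j) F j) i = \sum_(j <- s | P j) coef (F j) i.
Proof.
by elim/big_rec2 : _ => [|j x y _ <-]; rewrite ?gcoef0.
Qed.

Lemma gmonoM x y k l : gmono B x k * gmono B y l = gmono B (x * y : K) (k + l).
Proof. by apply/germ_eq; exact: lmul_mono. Qed.

Lemma gmono1 : gmono B (1 : K) 0 = 1. Proof. by []. Qed.

Lemma gcstM x y : gcst B (x * y : K) = gcst B x * gcst B y.
Proof. by rewrite /gcst gmonoM addr0. Qed.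

Lemma gcstD x y : gcst B (x + y : K) = gcst B x + gcst B y.
Proof.
by apply/germ_eq/funext => i; rewrite /= /lmono; case: eqP; rewrite ?addr0.
Qed.

Lemma gcst0 : gcst B (0 : K) = 0. Proof. by []. Qed.
Lemma gcst1 : gcst B (1 : K) = 1. Proof. by []. Qed.
Lemma gcstN x : gcst B (- x : K) = - gcst B x.
Proof. by apply/eqP; rewrite -subr_eq0 opprK -gcstD addNr gcst0. Qed.
Lemma gcstB x y : gcst B (x - y : K) = gcst B x - gcst B y.
Proof. by rewrite gcstD gcstN. Qed.

Lemma gcstX x n : gcst B (x ^+ n : K) = gcst B x ^+ n.
Proof. by elim: n => [|n IH]; rewrite ?expr0// !exprS gcstM IH. Qed.

Lemma gcst_sum (I : Type) (s : seq I) (P : pred I) (F : I -> K) :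
  gcst B (\sum_(j <- s | P j) F j) = \sum_(j <- s | P j) gcst B (F j).
Proof.
by elim/big_rec2 : _ => [|j x y _ <-]; rewrite ?gcst0 ?gcstD.
Qed.

Lemma gcst_prod (I : Type) (s : seq I) (P : pred I) (F : I -> K) :
  gcst B (\prod_(j <- s | P j) F j) = \prod_(j <- s | P j) gcst B (F j).
Proof.
by elim/big_rec2 : _ => [|j x y _ <-]; rewrite ?gcst1 ?gcstM.
Qed.

Lemma gcst_nat n : gcst B (n%:R : K) = n%:R.
Proof. by elim: n => [|n IH]; rewrite ?gcst0// -!natr1 gcstD IH. Qed.

Lemma gTX n : gT K B ^+ n = gmono B (1 : K) n%:Z.
Proof.
elim: n => [|n IH]; first by rewrite expr0.
by rewrite exprS IH /gT gmonoM mulr1; congr gmono; lia.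
Qed.

Lemma gTK : gT K B * gTinv K B = 1.
Proof. by rewrite /gT /gTinv gmonoM mulr1. Qed.

Lemma coef_gcstM x f i : coef (gcst B x * f) i = x * coef f i.
Proof.
rewrite /= /lmul (@sumZ_supp _ _ _ _ 0) ?subr0.
  by rewrite /= /lmono eqxx.
by move=> j /negPf j0; rewrite /= /lmono j0 mul0r.
Qed.

Lemma coef_gmonoM x k f i : coef (gmono B x k * f) i = x * coef f (i - k).
Proof.
rewrite /= /lmul (@sumZ_supp _ _ _ _ k).
  by rewrite /= /lmono eqxx.
by move=> j /negPf j0; rewrite /= /lmono j0 mul0r.
Qed.

Section AtRho.
Variables (rho : R) (rho0 : 0 < rho).

Lemma gleW f c d : c <= d -> gle rho f c -> gle rho f d.
Proof. by move=> cd [cf H]; split=> // i; apply: le_trans (H i) cd. Qed.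

Lemma gle_ge0 f c : gle rho f c -> 0 <= c.
Proof.
by move=> [_ /(_ 0)]; apply: le_trans; rewrite mulr_ge0 ?vabs_ge0// ltW// exprz_gt0.
Qed.

Lemma gle_fin f : cvg_at rho (coef f) -> exists c, gle rho f c.
Proof. by move=> cf; have [C _ HC] := cvg_at_bounded rho0 cf; exists C. Qed.

Lemma gle_gmono x k : gle rho (gmono B x k) (vabs x * rho ^ k).
Proof.
split; first exact: cvg_at_lmono.
move=> i; rewrite /= /lmono; case: eqP => [->//|_].
by rewrite vabs0 mul0r mulr_ge0 ?vabs_ge0// ltW// exprz_gt0.
Qed.

Lemma gle_gcst x : gle rho (gcst B x) (vabs x).
Proof. by have := gle_gmono x 0; rewrite expr0z mulr1. Qed.

Lemma gle0 c : 0 <= c -> gle rho 0 c.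
Proof. by move=> c0; apply: (@gleW _ 0) => //; have := gle_gcst 0; rewrite vabs0. Qed.

Lemma gle1 : gle rho 1 1.
Proof. by have := gle_gcst 1; rewrite vabs1. Qed.

Lemma gleD f g c : gle rho f c -> gle rho g c -> gle rho (f + g) c.
Proof.
move=> [cf Hf] [cg Hg]; split; first exact: cvg_atD.
move=> i; rewrite -ler_pdivlMr ?exprz_gt0//.
by apply: vabsD_le; rewrite ler_pdivlMr ?exprz_gt0.
Qed.

Lemma gleN f c : gle rho f c -> gle rho (- f) c.
Proof.
move=> [cf Hf]; split; last by move=> i; rewrite gcoefN vabsN.
by apply: cvg_at_le cf => // i; rewrite vabsN.
Qed.

Lemma gle_ultra : ultra_norm (gle rho).
Proof.
split; [exact: gle0|exact: gleD|exact: gleN|exact: gleW].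
Qed.

Lemma gleM f g c d : gle rho f c -> gle rho g d -> gle rho (f * g) (c * d).
Proof.
by move=> [cf Hf] [cg Hg]; split; [exact: lmul_cvg|exact: lmul_le].
Qed.

Lemma gle_coef f g c : gle rho f c -> (forall i, vabs (coef g i) <= vabs (coef f i)) ->
  gle rho g c.
Proof.
move=> [cf Hf] gf; split; first exact: cvg_at_le cf.
move=> i; apply: le_trans (Hf i); apply: ler_wpM2r => //; exact/ltW/exprz_gt0.
Qed.

Lemma gle_sigma (q : disk11 K) f c : gle rho f c -> gle rho (sigma q f) c.
Proof.
by move/gle_coef; apply=> i; rewrite /= vabsM vabsXz vabs_disk11 exp1rz mul1r.
Qed.

Lemma gle_gTinv : gle rho (gTinv K B) rho^-1.
Proof. by have := gle_gmono 1 (-1); rewrite vabs1 mul1r exprN1. Qed.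

Lemma gle_eq0 f : (forall e : R, 0 < e -> gle rho f e) -> f = 0.
Proof.
move=> H; apply/germ_eq/funext => i; rewrite gcoef0; apply/vabs_eq0/eqP.
have rz : 0 < rho ^ i by exact: exprz_gt0.
rewrite eq_le vabs_ge0 andbT; apply/ler_addgt0Pr => e e0; rewrite add0r.
have [_ /(_ i)] := H (e * rho ^ i) (mulr_gt0 e0 rz).
by rewrite ler_pM2r.
Qed.

End AtRho.

Lemma gfinP f : exists2 eps : R, 0 < eps < 1 &
  forall rho, annulus B eps rho -> exists c, gle rho f c.
Proof.
have [eps e01 H] := germP f; exists eps => // rho rI.
by apply: (gle_fin (annulus_gt0 e01 rI)); exact: H.
Qed.

Lemma annulus_sub (e1 e2 : R) : 0 < e1 < 1 -> 0 < e2 < 1 ->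
  exists2 eps : R, 0 < eps < 1 &
    annulus B eps `<=` annulus B e1 /\ annulus B eps `<=` annulus B e2.
Proof.
move=> /andP[e10 e11] /andP[e20 e21]; exists (Num.min e1 e2).
  by rewrite lt_min e10 e20 /= gt_min e11.
by split; apply: annulus_le; rewrite ge_min lexx ?orbT.
Qed.

Lemma annulus_sub_fin n (F : 'I_n -> R -> Prop) :
  (forall i, exists2 eps : R, 0 < eps < 1 & forall rho, annulus B eps rho -> F i rho) ->
  exists2 eps : R, 0 < eps < 1 & forall rho, annulus B eps rho -> forall i, F i rho.
Proof.
elim: n F => [|n IH] F H.
  by exists 2^-1; [apply/andP; split; lra|move=> rho _ []].
have [e1 e101 H1] := IH (fun i => F (lift ord0 i)) (fun i => H (lift ord0 i)).
have [e2 e201 H2] := H ord0.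
have [e e01 [S1 S2]] := annulus_sub e101 e201.
exists e => // rho rI i; case: (unliftP ord0 i) => [j ->|->].
  exact: H1 (S1 _ rI) _.
exact: H2 (S2 _ rI).
Qed.

(** The limit is formed coefficient by coefficient. At each radius the Cauchy estimate is uniform in
    the index, so it passes to the limit; the limit inherits from a single term of the sequence the
    decay that makes it converge on the circle. *)
Lemma germ_complete (eps : R) (u : nat -> G) : 0 < eps < 1 ->
  (forall rho, annulus B eps rho -> forall k, cvg_at rho (coef (u k))) ->
  (forall rho, annulus B eps rho -> forall e : R, 0 < e ->
    exists N : nat, forall m n, (N <= m)%N -> (N <= n)%N -> gle rho (u m - u n) e) ->
  exists s : G, forall rho, annulus B eps rho ->
    cvg_at rho (coef s) /\ ncvg (gle rho) u s.
Proof.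
move=> e01 cu Hu; have [e0 _] := andP e01.
have r1 := annulus_mem B e0; have r10 := annulus_gt0 e01 r1.
(* One radius of the annulus suffices to make each coefficient Cauchy. *)
have /choice[s Hs] : forall i, exists l, abs_cvg (@vabs R p K) (fun k => coef (u k) i) l.
  move=> i; apply: cu_complete => e ee0; set rho := (1 - eps / 2) in r1 r10.
  have d0 : 0 < e / 2 * rho ^ i by rewrite mulr_gt0 ?exprz_gt0// divr2_gt0.
  have [N HN] := Hu _ r1 _ d0; exists N => m n Nm Nn.
  have [_ /(_ i)] := HN m n Nm Nn; rewrite ler_pM2r ?exprz_gt0// gcoefB.
  by move=> /le_lt_trans; apply; lra.
have lim_le rho (rI : annulus B eps rho) (e : R) : 0 < e -> exists N : nat,
    forall n, (N <= n)%N -> forall i, vabs (coef (u n) i - s i) * rho ^ i <= e.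
  move=> ee0; have rho0 := annulus_gt0 e01 rI; have [N HN] := Hu _ rI _ ee0.
  exists N => n Nn i; rewrite -ler_pdivlMr ?exprz_gt0//.
  have c0 : 0 < e / rho ^ i by rewrite divr_gt0// exprz_gt0.
  apply: (@ncvg_le _ _ _ (vle_ultra K) (fun m => coef (u n) i - coef (u m) i)) => //.
    exists N => m Nm; rewrite /vle ler_pdivlMr ?exprz_gt0//.
    by have [_ /(_ i)] := HN n m Nn Nm.
  apply: (ncvgB (vle_ultra K)); first exact: (ncvg_const (vle_ultra K)).
  exact/abs_cvgP.
have cs : cvg_on (annulus B eps) s.
  move=> rho rI e ee0; have rho0 := annulus_gt0 e01 rI.
  have [N HN] := lim_le _ rI _ (divr2_gt0 ee0).
  have [M HM] := cu _ rI N _ ee0.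
  exists M => i Mi; rewrite -ltr_pdivlMr ?exprz_gt0//.
  rewrite -(subKr (coef (u N) i) (s i)); apply: vabsD_lt.
    by rewrite ltr_pdivlMr ?exprz_gt0//; exact: HM.
  rewrite vabsN ltr_pdivlMr ?exprz_gt0//; apply: le_lt_trans (HN _ (leqnn _) _) _.
  by lra.
exists (Germ (ex_intro2 _ _ eps e01 cs)) => rho rI.
split; first exact: cs.
have rho0 := annulus_gt0 e01 rI.
move=> e ee0; have [N HN] := lim_le _ rI _ ee0; exists N => n Nn; split.
  apply: cvg_atD => //; first exact: cu.
  by apply: (cvg_at_le rho0 _ (cs _ rI)) => i; rewrite vabsN.
by move=> i; exact: HN.
Qed.

(* Divided derivatives: binomial coefficients with negative upper index are
   still integers, which is why [f |-> f^(j)/j!] decreases norms. *)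
Lemma ffact_int (i : int) (j : nat) :
  exists z : int, \prod_(k < j) (i - k%:Z) = z * (j`!)%:Z.
Proof.
case: i => [n|n].
  exists ('C(n, j))%:Z; rewrite -PoszM bin_ffact.
  elim: j => [|j IH]; first by rewrite big_ord0 ffactn0.
  rewrite big_ord_recr /= IH ffactnSr PoszM.
  have [jn|nj] := leqP j n; first by rewrite subzn.
  by rewrite ffact_small// !mul0r.
exists ((-1) ^+ j * ('C(n + j, j))%:Z); rewrite -mulrA -PoszM bin_ffact.
elim: j => [|j IH]; first by rewrite big_ord0 ffactn0 expr0 mulr1.
rewrite big_ord_recr /= IH addnS ffactSS PoszM.
by rewrite exprSr NegzE; ring.
Qed.

Lemma coef_deriv_iter f j i :
  coef (iter j (@gderiv R p K B) f) i =
  (\prod_(k < j) (i + j%:Z - k%:Z))%:~R * coef f (i + j%:Z).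
Proof.
elim: j i => [|j IH] i; first by rewrite big_ord0 mul1r addr0.
rewrite [LHS]/= IH mulrA -intrM (_ : i + 1 + j%:Z = i + j.+1%:Z); last lia.
congr (_%:~R * _); rewrite big_ord_recr /= mulrC; congr (_ * _); last by lia.
Qed.

Lemma fact_neq0 n : (n`!%:R : K) != 0.
Proof.
have : [pchar K] =i pred0 := cu_char0 K.
by move/pcharf0P => ->; rewrite -lt0n fact_gt0.
Qed.

Lemma natS_neq0 n : (n.+1%:R : K) != 0.
Proof. by have /pcharf0P -> : [pchar K] =i pred0 := cu_char0 K. Qed.

Lemma vabs_gt0 (x : K) : x != 0 -> 0 < vabs x.
Proof.
move=> x0; rewrite lt_def vabs_ge0 andbT.
by apply: contra x0 => /eqP/vabs_eq0 ->.
Qed.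

Lemma gle_ddiv rho f c j : 0 < rho -> gle rho f c ->
  gle rho (gcst B (j`!%:R)^-1 * iter j (@gderiv R p K B) f) (c / rho ^+ j).
Proof.
move=> rho0 Hf.
have := gleM rho0 (gle_gmono rho0 1 (- j%:Z)) Hf.
rewrite vabs1 mul1r [X in gle _ _ X]mulrC -exprnN.
move/(gle_coef rho0); apply => i; rewrite coef_gmonoM mul1r coef_gcstM coef_deriv_iter opprK.
rewrite mulrA vabsM; apply: ler_piMl; first exact: vabs_ge0.
have [z ->] := ffact_int (i + j%:Z) j.
rewrite intrM mulrCA mulVf ?mulr1; first exact: vabs_int_le1.
exact: fact_neq0.
Qed.

Lemma gle_deriv rho f c : 0 < rho -> gle rho f c -> gle rho (gderiv f) (c / rho).
Proof.
by move=> rho0 /(gle_ddiv 1 rho0); rewrite /= factS fact0 muln1 invr1 mul1r expr1.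
Qed.

(** [q] is a unit of the valuation ring, so [q^i - 1] is [q - 1] times an integral element, also for
    negative [i]. *)
Lemma vabs_qnum (q : disk11 K) (i : int) : vabs ((q : K) ^ i - 1) <= vabs ((q : K) - 1).
Proof.
have H n : vabs ((q : K) ^+ n - 1) <= vabs ((q : K) - 1).
  elim: n => [|n IH]; first by rewrite expr0 subrr vabs0 vabs_ge0.
  rewrite exprS (_ : _ - 1 = (q : K) * ((q : K) ^+ n - 1) + ((q : K) - 1)); last by ring.
  by apply: vabsD_le => //; rewrite vabsM vabs_disk11 mul1r.
case: i => n; first exact: H.
have q0 : (q : K) ^+ n.+1 != 0.
  apply/eqP => /(congr1 (@vabs R p K)); rewrite vabsX vabs_disk11 expr1n vabs0.
  by move/eqP; rewrite oner_eq0.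
rewrite NegzE -exprnN (_ : _ - 1 = - (q : K) ^- n.+1 * ((q : K) ^+ n.+1 - 1)).
  by rewrite vabsM vabsN vabsV vabsX vabs_disk11 expr1n invr1 mul1r.
by field.
Qed.

Lemma gle_dquot (q : disk11 K) rho f c : 0 < rho -> gle rho f c ->
  gle rho (dquot q f) (c / rho).
Proof.
move=> rho0 Hf.
have := gleM rho0 (gle_gTinv rho0) Hf; rewrite [X in gle _ _ X]mulrC.
move/(gle_coef rho0); apply => i; rewrite !coef_gmonoM mul1r gcoefB /=.
rewrite -[X in _ * (_ - X)]mul1r -mulrBl mulrA vabsM.
apply: ler_piMl; first exact: vabs_ge0.
rewrite vabsM vabsV mulrC.
(* For [q = 1] the convention [0^-1 = 0] makes the factor vanish. *)
have [q1|q1] := eqVneq (vabs ((q : K) - 1)) 0.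
  by rewrite q1 invr0 mulr0.
rewrite ler_pdivrMr ?mul1r; first exact: vabs_qnum.
by rewrite lt_def q1 vabs_ge0.
Qed.

End GermNorm.

(** * Norms on free modules *)

Section ModNorm.
Variables (R : realType) (p : nat) (K : cufield R p) (B : germ_kind).
Local Notation G := (germ K B).
Variables (X : lmodType G) (n : nat) (e : 'I_n -> X).
Implicit Types (f g : G) (x y : X) (u v : nat -> X).

Definition ecoord x : 'rV[G]_n :=
  xget 0 [set c : 'rV[G]_n | \sum_i c 0 i *: e i = x].

(** For an empty basis the second clause says nothing; the first keeps bounds nonnegative in that
    case too. *)
Definition xle (rho : R) x (c : R) : Prop :=
  0 <= c /\ forall i, gle rho (ecoord x 0 i) c.

(** The finiteness clauses say that the terms and the limit live on each circle; [ncvg] alone only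
    controls differences. *)
Definition xlim (I : set R) u x : Prop := forall rho, I rho ->
  [/\ forall k, exists c, xle rho (u k) c, exists c, xle rho x c &
      ncvg (xle rho) u x].

Definition xlimG u x : Prop :=
  exists2 eps : R, 0 < eps < 1 & xlim (annulus B eps) u x.

Hypothesis be : is_basis e.

Lemma ecoordK x : \sum_i ecoord x 0 i *: e i = x.
Proof.
have [h _ hK] := be.
by apply: (@xgetPex _ 0 [set c : 'rV[G]_n | \sum_i c 0 i *: e i = x]); exists (h x); exact: hK.
Qed.

Lemma ecoord_uniq x (c : 'rV[G]_n) : \sum_i c 0 i *: e i = x -> ecoord x = c.
Proof.
move=> H; have [h hK _] := be; rewrite -(hK (ecoord x)) -(hK c); congr h.
by rewrite ecoordK H.
Qed.

Lemma ecoordD x y : ecoord (x + y) = ecoord x + ecoord y.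
Proof.
apply: ecoord_uniq; rewrite -{2}(ecoordK x) -{2}(ecoordK y) -big_split /=.
by apply: eq_bigr => i _; rewrite mxE scalerDl.
Qed.

Lemma ecoordZ f x : ecoord (f *: x) = f *: ecoord x.
Proof.
apply: ecoord_uniq; rewrite -{2}(ecoordK x) scaler_sumr.
by apply: eq_bigr => i _; rewrite mxE scalerA.
Qed.

Lemma ecoord0 : ecoord 0 = 0.
Proof. by apply: ecoord_uniq; rewrite big1// => i _; rewrite mxE scale0r. Qed.

Lemma ecoordN x : ecoord (- x) = - ecoord x.
Proof. by rewrite -scaleN1r ecoordZ scaleN1r. Qed.

Lemma ecoordB x y : ecoord (x - y) = ecoord x - ecoord y.
Proof. by rewrite ecoordD ecoordN. Qed.

Lemma ecoord_sum (I : Type) (s : seq I) (P : pred I) (F : I -> X) :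
  ecoord (\sum_(j <- s | P j) F j) = \sum_(j <- s | P j) ecoord (F j).
Proof.
by elim/big_rec2 : _ => [|j x y _ <-]; rewrite ?ecoord0 ?ecoordD.
Qed.

Lemma ecoord_basis i j : ecoord (e i) 0 j = (j == i)%:R.
Proof.
rewrite (ecoord_uniq (c := delta_mx 0 i)) ?mxE ?eqxx//.
rewrite (bigD1 i)//= mxE !eqxx scale1r big1 ?addr0// => k ki.
by rewrite mxE (negPf ki) andbF scale0r.
Qed.

Section AtRho.
Variables (rho : R) (rho0 : 0 < rho).

Lemma xle_ultra : ultra_norm (xle rho).
Proof.
split.
- by move=> c c0; split=> // i; rewrite ecoord0 mxE; exact: gle0.
- move=> x y c [c0 Hx] [_ Hy]; split=> // i.
  by rewrite ecoordD mxE; exact: gleD.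
- by move=> x c [c0 Hx]; split=> // i; rewrite ecoordN mxE; exact: gleN.
- move=> x c d cd [c0 Hx]; split; first exact: le_trans cd.
  by move=> i; exact: gleW cd _.
Qed.

Lemma xleZ f x c d : gle rho f c -> xle rho x d -> xle rho (f *: x) (c * d).
Proof.
move=> Hf [d0 Hx]; split; first by rewrite mulr_ge0// (gle_ge0 Hf).
by move=> i; rewrite ecoordZ mxE; exact: gleM.
Qed.

Lemma xle_gcst a x d : xle rho x d -> xle rho (gcst B a *: x) (vabs a * d).
Proof. by apply: xleZ; exact: gle_gcst. Qed.

Lemma xle_eq0 x : (forall eps : R, 0 < eps -> xle rho x eps) -> x = 0.
Proof.
move=> H; rewrite -(ecoordK x) big1// => i _.
rewrite (gle_eq0 rho0 (f := ecoord x 0 i)) ?scale0r// => eps e0.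
by have [_] := H _ e0; exact.
Qed.

Lemma xncvg_uniq u x y : ncvg (xle rho) u x -> ncvg (xle rho) u y -> x = y.
Proof.
move=> ux uy; apply/eqP; rewrite -subr_eq0; apply/eqP/xle_eq0 => eps e0.
have := ncvgB xle_ultra ux uy => H.
apply: (ncvg_le xle_ultra e0 _ H); exists 0%N => k _.
by rewrite subrr; apply/(nle0 xle_ultra)/ltW.
Qed.

Lemma xfinD x y : (exists c, xle rho x c) -> (exists c, xle rho y c) ->
  exists c, xle rho (x + y) c.
Proof.
move=> [c Hc] [d Hd]; exists (Num.max c d); apply: (nleD xle_ultra).
  by apply: (nleW xle_ultra) Hc; rewrite le_max lexx.
by apply: (nleW xle_ultra) Hd; rewrite le_max lexx orbT.
Qed.

Lemma xfinN x : (exists c, xle rho x c) -> exists c, xle rho (- x) c.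
Proof. by move=> [c Hc]; exists c; apply: (nleN xle_ultra). Qed.

Lemma xfinZ f x : (exists c, gle rho f c) -> (exists c, xle rho x c) ->
  exists c, xle rho (f *: x) c.
Proof. by move=> [c Hc] [d Hd]; exists (c * d); exact: xleZ. Qed.

Lemma xfin_sum (I : Type) (s : seq I) (P : pred I) (F : I -> X) :
  (forall i, P i -> exists c, xle rho (F i) c) ->
  exists c, xle rho (\sum_(i <- s | P i) F i) c.
Proof.
move=> H; apply: (big_ind (fun x => exists c, xle rho x c)) => //.
  by exists 0; apply: (nle0 xle_ultra).
by move=> x y; exact: xfinD.
Qed.

Lemma xncvgZ (g : nat -> G) gl u x : (exists c, gle rho gl c) -> (exists c, xle rho x c) ->
  ncvg (gle rho) g gl -> ncvg (xle rho) u x ->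
  ncvg (xle rho) (fun k => g k *: u k) (gl *: x).
Proof.
move=> [c Hc] [d [d0 Hd]] Hg Hu eps e0.
have c0 := gle_ge0 Hc.
(* The difference of the products splits into [(g - gl) (u - x)], [(g - gl) x] and [gl (u - x)].
   With [a * M <= eps] each is at most [eps], the quadratic one because [a <= 1 <= M]. *)
pose M := c + d + 1.
have M0 : 0 < M by rewrite /M; lra.
pose a := Num.min 1 (eps / M).
have a0 : 0 < a by rewrite lt_min ltr01 divr_gt0.
have a1 : a <= 1 by rewrite /a ge_min lexx.
have aM : a * M <= eps by rewrite -ler_pdivlMr// /a ge_min lexx orbT.
have [N1 H1] := Hg _ a0; have [N2 H2] := Hu _ a0.
exists (maxn N1 N2) => k; rewrite geq_max => /andP[/H1 k1 /H2 k2].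
have -> : g k *: u k - gl *: x = (g k - gl) *: (u k - x) + (g k - gl) *: x + gl *: (u k - x).
  by rewrite !scalerBr !scalerBl subrK addrA subrK.
have k2' : xle rho (u k - x) a by [].
apply: (nleD xle_ultra); first apply: (nleD xle_ultra).
- apply: (nleW xle_ultra) (xleZ k1 k2); apply: le_trans aM.
  by rewrite ler_pM2l// /M; lra.
- apply: (nleW xle_ultra) (xleZ k1 (conj d0 Hd)); apply: le_trans aM.
  by rewrite ler_pM2l// /M; lra.
- apply: (nleW xle_ultra) (xleZ Hc k2); apply: le_trans aM.
  by rewrite mulrC ler_pM2l// /M; lra.
Qed.

End AtRho.

Lemma xfinP x : exists2 eps : R, 0 < eps < 1 &
  forall rho, annulus B eps rho -> exists c, xle rho x c.
Proof.
have [eps e01 H] := annulus_sub_fin (fun i => gfinP (ecoord x 0 i)).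
exists eps => // rho rI; have rho0 := annulus_gt0 e01 rI.
have /choice[c Hc] : forall i, exists c, gle rho (ecoord x 0 i) c by exact: H.
have c0 i : 0 <= c i := gle_ge0 (Hc i).
exists (\sum_i c i); split; first by rewrite sumr_ge0.
move=> i; apply: gleW (Hc i); rewrite (bigD1 i)//= lerDl sumr_ge0//.
Qed.

Section OnAnnulus.
Variables (eps : R) (e01 : 0 < eps < 1).
Let I := annulus B eps.
Let Ipos rho : I rho -> 0 < rho := annulus_gt0 e01.

Lemma xlim_uniq u x y : xlim I u x -> xlim I u y -> x = y.
Proof.
have [e0 _] := andP e01; have r1 := annulus_mem B e0.
by move=> /(_ _ r1)[_ _ H1] /(_ _ r1)[_ _ H2]; exact: xncvg_uniq (Ipos r1) _ _ _ H1 H2.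
Qed.

Lemma x_complete u :
  (forall rho, I rho -> forall k, exists c, xle rho (u k) c) ->
  (forall rho, I rho -> forall d : R, 0 < d ->
    exists N : nat, forall k, (N <= k)%N -> xle rho (u k) d) ->
  exists x, xlim I (fun N => \sum_(k < N) u k) x.
Proof.
move=> fu Hu; pose U N := \sum_(k < N) u k.
have fU rho (rI : I rho) N : exists c, xle rho (U N) c.
  by apply: (xfin_sum (Ipos rI)) => k _; exact: fu.
have cauchyU rho (rI : I rho) (d : R) : 0 < d -> exists N : nat, forall k l,
    (N <= k)%N -> (N <= l)%N -> xle rho (U k - U l) d.
  move=> d0; have [N HN] := Hu _ rI _ d0; exists N.
  have W k l : (N <= l)%N -> (l <= k)%N -> xle rho (U k - U l) d.
    move=> Nl lk; rewrite -(subnKC lk) /U big_split_ord /= addrAC subrr add0r.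
    apply: (nle_sum (xle_ultra (Ipos rI))) => [|i _]; first exact: ltW.
    by apply: HN; rewrite (leq_trans Nl)// leq_addr.
  move=> k l Nk Nl; have [lk|/ltnW kl] := leqP l k; first exact: W.
  by rewrite -opprB; apply: (nleN (xle_ultra (Ipos rI))); exact: W.
have /choice[s Hs] : forall i, exists s : G, forall rho, I rho ->
    cvg_at rho (coef s) /\ ncvg (gle rho) (fun N => ecoord (U N) 0 i) s.
  move=> i; apply: (germ_complete e01) => rho rI.
    by move=> N; have [c [_ /(_ i)[]]] := fU _ rI N.
  move=> d d0; have [N HN] := cauchyU _ rI _ d0; exists N => k l Nk Nl.
  by have [_ /(_ i)] := HN k l Nk Nl; rewrite ecoordB !mxE.
pose x := \sum_i s i *: e i.
have xE : ecoord x = \row_i s i.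
  by apply: ecoord_uniq; apply: eq_bigr => i _; rewrite mxE.
exists x => rho rI; have rho0 := Ipos rI; split; first exact: fU.
  apply: (xfin_sum rho0) => i _.
  have [c Hc] := gle_fin rho0 (Hs i _ rI).1.
  apply: (xfinZ rho0); first by exists c.
  exists 1; split=> // j; rewrite ecoord_basis.
  by case: eqP => _; [exact: gle1|exact: gle0].
move=> d d0.
have /choice[N HN] : forall i, exists N : nat, forall k, (N <= k)%N ->
    gle rho (ecoord (U k) 0 i - s i) d.
  by move=> i; have [_ /(_ _ d0)] := Hs i _ rI.
exists (\max_i N i) => k Nk; split; first exact: ltW.
move=> i; rewrite ecoordB xE !mxE; apply: HN; apply: leq_trans Nk.
exact: leq_bigmax.
Qed.

End OnAnnulus.

Lemma xlim_sub (I J : set R) u x : I `<=` J -> xlim J u x -> xlim I u x.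
Proof. by move=> IJ H rho /IJ /H. Qed.

Lemma xlimG_uniq u x y : xlimG u x -> xlimG u y -> x = y.
Proof.
move=> [e1 e101 H1] [e2 e201 H2]; have [e3 e301 [S1 S2]] := annulus_sub B e101 e201.
by apply: (xlim_uniq e301 (xlim_sub S1 H1)); exact: xlim_sub H2.
Qed.

Lemma xlimGD u v x y : xlimG u x -> xlimG v y -> xlimG (fun k => u k + v k) (x + y).
Proof.
move=> [e1 e101 H1] [e2 e201 H2]; have [e3 e301 [S1 S2]] := annulus_sub B e101 e201.
exists e3 => // rho rI; have rho0 := annulus_gt0 e301 rI.
have [a1 b1 c1] := H1 _ (S1 _ rI); have [a2 b2 c2] := H2 _ (S2 _ rI).
split; [by move=> k; exact: xfinD|exact: xfinD|].
exact: ncvgD (xle_ultra rho0) _ _ _ _ c1 c2.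
Qed.

End ModNorm.

(** * Boundedness of linear maps between free modules *)

Section LinearMaps.
Variables (R : realType) (p : nat) (K : cufield R p) (B : germ_kind).
Local Notation G := (germ K B).
Variables (X Y : lmodType G) (n m : nat) (e : 'I_n -> X) (e' : 'I_m -> Y).
Hypotheses (be : is_basis e) (be' : is_basis e').
Variable f : X -> Y.
Hypothesis lf : linear f.

Lemma lin0 : f 0 = 0.
Proof. by have := lf (-1) 0 0; rewrite scaler0 addr0 scaleN1r addNr. Qed.

Lemma linD x y : f (x + y) = f x + f y.
Proof. by have := lf 1 x y; rewrite !scale1r. Qed.

Lemma linZ a x : f (a *: x) = a *: f x.
Proof. by have := lf a x 0; rewrite !addr0 lin0 addr0. Qed.

Lemma linB x y : f (x - y) = f x - f y.
Proof. by rewrite linD -scaleN1r linZ scaleN1r. Qed.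

Lemma lin_sum (I : Type) (s : seq I) (P : pred I) (F : I -> X) :
  f (\sum_(j <- s | P j) F j) = \sum_(j <- s | P j) f (F j).
Proof. by elim/big_rec2 : _ => [|j x y _ <-]; rewrite ?lin0 ?linD. Qed.

(** The constant only involves the images of the finitely many basis vectors, so it exists on an
    annulus on which all of these converge. *)
Lemma lin_bound : exists2 eps : R, 0 < eps < 1 & forall rho, annulus B eps rho ->
  exists2 C : R, 0 <= C & forall x c, xle e rho x c -> xle e' rho (f x) (C * c).
Proof.
have [eps e01 H] := annulus_sub_fin (fun i => xfinP e' (f (e i))).
exists eps => // rho rI; have rho0 := annulus_gt0 e01 rI.
have /choice[c Hc] : forall i, exists c, xle e' rho (f (e i)) c by exact: H.
have c0 i : 0 <= c i by have [] := Hc i.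
exists (\sum_i c i); first by rewrite sumr_ge0.
move=> x d [d0 Hx]; rewrite -(ecoordK be x) lin_sum.
apply: (nle_sum (xle_ultra be' rho0)); first by rewrite mulr_ge0// sumr_ge0.
move=> i _; rewrite linZ mulrC.
apply: (nleW (xle_ultra be' rho0)) (xleZ be' rho0 (Hx i) (Hc i)).
by rewrite ler_wpM2l// (bigD1 i)//= lerDl sumr_ge0.
Qed.

(** For [f] the identity and two bases of one module this says that limits do not depend on the
    basis; for a morphism it makes every operator defined by a limit functorial. *)
Lemma lin_xlimG (u : nat -> X) x : xlimG e u x -> xlimG e' (fun k => f (u k)) (f x).
Proof.
move=> [e1 e101 H1]; have [e2 e201 H2] := lin_bound.
have [e3 e301 [S1 S2]] := annulus_sub B e101 e201.
exists e3 => // rho rI; have rho0 := annulus_gt0 e301 rI.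
have [a1 b1 c1] := H1 _ (S1 _ rI); have [C C0 HC] := H2 _ (S2 _ rI); split.
- by move=> k; have [c Hc] := a1 k; exists (C * c); exact: HC.
- by have [c Hc] := b1; exists (C * c); exact: HC.
move=> d d0; have C1 : 0 < C + 1 by lra.
have [N HN] := c1 _ (divr_gt0 d0 C1); exists N => k /HN /HC.
rewrite linB; apply: (nleW (xle_ultra be' rho0)).
by rewrite mulrCA ler_piMr ?(ltW d0)// ler_pdivrMr// mul1r; lra.
Qed.

End LinearMaps.

(** * Newton interpolation *)

Section NewtonBasis.
Variables (R : realType) (p : nat) (K : cufield R p) (b : nat -> K).

Definition newton (n : nat) (z : K) : K := \prod_(i < n) (z - b i).

(** Coefficient of [z^k] in the [n]-th Newton polynomial. For the nodes [b n = n] these are the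
    signed Stirling numbers of the first kind. *)
Fixpoint newton_coef (n k : nat) : K :=
  if n is n'.+1 then
    (if k is k'.+1 then newton_coef n' k' else 0) - b n' * newton_coef n' k
  else (k == 0%N)%:R.

(** Coefficient of the [n]-th Newton polynomial in [z^k]; the recursion expresses [z * newton n z =
    newton n.+1 z + b n * newton n z]. For [b n = n] these are the Stirling numbers of the second
    kind. *)
Fixpoint power_coef (k n : nat) : K :=
  if k is k'.+1 then
    (if n is n'.+1 then power_coef k' n' else 0) + b n * power_coef k' n
  else (n == 0%N)%:R.

Lemma newton_coefS n k : newton_coef n.+1 k =
  (if k is k'.+1 then newton_coef n k' else 0) - b n * newton_coef n k.
Proof. by []. Qed.

Lemma power_coefS k n : power_coef k.+1 n =
  (if n is n'.+1 then power_coef k n' else 0) + b n * power_coef k n.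
Proof. by []. Qed.

Local Arguments newton_coef : simpl never.
Local Arguments power_coef : simpl never.

Lemma newton_coef_tri n k : (n < k)%N -> newton_coef n k = 0.
Proof.
elim: n k => [|n IH] [|k] // nk.
by rewrite newton_coefS !IH ?mulr0 ?subr0//; lia.
Qed.

Lemma power_coef_tri n k : (n < k)%N -> power_coef n k = 0.
Proof.
elim: n k => [|n IH] [|k] // nk.
by rewrite power_coefS !IH ?mulr0 ?addr0//; lia.
Qed.

Lemma newtonE n z : newton n z = \sum_(k < n.+1) newton_coef n k * z ^+ k.
Proof.
elim: n => [|n IH].
  by rewrite /newton big_ord0 big_ord_recl big_ord0 /= /newton_coef mul1r addr0.
rewrite /newton big_ord_recr /= -/(newton n z) IH mulrBr.
under [RHS]eq_bigr => k _ do rewrite newton_coefS mulrBl.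
rewrite sumrB [X in _ = X - _]big_ord_recl /= mul0r add0r mulr_suml; congr (_ - _).
  by apply: eq_bigr => i _; rewrite -mulrA -exprSr.
rewrite [RHS]big_ord_recr /= newton_coef_tri// mulr0 mul0r addr0 mulr_suml.
by apply: eq_bigr => i _; ring.
Qed.

Lemma newtonS n z : newton n.+1 z = newton n z * (z - b n).
Proof. by rewrite /newton big_ord_recr. Qed.

Lemma powerE k z : z ^+ k = \sum_(n < k.+1) power_coef k n * newton n z.
Proof.
elim: k => [|k IH].
  by rewrite expr0 big_ord_recl big_ord0 /= /newton big_ord0 /power_coef mul1r addr0.
rewrite exprSr IH mulr_suml.
under [RHS]eq_bigr => n _ do rewrite power_coefS mulrDl.
rewrite big_split /= [X in _ = X + _]big_ord_recl /= mul0r add0r.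
rewrite [X in _ = _ + X]big_ord_recr /= power_coef_tri// mulr0 mul0r addr0.
rewrite -big_split /=; apply: eq_bigr => n _.
by rewrite /bump /= add1n add0n newtonS; ring.
Qed.

Variable w : R.
Hypotheses (w0 : 0 <= w) (bw : forall n, vabs (b n) <= w).

(** For the norm giving [z^k] the weight [w^k], multiplication by [z - b n] has norm at most [w],
    because all nodes lie in the disk of radius [w]. Together with [power_coef_le] this makes the
    change of basis between powers and Newton polynomials isometric for the weights [w^k]. *)
Lemma newton_coef_le n k : vabs (newton_coef n k) * w ^+ k <= w ^+ n.
Proof.
elim: n k => [|n IH] k.
  case: k => [|k]; rewrite /newton_coef /=; first by rewrite vabs1 mul1r.
  by rewrite vabs0 mul0r expr0.
have H : vabs (b n * newton_coef n k) * w ^+ k <= w ^+ n.+1.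
  by rewrite vabsM -mulrA exprS; apply: ler_pM => //; rewrite ?mulr_ge0 ?vabs_ge0 ?exprn_ge0.
have [w00|wn0] := eqVneq (w ^+ k) 0; first by rewrite w00 mulr0 exprn_ge0.
have wk : 0 < w ^+ k by rewrite lt_def wn0 exprn_ge0.
rewrite newton_coefS -ler_pdivlMr//; apply: vabsD_le; last by rewrite vabsN ler_pdivlMr.
case: k {H wn0} wk => [|k] wk; first by rewrite vabs0 divr_ge0 ?exprn_ge0.
by rewrite ler_pdivlMr// exprSr mulrA exprSr; apply: ler_wpM2r.
Qed.

Lemma power_coef_le k n : vabs (power_coef k n) * w ^+ n <= w ^+ k.
Proof.
elim: k n => [|k IH] n.
  case: n => [|n]; rewrite /power_coef /=; first by rewrite vabs1 mul1r.
  by rewrite vabs0 mul0r expr0.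
have H : vabs (b n * power_coef k n) * w ^+ n <= w ^+ k.+1.
  by rewrite vabsM -mulrA exprS; apply: ler_pM => //; rewrite ?mulr_ge0 ?vabs_ge0 ?exprn_ge0.
have [w00|wn0] := eqVneq (w ^+ n) 0; first by rewrite w00 mulr0 exprn_ge0.
have wk : 0 < w ^+ n by rewrite lt_def wn0 exprn_ge0.
rewrite power_coefS -ler_pdivlMr//; apply: vabsD_le; last by rewrite ler_pdivlMr.
case: n {H wn0} wk => [|n] wk; first by rewrite vabs0 divr_ge0 ?exprn_ge0.
by rewrite ler_pdivlMr// exprSr mulrA exprSr; apply: ler_wpM2r.
Qed.

Lemma newton_le n z : vabs z <= w -> vabs (newton n z) <= w ^+ n.
Proof.
move=> zw; elim: n => [|n IH]; first by rewrite /newton big_ord0 vabs1 expr0.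
rewrite newtonS exprSr vabsM; apply: ler_pM; rewrite ?vabs_ge0//.
by apply: vabsD_le; rewrite ?vabsN.
Qed.

End NewtonBasis.

(** * Triangular changes of basis between families of geometric growth *)

Section Exchange.
Variables (R : realType) (p : nat) (K : cufield R p) (B : germ_kind).
Local Notation G := (germ K B).
Variables (X : lmodType G) (n0 : nat) (e : 'I_n0 -> X).
Hypothesis be : is_basis e.
Variables (eps : R) (e01 : 0 < eps < 1).
Let I := annulus B eps.
Let Ipos rho : I rho -> 0 < rho := annulus_gt0 e01.
Local Notation "a %* x" := (gcst B a *: x) (at level 40).

Definition xsum (I : set R) (u : nat -> X) x := xlim e I (fun N => \sum_(k < N) u k) x.

(** The ratio [s] may depend on the radius, but exceeds [w] strictly: this leaves room to sum
    against coefficients of size [w^k]. *)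
Definition geo (I : set R) (w : R) (u : nat -> X) : Prop := forall rho, I rho ->
  exists C s : R, [/\ 0 < C, w < s & forall k, xle e rho (u k) (C / s ^+ k)].

Variables (w : R) (w0 : 0 < w) (u : nat -> X).

Lemma geo_term rho C s A : 0 < rho -> 0 <= C -> w < s ->
  (forall k, xle e rho (u k) (C / s ^+ k)) ->
  forall (f : nat -> K), (forall k, vabs (f k) <= A * w ^+ k) ->
  forall k, xle e rho (f k %* u k) (C * A * (w / s) ^+ k).
Proof.
move=> r0 C0 ws Hu f Hf k; have s0 : 0 < s := lt_trans w0 ws.
apply: (nleW (xle_ultra be r0)) (xle_gcst be r0 (f k) (Hu k)).
rewrite expr_div_n mulrCA -!mulrA; apply: ler_wpM2l => //; rewrite mulrA.
by apply: ler_wpM2r => //; rewrite invr_ge0 exprn_ge0// ltW.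
Qed.

Lemma ratio01 s : w < s -> 0 <= w / s < 1.
Proof.
move=> ws; have s0 : 0 < s := lt_trans w0 ws.
by rewrite divr_ge0 ?ltW//= ltr_pdivrMr// mul1r.
Qed.

Lemma geo_sum_ex (f : nat -> K) A : geo I w u ->
  (forall k, vabs (f k) <= A * w ^+ k) -> exists x, xsum I (fun k => f k %* u k) x.
Proof.
move=> Hu Hf; apply: (x_complete be e01) => rho rI.
  have [C [s [C0 ws H]]] := Hu _ rI => k.
  by exists (C * A * (w / s) ^+ k); apply: geo_term => //; [exact: Ipos|exact: ltW].
have [C [s [C0 ws H]]] := Hu _ rI => d d0.
have [N HN] := geo_small (C * A) (ratio01 ws) d0; exists N => k Nk.
apply: (nleW (xle_ultra be (Ipos rI)) (HN _ Nk)).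
by apply: geo_term => //; [exact: Ipos|exact: ltW].
Qed.

Variable a : nat -> nat -> K.
Hypothesis atri : forall n k, (n < k)%N -> a n k = 0.
Hypothesis ale : forall n k, vabs (a n k) * w ^+ k <= w ^+ n.

Lemma col_ex k : geo I w u -> exists x, xsum I (fun n => a n k %* u n) x.
Proof.
move=> Hu; apply: (@geo_sum_ex (fun n => a n k) (w ^+ k)^-1) => // n.
by rewrite mulrC ler_pdivlMr// exprn_gt0.
Qed.

Lemma col_le k x rho C s : I rho -> 0 < C -> w <= s ->
  (forall n, xle e rho (u n) (C / s ^+ n)) ->
  xsum I (fun n => a n k %* u n) x -> xle e rho x (C / s ^+ k).
Proof.
move=> rI C0 ws Hu /(_ _ rI)[_ _ Hx]; have r0 := Ipos rI.
have s0 : 0 < s := lt_le_trans w0 ws.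
have d0 : 0 < C / s ^+ k by rewrite divr_gt0// exprn_gt0.
apply: (nsum_le (u := fun n => a n k %* u n) (xle_ultra be r0) d0 _ Hx) => n.
have [nk|kn] := ltnP n k.
  by rewrite atri// gcst0 scale0r; apply: (nle0 (xle_ultra be r0)); exact: ltW.
apply: (nleW (xle_ultra be r0) _ (xle_gcst be r0 _ (Hu n))).
have -> : C / s ^+ k = (s ^+ (n - k)) * (C / s ^+ n).
  by rewrite -[in s ^+ n](subnK kn) exprD; field; rewrite !expf_neq0// gt_eqF.
apply: ler_wpM2r; first by rewrite divr_ge0 ?exprn_ge0 ?ltW.
apply: (@le_trans _ _ (w ^+ (n - k))).
  by rewrite -(ler_pM2r (exprn_gt0 k w0)) -exprD subnK.
by apply: lerXn2r => //; rewrite nnegrE ltW.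
Qed.

(** The array [(a n k * g k) %* u n] has row sums [f n %* u n] and column sums [g k %* v k]; its
    terms decay like [(w / s)^n] uniformly in [k], which allows the exchange at every radius. *)
Lemma exchange_sum (f g : nat -> K) (v : nat -> X) S A : geo I w u ->
  (forall n, f n = \sum_(k < n.+1) a n k * g k) ->
  (forall k, vabs (g k) <= A * w ^+ k) ->
  (forall k, xsum I (fun n => a n k %* u n) (v k)) ->
  xsum I (fun n => f n %* u n) S -> xsum I (fun k => g k %* v k) S.
Proof.
move=> Hu fE Hg Hv HS rho rI; have r0 := Ipos rI; have U := xle_ultra be r0.
have A0 : 0 <= A.
  by have := Hg 0%N; rewrite expr0 mulr1; apply: le_trans; exact: vabs_ge0.
have [_ Sfin HSr] := HS _ rI; split=> //.
  move=> N; apply: (xfin_sum be r0) => k _; apply: (xfinZ be r0).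
    by exists (vabs (g k)); exact: gle_gcst.
  by have [] := Hv k _ rI.
have [C [s [C0 ws H]]] := Hu _ rI; have s0 : 0 < s := lt_trans w0 ws.
apply: (@sum_exchange _ _ _ U (fun n k => (a n k * g k) %* u n)
   (fun n => C * A * (w / s) ^+ n) (fun n => f n %* u n) (fun k => g k %* v k) S).
- by move=> n k nk; rewrite atri// mul0r gcst0 scale0r.
- move=> n k; apply: (nleW U _ (xle_gcst be r0 _ (H n))).
  rewrite expr_div_n mulrCA -!mulrA; apply: ler_wpM2l; first exact: ltW.
  rewrite mulrA; apply: ler_wpM2r; first by rewrite invr_ge0 exprn_ge0// ltW.
  rewrite vabsM; apply: (@le_trans _ _ (vabs (a n k) * (A * w ^+ k))).
    by apply: ler_wpM2l; rewrite ?vabs_ge0.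
  by rewrite mulrCA; apply: ler_wpM2l.
- exact: geo_small (ratio01 ws).
- by move=> n; rewrite fE gcst_sum scaler_suml.
- exact: HSr.
move=> k; have [_ vfin Hvr] := Hv k _ rI.
have Hc : ncvg (gle rho) (fun _ => gcst B (g k)) (gcst B (g k)).
  exact: ncvg_const (gle_ultra K B r0) _.
apply: eq_ncvg (xncvgZ be r0 _ vfin Hc Hvr).
  by move=> N; rewrite scaler_sumr; apply: eq_bigr => n _; rewrite scalerA -gcstM mulrC.
by exists (vabs (g k)); exact: gle_gcst.
Qed.

End Exchange.

(** * q-derivatives and divided derivatives *)

Section GermOps.
Variables (R : realType) (p : nat) (K : cufield R p) (B : germ_kind).
Local Notation G := (germ K B).
Implicit Types (f g : G).

Lemma disk_neq0 (q : disk11 K) : (q : K) != 0.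
Proof.
by apply/eqP => q0; have := vabs_disk11 q; rewrite q0 vabs0 => /eqP; rewrite eq_sym oner_eq0.
Qed.

Lemma sigmaD (q : disk11 K) f g : sigma q (f + g) = sigma q f + sigma q g.
Proof. by apply/germ_eq/funext => i; rewrite /= mulrDr. Qed.

Lemma coef_sigma (q : disk11 K) f i : coef (sigma q f) i = (q : K) ^ i * coef f i.
Proof. by []. Qed.

Lemma sigma_gmono (q : disk11 K) x k : sigma q (gmono B x k) = gmono B ((q : K) ^ k * x) k.
Proof.
by apply/germ_eq/funext => i; rewrite /= /lmono; case: eqP => [->//|_]; rewrite mulr0.
Qed.

Lemma sigma_gcst (q : disk11 K) x : sigma q (gcst B x) = gcst B x.
Proof. by rewrite /gcst sigma_gmono expr0z mul1r. Qed.

Lemma sigma_gmonoM (q : disk11 K) x k f :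
  sigma q (gmono B x k * f) = gmono B ((q : K) ^ k * x) k * sigma q f.
Proof.
apply/germ_eq/funext => i; rewrite coef_sigma !coef_gmonoM coef_sigma.
have -> : (q : K) ^ i = (q : K) ^ (i - k) * (q : K) ^ k.
  by rewrite -expfzDr ?disk_neq0// subrK.
by rewrite [RHS]mulrACA; congr (_ * _); rewrite mulrC.
Qed.

Lemma coef_delta1 f i : coef (delta1 f) i = i%:~R * coef f i.
Proof. by rewrite coef_gmonoM mul1r /= subrK. Qed.

Lemma delta1_gmono x k : delta1 (gmono B x k) = gmono B (k%:~R * x : K) k.
Proof.
apply/germ_eq/funext => i; rewrite coef_delta1 /= /lmono.
by case: eqP => [->//|_]; rewrite mulr0.
Qed.

Lemma delta1_gmonoM x k f :
  delta1 (gmono B x k * f) = k%:~R * (gmono B x k * f) + gmono B x k * delta1 f.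
Proof.
apply/germ_eq/funext => i; rewrite gcoefD coef_delta1 (coef_gmonoM x k (delta1 f)) coef_delta1 (coef_gmonoM x k f).
have -> : (k%:~R : G) = gcst B k%:~R.
  by case: k => n; rewrite ?NegzE ?mulrNz ?gcstN gcst_nat.
by rewrite coef_gcstM coef_gmonoM rmorphB /=; set a := k%:~R; set b := i%:~R; ring.
Qed.

(** This is [T^j f^(j) / j!]: it multiplies the coefficient of [T^i] by the binomial coefficient
    [binom(i, j)], an integer for negative [i] too. *)
Definition ddiv (j : nat) f : G := gmono B (j`!%:R)^-1 j%:Z * iter j (@gderiv R p K B) f.

Lemma coef_ddiv j f i :
  coef (ddiv j f) i = (j`!%:R)^-1 * (\prod_(k < j) (i - k%:Z))%:~R * coef f i.
Proof. by rewrite coef_gmonoM coef_deriv_iter subrK mulrA. Qed.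

Lemma ddiv0 f : ddiv 0 f = f.
Proof. by rewrite /ddiv /= fact0 invr1 mul1r. Qed.

Lemma coef_natM m f i : coef (m%:R * f) i = m%:R * coef f i.
Proof. by rewrite -gcst_nat coef_gcstM. Qed.

(** On the coefficient of [T^i] this is [i binom(i, j) = (j + 1) binom(i, j + 1) + j binom(i,
    j)]. *)
Lemma delta1_ddiv j f : delta1 (ddiv j f) = j.+1%:R * ddiv j.+1 f + j%:R * ddiv j f.
Proof.
apply/germ_eq/funext => i; rewrite coef_delta1 gcoefD (coef_natM _ (ddiv j.+1 f)) (coef_natM _ (ddiv j f)).
rewrite !coef_ddiv big_ord_recr /= intrM intrB factS natrM invfM -[_ j%:Z]pmulrn.
move: (\prod_(_ < _) _)%:~R (i%:~R) (coef f i) => P a b.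
have H1 := natS_neq0 K j; have H2 := fact_neq0 K j.
by field; rewrite nat1r H1 H2.
Qed.

Lemma gle_ddiv_norm rho f c j : 0 < rho -> gle rho f c -> gle rho (ddiv j f) c.
Proof.
move=> r0 /(gle_coef r0); apply=> i; rewrite coef_ddiv vabsM.
apply: ler_piMl; first exact: vabs_ge0.
have [z ->] := ffact_int i j.
by rewrite intrM mulrCA mulVf ?fact_neq0// mulr1 vabs_int_le1.
Qed.

Lemma gle_delta1 rho f c : 0 < rho -> gle rho f c -> gle rho (delta1 f) c.
Proof.
move=> r0 /(gle_coef r0); apply=> i; rewrite coef_delta1 vabsM.
by apply: ler_piMl; rewrite ?vabs_ge0// vabs_int_le1.
Qed.

End GermOps.

Section SigmaOps.
Variables (R : realType) (p : nat) (K : cufield R p) (B : germ_kind).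
Local Notation G := (germ K B).
Variables (q : disk11 K) (X : lmodType G) (sg : X -> X).
Hypothesis sgD : {morph sg : x y / x + y}.
Hypothesis sgZ : forall f x, sg (f *: x) = sigma q f *: sg x.
Hypothesis qroot : forall n, (q : K) ^+ n.+1 != 1.
Local Notation "a %* x" := (gcst B a *: x) (at level 40).

(** The operator [T^n d_q^n / [n]_q!]. Since [d_q (T^-n y)] equals
    [(q^-n sg y - y) / ((q - 1) T^(n+1))], passing from [n] to [n + 1] amounts to applying
    [q^-n sg - 1] and dividing by [q^(n+1) - 1]. *)
Fixpoint theta (n : nat) (x : X) : X :=
  if n is n'.+1 then
    ((q : K) ^+ n'.+1 - 1)^-1 %* ((q : K) ^- n' %* sg (theta n' x) - theta n' x)
  else x.

Definition qpow (n : nat) : K := (q : K) ^+ n - 1.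

Lemma qpow_neq0 n : qpow n.+1 != 0.
Proof. by rewrite subr_eq0 qroot. Qed.

Lemma sg_gcst a x : sg (a %* x) = a %* sg x.
Proof. by rewrite sgZ sigma_gcst. Qed.

Lemma sg0 : sg 0 = 0.
Proof. by apply: (addIr (sg 0)); rewrite -sgD !add0r. Qed.

Lemma sg_sum (I : Type) (s : seq I) (P : pred I) (F : I -> X) :
  sg (\sum_(j <- s | P j) F j) = \sum_(j <- s | P j) sg (F j).
Proof. by elim/big_rec2 : _ => [|j x y _ <-]; rewrite ?sg0 ?sgD. Qed.

Lemma sg_theta n x :
  sg (theta n x) = (q : K) ^+ n %* theta n x + ((q : K) ^+ n * qpow n.+1) %* theta n.+1 x.
Proof.
rewrite /= scalerA -gcstM /qpow mulfK ?qpow_neq0// scalerBr scalerA -gcstM.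
by rewrite mulfV ?expf_neq0 ?disk_neq0// gcst1 scale1r addrC subrK.
Qed.

(* Newton's interpolation formula for [m |-> sg^m], at the nodes [q^n - 1]. *)
Lemma iter_sg_newton m x :
  iter m sg x = \sum_(n < m.+1) newton qpow n (qpow m) %* theta n x.
Proof.
elim: m => [|m IH].
  by rewrite big_ord_recl big_ord0 /= /newton big_ord0 gcst1 scale1r addr0.
rewrite iterS IH sg_sum.
pose c m n := newton qpow n (qpow m).
have tri l k : (l < k)%N -> c l k = 0.
  move=> lk; apply/eqP/prodf_eq0; exists (Ordinal lk) => //=.
  by rewrite subrr.
(* A q-Pascal rule for the products [\prod_(i < n) (q^m - q^i)]; it mirrors the expansion of
   [sg (theta n x)] in [sg_theta]. *)
have rec n : c m.+1 n.+1 = (q : K) ^+ n.+1 * c m n.+1 + ((q : K) ^+ n * qpow n.+1) * c m n.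
  have -> : c m.+1 n.+1 = (q : K) ^+ n * qpow m.+1 * c m n.
    rewrite /c /newton; elim: n => [|n IHn].
      by rewrite big_ord_recr !big_ord0 /= /qpow expr0; ring.
    rewrite big_ord_recr /= IHn [in RHS]big_ord_recr /= /qpow !exprS; ring.
  by rewrite {2}/c newtonS -/(c m n) /qpow !exprS; ring.
rewrite [RHS]big_ord_recl.
transitivity (\sum_(n < m.+1) (((q : K) ^+ n * c m n) %* theta n x +
   ((q : K) ^+ n * qpow n.+1 * c m n) %* theta n.+1 x)).
  apply: eq_bigr => n _; rewrite sg_gcst sg_theta scalerDr !scalerA -!gcstM.
  by congr (_ %* _ + _ %* _); rewrite -/(c m n); ring.
rewrite big_split /= big_ord_recl /= -addrA; congr (_ + _).
  by rewrite /c /newton !big_ord0 expr0 mulr1.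
transitivity (\sum_(n < m.+1) ((q : K) ^+ n.+1 * c m n.+1) %* theta n.+1 x +
  \sum_(n < m.+1) ((q : K) ^+ n * qpow n.+1 * c m n) %* theta n.+1 x).
  congr (_ + _); rewrite [RHS]big_ord_recr /= tri// mulr0 gcst0 scale0r addr0.
  by apply: eq_bigr.
rewrite -big_split /=; apply: eq_bigr => n _.
by rewrite -scalerDl -gcstD -rec.
Qed.

Variables (n0 : nat) (e : 'I_n0 -> X).
Hypothesis be : is_basis e.
Variable A : 'M[G]_n0.
Hypothesis eA : is_matrix e sg A.

Lemma ecoord_sg x : ecoord e (sg x) = map_mx (sigma q) (ecoord e x) *m A.
Proof.
apply: (ecoord_uniq be); rewrite -{2}(ecoordK be x) sg_sum.
under [RHS]eq_bigr => i _ do rewrite sgZ eA scaler_sumr.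
rewrite exchange_big /=; apply: eq_bigr => j _.
rewrite mxE scaler_suml; apply: eq_bigr => i _.
by rewrite mxE scalerA.
Qed.

Lemma HseqS k : Hseq q A k.+1 =
  gmono B ((q : K) - 1)^-1 (-1) *: (map_mx (sigma q) (Hseq q A k) *m A - Hseq q A k).
Proof.
rewrite /= -scalemxAr mulmxBr mulmx1.
have -> : map_mx (dquot q) (Hseq q A k) =
    gmono B ((q : K) - 1)^-1 (-1) *: (map_mx (sigma q) (Hseq q A k) - Hseq q A k).
  by apply/matrixP => i j; rewrite !mxE.
by rewrite -scalerDr; congr (_ *: _); rewrite addrC addrA subrK.
Qed.

Lemma qfactS n : qfact (q : K) n.+1 = qfact (q : K) n * (((q : K) ^+ n.+1 - 1) / ((q : K) - 1)).
Proof. by rewrite /qfact big_nat_recr. Qed.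

Lemma qfact_neq0 n : qfact (q : K) n != 0.
Proof.
elim: n => [|n IH]; first by rewrite /qfact big_geq// oner_eq0.
rewrite qfactS mulf_neq0// mulf_neq0 ?invr_eq0 ?(qpow_neq0 n)//.
by have := qpow_neq0 0; rewrite /qpow expr1.
Qed.

Lemma ecoord_theta n i j :
  ecoord e (theta n (e i)) 0 j = gmono B (qfact (q : K) n)^-1 n%:Z * Hseq q A n i j.
Proof.
elim: n j => [|n IH] j.
  by rewrite /= ecoord_basis// mxE eq_sym /qfact big_geq// invr1 mul1r.
have q1 : (q : K) - 1 != 0 by have := qpow_neq0 0; rewrite /qpow expr1.
rewrite /= -/(Hseq q A n.+1) HseqS !(ecoordZ be, ecoordB be) ecoord_sg !mxE.
have -> : \sum_k map_mx (sigma q) (ecoord e (theta n (e i))) 0 k * A k j =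
    gmono B ((q : K) ^+ n * (qfact (q : K) n)^-1) n%:Z *
      \sum_k map_mx (sigma q) (Hseq q A n) i k * A k j.
  by rewrite mulr_sumr; apply: eq_bigr => k _; rewrite !mxE IH sigma_gmonoM mulrA.
rewrite IH !mulrBr !mulrA /gcst !gmonoM; congr (_ * _ - _ * _).
  rewrite qfactS; congr gmono; last lia.
  have H1 := qfact_neq0 n; have H2 := qpow_neq0 n; rewrite /qpow in H2.
  by field; rewrite H1 H2 q1 expf_neq0 ?disk_neq0.
rewrite qfactS; congr gmono; last lia.
have H1 := qfact_neq0 n; have H2 := qpow_neq0 n; rewrite /qpow in H2.
by field; rewrite H1 H2 q1.
Qed.

End SigmaOps.

(** * Divided powers of a connection *)

Section ConnOps.
Variables (R : realType) (p : nat) (K : cufield R p) (B : germ_kind).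
Local Notation G := (germ K B).
Variables (X : lmodType G) (cn : X -> X).
Hypothesis cnD : {morph cn : x y / x + y}.
Hypothesis cnZ : forall f x, cn (f *: x) = delta1 f *: x + f *: cn x.
Local Notation "a %* x" := (gcst B a *: x) (at level 40).

(* [T^k D^k / k!] for [D = T^-1 cn], i.e. the binomial coefficient of [cn]. *)
Fixpoint bin_conn (k : nat) (x : X) : X :=
  if k is k'.+1 then (k'.+1%:R)^-1 %* (cn (bin_conn k' x) - k'%:R *: bin_conn k' x)
  else x.

Lemma cn0 : cn 0 = 0.
Proof. by apply: (addIr (cn 0)); rewrite -cnD !add0r. Qed.

Lemma cn_sum (I : Type) (s : seq I) (P : pred I) (F : I -> X) :
  cn (\sum_(j <- s | P j) F j) = \sum_(j <- s | P j) cn (F j).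
Proof. by elim/big_rec2 : _ => [|j x y _ <-]; rewrite ?cn0 ?cnD. Qed.

Lemma delta1_gcst a : delta1 (gcst B a) = 0 :> G.
Proof. by rewrite /gcst delta1_gmono mul0r. Qed.

Lemma cn_gcst a x : cn (a %* x) = a %* cn x.
Proof. by rewrite cnZ delta1_gcst scale0r add0r. Qed.

Lemma cn_nat m x : cn (m%:R *: x) = m%:R *: cn x.
Proof. by rewrite -gcst_nat cn_gcst. Qed.

Lemma cn_bin k x : cn (bin_conn k x) = k.+1%:R *: bin_conn k.+1 x + k%:R *: bin_conn k x.
Proof.
rewrite /= scalerA -[k.+1%:R in RHS]gcst_nat -gcstM mulfV ?natS_neq0//.
by rewrite gcst1 scale1r subrK.
Qed.

Lemma natS_scaleI k (x y : X) : k.+1%:R *: x = k.+1%:R *: y -> x = y.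
Proof.
rewrite -gcst_nat => /(congr1 (fun z => (k.+1%:R)^-1 %* z)).
by rewrite !scalerA -!gcstM mulVf ?natS_neq0// gcst1 !scale1r.
Qed.

Lemma bin_connS_eq k x y : k.+1%:R *: y = cn (bin_conn k x) - k%:R *: bin_conn k x ->
  y = bin_conn k.+1 x.
Proof.
by move=> H; apply: (@natS_scaleI k); rewrite H cn_bin addrK.
Qed.

Lemma bin_connD k x y : bin_conn k (x + y) = bin_conn k x + bin_conn k y.
Proof.
elim: k => [//|k IH] /=; rewrite IH cnD -scalerDr; congr (_ *: _).
by rewrite scalerDr opprD addrACA.
Qed.

Lemma bin_conn0r k : bin_conn k 0 = 0.
Proof. by apply: (addIr (bin_conn k 0)); rewrite -bin_connD !add0r. Qed.

Lemma bin_conn_sum (I : Type) (s : seq I) (P : pred I) (F : I -> X) k :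
  bin_conn k (\sum_(j <- s | P j) F j) = \sum_(j <- s | P j) bin_conn k (F j).
Proof. by elim/big_rec2 : _ => [|j x y _ <-]; rewrite ?bin_conn0r ?bin_connD. Qed.

(** In the induction, [cn - k] turns the term of index [j] into one of index [j + 1] with weight
    [j + 1] and one of index [j] with weight [k + 1 - j]. The weights arriving at an index add up to
    [k + 1], the denominator introduced by [bin_conn k.+1]. *)
Lemma bin_conn_leibniz k f x :
  bin_conn k (f *: x) = \sum_(j < k.+1) ddiv j f *: bin_conn (k - j) x.
Proof.
elim: k => [|k IH].
  by rewrite big_ord_recl big_ord0 addr0 ddiv0.
apply/esym/bin_connS_eq; rewrite IH cn_sum [X in _ = _ - X]scaler_sumr -sumrB.
have step (j : 'I_k.+1) :
    cn (ddiv j f *: bin_conn (k - j) x) - k%:R *: (ddiv j f *: bin_conn (k - j) x) =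
    j.+1%:R *: (ddiv j.+1 f *: bin_conn (k.+1 - j.+1) x) +
    (k.+1 - j)%N%:R *: (ddiv j f *: bin_conn (k.+1 - j) x).
  have jk : (j <= k)%N by rewrite -ltnS ltn_ord.
  rewrite subSS subSn//; set d := (k - j)%N.
  have -> : (k%:R : G) = (j + d)%:R by rewrite subnKC.
  rewrite cnZ delta1_ddiv cn_bin scalerDl scalerDr.
  move: (bin_conn d x) (bin_conn d.+1 x) => b b'.
  have -> : (j + d)%:R *: (ddiv j f *: b) =
      (j%:R * ddiv j f) *: b + ddiv j f *: (d%:R *: b).
    by rewrite natrD scalerDl !scalerA [ddiv j f * _]mulrC.
  rewrite addrACA addrK !scalerA; congr (_ + _ *: _); exact: mulrC.
rewrite (eq_bigr _ (fun j _ => step j)) big_split /=.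
pose F j := ddiv j f *: bin_conn (k.+1 - j) x.
have E (j : 'I_k.+2) : k.+1%:R *: F j = j%:R *: F j + (k.+1 - j)%N%:R *: F j.
  by rewrite -scalerDl -natrD subnKC// -ltnS ltn_ord.
rewrite scaler_sumr (eq_bigr _ (fun j _ => E j)) big_split /=; congr (_ + _).
  by rewrite big_ord_recl scale0r add0r.
by rewrite big_ord_recr /= subnn scale0r addr0.
Qed.

(** As [T^-k bin_conn k] is [D^k / k!] for [D = T^-1 cn], this is the composition law [(D^m / m!)
    (D^k / k!) = binom(m + k, k) D^(m+k) / (m + k)!], multiplied by [T^m]. *)
Lemma bin_conn_shift m k x : bin_conn m (gmono B 1 (- k%:Z) *: bin_conn k x) =
  ('C(m + k, k))%:R *: (gmono B 1 (- k%:Z) *: bin_conn (m + k) x).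
Proof.
elim: m => [|m IH]; first by rewrite add0n binn scale1r.
apply/esym/bin_connS_eq; rewrite IH cn_nat cnZ delta1_gmono mulr1 cn_bin.
set T := gmono B 1 _.
have -> : gmono B (- k%:Z)%:~R (- k%:Z) = - (k%:R * T) :> G.
  by rewrite -gcst_nat /gcst gmonoM mulr1 add0r mulrNz; apply/germ_eq/funext => i;
     rewrite gcoefN /= /lmono; case: eqP; rewrite ?oppr0.
rewrite addSn; move: (bin_conn (m + k) x) (bin_conn (m + k).+1 x) => b b'.
have -> : - (k%:R * T) *: b + T *: ((m + k).+1%:R *: b' + (m + k)%:R *: b) =
    (m + k).+1%:R *: (T *: b') + m%:R *: (T *: b).
  rewrite scalerDr addrCA; congr (_ + _); first by rewrite !scalerA mulrC.
  by rewrite natrD scalerDl scalerDr addrC scaleNr !scalerA [T * m%:R]mulrC [T * k%:R]mulrC addrK.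
have E (N : G) (z : X) : m%:R *: (N *: z) = N *: (m%:R *: z) by rewrite !scalerA mulrC.
rewrite scalerDr (E ('C(m + k, k))%:R) addrK.
rewrite !scalerA !mulrA -!natrM; congr (_%:R * _ *: _).
have -> : 'C((m + k).+1, k) = 'C((m + k).+1, m.+1).
  by rewrite -(@bin_sub (m + k).+1 k); [congr binomial; lia|lia].
have -> : 'C(m + k, k) = 'C(m + k, m).
  by rewrite -(@bin_sub (m + k) k); [congr binomial; lia|lia].
by rewrite -mul_bin_diag mulnC.
Qed.

Variables (n0 : nat) (e : 'I_n0 -> X).
Hypothesis be : is_basis e.
Variable M : 'M[G]_n0.
Hypothesis eM : is_matrix e cn M.

Lemma ecoord_cn x : ecoord e (cn x) = map_mx (@delta1 R p K B) (ecoord e x) + ecoord e x *m M.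
Proof.
apply: (ecoord_uniq be); rewrite -{3}(ecoordK be x) cn_sum.
under [RHS]eq_bigr => i _ do rewrite cnZ eM scaler_sumr.
rewrite big_split /= exchange_big -big_split /=; apply: eq_bigr => j _.
rewrite !mxE scalerDl scaler_suml; congr (_ + _); apply: eq_bigr => i _.
by rewrite scalerA.
Qed.

Lemma ecoord_bin_conn k i j :
  ecoord e (bin_conn k (e i)) 0 j = gmono B (k`!%:R)^-1 k%:Z * Gseq M k i j.
Proof.
elim: k j => [|k IH] j.
  by rewrite /= ecoord_basis// mxE eq_sym fact0 invr1 mul1r.
rewrite /= !(ecoordZ be, ecoordB be) ecoord_cn !mxE.
have -> : \sum_l ecoord e (bin_conn k (e i)) 0 l * M l j =
    gmono B (k`!%:R)^-1 k%:Z * \sum_l Gseq M k i l * M l j.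
  by rewrite mulr_sumr; apply: eq_bigr => l _; rewrite IH mulrA.
have -> : \sum_l Gseq M k i l * (gTinv K B *: M) l j =
    gTinv K B * \sum_l Gseq M k i l * M l j.
  by rewrite mulr_sumr; apply: eq_bigr => l _; rewrite mxE mulrCA.
rewrite IH delta1_gmonoM pmulrn addrAC [k%:~R * _ + _]addrC addrK.
rewrite /delta1 -mulrDr !mulrA /gT /gcst !gmonoM.
rewrite !mulrDr !mulrA /gTinv !gmonoM !mulr1 factS natrM invfM -pmulrn.
have -> : 0 + k%:Z + 1 = k.+1%:Z by lia.
by have -> : 0 + k%:Z = k.+1%:Z - 1 by lia.
Qed.

End ConnOps.

Section BinConnBounds.
Variables (R : realType) (p : nat) (K : cufield R p) (B : germ_kind).
Local Notation G := (germ K B).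
Variables (X : lmodType G) (cn : X -> X).
Hypothesis cnD : {morph cn : x y / x + y}.
Hypothesis cnZ : forall f x, cn (f *: x) = delta1 f *: x + f *: cn x.
Variables (n0 : nat) (e : 'I_n0 -> X).
Hypothesis be : is_basis e.
Local Notation "a %* x" := (gcst B a *: x) (at level 40).

(** By the Leibniz rule the bounds on basis vectors suffice, since [ddiv j] does not increase norms.
    The condition [s <= 1] serves to bound [1 / s^(k - j)] by [1 / s^k]; it corresponds to the cap
    by [rho] in the definition of the radius. *)
Lemma bin_conn_le rho C s x c : 0 < rho -> 0 < C -> 0 < s <= 1 ->
  (forall k i, xle e rho (bin_conn cn k (e i)) (C / s ^+ k)) -> xle e rho x c ->
  forall k, xle e rho (bin_conn cn k x) (c * C / s ^+ k).
Proof.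
move=> r0 C0 /andP[s0 s1] He [c0 Hx] k; have U := xle_ultra be r0.
have bnd : 0 <= c * C / s ^+ k.
  by rewrite divr_ge0 ?mulr_ge0 ?exprn_ge0// ltW.
rewrite -(ecoordK be x) bin_conn_sum//; apply: (nle_sum U) => // i _.
rewrite bin_conn_leibniz//; apply: (nle_sum U) => // j _.
have jk : (j <= k)%N by rewrite -ltnS ltn_ord.
apply: (nleW U _ (xleZ be r0 (gle_ddiv_norm j r0 (Hx i)) (He (k - j)%N i))).
rewrite -mulrA; apply: ler_wpM2l => //; apply: ler_wpM2l; first exact: ltW.
rewrite lef_pV2 ?posrE ?exprn_gt0//.
by apply: ler_wiXn2l; rewrite ?(ltW s0)//; exact: leq_subr.
Qed.

Lemma cn_bound rho : 0 < rho -> (forall i, exists c, xle e rho (cn (e i)) c) ->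
  exists2 C : R, 0 <= C & forall x c, xle e rho x c -> xle e rho (cn x) (C * c).
Proof.
move=> r0 /choice[c Hc]; have U := xle_ultra be r0.
have c0 i : 0 <= c i by have [] := Hc i.
exists (1 + \sum_i c i); first by rewrite addr_ge0// sumr_ge0.
move=> x d [d0 Hx]; rewrite -(ecoordK be x) cn_sum//.
have bnd : 0 <= (1 + \sum_i c i) * d by rewrite mulr_ge0// addr_ge0// sumr_ge0.
apply: (nle_sum U) => // i _; rewrite cnZ; apply: (nleD U).
  have He : xle e rho (e i) 1.
    split=> // j; rewrite ecoord_basis//.
    by case: eqP => _; [exact: gle1|exact: gle0].
  apply: (nleW U _ (xleZ be r0 (gle_delta1 r0 (Hx i)) He)).
  by rewrite mulr1 ler_peMl// lerDl sumr_ge0.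
apply: (nleW U _ (xleZ be r0 (Hx i) (Hc i))).
rewrite mulrC; apply: ler_wpM2r => //.
by rewrite (bigD1 i)//= addrCA lerDl addr_ge0// sumr_ge0.
Qed.

End BinConnBounds.

(** * From the divided powers of a connection to q-divided powers *)

Section ConnToQ.
Variables (R : realType) (p : nat) (K : cufield R p) (B : germ_kind).
Local Notation G := (germ K B).
Variables (q : disk11 K) (X : lmodType G) (sg cn : X -> X).
Hypothesis sgD : {morph sg : x y / x + y}.
Hypothesis sgZ : forall f x, sg (f *: x) = sigma q f *: sg x.
Hypothesis qroot : forall n, (q : K) ^+ n.+1 != 1.
Variables (n0 : nat) (e : 'I_n0 -> X).
Hypothesis be : is_basis e.
Variables (eps : R) (e01 : 0 < eps < 1).
Let I := annulus B eps.
Let Ipos rho : I rho -> 0 < rho := annulus_gt0 e01.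
Local Notation "a %* x" := (gcst B a *: x) (at level 40).
Local Notation b := (qpow q).
Variables (w : R) (w0 : 0 < w) (qw : vabs ((q : K) - 1) <= w).

Lemma qpow_le n : vabs (b n) <= w.
Proof. by apply: le_trans qw; have := vabs_qnum q n%:Z. Qed.

Variable x : X.
Hypothesis geox : geo e I w (fun k => bin_conn cn k x).
Hypothesis sgE : forall m, xsum e I (fun k => b m ^+ k %* bin_conn cn k x) (iter m sg x).

Lemma xsum_fin (u : nat -> X) m : (forall k, (m <= k)%N -> u k = 0) ->
  (forall rho, I rho -> forall k, exists c, xle e rho (u k) c) ->
  xsum e I u (\sum_(k < m) u k).
Proof.
move=> um fu rho rI; have r0 := Ipos rI; split.
- by move=> N; apply: (xfin_sum be r0) => k _; exact: fu.
- by apply: (xfin_sum be r0) => k _; exact: fu.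
exact: (nsum_fin (xle_ultra be r0) um).
Qed.

(** Re-expanding the given series in Newton polynomials produces vectors [v n] with [sg^m x =
    \sum_(n <= m) newton n (q^m - 1) v n]. Newton's formula says the same of [theta], and the system
    is triangular with nonzero diagonal because no [q^m] with [m > 0] is 1; hence [v] is [theta]. *)
Lemma bin_conn_theta n : xsum e I (fun k => power_coef b k n %* bin_conn cn k x) (theta q sg n x).
Proof.
have tri := @power_coef_tri _ _ _ b.
have ple := power_coef_le (ltW w0) qpow_le.
have /choice[v Hv] : forall n, exists y,
    xsum e I (fun k => power_coef b k n %* bin_conn cn k x) y.
  by move=> m; apply: (col_ex be e01 w0 ple).
have newton0 m k : (m < k)%N -> newton b k (b m) = 0.
  by move=> mk; apply/eqP/prodf_eq0; exists (Ordinal mk) => //=; rewrite subrr.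
have sv m : iter m sg x = \sum_(k < m.+1) newton b k (b m) %* v k.
  have H : xsum e I (fun k => newton b k (b m) %* v k) (iter m sg x).
    apply: (exchange_sum (a := power_coef b) (A := 1) (f := fun k => b m ^+ k)
      be e01 w0 tri ple geox) => //.
      by move=> k; exact: powerE.
    by move=> k; rewrite mul1r; apply: (newton_le qpow_le); exact: qpow_le.
  apply: (xlim_uniq be e01 H (y := \sum_(k < m.+1) _)).
  apply: (@xsum_fin (fun k => newton b k (b m) %* v k)) => [k mk|rho rI k].
    by rewrite newton0// gcst0 scale0r.
  apply: (xfinZ be (Ipos rI)); first by apply: gle_fin; [exact: Ipos|exact: cvg_at_lmono (Ipos rI) _ _].
  by have [] := Hv k _ rI.
suff vE m : v m = theta q sg m x by rewrite -vE; exact: Hv.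
elim/ltn_ind: m => m IH.
have := sv m; rewrite (iter_sg_newton sgD sgZ qroot) !big_ord_recr /=.
rewrite (eq_bigr (fun k : 'I_m => newton b k (b m) %* v k)); last by move=> k _; rewrite IH.
move=> /addrI /(congr1 (fun y => (newton b m (b m))^-1 %* y)).
rewrite !scalerA -!gcstM mulVf ?gcst1 ?scale1r//.
apply/prodf_neq0 => i _; rewrite subr_eq0 /qpow (inj_eq (addIr _)).
have -> : (q : K) ^+ m = (q : K) ^+ i * (q : K) ^+ (m - i).-1.+1.
  by rewrite -exprD; congr (_ ^+ _); have := ltn_ord i; lia.
rewrite -[X in _ != X]mulr1 (inj_eq (mulfI _)) ?qroot//.
by rewrite expf_neq0// disk_neq0.
Qed.

(** At [z = q' - 1] the series in powers of [z] is the Taylor solution at [q' T], and the series in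
    Newton polynomials is the q-Taylor solution there: the two values coincide. *)
Lemma qTaylor_sum z S : vabs z <= w ->
  xsum e I (fun k => z ^+ k %* bin_conn cn k x) S ->
  xsum e I (fun n => newton b n z %* theta q sg n x) S.
Proof.
move=> zw; apply: (exchange_sum (a := power_coef b) (A := 1) be e01 w0
  (@power_coef_tri _ _ _ b) (power_coef_le (ltW w0) qpow_le) geox).
- by move=> k; exact: powerE.
- by move=> k; rewrite mul1r; apply: (newton_le qpow_le).
exact: bin_conn_theta.
Qed.

Lemma theta_le rho C s : I rho -> 0 < C -> w <= s ->
  (forall k, xle e rho (bin_conn cn k x) (C / s ^+ k)) ->
  forall n, xle e rho (theta q sg n x) (C / s ^+ n).
Proof.
move=> rI C0 ws H n.
apply: (col_le be e01 w0 (@power_coef_tri _ _ _ b) (power_coef_le (ltW w0) qpow_le) rI C0 ws H).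
exact: bin_conn_theta.
Qed.

End ConnToQ.

(** * Powers of q *)

Section DiskPowers.
Variables (R : realType) (p : nat) (K : cufield R p).
Implicit Types (u : K).

Lemma p_neq0 : (p%:R : K) != 0.
Proof.
have /pcharf0P -> : [pchar K] =i pred0 := cu_char0 K.
by rewrite -lt0n prime_gt0// (cu_p_prime K).
Qed.

Lemma vabs_p_gt0 : 0 < vabs (p%:R : K).
Proof. exact: vabs_gt0 p_neq0. Qed.

Lemma vabs_unit u : vabs (u - 1) < 1 -> vabs u = 1.
Proof. by move=> H; exact: (vabs_disk11 (Disk11 H)). Qed.

Lemma vabs_pow_sub1 u n : vabs (u - 1) < 1 -> vabs (u ^+ n - 1) <= vabs (u - 1).
Proof. by move=> H; have := vabs_qnum (Disk11 H) n%:Z. Qed.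

Lemma vabs_geo_sum u n : vabs (u - 1) < 1 ->
  vabs (\sum_(i < n) u ^+ i - n%:R) <= vabs (u - 1).
Proof.
move=> H; have -> : \sum_(i < n) u ^+ i - n%:R = \sum_(i < n) (u ^+ i - 1).
  by rewrite sumrB sumr_const card_ord.
apply: (nle_sum (vle_ultra K)); first exact: vabs_ge0.
by move=> i _; exact: vabs_pow_sub1.
Qed.

Lemma vabs_strict (x y : K) : vabs (x - y) < vabs y -> vabs x = vabs y.
Proof.
move=> H; apply/eqP; rewrite eq_le; apply/andP; split.
  by rewrite -[x in vabs x](subrK y); apply: vabsD_le => //; exact: ltW.
rewrite leNgt; apply/negP => xy.
have : vabs (- (x - y) + x) < vabs y by apply: vabsD_lt; rewrite ?vabsN.
by rewrite opprB subrK ltxx.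
Qed.

(** The quotient of [u^n - 1] by [u - 1] is a sum of [n] powers of [u], hence congruent to [n]
    modulo [u - 1], and [n] dominates. *)
Lemma vabs_pow_sub1_eq u n : vabs (u - 1) < vabs (n%:R : K) ->
  vabs (u ^+ n - 1) = vabs (n%:R : K) * vabs (u - 1).
Proof.
move=> H; have u1 : vabs (u - 1) < 1 := lt_le_trans H (vabs_nat_le1 _ _).
rewrite subrX1 vabsM mulrC; congr (_ * _); apply: vabs_strict.
exact: le_lt_trans (vabs_geo_sum _ u1) H.
Qed.

Lemma vabs_coprime n : coprime p n -> vabs (n%:R : K) = 1.
Proof.
move=> pn; apply/eqP; rewrite eq_le vabs_nat_le1 leNgt /=; apply/negP => n1.
have n0 : (0 < n)%N.
  case: n pn {n1} => // pn; have := prime_gt1 (cu_p_prime K).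
  by move: pn; rewrite /coprime gcdn0 => /eqP ->.
have /(@coprimeP _ _ n0)[[a b] /= Hab] : coprime n p by rewrite coprime_sym.
have E : (1 : K) = a%:R * n%:R - b%:R * p%:R.
  by rewrite -!natrM -natrB ?Hab//; lia.
have : vabs (1 : K) < 1.
  rewrite E; apply: vabsD_lt; rewrite ?vabsN vabsM.
    by apply: le_lt_trans n1; rewrite ler_piMl ?vabs_ge0 ?vabs_nat_le1.
  by apply: le_lt_trans (cu_p_lt1 K); rewrite ler_piMl ?vabs_ge0 ?vabs_nat_le1.
by rewrite vabs1 ltxx.
Qed.

Lemma vabs_pow_coprime u n : coprime p n -> vabs (u - 1) < 1 ->
  vabs (u ^+ n - 1) = vabs (u - 1).
Proof.
by move=> /vabs_coprime n1 u1; rewrite vabs_pow_sub1_eq ?n1 ?mul1r.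
Qed.

(** The same factorisation for [n = p], without assuming that [p] dominates: [p]-th powers contract
    the open disk towards 1. *)
Lemma vabs_powp u : vabs (u - 1) < 1 ->
  vabs (u ^+ p - 1) <= Num.max (vabs (p%:R : K)) (vabs (u - 1)) * vabs (u - 1).
Proof.
move=> u1; rewrite subrX1 vabsM mulrC; apply: ler_wpM2r; first exact: vabs_ge0.
rewrite -[\sum_(i < p) _](subrK p%:R); apply: vabsD_le; rewrite le_max ?lexx//.
by rewrite vabs_geo_sum ?orbT.
Qed.

Lemma vabs_nat n : (0 < n)%N -> vabs (n%:R : K) = vabs (p%:R : K) ^+ logn p n.
Proof.
move=> n0; have [m pm nE] := pfactor_coprime (cu_p_prime K) n0.
by rewrite {1}nE natrM vabsM (vabs_coprime pm) mul1r natrX vabsX.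
Qed.

Lemma vabs_fact_lower n : vabs (p%:R : K) ^+ n <= vabs (n`!%:R : K).
Proof.
have P0 := vabs_p_gt0; have pp := cu_p_prime K.
have fact_le : (logn p n`! <= n)%N.
  rewrite logn_fact//; have p1 := prime_gt1 pp.
  (* As [p >= 2], two copies of [n %/ p^(m+1)] fit into [n %/ p^m], so the partial sums of
     Legendre's formula telescope to at most [n]. *)
  suff H m : (\sum_(1 <= j < m.+1) n %/ p ^ j + n %/ p ^ m <= n)%N.
    by apply: leq_trans (H n); rewrite leq_addr.
  elim: m => [|m IH]; first by rewrite big_geq// expn0 divn1.
  rewrite big_nat_recr//= -addnA; apply: leq_trans IH.
  rewrite leq_add2l addnn -mul2n expnSr divnMA.
  by apply: leq_trans (leq_divM _ p); rewrite mulnC leq_mul.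
rewrite (vabs_nat (fact_gt0 n)).
by apply: ler_wiXn2l; rewrite ?(ltW P0) ?(ltW (cu_p_lt1 K)).
Qed.

Variable q : disk11 K.
(** These numbers tend to 0 and do not vanish unless [q] is a [p]-power root of unity: they serve as
    increments of difference quotients and as zeros in the identity theorem. *)
Definition zp (j : nat) : K := (q : K) ^+ (p ^ j) - 1.

Lemma zpS j : zp j.+1 = ((q : K) ^+ (p ^ j)) ^+ p - 1.
Proof. by rewrite /zp expnSr exprM. Qed.

Lemma zp_lt1 j : vabs (zp j) < 1.
Proof. exact: le_lt_trans (vabs_pow_sub1 _ (disk_valP q)) (disk_valP q). Qed.

Lemma zp_le_q j : vabs (zp j) <= vabs ((q : K) - 1).
Proof. exact: vabs_pow_sub1 (disk_valP q). Qed.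

Lemma zp_le j : vabs (zp j) <=
  vabs ((q : K) - 1) * Num.max (vabs (p%:R : K)) (vabs ((q : K) - 1)) ^+ j.
Proof.
set l := Num.max _ _.
elim: j => [|j IH]; first by rewrite /zp expn0 expr1 expr0 mulr1.
rewrite zpS; apply: (le_trans (vabs_powp (zp_lt1 j))).
rewrite exprSr mulrA mulrC; apply: ler_pM => //; first exact: vabs_ge0.
  by rewrite le_max vabs_ge0.
by rewrite ge_max; apply/andP; split; rewrite le_max ?lexx// zp_le_q orbT.
Qed.

Lemma zp_small (d : R) : 0 < d ->
  exists N : nat, forall j, (N <= j)%N -> vabs (zp j) <= d.
Proof.
move=> d0; set l := Num.max (vabs (p%:R : K)) (vabs ((q : K) - 1)).
have l01 : 0 <= l < 1.
  by rewrite le_max vabs_ge0 /= gt_max (cu_p_lt1 K) (disk_valP q).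
have [N HN] := geo_small (vabs ((q : K) - 1)) l01 d0; exists N => j /HN.
exact/le_trans/zp_le.
Qed.

(** The error is uniform in the exponent, which makes [(sigma^(p^j) - 1) / (q^(p^j) - 1)] converge
    to [delta1] for every norm [|.|_rho]. *)
Lemma diff_quot (u : K) (i : int) : vabs (u - 1) < 1 ->
  vabs (u ^ i - 1 - i%:~R * (u - 1)) <= vabs (u - 1) ^+ 2.
Proof.
move=> u1; have H n : vabs (u ^+ n - 1 - n%:R * (u - 1)) <= vabs (u - 1) ^+ 2.
  rewrite subrX1 [_ * (u - 1)]mulrC -mulrBr vabsM expr2.
  by apply: ler_wpM2l; [exact: vabs_ge0|exact: vabs_geo_sum].
case: i => n; first by rewrite -exprnP -pmulrn.
have un : u ^+ n.+1 != 0.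
  apply/eqP => /(congr1 (@vabs R p K)); rewrite vabsX (vabs_unit u1) expr1n vabs0.
  by move/eqP; rewrite oner_eq0.
have -> : u ^ (Negz n) - 1 - (Negz n)%:~R * (u - 1) =
   - u ^- n.+1 * ((u ^+ n.+1 - 1 - n.+1%:R * (u - 1)) - n.+1%:R * (u - 1) * (u ^+ n.+1 - 1)).
  by rewrite NegzE -exprnN mulrNz -pmulrn; field.
rewrite vabsM vabsN vabsV vabsX (vabs_unit u1) expr1n invr1 mul1r.
apply: vabsD_le; first exact: H.
rewrite vabsN !vabsM -mulrA expr2; apply: (@le_trans _ _ (1 * (vabs (u - 1) * vabs (u - 1)))).
  apply: ler_pM; rewrite ?mulr_ge0 ?vabs_ge0 ?vabs_nat_le1//.
  by apply: ler_wpM2l; [exact: vabs_ge0|exact: vabs_pow_sub1].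
by rewrite mul1r.
Qed.

Hypothesis nroot : not_ppower_root p (q : K).

Lemma zp_neq0 j : zp j != 0.
Proof. by rewrite subr_eq0; exact: nroot. Qed.

(** The part of [n] prime to [p] does not change the distance of [q^n] to 1. Roots of unity in the
    disk therefore have [p]-power order, and excluding these keeps all [[n]_q!] nonzero. *)
Lemma vabs_qpow_decomp n : (0 < n)%N ->
  vabs ((q : K) ^+ n - 1) = vabs (zp (logn p n)).
Proof.
move=> n0; have [m pm nE] := pfactor_coprime (cu_p_prime K) n0.
rewrite {1}nE mulnC exprM vabs_pow_coprime//; exact: zp_lt1.
Qed.

Lemma disk_root n : (q : K) ^+ n.+1 != 1.
Proof.
rewrite -subr_eq0; apply/eqP => H.
have E := vabs_qpow_decomp (ltn0Sn n).
by have := vabs_gt0 (zp_neq0 (logn p n.+1)); rewrite -E H vabs0 ltxx.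
Qed.

(** Once [q^(p^N) - 1] is smaller than [p], every further [p]-th power multiplies its absolute value
    by exactly [|p|]; [k] is the value reached at that index. *)
Lemma zp_lower : exists2 k : R, 0 < k <= 1 &
  forall j, k * vabs (p%:R : K) ^+ j <= vabs (zp j).
Proof.
have P0 := vabs_p_gt0; have P1 := ltW (cu_p_lt1 K).
have [N HN] := zp_small (divr2_gt0 P0).
have NP j : (N <= j)%N -> vabs (zp j) < vabs (p%:R : K).
  by move=> /HN H; apply: le_lt_trans H _; lra.
exists (vabs (zp N)); first by rewrite vabs_gt0 ?zp_neq0//= ltW// zp_lt1.
move=> j; have [jN|Nj] := leqP j N.
  apply: (@le_trans _ _ (vabs (zp N))).
    by rewrite ler_piMr ?vabs_ge0// exprn_ile1// ltW.
  rewrite -(subnKC jN) /zp expnD exprM; apply: vabs_pow_sub1; exact: zp_lt1.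
rewrite -(subnKC (ltnW Nj)); move: (j - N)%N => d {j Nj}.
elim: d => [|d IH].
  by rewrite addn0 ler_piMr ?vabs_ge0// exprn_ile1// ltW.
rewrite addnS zpS vabs_pow_sub1_eq; last first.
  by rewrite -/(zp _) NP// leq_addr.
by rewrite exprS mulrCA ler_pM2l.
Qed.

(** Factor by factor [|[i]_q| >= k |i|], and [|n!| >= |p|^n]. The interpolation between radii
    requires such an exponential lower bound on the denominators. *)
Lemma qfact_lower : exists2 b : R, 0 < b & forall n, b ^+ n <= vabs (qfact (q : K) n).
Proof.
have [k /andP[k0 k1] Hk] := zp_lower; have P0 := vabs_p_gt0.
exists (k * vabs (p%:R : K)); first by rewrite mulr_gt0.
move=> n; apply: (@le_trans _ _ (k ^+ n * vabs (n`!%:R : K))).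
  rewrite exprMn; apply: ler_wpM2l; first by rewrite exprn_ge0// ltW.
  exact: vabs_fact_lower.
elim: n => [|n IH]; first by rewrite /qfact big_geq// expr0 fact0 mul1r.
have E (x y z t : R) : x * y * (z * t) = x * t * (y * z) by ring.
rewrite qfactS vabsM factS natrM vabsM exprSr E.
apply: ler_pM => //.
- by rewrite mulr_ge0 ?exprn_ge0 ?vabs_ge0// ltW.
- by rewrite mulr_ge0 ?vabs_ge0// ltW.
have E1 := vabs_qpow_decomp (ltn0Sn n); have E2 := vabs_nat (ltn0Sn n).
have q1 : 0 < vabs ((q : K) - 1) by have := vabs_gt0 (zp_neq0 0); rewrite /zp expn0 expr1.
rewrite vabsM vabsV E1 E2 ler_pdivlMr//; apply: le_trans (Hk _).
by rewrite ler_piMr ?mulr_ge0 ?exprn_ge0 ?vabs_ge0 ?(ltW k0)// (ltW (disk_valP q)).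
Qed.

End DiskPowers.

(** * From a semilinear operator to a connection *)

Section ConnLimit.
Variables (R : realType) (p : nat) (K : cufield R p) (B : germ_kind).
Local Notation G := (germ K B).
Variables (q : disk11 K) (X : lmodType G) (sg : X -> X).
Hypothesis sgD : {morph sg : x y / x + y}.
Hypothesis sgZ : forall f x, sg (f *: x) = sigma q f *: sg x.
Hypothesis nroot : not_ppower_root p (q : K).
Variables (n0 : nat) (e : 'I_n0 -> X).
Hypothesis be : is_basis e.
Variables (eps : R) (e01 : 0 < eps < 1).
Let I := annulus B eps.
Let Ipos rho : I rho -> 0 < rho := annulus_gt0 e01.
Local Notation "a %* x" := (gcst B a *: x) (at level 40).
Implicit Types (f : G) (x : X).

Lemma coef_iter_sigma m (f : G) i :
  coef (iter m (sigma q) f) i = ((q : K) ^+ m) ^ i * coef f i.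
Proof.
elim: m => [|m IH]; first by rewrite expr0 exp1rz mul1r.
by rewrite iterS coef_sigma IH exprS exprzMl ?unitfE ?expf_neq0 ?disk_neq0// mulrA.
Qed.

Lemma iter_sgZ m f x : iter m sg (f *: x) = iter m (sigma q) f *: iter m sg x.
Proof. by elim: m => [//|m IH]; rewrite !iterS IH sgZ. Qed.

Lemma iter_sg_sum m (J : Type) (s : seq J) (P : pred J) (F : J -> X) :
  iter m sg (\sum_(j <- s | P j) F j) = \sum_(j <- s | P j) iter m sg (F j).
Proof. by elim: m => [//|m IH]; rewrite iterS IH sg_sum. Qed.

Definition difq (j : nat) x : X := (zp q j)^-1 %* (iter (p ^ j) sg x - x).

Lemma gle_iter_sigma rho f c m : 0 < rho -> gle rho f c ->
  gle rho (iter m (sigma q) f) c.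
Proof. by move=> r0 H; elim: m => [//|m IH]; rewrite iterS; exact: gle_sigma. Qed.

Lemma iter_sigma_cvg rho f : 0 < rho -> (exists c, gle rho f c) ->
  ncvg (gle rho) (fun j => iter (p ^ j) (sigma q) f) f.
Proof.
move=> r0 [c Hc] d d0; have c0 := gle_ge0 Hc.
have c1 : 0 < c + 1 by lra.
have [N HN] := zp_small q (divr_gt0 d0 c1); exists N => j /HN zj.
have Hz := gleM r0 (gle_gcst B r0 (zp q j)) Hc.
apply: (@gleW _ _ _ _ rho _ (vabs (zp q j) * c)).
  apply: (@le_trans _ _ (d / (c + 1) * c)); first exact: ler_wpM2r.
  by rewrite mulrAC ler_pdivrMr//; apply: ler_wpM2l; lra.
move/(gle_coef r0): Hz; apply=> i.
rewrite gcoefB coef_iter_sigma coef_gcstM -[X in _ - X]mul1r -mulrBl !vabsM.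
apply: ler_wpM2r; first exact: vabs_ge0.
exact: (vabs_qnum (@Disk11 _ _ _ ((q : K) ^+ (p ^ j)) (zp_lt1 q j)) i).
Qed.

Lemma difq_sigma_cvg rho f : 0 < rho -> (exists c, gle rho f c) ->
  ncvg (gle rho) (fun j => gcst B (zp q j)^-1 * (iter (p ^ j) (sigma q) f - f)) (delta1 f).
Proof.
move=> r0 [c Hc] d d0; have c0 := gle_ge0 Hc.
have c1 : 0 < c + 1 by lra.
have [N HN] := zp_small q (divr_gt0 d0 c1); exists N => j /HN zj.
have Hz := gleM r0 (gle_gcst B r0 (zp q j)) Hc.
apply: (@gleW _ _ _ _ rho _ (vabs (zp q j) * c)).
  apply: (@le_trans _ _ (d / (c + 1) * c)); first exact: ler_wpM2r.
  by rewrite mulrAC ler_pdivrMr//; apply: ler_wpM2l; lra.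
move/(gle_coef r0): Hz; apply=> i.
rewrite gcoefB coef_gcstM gcoefB coef_iter_sigma coef_delta1 coef_gcstM.
rewrite -[X in _ * (_ - X)]mul1r -mulrBl mulrA -mulrBl !vabsM.
apply: ler_wpM2r; first exact: vabs_ge0.
have z0 := zp_neq0 nroot j; have vz := vabs_gt0 z0.
rewrite -(ler_pM2l vz) -vabsM mulrBr mulrA mulfV// mul1r [zp q j * _]mulrC -expr2.
exact: diff_quot (zp_lt1 q j).
Qed.

Variable cn : X -> X.
Hypothesis cnD : {morph cn : x y / x + y}.
Hypothesis cnZ : forall f x, cn (f *: x) = delta1 f *: x + f *: cn x.
Hypothesis cne : forall i, xlim e I (fun j => difq j (e i)) (cn (e i)).

Lemma xfin_basis rho i : I rho -> exists c, xle e rho (e i) c.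
Proof.
move=> /Ipos r0; exists 1; split=> // j; rewrite ecoord_basis//.
by case: eqP => _; [exact: gle1|exact: gle0].
Qed.

(** Difference quotients satisfy the twisted Leibniz rule displayed in [E]. In the limit the twist
    disappears and the Leibniz rule of [cn] remains, so convergence on the basis vectors
    suffices. *)
Lemma difq_cvg x : (forall rho, I rho -> exists c, xle e rho x c) ->
  xlim e I (fun j => difq j x) (cn x).
Proof.
move=> fx rho rI; have r0 := Ipos rI; have U := xle_ultra be r0.
have fc i : exists c, gle rho (ecoord e x 0 i) c.
  by have [c [_ Hc]] := fx _ rI; exists c.
have E j : difq j x = \sum_i (iter (p ^ j) (sigma q) (ecoord e x 0 i) *: difq j (e i) +
    (gcst B (zp q j)^-1 * (iter (p ^ j) (sigma q) (ecoord e x 0 i) - ecoord e x 0 i)) *: e i).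
  rewrite /difq -{1 2}(ecoordK be x) iter_sg_sum -sumrB scaler_sumr.
  apply: eq_bigr => i _; rewrite iter_sgZ -[X in _ = _ + X]scalerA scalerA mulrC -scalerA -scalerDr.
  by congr (_ *: _); rewrite scalerBr scalerBl addrA subrK.
have cxE : cn x = \sum_i (ecoord e x 0 i *: cn (e i) + delta1 (ecoord e x 0 i) *: e i).
  rewrite -{1}(ecoordK be x) cn_sum//; apply: eq_bigr => i _.
  by rewrite cnZ addrC.
have fe i : exists c, xle e rho (e i) c := xfin_basis i rI.
have fcne i : exists c, xle e rho (cn (e i)) c by have [] := cne i rI.
split.
- move=> j; rewrite E; apply: (xfin_sum be r0) => i _; have [c Hc] := fc i.
  have fs : exists d, gle rho (iter (p ^ j) (sigma q) (ecoord e x 0 i)) d.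
    by exists c; exact: gle_iter_sigma.
  apply: (xfinD be r0); apply: (xfinZ be r0) => //.
    by have [] := cne i rI.
  have [d Hd] := fs; exists (vabs (zp q j)^-1 * Num.max d c).
  apply: (gleM r0 (gle_gcst B r0 _)); apply: (nleB (gle_ultra K B r0)).
    by apply: gleW Hd; rewrite le_max lexx.
  by apply: gleW Hc; rewrite le_max lexx orbT.
- rewrite cxE; apply: (xfin_sum be r0) => i _; have [c Hc] := fc i.
  apply: (xfinD be r0); apply: (xfinZ be r0) => //.
  by exists c; exact: gle_delta1.
rewrite cxE; apply: eq_ncvg (fun j => esym (E j)) _.
apply: (@ncvg_sum _ _ _ U _ _ (fun i j => iter (p ^ j) (sigma q) (ecoord e x 0 i) *: difq j (e i) +
    (gcst B (zp q j)^-1 * (iter (p ^ j) (sigma q) (ecoord e x 0 i) - ecoord e x 0 i)) *: e i)) => i.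
have [c Hc] := fc i.
apply: (ncvgD U).
  apply: (xncvgZ be r0) => //; first exact: iter_sigma_cvg.
  by have [] := cne i rI.
apply: (xncvgZ be r0) => //.
- by exists c; exact: gle_delta1.
- exact: difq_sigma_cvg.
exact: ncvg_const.
Qed.

End ConnLimit.

Section Derivation.
Variables (R : realType) (p : nat) (K : cufield R p) (B : germ_kind).
Local Notation G := (germ K B).
Implicit Types (f g : G).

Lemma delta1D f g : delta1 (f + g) = delta1 f + delta1 g.
Proof.
by apply/germ_eq/funext => i; rewrite gcoefD !coef_delta1 gcoefD mulrDr.
Qed.

Lemma sumZ_scale (c : K) a : nullZ a -> sumZ (fun i => c * a i) = c * sumZ a.
Proof.
move=> na; apply/vlimE => d d0; have c1 : 0 < vabs c + 1 by rewrite ltr_wpDl ?vabs_ge0.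
have [N HN] := sumZ_cvg na (divr_gt0 d0 c1); exists N => m /HN H.
rewrite /psumZ -mulr_sumr -mulrBr vabsM; apply: (@le_lt_trans _ _ ((vabs c + 1) * vabs (psumZ a m - sumZ a))).
  by apply: ler_wpM2r; rewrite ?vabs_ge0// lerDl.
by rewrite mulrC -ltr_pdivlMr.
Qed.

Lemma delta1M f g : delta1 (f * g) = delta1 f * g + f * delta1 g.
Proof.
have [d d01 [cf cg]] := germ_common f g; have [d0 _] := andP d01.
have rI := annulus_mem B d0; have r0 := annulus_gt0 d01 rI.
have [cf1 cg1] := (cf _ rI, cg _ rI).
have cd (h : G) : cvg_at (1 - d / 2) (coef h) -> cvg_at (1 - d / 2) (coef (delta1 h)).
  move=> ch; apply: (cvg_at_le r0 _ ch) => i; rewrite coef_delta1 vabsM.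
  by apply: ler_piMl; rewrite ?vabs_ge0// vabs_int_le1.
apply/germ_eq/funext => n; rewrite gcoefD coef_delta1.
change (n%:~R * lmul (coef f) (coef g) n =
  lmul (coef (delta1 f)) (coef g) n + lmul (coef f) (coef (delta1 g)) n).
have N1 := lmul_null r0 n (cd _ cf1) cg1; have N2 := lmul_null r0 n cf1 (cd _ cg1).
have N3 := lmul_null r0 n cf1 cg1.
rewrite /lmul -(sumZ_scale n%:~R N3) -sumZD//; congr sumZ; apply/funext => i; rewrite !coef_delta1 intrB.
by move: (n%:~R) (i%:~R) (coef f i) (coef g (n - i)) => x y u v; ring.
Qed.

End Derivation.

(** * Identity theorem for power series with coefficients in a module *)

Section PowerSeries.
Variables (R : realType) (p : nat) (K : cufield R p) (B : germ_kind).
Local Notation G := (germ K B).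
Variables (X : lmodType G) (n0 : nat) (e : 'I_n0 -> X).
Hypothesis be : is_basis e.
Local Notation "a %* x" := (gcst B a *: x) (at level 40).
Variables (rho : R) (r0 : 0 < rho) (C s : R) (C0 : 0 < C) (s0 : 0 < s).
Variable W : nat -> X.
Hypothesis Wle : forall k, xle e rho (W k) (C / s ^+ k).

Lemma power_tail z S m : z != 0 -> vabs z <= s ->
  nsum (xle e rho) (fun k => z ^+ k %* W k) S ->
  xle e rho (S - \sum_(k < m) z ^+ k %* W k) (vabs z ^+ m * (C / s ^+ m)).
Proof.
move=> z0 zs HS; have U := xle_ultra be r0; have v0 := vabs_gt0 z0.
have c0 : 0 < vabs z ^+ m * (C / s ^+ m).
  by rewrite mulr_gt0 ?exprn_gt0// divr_gt0// exprn_gt0.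
apply: (nsum_le (u := fun k => z ^+ (m + k) %* W (m + k)%N) U c0 _ (nsum_shift m HS)) => k.
apply: (nleW U _ (xle_gcst be r0 _ (Wle (m + k)))).
have -> : vabs (z ^+ (m + k)) * (C / s ^+ (m + k)) =
    vabs z ^+ m * (C / s ^+ m) * (vabs z / s) ^+ k.
  by rewrite vabsX expr_div_n !exprD; field; rewrite !expf_neq0// gt_eqF.
rewrite ler_piMr ?(ltW c0)//.
apply: exprn_ile1; first by rewrite divr_ge0 ?vabs_ge0// ltW.
by rewrite ler_pdivrMr// mul1r.
Qed.

(** Once the coefficients below [k] vanish, dividing by [z^k] leaves [W k] up to an error
    proportional to [|z|], and the zeros tend to 0. *)
Lemma power_series_eq0 (z : nat -> K) : (forall j, z j != 0) ->
  (forall d : R, 0 < d -> exists N : nat, forall j, (N <= j)%N -> vabs (z j) <= d) ->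
  (forall j, vabs (z j) <= s) ->
  (forall j, nsum (xle e rho) (fun k => z j ^+ k %* W k) 0) -> forall k, W k = 0.
Proof.
move=> z0 zlim zs HW; elim/ltn_ind => k IH; have U := xle_ultra be r0.
apply: (xle_eq0 be r0) => d d0.
have c0 : 0 < C / s ^+ k.+1 by rewrite divr_gt0// exprn_gt0.
have [N HN] := zlim _ (divr_gt0 d0 c0); have zN := HN N (leqnn N).
have := power_tail k.+1 (z0 N) (zs N) (HW N).
rewrite sub0r big_ord_recr /= big1 ?add0r; last first.
  by move=> i _; rewrite IH// scaler0.
move=> /(nleN U); rewrite opprK => /(xle_gcst be r0 (z N ^+ k)^-1).
rewrite scalerA -gcstM mulVf ?expf_neq0// gcst1 scale1r; apply: (nleW U).
have v0 := vabs_gt0 (z0 N).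
rewrite vabsV vabsX exprSr !mulrA mulVf ?expf_neq0 ?gt_eqF// mul1r.
by rewrite -mulrA -ler_pdivlMr.
Qed.

End PowerSeries.

(** * The connection attached to a semilinear operator *)

Section SigmaToConn.
Variables (R : realType) (p : nat) (K : cufield R p) (B : germ_kind).
Local Notation G := (germ K B).
Variables (q : disk11 K) (X : lmodType G) (sg : X -> X).
Hypothesis sgD : {morph sg : x y / x + y}.
Hypothesis sgZ : forall f x, sg (f *: x) = sigma q f *: sg x.
Hypothesis nroot : not_ppower_root p (q : K).
Variables (n0 : nat) (e : 'I_n0 -> X).
Hypothesis be : is_basis e.
Variables (eps : R) (e01 : 0 < eps < 1).
Let I := annulus B eps.
Let Ipos rho : I rho -> 0 < rho := annulus_gt0 e01.
Local Notation "a %* x" := (gcst B a *: x) (at level 40).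
Local Notation b := (qpow q).
Variables (w : R) (w0 : 0 < w) (qw : vabs ((q : K) - 1) <= w).
Hypothesis geoth : forall i, geo e I w (fun n => theta q sg n (e i)).

Let bw := qpow_le qw.
Let tri := @newton_coef_tri _ _ _ b.
Let nle := newton_coef_le (ltW w0) bw.

(** Expanding Newton polynomials into powers, [N i k] collects the coefficient of [z^k] in the
    Newton series of [e i]. *)
Lemma theta_cols : exists N : 'I_n0 -> nat -> X,
  forall i k, xsum e I (fun n => newton_coef b n k %* theta q sg n (e i)) (N i k).
Proof.
have /choice[N HN] : forall i, exists v : nat -> X, forall k,
    xsum e I (fun n => newton_coef b n k %* theta q sg n (e i)) (v k).
  move=> i; have /choice[v Hv] : forall k, exists x,
      xsum e I (fun n => newton_coef b n k %* theta q sg n (e i)) x.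
    by move=> k; exact: (col_ex be e01 w0 nle).
  by exists v.
by exists N.
Qed.

Variable N : 'I_n0 -> nat -> X.
Hypothesis HN : forall i k,
  xsum e I (fun n => newton_coef b n k %* theta q sg n (e i)) (N i k).

Lemma newton_gt m k : (m < k)%N -> newton b k (b m) = 0.
Proof. by move=> mk; apply/eqP/prodf_eq0; exists (Ordinal mk) => //=; rewrite subrr. Qed.

Lemma N_sum i m : xsum e I (fun k => b m ^+ k %* N i k) (iter m sg (e i)).
Proof.
apply: (exchange_sum (a := newton_coef b) (A := 1) (f := fun n => newton b n (b m))
  be e01 w0 tri nle (geoth i)) => //.
- by move=> n; exact: newtonE.
- by move=> k; rewrite mul1r vabsX; apply: lerXn2r; rewrite ?nnegrE ?vabs_ge0 ?(ltW w0)//; exact: bw.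
rewrite (iter_sg_newton sgD sgZ (disk_root nroot)).
apply: (xsum_fin be e01 (u := fun k => newton b k (b m) %* theta q sg k (e i))) => [k mk|rho rI k].
  by rewrite newton_gt// gcst0 scale0r.
have r0 := Ipos rI; have [C [s [_ _ Hs]]] := geoth i rI.
apply: (xfinZ be r0); first by exists (vabs (newton b k (b m))); exact: gle_gcst.
by eexists; exact: Hs.
Qed.

Lemma N_le i rho C s : I rho -> 0 < C -> w <= s ->
  (forall n, xle e rho (theta q sg n (e i)) (C / s ^+ n)) ->
  forall k, xle e rho (N i k) (C / s ^+ k).
Proof.
move=> rI C0 ws Hs k.
exact: (col_le be e01 w0 tri nle rI C0 ws Hs (HN i k)).
Qed.

Lemma N_geo i : geo e I w (N i).
Proof.
move=> rho rI; have [C [s [C0 ws Hs]]] := geoth i rI; exists C, s; split=> //.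
exact: N_le rI C0 (ltW ws) Hs.
Qed.

Lemma N0 i : N i 0%N = e i.
Proof.
have H := N_sum i 0; apply: (xlim_uniq be e01 _ H).
have z0 k : (1 <= k)%N -> b 0%N ^+ k %* N i k = 0.
  by case: k => // k _; rewrite /qpow expr0 subrr expr0n /= gcst0 scale0r.
have -> : N i 0%N = \sum_(k < 1) b 0%N ^+ k %* N i k.
  by rewrite big_ord_recl big_ord0 addr0 expr0 gcst1 scale1r.
apply: (xsum_fin be e01 z0) => rho rI k.
have [C [s [_ _ Hs]]] := N_geo i rI.
apply: (xfinZ be (Ipos rI)); first by exists (vabs (b 0%N ^+ k)); exact: gle_gcst (Ipos rI) _.
by eexists; exact: Hs.
Qed.

(** The constant term of the power series is [e i], so dividing its increment by [z] leaves [N i 1]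
    up to an error proportional to [|z|]. *)
Lemma difq_N i : xlim e I (fun j => difq q sg j (e i)) (N i 1%N).
Proof.
move=> rho rI; have r0 := Ipos rI; have U := xle_ultra be r0.
have [C [s [C0 ws Hs]]] := N_geo i rI; have s0 : 0 < s := lt_trans w0 ws.
have fN k : exists c, xle e rho (N i k) c by eexists; exact: Hs.
have fit m : exists c, xle e rho (iter m sg (e i)) c by have [] := N_sum i m rI.
split=> //.
  move=> j; apply: (xfinZ be r0); first by exists (vabs (zp q j)^-1); exact: gle_gcst.
  by apply: (xfinD be r0) => //; apply: (xfinN be r0); exact: (fit 0%N).
move=> d d0; have c0 : 0 < C / s ^+ 2 by rewrite divr_gt0// exprn_gt0.
have [M HM] := zp_small q (divr_gt0 d0 c0); exists M => j /HM zj.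
have zn := zp_neq0 nroot j; have v0 := vabs_gt0 zn.
have [_ _ Hsum] := N_sum i (p ^ j) rI.
have zs : vabs (zp q j) <= s by apply: le_trans (ltW ws); exact: bw.
have := power_tail be r0 C0 s0 Hs 2 zn zs Hsum.
rewrite !big_ord_recl big_ord0 /= addr0 expr0 expr1 gcst1 scale1r N0.
move=> /(xle_gcst be r0 (zp q j)^-1).
have -> : (zp q j)^-1 %* (iter (p ^ j) sg (e i) - (e i + zp q j %* N i 1%N)) =
    difq q sg j (e i) - N i 1%N.
  rewrite opprD addrA scalerBr scalerA -gcstM mulVf// gcst1 scale1r.
  by [].
apply: (nleW U); rewrite vabsV expr2 !mulrA mulVf ?gt_eqF// mul1r.
by rewrite -mulrA -ler_pdivlMr.
Qed.

(** The Leibniz rule leaves the values on a basis free. *)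
Lemma conn_exists : exists cn : X -> X, [/\ {morph cn : x y / x + y},
  forall f x, cn (f *: x) = delta1 f *: x + f *: cn x &
  forall i, cn (e i) = N i 1%N].
Proof.
exists (fun x => \sum_i (delta1 (ecoord e x 0 i) *: e i + ecoord e x 0 i *: N i 1%N)).
split.
- move=> x y; rewrite -big_split /=; apply: eq_bigr => i _.
  by rewrite ecoordD// mxE delta1D !scalerDl addrACA.
- move=> f x; rewrite -[X in delta1 f *: X](ecoordK be x) !scaler_sumr -big_split /=.
  apply: eq_bigr => i _; rewrite ecoordZ// mxE delta1M scalerDl scalerDr !scalerA.
  by rewrite -addrA.
move=> i; rewrite (bigD1 i)//= big1 ?addr0.
  by rewrite ecoord_basis// eqxx delta1_gcst scale0r add0r scale1r.
move=> j ji; rewrite ecoord_basis// (negPf ji) scale0r addr0.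
by rewrite -[0%:R]/(gcst B 0) delta1_gcst scale0r.
Qed.

End SigmaToConn.

Section ScaleSum.
Variables (R : realType) (p : nat) (K : cufield R p) (B : germ_kind).
Local Notation G := (germ K B).
Variables (X : lmodType G) (n0 : nat) (e : 'I_n0 -> X).
Hypothesis be : is_basis e.

Lemma xnsumZ (a : K) rho (u : nat -> X) S : 0 < rho -> nsum (xle e rho) u S ->
  nsum (xle e rho) (fun k => gcst B a *: u k) (gcst B a *: S).
Proof.
move=> r0 H d d0; have c1 : 0 < vabs a + 1 by rewrite ltr_wpDl ?vabs_ge0.
have [N HN] := H _ (divr_gt0 d0 c1); exists N => k /HN /(xle_gcst be r0 a).
rewrite -scaler_sumr -scalerBr; apply: (nleW (xle_ultra be r0)).
by rewrite mulrCA ler_piMr ?(ltW d0)// ler_pdivrMr// mul1r lerDl.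
Qed.

Lemma xsum_at (I : set R) rho (u : nat -> X) S : xsum e I u S -> I rho ->
  nsum (xle e rho) u S.
Proof. by move=> H /H[]. Qed.

End ScaleSum.

(** * The power coefficients are the divided powers of the connection *)

Section Recursion.
Variables (R : realType) (p : nat) (K : cufield R p) (B : germ_kind).
Local Notation G := (germ K B).
Variables (q : disk11 K) (X : lmodType G) (sg : X -> X).
Hypothesis sgD : {morph sg : x y / x + y}.
Hypothesis sgZ : forall f x, sg (f *: x) = sigma q f *: sg x.
Hypothesis nroot : not_ppower_root p (q : K).
Variables (n0 : nat) (e : 'I_n0 -> X).
Hypothesis be : is_basis e.
Variables (eps : R) (e01 : 0 < eps < 1).
Let I := annulus B eps.
Let Ipos rho : I rho -> 0 < rho := annulus_gt0 e01.
Local Notation "a %* x" := (gcst B a *: x) (at level 40).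
Local Notation b := (qpow q).
Variables (w : R) (w0 : 0 < w) (qw : vabs ((q : K) - 1) <= w).
Hypothesis geoth : forall i, geo e I w (fun n => theta q sg n (e i)).
Variable N : 'I_n0 -> nat -> X.
Hypothesis HN : forall i k,
  xsum e I (fun n => newton_coef b n k %* theta q sg n (e i)) (N i k).
Variable cn : X -> X.
Hypothesis cnD : {morph cn : x y / x + y}.
Hypothesis cnZ : forall f x, cn (f *: x) = delta1 f *: x + f *: cn x.
Hypothesis cnN : forall i, cn (e i) = N i 1%N.

(** Second-order remainder of [z^k] on the disk of radius [w]; the factor [w^2] on the left avoids
    the exponent [k - 2], negative for small [k]. *)
Lemma taylor_remainder (a h : K) k : vabs a <= w -> vabs h <= w ->
  vabs ((a + h) ^+ k - a ^+ k - h * (k%:R * a ^+ k.-1)) * w ^+ 2 <= vabs h ^+ 2 * w ^+ k.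
Proof.
move=> aw hw; elim: k => [|k IH].
  by rewrite !expr0 mul0r mulr0 !subrr vabs0 mul0r mulr_ge0 ?exprn_ge0 ?vabs_ge0// ltW.
have -> : (a + h) ^+ k.+1 - a ^+ k.+1 - h * (k.+1%:R * a ^+ k.+1.-1) =
   (a + h) * ((a + h) ^+ k - a ^+ k - h * (k%:R * a ^+ k.-1)) + h ^+ 2 * (k%:R * a ^+ k.-1).
  (* For [k = 0] the exponent [k.-1] is 0, which is harmless because of the factor [k]. *)
  case: k {IH} => [|k]; first by rewrite !expr1 !expr0; ring.
  by rewrite /= !exprS -!natr1; ring.
have w2 : 0 < w ^+ 2 by exact: exprn_gt0.
rewrite -ler_pdivlMr//; apply: vabsD_le; rewrite ler_pdivlMr//.
  rewrite vabsM -mulrA [w ^+ k.+1]exprS [leRHS]mulrCA; apply: ler_pM => //; rewrite ?vabs_ge0//.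
    by rewrite mulr_ge0 ?vabs_ge0// ltW.
  exact: vabsD_le.
rewrite vabsM (vabsX h) -mulrA; apply: ler_wpM2l; first by rewrite exprn_ge0 ?vabs_ge0.
case: k {IH} => [|k]; first by rewrite mul0r vabs0 mul0r exprn_ge0// ltW.
rewrite -[k.+2]addn2 exprD; apply: ler_wpM2r; first exact: ltW.
rewrite vabsM; apply: (@le_trans _ _ (1 * w ^+ k)); last by rewrite mul1r.
apply: ler_pM; rewrite ?vabs_ge0 ?vabs_nat_le1//= vabsX.
by apply: lerXn2r; rewrite ?nnegrE ?vabs_ge0// ltW.
Qed.

Lemma deriv_coef_le (a : K) k : vabs a <= w -> vabs (k%:R * a ^+ k.-1) <= w^-1 * w ^+ k.
Proof.
move=> aw; case: k => [|k].
  by rewrite mul0r vabs0 mulr_ge0 ?exprn_ge0 ?invr_ge0// ltW.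
rewrite exprS mulrA mulVf ?gt_eqF// mul1r vabsM vabsX -[leRHS]mul1r.
apply: ler_pM; rewrite ?vabs_ge0 ?vabs_nat_le1 ?exprn_ge0 ?vabs_ge0//=.
by apply: lerXn2r; rewrite ?nnegrE ?vabs_ge0// ltW.
Qed.

Let bw := qpow_le qw.
Let Nsum := N_sum sgD sgZ nroot be e01 w0 qw geoth HN.
Let Ngeo := N_geo be e01 w0 qw geoth HN.
Let cnlim i : xlim e I (fun j => difq q sg j (e i)) (cn (e i)).
Proof. by rewrite cnN; exact: (difq_N sgD sgZ nroot be e01 w0 qw geoth HN). Qed.

(* [cn (sg^l e) = (1 + z) F'(z)] at [z = q^l - 1], for [F z = \sum_k z^k N k] *)
Lemma cn_iter i l : exists S,
  xsum e I (fun k => (k%:R * b l ^+ k.-1) %* N i k) S /\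
  cn (iter l sg (e i)) = S + b l %* S.
Proof.
have [S HS] : exists S, xsum e I (fun k => (k%:R * b l ^+ k.-1) %* N i k) S.
  apply: (geo_sum_ex be e01 w0 (A := w^-1) (Ngeo i)) => k.
  by apply: deriv_coef_le; exact: bw.
exists S; split=> //.
have fl rho : I rho -> exists c, xle e rho (iter l sg (e i)) c.
  by move=> rI; have [] := Nsum i l rI.
have H1 := difq_cvg sgD sgZ nroot be e01 cnD cnZ cnlim fl.
have -> : S + b l %* S = (q : K) ^+ l %* S.
  by rewrite -{1}[S]scale1r -gcst1 -scalerDl -gcstD addrC subrK.
have [d0 _] := andP e01; have rI := annulus_mem B d0.
have r0 := Ipos rI; have U := xle_ultra be r0.
have [_ _ H1r] := H1 _ rI; apply: (xncvg_uniq be r0 H1r).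
have [C [s [C0 ws Hs]]] := Ngeo i rI; have s0 : 0 < s := lt_trans w0 ws.
move=> d dpos; have c0 : 0 < C / w ^+ 2 by rewrite divr_gt0// exprn_gt0.
have [M HM] := zp_small q (divr_gt0 dpos c0); exists M => j /HM zj.
have zn := zp_neq0 nroot j; have v0 := vabs_gt0 zn.
set m := (p ^ j)%N; set z := zp q j in zj zn v0 *.
(* Since [q^(m+l) - 1 = (q^l - 1) + q^l (q^m - 1)], the numerator is the increment of [F] from [b l]
   to [b l + h]; dividing by [z] instead of [h] produces the factor [q^l = 1 + b l]. *)
pose h := (q : K) ^+ l * z.
have hz : vabs h = vabs z by rewrite vabsM vabsX vabs_disk11 expr1n mul1r.
have ahE : b (m + l) = b l + h by rewrite /h /z /zp /qpow -/m exprD; ring.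
have E1 := xsum_at (Nsum i (m + l)) rI; have E2 := xsum_at (Nsum i l) rI.
have E3 := xsum_at HS rI.
have E12 := nsumB U E1 E2.
have E4 := nsumB U (xnsumZ be z^-1 r0 E12) (xnsumZ be ((q : K) ^+ l) r0 E3).
apply: (nsum_le U dpos _ (l := difq q sg j (iter l sg (e i)) - (q : K) ^+ l %* S)).
  2: by rewrite /difq -iterD -/m -/z; exact: E4.
move=> k /=; rewrite scalerA -gcstM -scalerBl -gcstB scalerA -gcstM -scalerBl -gcstB ahE.
have -> : z^-1 * ((b l + h) ^+ k - b l ^+ k) - (q : K) ^+ l * (k%:R * b l ^+ k.-1) =
    z^-1 * ((b l + h) ^+ k - b l ^+ k - h * (k%:R * b l ^+ k.-1)).
  by rewrite mulrBr mulrBr /h; congr (_ - _); field.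
apply: (nleW U _ (xle_gcst be r0 _ (Hs k))).
have hw : vabs h <= w by rewrite hz; exact: bw.
have aw : vabs (b l) <= w by exact: bw.
have w2 : 0 < w ^+ 2 by exact: exprn_gt0.
have := taylor_remainder k aw hw; rewrite hz -ler_pdivlMr// => T.
rewrite vabsM vabsV; apply: (@le_trans _ _ (vabs z * (C / w ^+ 2))); last first.
  by rewrite -ler_pdivlMr.
apply: (@le_trans _ _ ((vabs z)^-1 * (vabs z ^+ 2 * w ^+ k / w ^+ 2) * (C / s ^+ k))).
  apply: ler_wpM2r; first by rewrite divr_ge0 ?exprn_ge0 ?ltW.
  by apply: ler_wpM2l => //; rewrite invr_ge0 vabs_ge0.
have -> : (vabs z)^-1 * (vabs z ^+ 2 * w ^+ k / w ^+ 2) * (C / s ^+ k) =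
   vabs z * (C / w ^+ 2) * (w / s) ^+ k.
  by rewrite expr_div_n; field; rewrite !gt_eqF ?exprn_gt0.
have [r1 r2] := andP (ratio01 w0 ws).
rewrite ler_piMr ?exprn_ile1 ?(ltW r2)//.
by rewrite mulr_ge0 ?vabs_ge0// ltW.
Qed.

(** For [F z = \sum_k z^k N i k], [cn_iter] gives [cn (F z) = (1 + z) F' z] at every
    [z = q^(p^j) - 1]. The vectors [W k] are the coefficients of the difference, to which the
    identity theorem applies. *)
Lemma N_recursion i k : k.+1%:R *: N i k.+1 = cn (N i k) - k%:R *: N i k.
Proof.
have [d0 _] := andP e01; have rI := annulus_mem B d0.
have r0 := Ipos rI; have U := xle_ultra be r0.
have [C [s [C0 ws Hs]]] := Ngeo i rI; have s0 : 0 < s := lt_trans w0 ws.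
have fcn j : exists c, xle e (1 - eps / 2) (cn (e j)) c by have [] := cnlim j rI.
have [D D0 HD] := cn_bound cnD cnZ be r0 fcn.
pose W k := cn (N i k) - (k.+1%:R *: N i k.+1 + k%:R *: N i k).
(* [D] accounts for [cn (N i k)], [s^-1] for the shifted index in [N i k.+1], and 1 for [N i k];
   integers have absolute value at most 1. *)
pose C' := C * (1 + D + s^-1).
have C'0 : 0 < C' by rewrite mulr_gt0// ltr_wpDr ?invr_ge0 ?(ltW s0)// ltr_wpDr.
have le_nat (m : nat) x c : xle e (1 - eps / 2) x c -> xle e (1 - eps / 2) (m%:R *: x) c.
  move=> /[dup] Hx [c0 _]; rewrite -gcst_nat; apply: (nleW U _ (xle_gcst be r0 _ Hx)).
  by rewrite ler_piMl// vabs_nat_le1.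
have Wle k' : xle e (1 - eps / 2) (W k') (C' / s ^+ k').
  have sk : 0 <= (s ^+ k')^-1 by rewrite invr_ge0 exprn_ge0// ltW.
  have C1 : C <= C' by rewrite ler_peMr ?(ltW C0)// -addrA lerDl addr_ge0// invr_ge0 ltW.
  apply: (nleB U); last apply: (nleD U).
  - apply: (nleW U _ (HD _ _ (Hs k'))); rewrite mulrA; apply: ler_wpM2r => //.
    rewrite mulrC; apply: ler_wpM2l; first exact: ltW.
    by rewrite -addrA addrCA lerDl addr_ge0// invr_ge0 ltW.
  - apply: le_nat; apply: (nleW U _ (Hs k'.+1)); rewrite exprS invfM mulrA.
    apply: ler_wpM2r => //; apply: ler_wpM2l; first exact: ltW.
    by rewrite lerDr addr_ge0.
  by apply: le_nat; apply: (nleW U _ (Hs k')); apply: ler_wpM2r.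
suff W0 : W k = 0 by move/eqP: W0; rewrite subr_eq0 => /eqP ->; rewrite addrK.
apply: (power_series_eq0 be r0 C'0 s0 Wle (z := zp q)).
- by move=> j; exact: zp_neq0.
- by move=> d; exact: zp_small.
- by move=> j; apply: le_trans (ltW ws); exact: bw.
move=> j; have [S [HS Scn]] := cn_iter i (p ^ j).
set a := zp q j; have aE : b (p ^ j) = a by [].
rewrite aE in HS Scn.
have E1 := xsum_at (Nsum i (p ^ j)) rI; rewrite aE in E1.
have {}E1 : nsum (xle e (1 - eps / 2)) (fun k => a ^+ k %* cn (N i k)) (cn (iter (p ^ j) sg (e i))).
  move=> d dpos; have D1 : 0 < D + 1 by lra.
  have [M HM] := E1 _ (divr_gt0 dpos D1); exists M => m /HM /HD.
  have -> : cn (\sum_(k < m) a ^+ k %* N i k - iter (p ^ j) sg (e i)) =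
      \sum_(k < m) a ^+ k %* cn (N i k) - cn (iter (p ^ j) sg (e i)).
    have cnB x y : cn (x - y) = cn x - cn y.
      by apply/eqP; rewrite eq_sym subr_eq -cnD subrK.
    by rewrite cnB cn_sum//; congr (_ - _); apply: eq_bigr => k' _; rewrite cn_gcst.
  by apply: (nleW U); rewrite mulrCA ler_piMr ?(ltW dpos)// ler_pdivrMr// mul1r lerDl.
have E2 := xsum_at HS rI.
have E3 := xnsumZ be a r0 E2.
(* The term of index 0 of [F'] is zero; dropping it aligns the series with the powers of [z]. *)
have {}E2 := nsum_shift 1 E2.
rewrite big_ord_recl big_ord0 mul0r gcst0 scale0r addr0 subr0 in E2.
have := nsumB U E1 (nsumD U E2 E3); rewrite Scn subrr.
apply: eq_nsum => k'; rewrite /W scalerBr; congr (_ - _); rewrite scalerDr.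
congr (_ + _).
  by rewrite add1n /= -gcst_nat scalerA -gcstM mulrC.
rewrite -gcst_nat !scalerA -!gcstM; congr (_ %* _).
case: k' => [|k']; first by rewrite mul0r !mulr0.
by rewrite /= exprS; ring.
Qed.

Lemma N_bin_conn i k : N i k = bin_conn cn k (e i).
Proof.
elim: k => [|k IH]; first exact: (N0 sgD sgZ nroot be e01 w0 qw geoth HN).
by apply: bin_connS_eq; rewrite -IH; exact: N_recursion.
Qed.

End Recursion.

(** * Evaluation and Taylor expansion at points of an extension *)

Section Density.
Variables (R : realType) (p : nat) (K : cufield R p) (B : germ_kind) (L : cufield R p).
Local Notation G := (germ K B).
Implicit Types (f g : G).

Definition gtrunc (N : nat) f : G :=
  \sum_(i < N.*2.+1) gmono B (coef f (i%:Z - N%:Z)) (i%:Z - N%:Z).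

Lemma coef_gtrunc N f i : coef (gtrunc N f) i = if (`|i| <= N)%N then coef f i else 0.
Proof.
rewrite gcoef_sum; case: ifPn => iN; last first.
  by rewrite big1// => j _; rewrite /= /lmono; case: eqP => // E; have := ltn_ord j; lia.
have jN : (absz (i + N%:Z)%R < N.*2.+1)%N by lia.
rewrite (bigD1 (Ordinal jN))//= big1 ?addr0.
  by rewrite /lmono; case: eqP => [<-//|]; lia.
move=> j; rewrite -val_eqE /= => ij; rewrite /lmono; case: eqP => // E; lia.
Qed.

Variables (rho : R) (r0 : 0 < rho).

Lemma gtrunc_cvg N f : cvg_at rho (coef (gtrunc N f)).
Proof.
apply: (@cvg_at_supp _ _ _ _ _ N.+1) => i iN.
by rewrite coef_gtrunc leqNgt iN.
Qed.

Lemma gtrunc_rest f (d : R) : cvg_at rho (coef f) -> 0 < d ->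
  exists N, gle rho (f - gtrunc N f) d.
Proof.
move=> cf d0; have [N HN] := cf _ d0; exists N; split.
  apply: (cvg_at_le r0 _ cf) => i; rewrite gcoefB coef_gtrunc.
  by case: ifP; rewrite ?subr0// subrr vabs0 vabs_ge0.
move=> i; rewrite gcoefB coef_gtrunc; case: ifPn => iN.
  by rewrite subrr vabs0 mul0r ltW.
by rewrite subr0 ltW// HN//; lia.
Qed.

(** Laurent polynomials are dense for the norm at [rho]; identities between evaluations are thereby
    reduced to monomials. *)
Lemma germ_density (Phi : G -> L) (D : R) : 0 < D ->
  (forall f g, cvg_at rho (coef f) -> cvg_at rho (coef g) -> Phi (f + g) = Phi f + Phi g) ->
  (forall f c, gle rho f c -> vabs (Phi f) <= D * c) ->
  (forall a k, Phi (gmono B a k) = 0) ->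
  forall f, cvg_at rho (coef f) -> Phi f = 0.
Proof.
move=> D0 PD Pb Pm f cf; apply/vabs_eq0/eqP; rewrite eq_le vabs_ge0 andbT.
apply/ler_addgt0Pr => d d0; rewrite add0r.
have [N HN] := gtrunc_rest cf (divr_gt0 d0 D0).
rewrite -[f](subrK (gtrunc N f)) PD; [|by case: HN|exact: gtrunc_cvg].
have -> : Phi (gtrunc N f) = 0.
  have : cvg_at rho (coef (gtrunc N f)) /\ Phi (gtrunc N f) = 0.
    rewrite /gtrunc; apply: (big_ind (fun g => cvg_at rho (coef g) /\ Phi g = 0)).
    - by split; [exact: cvg_at_lmono|exact: Pm].
    - move=> g h [cg Pg] [ch Ph]; split; first exact: cvg_atD.
      by rewrite PD// Pg Ph addr0.
    - by move=> i _; split; [exact: cvg_at_lmono|exact: Pm].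
  by case.
by rewrite addr0; apply: le_trans (Pb _ _ HN) _; rewrite mulrC divfK// gt_eqF.
Qed.

End Density.

Section Eval.
Variables (R : realType) (p : nat) (K : cufield R p) (B : germ_kind).
Variable Om : cu_extension K.
Local Notation G := (germ K B).
Local Notation emb := (ext_emb Om).
Implicit Types (f g : G).

Section AtPoint.
Variables (x : Om) (rho : R) (r0 : 0 < rho) (xr : vabs x = rho).

Lemma vabs_term (a : K) (i : int) : vabs (emb a * x ^ i) = vabs a * rho ^ i.
Proof. by rewrite vabsM vabsXz xr ext_abs. Qed.

Lemma geval_null f : cvg_at rho (coef f) -> nullZ (fun i => emb (coef f i) * x ^ i).
Proof.
by move=> cf d /cf[N HN]; exists N => i /HN; rewrite vabs_term.
Qed.

Lemma geval_le f c : gle rho f c -> vabs (geval f x) <= c.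
Proof.
move=> [cf Hf]; apply: sumZ_le; first exact: geval_null.
by move=> i; rewrite vabs_term.
Qed.

Lemma gevalD f g : cvg_at rho (coef f) -> cvg_at rho (coef g) ->
  geval (f + g) x = geval f x + geval g x.
Proof.
move=> cf cg; rewrite /geval -sumZD; [|exact: geval_null|exact: geval_null].
by congr sumZ; apply/funext => i; rewrite gcoefD rmorphD mulrDl.
Qed.

Lemma gevalN f : cvg_at rho (coef f) -> geval (- f) x = - geval f x.
Proof.
move=> cf; have cN : cvg_at rho (coef (- f)).
  by apply: (cvg_at_le r0 _ cf) => i; rewrite gcoefN vabsN.
apply/eqP; rewrite -addr_eq0 -gevalD// addNr.
by rewrite /geval (@sumZ_supp _ _ _ _ 0) => [|i _]; rewrite gcoef0 rmorph0 mul0r.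
Qed.

Lemma gevalB f g : cvg_at rho (coef f) -> cvg_at rho (coef g) ->
  geval (f - g) x = geval f x - geval g x.
Proof.
move=> cf cg; rewrite gevalD ?gevalN//.
by apply: (cvg_at_le r0 _ cg) => i; rewrite gcoefN vabsN.
Qed.

Lemma geval_gmono a k : geval (gmono B a k) x = emb a * x ^ k.
Proof.
rewrite /geval (@sumZ_supp _ _ _ _ k) /= /lmono ?eqxx//.
by move=> i /negPf ->; rewrite rmorph0 mul0r.
Qed.

Lemma x_neq0 : x != 0.
Proof. by apply/eqP => x0; move: r0; rewrite -xr x0 vabs0 ltxx. Qed.

Lemma gevalM f g : cvg_at rho (coef f) -> cvg_at rho (coef g) ->
  geval (f * g) x = geval f x * geval g x.
Proof.
have bnd g1 d f1 c : gle rho g1 d -> gle rho f1 c ->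
    vabs (geval (f1 * g1) x - geval f1 x * geval g1 x) <= (d + 1) * c.
  move=> Hg Hf; have d0 := gle_ge0 Hg; have c0 := gle_ge0 Hf.
  apply: (@le_trans _ _ (c * d)); last by rewrite mulrC ler_wpM2r// lerDl.
  apply: vabsD_le; first exact: geval_le (gleM r0 Hf Hg).
  by rewrite vabsN vabsM; apply: ler_pM; rewrite ?vabs_ge0//; exact: geval_le.
(* Density is applied to each factor in turn, the other one being fixed. *)
have step g1 : cvg_at rho (coef g1) ->
   (forall a k, geval (gmono B a k * g1) x = geval (gmono B a k) x * geval g1 x) ->
   forall f1, cvg_at rho (coef f1) -> geval (f1 * g1) x = geval f1 x * geval g1 x.
  move=> cg1 Hm f1 cf1; have [d Hd] := gle_fin r0 cg1; have d0 := gle_ge0 Hd.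
  apply/eqP; rewrite -subr_eq0; apply/eqP.
  apply: (germ_density r0 (D := d + 1) (Phi := fun f => geval (f * g1) x - geval f x * geval g1 x)) => //.
  - by rewrite ltr_wpDl.
  - move=> h k ch ck; rewrite mulrDl !gevalD//; try exact: lmul_cvg.
    by rewrite mulrDl opprD addrACA.
  - by move=> h c Hh; exact: bnd.
  - by move=> a k; rewrite Hm subrr.
move=> cf cg; apply: (step) => // a k; rewrite mulrC [RHS]mulrC.
move: g cg; apply: step; first exact: cvg_at_lmono.
move=> b l; rewrite gmonoM !geval_gmono rmorphM expfzDr ?x_neq0//.
by rewrite mulrACA.
Qed.

End AtPoint.

(* A generic point detects zero: the Gauss norm of a Laurent polynomial is
   attained, and the tail is negligible. *)
Lemma geval_generic_eq0 (t : Om) rho f : 0 < rho -> generic_point (K := K) rho t ->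
  vabs t = rho -> cvg_at rho (coef f) -> geval f t = 0 -> f = 0.
Proof.
move=> r0 gt tr cf f0; apply/germ_eq/funext => i; rewrite gcoef0.
apply/eqP/contraT => fi; have vi := vabs_gt0 fi.
pose d := vabs (coef f i) * rho ^ i / 2.
have d0 : 0 < d by rewrite divr2_gt0// mulr_gt0// exprz_gt0.
have [N0 HN0] := gtrunc_rest r0 cf d0.
have [N [N1 N2]] : exists N, (N0 <= N)%N /\ (`|i| <= N)%N.
  by exists (maxn N0 `|i|); rewrite leq_maxl leq_maxr.
have HN : gle rho (f - gtrunc N f) d.
  apply: (gle_coef r0 HN0) => j; rewrite !gcoefB !coef_gtrunc.
  case: ifPn => jN; first by rewrite subrr vabs0 vabs_ge0.
  by rewrite ifF// ?subr0//; apply/negbTE; lia.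
have trN : vabs (geval (gtrunc N f) t) <= d.
  have -> : geval (gtrunc N f) t = - geval (f - gtrunc N f) t.
    by rewrite (gevalB r0 tr)// ?f0 ?sub0r ?opprK//; exact: gtrunc_cvg.
  by rewrite vabsN; exact: geval_le HN.
(* The definition of a generic point speaks of polynomials, so the truncation is multiplied by
   [T^N]. *)
pose P : {poly K} := \poly_(j < N.*2.+1) coef f (j%:Z - N%:Z).
have PE : (map_poly emb P).[t] = t ^+ N * geval (gtrunc N f) t.
  have -> : geval (gtrunc N f) t = \sum_(j < N.*2.+1) emb (coef f (j%:Z - N%:Z)) * t ^ (j%:Z - N%:Z).
    have H m (g : 'I_m -> K) (k : 'I_m -> int) :
        geval (\sum_(j < m) gmono B (g j) (k j)) t = \sum_(j < m) emb (g j) * t ^ (k j).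
      elim: m g k => [|m IH] g k.
        by rewrite !big_ord0 -[0 : G]/(gmono B 0 0) geval_gmono rmorph0 mul0r.
      rewrite !big_ord_recl (gevalD tr) ?IH ?geval_gmono//; first exact: cvg_at_lmono.
      apply: (big_ind (fun g : G => cvg_at rho (coef g))) => [|a b ca cb|j _].
      - exact: cvg_at_lmono.
      - exact: cvg_atD.
      - exact: cvg_at_lmono.
    exact: H.
  have t0 : t != 0 := x_neq0 r0 tr.
  rewrite (@horner_coef_wide _ N.*2.+1); last first.
    by rewrite size_map_poly size_poly.
  rewrite mulr_sumr; apply: eq_bigr => j _.
  rewrite coef_map coef_poly ltn_ord mulrCA; congr (_ * _).
  by rewrite exprnP [in RHS]exprnP -expfzDr//; congr (_ ^ _); lia.
have jN : (absz (i + N%:Z)%R < N.*2.+1)%N by lia.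
have Pj : P`_(absz (i + N%:Z)%R) = coef f i.
  by rewrite coef_poly jN; congr (coef f _); lia.
have jP : (absz (i + N%:Z)%R < size P)%N.
  by rewrite ltnNge; apply/negP => /(nth_default 0); rewrite Pj => E; rewrite E eqxx in fi.
have := gt P; rewrite PE vabsM vabsX tr => E.
have : vabs (coef f i) * rho ^+ absz (i + N%:Z)%R <= rho ^+ N * vabs (geval (gtrunc N f) t).
  rewrite E -Pj; exact: (le_bigmax _ (fun j : 'I_(size P) => vabs P`_j * rho ^+ j) (Ordinal jP)).
have -> : rho ^+ absz (i + N%:Z)%R = rho ^+ N * rho ^ i.
  by rewrite exprnP [in RHS]exprnP -expfzDr ?gt_eqF//; congr (_ ^ _); lia.
rewrite mulrCA ler_pM2l ?exprn_gt0// => /le_trans /(_ trN).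
have : 0 < vabs (coef f i) * rho ^ i by rewrite mulr_gt0// exprz_gt0.
by rewrite /d; set y := _ * _; lra.
Qed.

End Eval.

(** * Taylor expansion of evaluations *)

Section Taylor.
Variables (R : realType) (p : nat) (K : cufield R p) (B : germ_kind).
Variable Om : cu_extension K.
Local Notation G := (germ K B).
Local Notation emb := (ext_emb Om).
Implicit Types (f g : G).

(** The ring is itself a module with connection [delta1], so the Leibniz rule for [ddiv] is an
    instance of the one for [bin_conn]. *)
Lemma ddiv_bin_conn k f : ddiv k f = bin_conn (X := G^o) (@delta1 R p K B) k f.
Proof.
have dD : {morph @delta1 R p K B : x y / x + y} by move=> x y; exact: delta1D.
have dZ (x y : G) : delta1 (x * y) = delta1 x * y + x * delta1 y by exact: delta1M.
elim: k => [|k IH]; first exact: ddiv0.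
apply: (bin_connS_eq (X := G^o) (cn := @delta1 R p K B)); rewrite -IH delta1_ddiv.
exact/esym/addrK.
Qed.

Lemma ddivM k f g : ddiv k (f * g) = \sum_(j < k.+1) ddiv j f * ddiv (k - j) g.
Proof.
have dD : {morph @delta1 R p K B : x y / x + y} by move=> x y; exact: delta1D.
rewrite ddiv_bin_conn (bin_conn_leibniz (X := G^o) dD).
  by apply: eq_bigr => j _; rewrite -ddiv_bin_conn.
by move=> x y; exact: delta1M.
Qed.

Lemma ddivD k f g : ddiv k (f + g) = ddiv k f + ddiv k g.
Proof.
by apply/germ_eq/funext => i; rewrite gcoefD !coef_ddiv gcoefD mulrDr.
Qed.

Lemma ddiv_gcst k (a : K) : (0 < k)%N -> ddiv k (gcst B a) = 0.
Proof.
move=> k0; apply/germ_eq/funext => i; rewrite coef_ddiv gcoef0 /= /lmono.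
case: eqP => [->|_]; last by rewrite mulr0.
by rewrite (bigD1 (Ordinal k0))//= mul0r mulr0 mul0r.
Qed.

Lemma ddiv_gT k : (1 < k)%N -> ddiv k (gT K B) = 0.
Proof.
move=> k0; apply/germ_eq/funext => i; rewrite coef_ddiv gcoef0 /= /lmono.
case: eqP => [->|_]; last by rewrite mulr0.
by rewrite (bigD1 (Ordinal k0))//= subrr mul0r mulr0 mul0r.
Qed.

Lemma ddiv1_gT : ddiv 1 (gT K B) = gT K B.
Proof.
apply/germ_eq/funext => i; rewrite coef_ddiv big_ord_recl big_ord0 /= /lmono.
by case: eqP => [->|_]; rewrite ?mulr0// invr1 !mulr1.
Qed.

Variables (rho : R) (r0 : 0 < rho) (t z : Om) (tr : vabs t = rho) (z1 : vabs z < 1).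

Let x := t * (1 + z).

Lemma vabs_1z : vabs (1 + z) = 1.
Proof. by apply: vabs_unit; rewrite addrC addKr. Qed.

Lemma xr : vabs x = rho.
Proof. by rewrite vabsM vabs_1z mulr1. Qed.

Let z01 : 0 <= vabs z < 1. Proof. by rewrite vabs_ge0. Qed.

Definition tay f : Om := sumN (fun m => z ^+ m * geval (ddiv m f) t).

Lemma tay_term f c m : gle rho f c -> vabs (z ^+ m * geval (ddiv m f) t) <= c * vabs z ^+ m.
Proof.
move=> Hf; rewrite vabsM vabsX mulrC; apply: ler_wpM2r; first by rewrite exprn_ge0 ?vabs_ge0.
by apply: (geval_le tr); exact: gle_ddiv_norm.
Qed.

Lemma ddiv_cvg m f : cvg_at rho (coef f) -> cvg_at rho (coef (ddiv m f)).
Proof.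
by move=> /(gle_fin r0)[c Hc]; have [] := gle_ddiv_norm m r0 Hc.
Qed.

Lemma tay_nsum f : cvg_at rho (coef f) ->
  nsum (@vle R p Om) (fun m => z ^+ m * geval (ddiv m f) t) (tay f).
Proof.
by move=> /(gle_fin r0)[c Hc]; apply: (geo_ex z01) => m; exact: tay_term Hc.
Qed.

Lemma tayD f g : cvg_at rho (coef f) -> cvg_at rho (coef g) -> tay (f + g) = tay f + tay g.
Proof.
move=> cf cg; apply: sumN_nsum.
apply: eq_nsum (nsumD (vle_ultra Om) (tay_nsum cf) (tay_nsum cg)) => m.
by rewrite ddivD (gevalD tr) ?mulrDr//; exact: ddiv_cvg.
Qed.

Lemma tay_le f c : gle rho f c -> vabs (tay f) <= c.
Proof.
move=> Hf; apply/ler_addgt0Pr => d d0.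
have [cf _] := Hf; have c0 := gle_ge0 Hf.
apply: (nsum_le (vle_ultra Om) _ _ (tay_nsum cf)); first by rewrite ltr_wpDl.
move=> m; apply: le_trans (tay_term m Hf) _; apply: (@le_trans _ _ c); last by rewrite lerDl ltW.
by rewrite ler_piMr// exprn_ile1 ?vabs_ge0// ltW.
Qed.

Lemma geval_sum (I : Type) (s : seq I) (P : pred I) (F : I -> G) (y : Om) : vabs y = rho ->
  (forall i, cvg_at rho (coef (F i))) ->
  geval (\sum_(i <- s | P i) F i) y = \sum_(i <- s | P i) geval (F i) y.
Proof.
move=> yr H.
have : cvg_at rho (coef (\sum_(i <- s | P i) F i)) /\
    geval (\sum_(i <- s | P i) F i) y = \sum_(i <- s | P i) geval (F i) y.
  elim/big_rec2 : _ => [|i a b _ [cb Hb]].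
    by rewrite -[0 : G]/(gmono B 0 0) geval_gmono rmorph0 mul0r; split=> //; exact: cvg_at_lmono.
  by split; [exact: cvg_atD|rewrite (gevalD yr)// Hb].
by case.
Qed.

Lemma tayM f g : cvg_at rho (coef f) -> cvg_at rho (coef g) -> tay (f * g) = tay f * tay g.
Proof.
move=> cf cg; have [c Hc] := gle_fin r0 cf; have [d Hd] := gle_fin r0 cg.
rewrite /tay -(cauchy_product (gle_ge0 Hc) (gle_ge0 Hd) z01 (fun m => tay_term m Hc)
  (fun m => tay_term m Hd)).
congr sumN; apply/funext => m; rewrite ddivM geval_sum//; last first.
  by move=> j; apply: lmul_cvg => //; exact: ddiv_cvg.
rewrite mulr_sumr; apply: eq_bigr => j _.
rewrite (gevalM r0 tr)//; try exact: ddiv_cvg.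
by rewrite mulrACA -exprD subnKC// -ltnS ltn_ord.
Qed.

Lemma tay_gcst a : tay (gcst B a) = emb a.
Proof.
apply: sumN_nsum.
have -> : emb a = \sum_(m < 1) z ^+ m * geval (ddiv m (gcst B a)) t.
  by rewrite big_ord_recl big_ord0 addr0 expr0 mul1r ddiv0 geval_gmono expr0z mulr1.
apply: (nsum_fin (vle_ultra Om)) => m m1; rewrite ddiv_gcst//.
by rewrite -[0 : G]/(gmono B 0 0) geval_gmono rmorph0 mul0r mulr0.
Qed.

Lemma tay_gT : tay (gT K B) = x.
Proof.
apply: sumN_nsum.
have -> : x = \sum_(m < 2) z ^+ m * geval (ddiv m (gT K B)) t.
  rewrite !big_ord_recl big_ord0 /= addr0 expr0 mul1r expr1 ddiv0 ddiv1_gT geval_gmono.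
  by rewrite rmorph1 mul1r expr1z /x mulrDr mulr1 mulrC.
apply: (nsum_fin (vle_ultra Om)) => m m1; rewrite ddiv_gT//.
by rewrite -[0 : G]/(gmono B 0 0) geval_gmono rmorph0 mul0r mulr0.
Qed.

Lemma tay_gmono a k : tay (gmono B a k) = emb a * x ^ k.
Proof.
have x0 : x != 0 := x_neq0 r0 xr.
have cm b l : cvg_at rho (coef (gmono B b l)) by exact: cvg_at_lmono.
have tinv : tay (gTinv K B) = x^-1.
  apply: (mulfI x0); rewrite mulfV// -tay_gT -tayM; try exact: cm.
  by rewrite gTK -gcst1 tay_gcst rmorph1.
have tT n : tay (gmono B 1 n%:Z) = x ^+ n.
  elim: n => [|n IH]; first by rewrite -[gmono _ _ _]/(gcst B 1) tay_gcst rmorph1 expr0.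
  rewrite exprS -IH -tay_gT -tayM; try exact: cm.
  by rewrite /gT gmonoM mulr1; congr (tay (gmono _ _ _)); lia.
have tTV n : tay (gmono B 1 (- n%:Z)) = x ^- n.
  elim: n => [|n IH]; first by rewrite -[gmono _ _ _]/(gcst B 1) tay_gcst rmorph1 expr0 invr1.
  rewrite exprS invfM -IH -tinv -tayM; try exact: cm.
  by rewrite /gTinv gmonoM mulr1; congr (tay (gmono _ _ _)); lia.
have -> : gmono B a k = gcst B a * gmono B 1 k by rewrite /gcst gmonoM mulr1 add0r.
rewrite tayM ?tay_gcst; try exact: cm; congr (_ * _).
by case: k => n; [exact: tT|rewrite NegzE tTV exprnN].
Qed.

(** Both sides are additive, multiplicative and bounded in [f] and agree on constants and on [T];
    hence they agree on monomials, and by density on all germs converging at [rho]. *)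
Lemma geval_taylor f : cvg_at rho (coef f) -> geval f x = tay f.
Proof.
move=> cf; apply/eqP; rewrite -subr_eq0; apply/eqP.
apply: (germ_density r0 (D := 1) (Phi := fun f => geval f x - tay f)) => //.
- move=> g h cg ch; rewrite (gevalD xr)// tayD// opprD addrACA //.
- move=> g c Hg; rewrite mul1r; apply: vabsD_le; first exact: (geval_le xr).
  by rewrite vabsN; exact: tay_le.
by move=> a k; rewrite geval_gmono tay_gmono subrr.
Qed.

End Taylor.

(** * Horizontal translation from a point *)

Section Fev.
Variables (R : realType) (p : nat) (K : cufield R p) (B : germ_kind).
Variable Om : cu_extension K.
Local Notation G := (germ K B).
Local Notation emb := (ext_emb Om).
Variables (X : lmodType G) (cn : X -> X).
Hypothesis cnD : {morph cn : x y / x + y}.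
Hypothesis cnZ : forall f x, cn (f *: x) = delta1 f *: x + f *: cn x.
Variables (n0 : nat) (e : 'I_n0 -> X).
Hypothesis be : is_basis e.
Local Notation "a %* x" := (gcst B a *: x) (at level 40).
Variables (rho C s : R) (r0 : 0 < rho) (C0 : 0 < C) (s01 : 0 < s <= 1).
Hypothesis He : forall k i, xle e rho (bin_conn cn k (e i)) (C / s ^+ k).
Variables (t : Om) (tr : vabs t = rho).
Implicit Types (f g : G) (x y : X).

Let s0 : 0 < s. Proof. by case/andP: s01. Qed.
Let s1 : s <= 1. Proof. by case/andP: s01. Qed.

(* The value at [t * (1 + z)] of the horizontal translation of [x] from the
   point [t], in the basis [e]. *)
Definition Fev (z : Om) x (j : 'I_n0) : Om :=
  sumN (fun m => z ^+ m * geval (ecoord e (bin_conn cn m x) 0 j) t).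

Lemma cb_le x c m j : xle e rho x c ->
  vabs (geval (ecoord e (bin_conn cn m x) 0 j) t) <= c * C / s ^+ m.
Proof.
move=> Hx; apply: (geval_le tr).
by have [_ ] := bin_conn_le cnD cnZ be r0 C0 s01 He Hx m; exact.
Qed.

Section AtZ.
Variables (z : Om) (zs : vabs z < s).

Let u01 : 0 <= vabs z / s < 1.
Proof. by rewrite divr_ge0 ?vabs_ge0 ?(ltW s0)//= ltr_pdivrMr// mul1r. Qed.
Let z1 : vabs z < 1 := lt_le_trans zs s1.

Lemma Fev_term x c m j : xle e rho x c ->
  vabs (z ^+ m * geval (ecoord e (bin_conn cn m x) 0 j) t) <= c * C * (vabs z / s) ^+ m.
Proof.
move=> Hx; rewrite vabsM vabsX expr_div_n mulrCA; apply: ler_wpM2l.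
  by rewrite exprn_ge0 ?vabs_ge0.
exact: cb_le.
Qed.

Lemma Fev_nsum x j : (exists c, xle e rho x c) ->
  nsum (@vle R p Om) (fun m => z ^+ m * geval (ecoord e (bin_conn cn m x) 0 j) t) (Fev z x j).
Proof. by move=> [c Hc]; apply: (geo_ex u01) => m; exact: Fev_term Hc. Qed.

Lemma Fev_le x c j : xle e rho x c -> vabs (Fev z x j) <= c * C.
Proof.
move=> Hx; apply/ler_addgt0Pr => d d0; have [c0 _] := Hx.
have cC : 0 <= c * C by rewrite mulr_ge0// ltW.
apply: (nsum_le (vle_ultra Om) _ _ (Fev_nsum j (ex_intro _ c Hx))); first by rewrite ltr_wpDl.
move=> m; apply: le_trans (Fev_term m j Hx) _; apply: (@le_trans _ _ (c * C)); last by rewrite lerDl ltW.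
by have [u0 u1] := andP u01; rewrite ler_piMr// exprn_ile1// ltW.
Qed.

Lemma cb_cvg x m j : (exists c, xle e rho x c) ->
  cvg_at rho (coef (ecoord e (bin_conn cn m x) 0 j)).
Proof.
move=> [c Hc]; by have [_ /(_ j)[]] := bin_conn_le cnD cnZ be r0 C0 s01 He Hc m.
Qed.

Lemma FevD x y j : (exists c, xle e rho x c) -> (exists c, xle e rho y c) ->
  Fev z (x + y) j = Fev z x j + Fev z y j.
Proof.
move=> fx fy; apply: sumN_nsum.
apply: eq_nsum (nsumD (vle_ultra Om) (Fev_nsum j fx) (Fev_nsum j fy)) => m.
rewrite bin_connD// ecoordD// mxE (gevalD tr) ?mulrDr//; exact: cb_cvg.
Qed.

(** The Leibniz rule turns the translation of [f *: x] into the Cauchy product of the Taylor series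
    of [f] and the translation of [x]. *)
Lemma FevZ f x j : cvg_at rho (coef f) -> (exists c, xle e rho x c) ->
  Fev z (f *: x) j = geval f (t * (1 + z)) * Fev z x j.
Proof.
move=> cf fx; have [c Hc] := gle_fin r0 cf; have [d Hd] := fx; have [d0 _] := Hd.
rewrite (geval_taylor r0 tr z1 cf) /tay /Fev.
have v01 := u01; have [v0 v1] := andP v01.
have Ha m : vabs (z ^+ m * geval (ddiv m f) t) <= c * (vabs z / s) ^+ m.
  apply: le_trans (tay_term r0 z tr m Hc) _; apply: ler_wpM2l; first exact: gle_ge0 Hc.
  apply: lerXn2r; rewrite ?nnegrE ?vabs_ge0//.
  by rewrite ler_pdivlMr// ler_piMr ?vabs_ge0.
have dC : 0 <= d * C by rewrite mulr_ge0// ltW.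
rewrite -(cauchy_product (gle_ge0 Hc) dC v01 Ha (fun m => Fev_term m j Hd)).
congr sumN; apply/funext => m; rewrite bin_conn_leibniz// ecoord_sum// summxE.
rewrite (geval_sum r0)//; last first.
  move=> i; rewrite ecoordZ// mxE; apply: lmul_cvg => //; first exact: ddiv_cvg.
  exact: cb_cvg.
rewrite mulr_sumr; apply: eq_bigr => i _; rewrite ecoordZ// mxE.
rewrite (gevalM r0 tr); [|exact: ddiv_cvg|exact: cb_cvg].
by rewrite mulrACA -exprD subnKC// -ltnS ltn_ord.
Qed.

Lemma Fev_sum x j : (exists c, xle e rho x c) -> Fev z x j =
  \sum_i geval (ecoord e x 0 i) (t * (1 + z)) * Fev z (e i) j.
Proof.
move=> fx; rewrite -{1}(ecoordK be x).
have fe i : exists c, xle e rho (e i) c.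
  by have := He 0 i; rewrite /= expr0 divr1; exists C.
have cc i : cvg_at rho (coef (ecoord e x 0 i)) by have [c [_ /(_ i)[]]] := fx.
have H (I : seq 'I_n0) : (exists c, xle e rho (\sum_(i <- I) ecoord e x 0 i *: e i) c) /\
    Fev z (\sum_(i <- I) ecoord e x 0 i *: e i) j =
      \sum_(i <- I) geval (ecoord e x 0 i) (t * (1 + z)) * Fev z (e i) j.
  elim/big_rec2 : _ => [|i a b _ [fb Hb]].
    split; first by exists 0; exact: (nle0 (xle_ultra be r0)).
    apply/vabs_eq0/eqP; rewrite eq_le vabs_ge0 andbT.
    have := @Fev_le 0 0 j; rewrite mul0r; apply.
    exact: (nle0 (xle_ultra be r0)).
  have fi : exists c, xle e rho (ecoord e x 0 i *: e i) c.
    by apply: (xfinZ be r0) => //; exact: gle_fin.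
  split; first exact: xfinD.
  by rewrite FevD// Hb FevZ.
exact: (H _).2.
Qed.

(** In [bin_conn k = T^k (T^-k bin_conn k)] the factor [T^k] takes the value [t^k (1 + z)^k], and
    the rest is a divided derivative, whose Taylor coefficients are given by [bin_conn_shift]; the
    powers of [t] cancel. *)
Lemma Fev_bin_conn x k j : (exists c, xle e rho x c) -> Fev z (bin_conn cn k x) j =
  (1 + z) ^+ k * sumN (fun m => z ^+ m *
    ('C(m + k, k)%:R * geval (ecoord e (bin_conn cn (m + k) x) 0 j) t)).
Proof.
move=> fx; have t0 : t != 0 := x_neq0 r0 tr.
have fb : exists c, xle e rho (bin_conn cn k x) c.
  have [c Hc] := fx; exists (c * C / s ^+ k); exact: (bin_conn_le cnD cnZ be r0 C0 s01 He Hc).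
have -> : bin_conn cn k x = gmono B 1 k%:Z *: (gmono B 1 (- k%:Z) *: bin_conn cn k x).
  by rewrite scalerA gmonoM mulr1 subrr gmono1 scale1r.
have fb' : exists c, xle e rho (gmono B 1 (- k%:Z) *: bin_conn cn k x) c.
  by apply: (xfinZ be r0) => //; apply: gle_fin => //; exact: cvg_at_lmono.
rewrite FevZ//; last exact: cvg_at_lmono.
rewrite geval_gmono rmorph1 mul1r -exprnP exprMn mulrAC mulrC; congr (_ * _).
apply/esym/sumN_nsum.
apply: eq_nsum (nsumZl (t ^+ k) (Fev_nsum j fb')) => m.
rewrite bin_conn_shift// mulrCA; congr (_ * _).
rewrite -gcst_nat !(ecoordZ be) !mxE (gevalM r0 tr); first last.
- by apply: lmul_cvg => //; [exact: cvg_at_lmono|exact: cb_cvg].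
- exact: cvg_at_lmono.
rewrite (gevalM r0 tr); [|exact: cvg_at_lmono|exact: cb_cvg].
rewrite !geval_gmono expr0z mulr1 rmorph_nat rmorph1 mul1r -exprnN.
by rewrite mulrCA [t ^+ k * _]mulrA mulfV ?expf_neq0// mul1r.
Qed.

End AtZ.
End Fev.

(** * Composition of translations *)

Section Key.
Variables (R : realType) (p : nat) (K : cufield R p) (B : germ_kind).
Variable Om : cu_extension K.
Local Notation G := (germ K B).
Local Notation emb := (ext_emb Om).
Variables (X : lmodType G) (cn : X -> X).
Hypothesis cnD : {morph cn : x y / x + y}.
Hypothesis cnZ : forall f x, cn (f *: x) = delta1 f *: x + f *: cn x.
Variables (n0 : nat) (e : 'I_n0 -> X).
Hypothesis be : is_basis e.
Local Notation "a %* x" := (gcst B a *: x) (at level 40).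
Variables (rho C s : R) (r0 : 0 < rho) (C0 : 0 < C) (s01 : 0 < s <= 1).
Hypothesis He : forall k i, xle e rho (bin_conn cn k (e i)) (C / s ^+ k).
Variables (t : Om) (tr : vabs t = rho).
Implicit Types (f g : G) (x y : X).

Let s0 : 0 < s. Proof. by case/andP: s01. Qed.
Let s1 : s <= 1. Proof. by case/andP: s01. Qed.

Lemma Fev0 x j : Fev cn e t 0 x j = geval (ecoord e x 0 j) t.
Proof.
apply: sumN_nsum.
have -> : geval (ecoord e x 0 j) t =
   \sum_(m < 1) (0 : Om) ^+ m * geval (ecoord e (bin_conn cn m x) 0 j) t.
  by rewrite big_ord_recl big_ord0 addr0 expr0 mul1r.
by apply: (nsum_fin (vle_ultra Om)) => -[|m] // _; rewrite expr0n mul0r.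
Qed.

Lemma Fev_psum (z : Om) (a : nat -> K) (u : nat -> X) N j : vabs z < s ->
  (forall k, exists c, xle e rho (u k) c) ->
  Fev cn e t z (\sum_(k < N) a k %* u k) j = \sum_(k < N) emb (a k) * Fev cn e t z (u k) j.
Proof.
move=> zs fu.
have fau k : exists c, xle e rho (a k %* u k) c.
  by apply: (xfinZ be r0) => //; exists (vabs (a k)); exact: gle_gcst.
elim: N => [|N IH].
  rewrite !big_ord0; apply/vabs_eq0/eqP; rewrite eq_le vabs_ge0 andbT.
  have := Fev_le cnD cnZ be r0 C0 s01 He tr zs j (nle0 (xle_ultra be r0) (lexx 0)).
  by rewrite mul0r.
rewrite !big_ord_recr /= (FevD cnD cnZ be r0 C0 s01 He tr zs) ?IH//; last first.
  by apply: (xfin_sum be r0) => k _; exact: fau.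
congr (_ + _); rewrite (FevZ cnD cnZ be r0 C0 s01 He tr zs)//; last exact: cvg_at_lmono.
by rewrite geval_gmono expr0z mulr1.
Qed.

(* Transporting [S], the value at [q * t] of the Taylor solution, from [t] to
   [t * (1 + z)] is transporting [x] from [t] to [q * t * (1 + z)], where
   [q = 1 + y]: both sides are sums of the same double series. *)
Lemma Fev_key (z : Om) (y : K) S x j : vabs z < s -> vabs y < s ->
  (exists c, xle e rho x c) -> (exists c, xle e rho S c) ->
  nsum (xle e rho) (fun k => y ^+ k %* bin_conn cn k x) S ->
  Fev cn e t z S j = Fev cn e t (z + emb y * (1 + z)) x j.
Proof.
move=> zs ys fx fS HS; have U := xle_ultra be r0; have UO := vle_ultra Om.
have z1 : vabs z < 1 := lt_le_trans zs s1.
set u := emb y * (1 + z).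
have uy : vabs u = vabs y by rewrite vabsM (vabs_1z z1) mulr1 ext_abs.
have [c Hc] := fx; have [c0 _] := Hc.
pose a n := geval (ecoord e (bin_conn cn n x) 0 j) t.
have aC n : vabs (a n) <= c * C / s ^+ n by exact: (cb_le cnD cnZ be r0 C0 s01 He tr).
have fb k : exists d, xle e rho (bin_conn cn k x) d.
  by eexists; exact: (bin_conn_le cnD cnZ be r0 C0 s01 He Hc).
have lhs : nsum (@vle R p Om) (fun k => u ^+ k * sumN (fun m => z ^+ m *
    ('C(m + k, k)%:R * a (m + k)%N))) (Fev cn e t z S j).
  have H : nsum (@vle R p Om) (fun k => emb (y ^+ k) * Fev cn e t z (bin_conn cn k x) j)
      (Fev cn e t z S j).
    move=> d d0; have [N HN] := HS _ (divr_gt0 d0 C0); exists N => n /HN Hn.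
    rewrite -(@Fev_psum z (fun k => y ^+ k) (fun k => bin_conn cn k x))// /vle vabsB.
    have fP : exists d, xle e rho (\sum_(k < n) y ^+ k %* bin_conn cn k x) d.
      apply: (xfin_sum be r0) => k _; apply: (xfinZ be r0) => //.
      by exists (vabs (y ^+ k)); exact: gle_gcst.
    have -> : S = (S - \sum_(k < n) y ^+ k %* bin_conn cn k x) +
        \sum_(k < n) y ^+ k %* bin_conn cn k x by rewrite subrK.
    rewrite (FevD cnD cnZ be r0 C0 s01 He tr zs) ?addrK//; last first.
      by apply: (xfinD be r0) => //; exact: xfinN.
    move/(nleN U): Hn; rewrite opprB => /(Fev_le cnD cnZ be r0 C0 s01 He tr zs j).
    by rewrite divfK// gt_eqF.
  apply: eq_nsum H => k; rewrite (Fev_bin_conn cnD cnZ be r0 C0 s01 He tr zs)//.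
  by rewrite mulrA rmorphXn -exprMn.
pose w := Num.max (vabs z) (vabs y).
have w0 : 0 <= w by rewrite le_max vabs_ge0.
have ws : w < s by rewrite gt_max zs.
have ws01 : 0 <= w / s < 1 by rewrite divr_ge0 ?(ltW s0)//= ltr_pdivrMr// mul1r.
have zw : vabs z <= w by rewrite le_max lexx.
have uw : vabs u <= w by rewrite uy le_max lexx orbT.
have zus : vabs (z + u) < s by apply: vabsD_lt => //; rewrite uy.
(* Row [n] is the binomial expansion of [(z + u)^n a n], where [z + u] is the total displacement;
   column [k] is the [k]-th term of the translation of [S]. *)
pose tt n k := if (k <= n)%N then 'C(n, k)%:R * (z ^+ (n - k) * u ^+ k) * a n else 0.
have ttle n k : vle (tt n k) (c * C * (w / s) ^+ n).
  rewrite /tt /vle; have [w0' w1'] := andP ws01; case: ifP => kn; last first.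
    by rewrite vabs0 !mulr_ge0 ?exprn_ge0// ltW.
  have -> : c * C * (w / s) ^+ n = 1 * w ^+ n * (c * C / s ^+ n).
    by rewrite expr_div_n; field; rewrite expf_neq0// gt_eqF.
  rewrite !vabsM !vabsX; apply: ler_pM; rewrite ?mulr_ge0 ?exprn_ge0 ?vabs_ge0//.
  apply: ler_pM; rewrite ?mulr_ge0 ?exprn_ge0 ?vabs_ge0 ?vabs_nat_le1//.
  rewrite -(subnK kn) exprD addnK; apply: ler_pM; rewrite ?exprn_ge0 ?vabs_ge0//;
    by apply: lerXn2r; rewrite ?nnegrE ?vabs_ge0.
apply: (ncvg_uniq lhs).
apply: (@sum_exchange _ _ _ UO tt (fun n => c * C * (w / s) ^+ n)
  (fun n => (z + u) ^+ n * a n)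
  (fun k => u ^+ k * sumN (fun m => z ^+ m * ('C(m + k, k)%:R * a (m + k)%N)))) => //.
- by move=> n k nk; rewrite /tt leqNgt nk.
- exact: geo_small.
- move=> n; rewrite exprDn mulr_suml; apply: eq_bigr => k _.
  by rewrite /tt -ltnS ltn_ord -mulr_natl.
- exact: (Fev_nsum cnD cnZ be r0 C0 s01 He tr zus j fx).
move=> k; have := nsum_unshift (nle := @vle R p Om) (u := fun n => tt n k) (m := k)
  (l := u ^+ k * sumN (fun m => z ^+ m * ('C(m + k, k)%:R * a (m + k)%N))).
rewrite big1 => [|i _]; last by rewrite /tt leqNgt ltn_ord.
rewrite add0r; apply.
have zs01 : 0 <= vabs z / s < 1.
  by rewrite divr_ge0 ?vabs_ge0 ?(ltW s0)//= ltr_pdivrMr// mul1r.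
have H : nsum (@vle R p Om) (fun m => z ^+ m * ('C(m + k, k)%:R * a (m + k)%N))
   (sumN (fun m => z ^+ m * ('C(m + k, k)%:R * a (m + k)%N))).
  apply: (geo_ex (C := c * C / s ^+ k) zs01) => m; rewrite !vabsM vabsX.
  have -> : c * C / s ^+ k * (vabs z / s) ^+ m = vabs z ^+ m * (1 * (c * C / s ^+ (m + k))).
    by rewrite expr_div_n exprD; field; rewrite !expf_neq0// gt_eqF.
  apply: ler_wpM2l; first by rewrite exprn_ge0 ?vabs_ge0.
  by apply: ler_pM; rewrite ?vabs_ge0 ?vabs_nat_le1.
apply: eq_nsum (nsumZl (u ^+ k) H) => m; rewrite /tt leq_addr addKn [(k + m)%N]addnC.
move: (_%:R) (z ^+ m) (u ^+ k) (a _) => x1 x2 x3 x4.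
by ring.
Qed.

End Key.

(** * Completion and generic points *)

Record ufield (R : realType) := UField {
  uf_sort :> fieldType;
  uabs : uf_sort -> R;
  uabs_ge0 : forall x, 0 <= uabs x;
  uabs_eq0 : forall x, uabs x = 0 <-> x = 0;
  uabsM : forall x y, uabs (x * y) = uabs x * uabs y;
  uabsD : forall x y, uabs (x + y) <= Num.max (uabs x) (uabs y)
}.

Section Completion.
Variables (R : realType) (F : ufield R).
Local Notation v := (@uabs R F).
Implicit Types (x y : F).

Lemma uabs0 : v 0 = 0. Proof. exact/uabs_eq0. Qed.

Lemma uabs_gt0 x : x != 0 -> 0 < v x.
Proof.
by move=> x0; rewrite lt_def uabs_ge0 andbT; apply: contra x0 => /eqP/uabs_eq0 ->.
Qed.

Lemma uabs1 : v 1 = 1.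
Proof.
have := uabsM (1 : F) 1; rewrite mulr1 => /esym/eqP.
by rewrite -{3}[v 1]mulr1 -subr_eq0 -mulrBr mulf_eq0 gt_eqF ?uabs_gt0 ?oner_eq0//= subr_eq0 => /eqP.
Qed.

Lemma uabsN x : v (- x) = v x.
Proof.
have : v (-1) ^+ 2 = 1 by rewrite expr2 -uabsM mulrNN mulr1 uabs1.
move=> /eqP; rewrite sqrf_eq1 => /orP[/eqP E|/eqP E].
  by rewrite -mulN1r uabsM E mul1r.
by have := uabs_ge0 (-1 : F); rewrite E; lra.
Qed.

Lemma uabsD_lt x y c : v x < c -> v y < c -> v (x + y) < c.
Proof. by move=> ? ?; apply: le_lt_trans (uabsD _ _) _; rewrite gt_max; apply/andP. Qed.

Lemma uabsV x : v x^-1 = (v x)^-1.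
Proof.
have [->|x0] := eqVneq x 0; first by rewrite invr0 uabs0 invr0.
apply: (mulfI (lt0r_neq0 (uabs_gt0 x0))).
by rewrite -uabsM !mulfV ?uabs1// gt_eqF// uabs_gt0.
Qed.

Record cauchy_seq := CauchySeq {
  cseq :> nat -> F;
  cseqP : abs_cauchy v cseq
}.
Implicit Types (a b : cauchy_seq).

Definition null_seq (u : nat -> F) : Prop := abs_cvg v u 0.

Definition csim a b : Prop := null_seq (fun n => a n - b n).

Lemma null_eq u w : (forall n, u n = w n) -> null_seq u -> null_seq w.
Proof. by move=> /funext ->. Qed.

Lemma null0 : null_seq (fun _ => 0).
Proof. by move=> e e0; exists 0%N => n _; rewrite subrr uabs0. Qed.

Lemma nullD u w : null_seq u -> null_seq w -> null_seq (fun n => u n + w n).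
Proof.
move=> Hu Hw e e0; have [N1 H1] := Hu e e0; have [N2 H2] := Hw e e0.
exists (maxn N1 N2) => n; rewrite geq_max => /andP[/H1 + /H2 +]; rewrite !subr0.
exact: uabsD_lt.
Qed.

Lemma nullN u : null_seq u -> null_seq (fun n => - u n).
Proof.
by move=> Hu e /Hu[N HN]; exists N => n /HN; rewrite !subr0 uabsN.
Qed.

Lemma csim_refl a : csim a a.
Proof. by apply: null_eq null0 => n; rewrite subrr. Qed.

Lemma csim_sym a b : csim a b -> csim b a.
Proof. by move=> /nullN; apply: null_eq => n; rewrite opprB. Qed.

Lemma csim_trans a b c : csim a b -> csim b c -> csim a c.
Proof. by move=> ab bc; apply: null_eq (nullD ab bc) => n; rewrite subrKA. Qed.

Lemma cauchy_bounded a : exists2 M : R, 0 < M & forall n, v (a n) <= M.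
Proof.
have [N HN] := cseqP a ltr01.
have [M M0 HM] : exists2 M : R, 0 < M & forall n, (n <= N)%N -> v (a n) <= M.
  elim: N {HN} => [|N [M M0 HM]].
    exists (v (a 0%N) + 1); first by rewrite ltr_wpDl ?uabs_ge0.
    by move=> n; rewrite leqn0 => /eqP ->; rewrite lerDl.
  exists (M + v (a N.+1)); first by rewrite ltr_wpDr ?uabs_ge0.
  move=> n; rewrite leq_eqVlt => /orP[/eqP ->|]; first by rewrite lerDr ltW.
  by rewrite ltnS => /HM /le_trans; apply; rewrite lerDl uabs_ge0.
exists (M + 1); first by rewrite ltr_wpDr.
move=> n; have [/HM /le_trans|nN] := leqP n N; first by apply; rewrite lerDl.
rewrite -[a n](subrK (a N)); apply: le_trans (uabsD _ _) _; rewrite ge_max.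
rewrite (le_trans (HM _ (leqnn N))) ?lerDl// andbT.
by apply: le_trans (ltW (HN _ _ (ltnW nN) (leqnn N))) _; rewrite lerDr ltW.
Qed.

Lemma nullM a u : null_seq u -> null_seq (fun n => a n * u n).
Proof.
move=> Hu e e0; have [M M0 HM] := cauchy_bounded a.
have [N HN] := Hu _ (divr_gt0 e0 M0); exists N => n /HN.
rewrite !subr0 uabsM ltr_pdivlMr// mulrC; apply: le_lt_trans.
by apply: ler_wpM2r; rewrite ?uabs_ge0.
Qed.

Lemma cauchyD a b : abs_cauchy v (fun n => a n + b n).
Proof.
move=> e e0; have [N1 H1] := cseqP a e0; have [N2 H2] := cseqP b e0.
exists (maxn N1 N2) => m n; rewrite !geq_max => /andP[m1 m2] /andP[n1 n2].
by rewrite opprD addrACA; apply: uabsD_lt; [exact: H1|exact: H2].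
Qed.
Definition cs_add a b := CauchySeq (@cauchyD a b).

Lemma cauchyN a : abs_cauchy v (fun n => - a n).
Proof.
move=> e /(cseqP a)[N HN]; exists N => m n Nm Nn.
by rewrite -opprD uabsN; exact: HN.
Qed.
Definition cs_opp a := CauchySeq (@cauchyN a).

Lemma cauchyM a b : abs_cauchy v (fun n => a n * b n).
Proof.
move=> e e0; have [M1 M10 H1] := cauchy_bounded a; have [M2 M20 H2] := cauchy_bounded b.
have [N1 HN1] := cseqP a (divr_gt0 e0 M20); have [N2 HN2] := cseqP b (divr_gt0 e0 M10).
exists (maxn N1 N2) => m n; rewrite !geq_max => /andP[m1 m2] /andP[n1 n2].
have -> : a m * b m - a n * b n = (a m - a n) * b m + a n * (b m - b n) by ring.
apply: uabsD_lt; rewrite uabsM.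
  have := HN1 _ _ m1 n1; rewrite ltr_pdivlMr//; apply: le_lt_trans.
  by apply: ler_wpM2l; rewrite ?uabs_ge0.
have := HN2 _ _ m2 n2; rewrite ltr_pdivlMr// mulrC; apply: le_lt_trans.
by apply: ler_wpM2r; rewrite ?uabs_ge0.
Qed.
Definition cs_mul a b := CauchySeq (@cauchyM a b).

Lemma cauchy_cst x : abs_cauchy v (fun _ => x).
Proof. by move=> e e0; exists 0%N => m n _ _; rewrite subrr uabs0. Qed.
Definition cs_cst x := CauchySeq (@cauchy_cst x).

(** By the ultrametric inequality, two elements closer to each other than to 0 have equal absolute
    values. The absolute value of the completion thus needs no limit of real numbers. *)
Lemma stationary a : null_seq a \/
  exists2 c : R, 0 < c & exists N : nat, forall n, (N <= n)%N -> v (a n) = c.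
Proof.
have [|na] := pselect (null_seq a); [by left|right].
have [e [e0 He]] : exists e : R, 0 < e /\ forall N, exists2 n, (N <= n)%N & e <= v (a n).
  apply: contrapT => H; apply: na => e e0; apply: contrapT => H'; apply: H.
  exists e; split=> // N; apply: contrapT => H; apply: H'; exists N => n Nn.
  by rewrite subr0 ltNge; apply/negP => en; apply: H; exists n.
have [N HN] := cseqP a e0; have [m Nm em] := He N.
exists (v (a m)); first exact: lt_le_trans e0 em.
exists N => n Nn; have lt := lt_le_trans (HN n m Nn Nm) em.
apply/eqP; rewrite eq_le; apply/andP; split.
  by rewrite -[a n](subrK (a m)); apply: le_trans (uabsD _ _) _; rewrite ge_max lexx (ltW lt).
rewrite leNgt; apply/negP => nm.
have : v (- (a n - a m) + a n) < v (a m) by apply: uabsD_lt; rewrite ?uabsN.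
by rewrite opprB subrK ltxx.
Qed.

Lemma cauchyV a : ~ null_seq a -> abs_cauchy v (fun n => (a n)^-1).
Proof.
move=> na; have [//|[c c0 [N HN]]] := stationary a => e e0.
have d0 : 0 < e * c ^+ 2 by rewrite mulr_gt0// exprn_gt0.
have [M HM] := cseqP a d0; exists (maxn N M) => m n.
rewrite !geq_max => /andP[m1 m2] /andP[n1 n2].
have nz k : (N <= k)%N -> a k != 0.
  by move=> /HN E; apply: contraTneq c0 => ak; rewrite -E ak uabs0 ltxx.
have -> : (a m)^-1 - (a n)^-1 = (a n - a m) / (a m * a n) by field; rewrite !nz.
rewrite uabsM uabsV uabsM !HN// -expr2 ltr_pdivrMr ?exprn_gt0//.
exact: HM.
Qed.

Definition cs_inv a : cauchy_seq :=
  match pselect (null_seq a) with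
  | left _ => cs_cst 0
  | right na => CauchySeq (cauchyV na)
  end.

(** A point is an equivalence class stored as a set of sequences, so that equal classes give equal
    points; representatives are chosen by [cid]. *)
Record completion := Completion {
  cclass : set cauchy_seq;
  cclassP : exists a, cclass = [set b | csim a b]
}.

Definition cs_class a : completion := Completion (ex_intro _ a erefl).
Definition cs_repr (z : completion) : cauchy_seq := projT1 (cid (cclassP z)).

Lemma completion_eq z1 z2 : cclass z1 = cclass z2 -> z1 = z2.
Proof.
case: z1 z2 => [A1 H1] [A2 H2] /= E; rewrite -E in H2 *.
by congr Completion; exact: Prop_irrelevance.
Qed.

Lemma cs_classP a b : cs_class a = cs_class b <-> csim a b.
Proof.
split=> [/(congr1 cclass) /= E|ab].
  suff : [set c | csim a c] b by [].
  by rewrite E; exact: csim_refl.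
have E : [set c | csim a c] = [set c | csim b c].
  apply/funext => c; apply/propext; split=> [ac|bc].
    by apply: csim_trans ac; exact: csim_sym.
  exact: csim_trans bc.
exact: completion_eq.
Qed.

Lemma cs_reprK z : cs_class (cs_repr z) = z.
Proof.
by rewrite /cs_repr; case: cid => a /= E; apply: completion_eq.
Qed.

Lemma cs_repr_sim a : csim (cs_repr (cs_class a)) a.
Proof. by apply/cs_classP; exact: cs_reprK. Qed.

Definition cadd z1 z2 := cs_class (cs_add (cs_repr z1) (cs_repr z2)).
Definition copp z := cs_class (cs_opp (cs_repr z)).
Definition cmul z1 z2 := cs_class (cs_mul (cs_repr z1) (cs_repr z2)).
Definition cinv z := cs_class (cs_inv (cs_repr z)).
Definition ccst x := cs_class (cs_cst x).

Lemma csim_eq a b : (forall n, a n = b n) -> csim a b.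
Proof. by move=> H; apply: null_eq null0 => n; rewrite H subrr. Qed.

Lemma csim_add a b a' b' : csim a a' -> csim b b' -> csim (cs_add a b) (cs_add a' b').
Proof.
move=> Ha Hb; apply: null_eq (nullD Ha Hb) => n /=.
by rewrite opprD addrACA.
Qed.

Lemma csim_mul a b a' b' : csim a a' -> csim b b' -> csim (cs_mul a b) (cs_mul a' b').
Proof.
move=> Ha Hb; apply: null_eq (nullD (nullM b Ha) (nullM a' Hb)) => n /=.
by ring.
Qed.

Lemma caddE a b : cadd (cs_class a) (cs_class b) = cs_class (cs_add a b).
Proof. by apply/cs_classP/csim_add; exact: cs_repr_sim. Qed.

Lemma cmulE a b : cmul (cs_class a) (cs_class b) = cs_class (cs_mul a b).
Proof. by apply/cs_classP/csim_mul; exact: cs_repr_sim. Qed.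

Lemma coppE a : copp (cs_class a) = cs_class (cs_opp a).
Proof.
apply/cs_classP; apply: null_eq (nullN (cs_repr_sim a)) => n /=.
by rewrite opprD.
Qed.

HB.instance Definition _ := gen_eqMixin completion.
HB.instance Definition _ := gen_choiceMixin completion.

Fact caddA : associative cadd.
Proof.
move=> x y z; rewrite -(cs_reprK x) -(cs_reprK y) -(cs_reprK z) !caddE.
by apply/cs_classP/csim_eq => n /=; rewrite addrA.
Qed.
Fact caddC : commutative cadd.
Proof.
move=> x y; rewrite -(cs_reprK x) -(cs_reprK y) !caddE.
by apply/cs_classP/csim_eq => n /=; rewrite addrC.
Qed.
Fact cadd0 : left_id (ccst 0) cadd.
Proof.
move=> x; rewrite -(cs_reprK x) !caddE.
by apply/cs_classP/csim_eq => n /=; rewrite add0r.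
Qed.
Fact caddN : left_inverse (ccst 0) copp cadd.
Proof.
move=> x; rewrite -(cs_reprK x) coppE !caddE.
by apply/cs_classP/csim_eq => n /=; rewrite addNr.
Qed.
HB.instance Definition _ := GRing.isZmodule.Build completion caddA caddC cadd0 caddN.

Fact cmulA : associative cmul.
Proof.
move=> x y z; rewrite -(cs_reprK x) -(cs_reprK y) -(cs_reprK z) !cmulE.
by apply/cs_classP/csim_eq => n /=; rewrite mulrA.
Qed.
Fact cmulC : commutative cmul.
Proof.
move=> x y; rewrite -(cs_reprK x) -(cs_reprK y) !cmulE.
by apply/cs_classP/csim_eq => n /=; rewrite mulrC.
Qed.
Fact cmul1 : left_id (ccst 1) cmul.
Proof.
move=> x; rewrite -(cs_reprK x) !cmulE.
by apply/cs_classP/csim_eq => n /=; rewrite mul1r.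
Qed.
Fact cmulDl : left_distributive cmul cadd.
Proof.
move=> x y z; rewrite -(cs_reprK x) -(cs_reprK y) -(cs_reprK z) !(caddE, cmulE).
by apply/cs_classP/csim_eq => n /=; rewrite mulrDl.
Qed.
Fact cone_neq0 : ccst 1 != 0.
Proof.
apply/eqP => /cs_classP /(_ 1 ltr01)[N /(_ N (leqnn N))] /=.
by rewrite !subr0 uabs1 ltxx.
Qed.
HB.instance Definition _ := GRing.Zmodule_isComNzRing.Build completion
  cmulA cmulC cmul1 cmulDl cone_neq0.

Lemma class_eq0 a : cs_class a = 0 <-> null_seq a.
Proof.
split=> [/cs_classP H|H]; first by apply: null_eq H => n /=; rewrite subr0.
by apply/cs_classP; apply: null_eq H => n /=; rewrite subr0.
Qed.

Fact cmulV : forall z : completion, z != 0 -> cinv z * z = 1.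
Proof.
move=> z z0; rewrite -{2}(cs_reprK z); set a := cs_repr z.
have na : ~ null_seq a by move=> H; move: z0; rewrite -(cs_reprK z) (class_eq0 a).2// eqxx.
rewrite /cinv -/a -[LHS]/(cmul _ _) cmulE; apply/cs_classP; rewrite /cs_inv.
case: pselect => // na'; have [//|[c c0 [N HN]]] := stationary a => e e0.
exists N => n /HN E; have an : a n != 0.
  by apply: contraTneq c0 => ak; rewrite -E ak uabs0 ltxx.
by rewrite /= mulVf// !subrr uabs0.
Qed.
Fact cinv0 : cinv 0 = 0.
Proof.
apply/class_eq0; rewrite /cs_inv; case: pselect => [_|na]; first exact: null0.
by exfalso; apply: na; apply/class_eq0; exact: cs_reprK.
Qed.
HB.instance Definition _ := GRing.ComNzRing_isField.Build completion cmulV cinv0.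

Definition has_abs a (c : R) : Prop := (c = 0 /\ null_seq a) \/
  (0 < c /\ exists N : nat, forall n, (N <= n)%N -> v (a n) = c).

Lemma has_abs_ex a : exists c, has_abs a c.
Proof.
by have [na|[c c0 H]] := stationary a; [exists 0; left|exists c; right].
Qed.

Definition cabs (z : completion) : R := projT1 (cid (has_abs_ex (cs_repr z))).

Lemma cabsP z : has_abs (cs_repr z) (cabs z).
Proof. by rewrite /cabs; case: cid. Qed.

Lemma has_abs_sim a b c : csim a b -> has_abs a c -> has_abs b c.
Proof.
move=> ab [[c0 na]|[c0 [N HN]]].
  left; split=> //; apply: null_eq (nullD na (nullN ab)) => n.
  by rewrite opprB addrC subrK.
right; split=> //; have [M HM] := ab _ c0; exists (maxn N M) => n.
rewrite geq_max => /andP[/HN E /HM]; rewrite subr0 -E => lt.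
apply/eqP; rewrite eq_le; apply/andP; split.
  rewrite -[b n](subKr (a n)); apply: le_trans (uabsD _ _) _.
  by rewrite uabsN ge_max lexx (ltW lt).
rewrite leNgt; apply/negP => ba.
have : v ((a n - b n) + b n) < v (a n) by exact: uabsD_lt.
by rewrite subrK ltxx.
Qed.

Lemma has_abs_uniq a c d : has_abs a c -> has_abs a d -> c = d.
Proof.
have aux c' d' N : 0 < c' -> (forall n, (N <= n)%N -> v (a n) = c') -> has_abs a d' -> c' = d'.
  move=> c0 HN [[_ na]|[d0 [M HM]]].
    have [M HM] := na _ c0; have := HM (maxn N M) (leq_maxr _ _).
    by rewrite subr0 HN ?leq_maxl// ltxx.
  by rewrite -(HN (maxn N M)) ?leq_maxl// HM ?leq_maxr.
move=> [[-> na]|[c0 [N HN]]]; last exact: aux HN.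
move=> [[-> //]|[d0 [N HN]]]; apply/esym; apply: aux d0 HN _.
by left.
Qed.

Lemma cabsE a c : has_abs a c -> cabs (cs_class a) = c.
Proof.
move=> Ha; apply: has_abs_uniq Ha.
exact: has_abs_sim (cs_repr_sim a) (cabsP _).
Qed.

Lemma cabs_class a : has_abs a (cabs (cs_class a)).
Proof. by have [c Hc] := has_abs_ex a; rewrite (cabsE Hc). Qed.

Fact cabs_ge0 z : 0 <= cabs z.
Proof. by have [[-> _]|[/ltW]] := cabsP z. Qed.

Fact cabs_eq0 z : cabs z = 0 <-> z = 0.
Proof.
split=> [z0|->].
  rewrite -(cs_reprK z); apply/class_eq0.
  by have [[]//|[]] := cabsP z; rewrite z0 ltxx.
by apply: cabsE; left; split=> //; exact: null0.
Qed.

Fact cabsM (x y : completion) : cabs (x * y) = cabs x * cabs y.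
Proof.
rewrite -(cs_reprK x) -(cs_reprK y); set a := cs_repr x; set b := cs_repr y.
rewrite -[cs_class a * _]/(cmul _ _) cmulE; apply: cabsE.
have [[-> na]|[c0 [N HN]]] := cabs_class a.
  left; rewrite mul0r; split=> //; apply: null_eq (nullM b na) => n /=; exact: mulrC.
have [[-> nb]|[d0 [M HM]]] := cabs_class b.
  by left; rewrite mulr0; split=> //; exact: nullM.
right; split; first exact: mulr_gt0.
exists (maxn N M) => n; rewrite geq_max => /andP[/HN E1 /HM E2].
by rewrite /= uabsM E1 E2.
Qed.

Lemma has_abs_le a c (d : R) : has_abs a c -> 0 < d ->
  exists N : nat, forall n, (N <= n)%N -> v (a n) <= Num.max c d.
Proof.
move=> [[-> na]|[_ [N HN]]] d0; last by exists N => n /HN ->; rewrite le_max lexx.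
by have [N HN] := na _ d0; exists N => n /HN; rewrite subr0 le_max => /ltW ->; rewrite orbT.
Qed.

Fact cabsD (x y : completion) : cabs (x + y) <= Num.max (cabs x) (cabs y).
Proof.
rewrite -(cs_reprK x) -(cs_reprK y); set a := cs_repr x; set b := cs_repr y.
rewrite -[cs_class a + _]/(cadd _ _) caddE.
have [[-> _]|[c0 [N HN]]] := cabs_class (cs_add a b).
  by rewrite le_max cabs_ge0.
set c := cabs _ in c0 HN *; have d0 := divr2_gt0 c0.
have [N1 H1] := has_abs_le (cabs_class a) d0.
have [N2 H2] := has_abs_le (cabs_class b) d0.
pose n := maxn N (maxn N1 N2).
have := HN n (leq_maxl _ _); have := uabsD (a n) (b n) => /= + E; rewrite E.
have n1 : (N1 <= n)%N by rewrite /n; lia.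
have n2 : (N2 <= n)%N by rewrite /n; lia.
have := H1 _ n1; have := H2 _ n2; rewrite !le_max => h2 h1 /orP[h|h].
  by have [/(le_trans h) ->//|/(le_trans h)] := orP h1; lra.
by have [/(le_trans h) ->|/(le_trans h)] := orP h2; [rewrite orbT|lra].
Qed.

Lemma cabs_ccst x : cabs (ccst x) = v x.
Proof.
apply: cabsE; have [->|x0] := eqVneq x 0; first by left; rewrite uabs0; split=> //; exact: null0.
by right; split; [exact: uabs_gt0|exists 0%N].
Qed.

Lemma ccstD x y : ccst (x + y) = ccst x + ccst y.
Proof.
by rewrite -[RHS]/(cadd _ _) caddE; apply/cs_classP/csim_eq.
Qed.

Lemma ccstM x y : ccst (x * y) = ccst x * ccst y.
Proof.
by rewrite -[RHS]/(cmul _ _) cmulE; apply/cs_classP/csim_eq.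
Qed.

Lemma ccstB x y : ccst (x - y) = ccst x - ccst y.
Proof. by apply/eqP; rewrite eq_sym subr_eq -ccstD subrK. Qed.

Lemma ccst_cvg a (e : R) : 0 < e -> exists N : nat, forall n, (N <= n)%N ->
  cabs (cs_class a - ccst (a n)) < e.
Proof.
move=> e0; have [N HN] := cseqP a (divr2_gt0 e0); exists N => n Nn.
have -> : cs_class a - ccst (a n) = cs_class (cs_add a (cs_opp (cs_cst (a n)))).
  by rewrite -caddE -coppE.
have [[-> _]//|[c0 [M HM]]] := cabs_class (cs_add a (cs_opp (cs_cst (a n)))).
rewrite -(HM (maxn M N) (leq_maxl _ _)) /=.
by apply: lt_trans (HN _ _ (leq_maxr _ _) Nn) _; lra.
Qed.

Lemma completion_complete (u : nat -> completion) : abs_cauchy cabs u ->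
  exists l, abs_cvg cabs u l.
Proof.
move=> Hu.
have cabsN (x : completion) : cabs (- x) = cabs x.
  have H1 : cabs (-1) = 1.
    by rewrite -[-1]/(copp (ccst 1)) coppE; rewrite -[RHS](uabs1) -(uabsN 1) -cabs_ccst; congr cabs; apply/cs_classP/csim_eq.
  by rewrite -mulN1r cabsM H1 mul1r.
have cabsD_lt (x y : completion) c : cabs x < c -> cabs y < c -> cabs (x + y) < c.
  by move=> ? ?; apply: le_lt_trans (cabsD _ _) _; rewrite gt_max; apply/andP.
(* Diagonal approximation: [f k] comes from the dense subfield at distance less than [1 / (k + 1)]
   from [u k], so [f] is Cauchy and its class is the limit. *)
have /choice[f Hf] : forall k, exists x : F, cabs (u k - ccst x) < k.+1%:R^-1.
  move=> k; rewrite -{1}(cs_reprK (u k)).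
  have k0 : (0 : R) < k.+1%:R^-1 by rewrite invr_gt0.
  have [N HN] := ccst_cvg (cs_repr (u k)) k0.
  by exists (cs_repr (u k) N); exact: HN.
have small (e : R) : 0 < e -> exists N : nat, forall k, (N <= k)%N -> k.+1%:R^-1 < e.
  move=> e0; exists (Num.truncn e^-1) => k Nk.
  rewrite invf_plt ?posrE//; apply: lt_le_trans (truncnS_gt _) _.
  by rewrite ler_nat.
have cf : abs_cauchy v f.
  move=> e e0; have [N1 H1] := Hu _ e0; have [N2 H2] := small _ e0.
  exists (maxn N1 N2) => m n; rewrite !geq_max => /andP[m1 m2] /andP[n1 n2].
  rewrite -cabs_ccst ccstB.
  have -> : ccst (f m) - ccst (f n) =
      - (u m - ccst (f m)) + ((u m - u n) + (u n - ccst (f n))) by ring.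
  apply: (cabsD_lt); first by rewrite cabsN; apply: lt_trans (Hf m) (H2 m m2).
  apply: (cabsD_lt); first exact: H1.
  exact: lt_trans (Hf n) (H2 n n2).
exists (cs_class (CauchySeq cf)) => e e0.
have [N1 H1] := ccst_cvg (CauchySeq cf) e0; have [N2 H2] := small _ e0.
exists (maxn N1 N2) => n; rewrite geq_max => /andP[/H1 h1 /H2 h2].
rewrite -(subrKA (ccst (f n))); apply: (cabsD_lt); first exact: lt_trans (Hf n) h2.
by rewrite -cabsN opprB.
Qed.

End Completion.

(** * Fractions of polynomials and the Gauss norm *)

Lemma fraction_quot (A : idomainType) (x : {fraction A}) :
  exists n d : A, d != 0 /\ x = FracField.tofrac n / FracField.tofrac d.
Proof.
elim/quotW: x => r; exists (frac r).1, (frac r).2; split; first exact: denom_ratioP.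
have d0 : FracField.tofrac (frac r).2 != 0 by rewrite tofrac_eq0 denom_ratioP.
apply: (mulIf d0); rewrite divfK//.
unlock FracField.tofrac; rewrite -[LHS]FracField.pi_mul; apply/eqmodP.
rewrite /= FracField.equivfE !numden_Ratio ?mulf_neq0 ?oner_eq0 ?denom_ratioP//=.
by rewrite !mulr1 mulrC.
Qed.

Section Fractions.
Variable A : idomainType.
Implicit Types (n d m c : A).
Local Notation tf := (@FracField.tofrac A).

Lemma tofrac_neq0 d : d != 0 -> tf d != 0.
Proof. by rewrite tofrac_eq0. Qed.

Lemma tofrac_div_eq n d m c : d != 0 -> c != 0 -> tf n / tf d = tf m / tf c ->
  n * c = m * d.
Proof.
move=> /tofrac_neq0 d0 /tofrac_neq0 c0 /eqP; rewrite (eqr_div _ _ d0 c0) => /eqP E.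
by apply/eqP; rewrite -tofrac_eq !tofracM E.
Qed.

Lemma tofrac_divM n d m c : tf n / tf d * (tf m / tf c) = tf (n * m) / tf (d * c).
Proof. by rewrite !tofracM mulf_div. Qed.

Lemma tofrac_divD n d m c : d != 0 -> c != 0 ->
  tf n / tf d + tf m / tf c = tf (n * c + m * d) / tf (d * c).
Proof.
by move=> /tofrac_neq0 d0 /tofrac_neq0 c0; rewrite tofracD !tofracM addf_div.
Qed.

Lemma tofrac_div_eq0 n d : d != 0 -> (tf n / tf d == 0) = (n == 0).
Proof. by move=> /tofrac_neq0 d0; rewrite mulf_eq0 invr_eq0 (negPf d0) orbF tofrac_eq0. Qed.

Lemma tofrac_div1 n : tf n / tf 1 = tf n.
Proof. by rewrite tofrac1 divr1. Qed.

End Fractions.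

Section Gauss.
Variables (R : realType) (p : nat) (K : cufield R p) (rho : R) (r0 : 0 < rho).
Implicit Types (P Q : {poly K}).

Definition pgauss P : R := \big[Num.max/0]_(i < size P) (vabs P`_i * rho ^+ i).

Lemma pgauss_ge P i : vabs P`_i * rho ^+ i <= pgauss P.
Proof.
have [iP|Pi] := ltnP i (size P).
  exact: (le_bigmax _ (fun j : 'I_(size P) => vabs P`_j * rho ^+ j) (Ordinal iP)).
rewrite nth_default// vabs0 mul0r; apply: (big_ind (fun y => 0 <= y)) => //.
  by move=> x y x0 y0; rewrite le_max x0.
by move=> j _; rewrite mulr_ge0 ?vabs_ge0 ?exprn_ge0// ltW.
Qed.

Lemma pgauss_le P c : 0 <= c -> (forall i, vabs P`_i * rho ^+ i <= c) -> pgauss P <= c.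
Proof. by move=> c0 H; apply: bigmax_le. Qed.

Lemma pgauss_ge0 P : 0 <= pgauss P.
Proof.
by apply: le_trans (pgauss_ge P 0); rewrite mulr_ge0 ?vabs_ge0 ?exprn_ge0// ltW.
Qed.

Lemma pgauss0 : pgauss 0 = 0.
Proof. by rewrite /pgauss size_poly0 big_ord0. Qed.

Lemma pgauss_gt0 P : P != 0 -> 0 < pgauss P.
Proof.
rewrite -lead_coef_eq0 => P0; apply: lt_le_trans (pgauss_ge P (size P).-1).
by rewrite mulr_gt0 ?exprn_gt0// vabs_gt0.
Qed.

Lemma pgaussD P Q : pgauss (P + Q) <= Num.max (pgauss P) (pgauss Q).
Proof.
apply: pgauss_le => [|i]; first by rewrite le_max pgauss_ge0.
rewrite coefD -ler_pdivlMr ?exprn_gt0//; apply: vabsD_le;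
  rewrite ler_pdivlMr ?exprn_gt0// le_max pgauss_ge ?orbT//.
Qed.

Lemma pgauss_attained P : P != 0 -> exists i, vabs P`_i * rho ^+ i = pgauss P /\
  forall j, (j < i)%N -> vabs P`_j * rho ^+ j < pgauss P.
Proof.
move=> P0; have gP := pgauss_gt0 P0.
have ex : exists i, vabs P`_i * rho ^+ i == pgauss P.
  apply: contrapT => H; suff : pgauss P < pgauss P by rewrite ltxx.
  rewrite {1}/pgauss; apply: bigmax_lt => // i _.
  by rewrite lt_neqAle pgauss_ge andbT; apply/negP => E; apply: H; exists i.
case: (ex_minnP ex) => i /eqP Hi Hmin; exists i; split=> // j ji.
rewrite lt_neqAle pgauss_ge andbT; apply/negP => /Hmin; by rewrite leqNgt ji.
Qed.

(* Gauss's lemma: at the sum of the first indices where the norms of [P] and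
   [Q] are attained, one term of the coefficient of [P * Q] dominates. *)
Lemma pgaussM P Q : pgauss (P * Q) = pgauss P * pgauss Q.
Proof.
have [->|P0] := eqVneq P 0; first by rewrite mul0r pgauss0 mul0r.
have [->|Q0] := eqVneq Q 0; first by rewrite mulr0 pgauss0 mulr0.
have gP := pgauss_gt0 P0; have gQ := pgauss_gt0 Q0.
have wM i j k : i = (j + k)%N -> vabs (P`_j * Q`_k) * rho ^+ i =
    (vabs P`_j * rho ^+ j) * (vabs Q`_k * rho ^+ k).
  by move=> ->; rewrite vabsM exprD mulrACA.
have term_ge0 P1 i : 0 <= vabs P1`_i * rho ^+ i.
  by rewrite mulr_ge0 ?vabs_ge0 ?exprn_ge0// ltW.
apply/eqP; rewrite eq_le; apply/andP; split.
  apply: pgauss_le => [|i]; first by rewrite mulr_ge0 ?ltW.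
  rewrite -ler_pdivlMr ?exprn_gt0// coefM; apply: (nle_sum (vle_ultra K)).
    by rewrite divr_ge0 ?mulr_ge0 ?exprn_ge0// ltW.
  move=> j _; rewrite /vle ler_pdivlMr ?exprn_gt0//.
  have ji : (j <= i)%N by rewrite -ltnS ltn_ord.
  rewrite (wM i j (i - j)%N (esym (subnKC ji))).
  by apply: ler_pM; rewrite ?term_ge0 ?pgauss_ge.
have [i [Pi Hi]] := pgauss_attained P0; have [j [Qj Hj]] := pgauss_attained Q0.
apply: le_trans (pgauss_ge (P * Q) (i + j)).
rewrite -Pi -Qj -(wM (i + j)%N)//; apply: ler_wpM2r; first by rewrite exprn_ge0// ltW.
have iij : (i < (i + j).+1)%N by rewrite ltnS leq_addr.
rewrite coefM (bigD1 (Ordinal iij))//= addKn; set a := P`_i * Q`_j; set b := \sum_(_ | _) _.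
have rij : 0 < rho ^+ (i + j) by exact: exprn_gt0.
have aE : vabs a * rho ^+ (i + j) = pgauss P * pgauss Q by rewrite wM// Pi Qj.
suff ab : vabs b < vabs a.
  by rewrite (@vabs_strict _ _ _ (a + b) a)// addrC addKr.
have a0 : 0 < vabs a by rewrite -(ltr_pM2r rij) mul0r aE mulr_gt0.
rewrite /b; apply: (big_ind (fun x => vabs x < vabs a)); first by rewrite vabs0.
  by move=> x y; exact: vabsD_lt.
move=> k; rewrite -val_eqE /= => ki; rewrite -(ltr_pM2r rij) aE.
have kij : (k <= i + j)%N by rewrite -ltnS.
rewrite (wM _ k (i + j - k)%N (esym (subnKC kij))).
have [lt|ge] := ltnP k i.
  apply: (@le_lt_trans _ _ (vabs P`_k * rho ^+ k * pgauss Q)).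
    by apply: ler_wpM2l; [exact: term_ge0|exact: pgauss_ge].
  by rewrite ltr_pM2r//; exact: Hi.
apply: (@le_lt_trans _ _ (pgauss P * (vabs Q`_(i + j - k) * rho ^+ (i + j - k)%N))).
  by apply: ler_wpM2r; [exact: term_ge0|exact: pgauss_ge].
by rewrite ltr_pM2l//; apply: Hj; move/eqP: ki; lia.
Qed.

(** Numerator and denominator are chosen arbitrarily; multiplicativity of the Gauss norm makes the
    quotient independent of the choice. *)
Definition fgauss (x : {fraction {poly K}}) : R :=
  let: nd := projT1 (cid (fraction_quot x)) in
  pgauss nd / pgauss (projT1 (cid (projT2 (cid (fraction_quot x))))).

Lemma fgaussE n d : d != 0 ->
  fgauss (FracField.tofrac n / FracField.tofrac d) = pgauss n / pgauss d.
Proof.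
move=> d0; rewrite /fgauss; case: cid => n' H /=; case: cid => d' /= [d'0 E].
have g1 := pgauss_gt0 d0; have g2 := pgauss_gt0 d'0.
apply/eqP; rewrite (eqr_div _ _ (lt0r_neq0 g2) (lt0r_neq0 g1)) -!pgaussM; apply/eqP; congr pgauss.
exact: (esym (tofrac_div_eq d0 d'0 E)).
Qed.

Fact fgauss_ge0 x : 0 <= fgauss x.
Proof.
by have [n [d [d0 ->]]] := fraction_quot x; rewrite fgaussE// divr_ge0 ?pgauss_ge0.
Qed.

Fact fgauss_eq0 x : fgauss x = 0 <-> x = 0.
Proof.
have [n [d [d0 ->]]] := fraction_quot x; rewrite fgaussE//.
have g := pgauss_gt0 d0; split.
  move/eqP; rewrite mulf_eq0 invr_eq0 [pgauss d == 0]gt_eqF// orbF => /eqP n0.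
  apply/eqP; rewrite tofrac_div_eq0//.
  by have [//|/pgauss_gt0] := eqVneq n 0; rewrite n0 ltxx.
move/eqP; rewrite tofrac_div_eq0// => /eqP ->.
by rewrite pgauss0 mul0r.
Qed.

Fact fgaussM x y : fgauss (x * y) = fgauss x * fgauss y.
Proof.
have [n [d [d0 ->]]] := fraction_quot x; have [m [c [c0 ->]]] := fraction_quot y.
rewrite tofrac_divM (fgaussE _ d0) (fgaussE _ c0) (fgaussE _ (mulf_neq0 d0 c0)).
by rewrite !pgaussM mulf_div.
Qed.

Fact fgaussD x y : fgauss (x + y) <= Num.max (fgauss x) (fgauss y).
Proof.
have [n [d [d0 ->]]] := fraction_quot x; have [m [c [c0 ->]]] := fraction_quot y.
have gd := pgauss_gt0 d0; have gc := pgauss_gt0 c0.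
rewrite (tofrac_divD _ _ d0 c0) (fgaussE _ d0) (fgaussE _ c0) (fgaussE _ (mulf_neq0 d0 c0)).
rewrite pgaussM ler_pdivrMr ?mulr_gt0//; apply: le_trans (pgaussD _ _) _.
rewrite !pgaussM ge_max; apply/andP; split.
  apply: (@le_trans _ _ (pgauss n / pgauss d * (pgauss d * pgauss c))).
    by rewrite mulrA divfK ?gt_eqF.
  by apply: ler_wpM2r; rewrite ?le_max ?lexx// mulr_ge0 ?pgauss_ge0.
apply: (@le_trans _ _ (pgauss m / pgauss c * (pgauss d * pgauss c))).
  by rewrite [pgauss d * _]mulrC mulrA divfK ?gt_eqF.
by apply: ler_wpM2r; rewrite ?le_max ?lexx ?orbT// mulr_ge0 ?pgauss_ge0.
Qed.

Definition gauss_ufield : ufield R :=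
  UField fgauss_ge0 fgauss_eq0 fgaussM fgaussD.

Local Notation tf := (@FracField.tofrac {poly K}).

Lemma fgauss_tofrac P : fgauss (tf P) = pgauss P.
Proof.
rewrite -(tofrac_div1 P) (fgaussE _ (oner_neq0 _)).
have -> : pgauss 1 = 1; last by rewrite divr1.
apply/eqP; rewrite eq_le; apply/andP; split.
  apply: pgauss_le => // i; rewrite coef1; case: i => [|i] /=.
    by rewrite vabs1 mulr1.
  by rewrite vabs0 mul0r.
by have := pgauss_ge 1 0; rewrite coef1 vabs1 mulr1.
Qed.

(** Only the morphism from polynomials and its norm are kept; the concrete field of fractions is
    hidden from what follows. *)
Lemma gauss_ufield_ex : exists (F : ufield R) (iota : {rmorphism {poly K} -> F}),
  forall P, uabs (iota P) = pgauss P.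
Proof.
by exists gauss_ufield, (tf : {rmorphism {poly K} -> {fraction {poly K}}}); exact: fgauss_tofrac.
Qed.

Lemma pgaussC (a : K) : pgauss a%:P = vabs a.
Proof.
apply/eqP; rewrite eq_le; apply/andP; split.
  apply: pgauss_le; first exact: vabs_ge0.
  by move=> [|i]; rewrite coefC /= ?mulr1// vabs0 mul0r vabs_ge0.
by have := pgauss_ge a%:P 0; rewrite coefC mulr1.
Qed.

End Gauss.

(** * The variable as a generic point of the completed field *)

Section GaussPoint.
Variables (R : realType) (p : nat) (K : cufield R p) (rho : R) (r0 : 0 < rho).
Variables (F : ufield R) (iota : {rmorphism {poly K} -> F}).
Hypothesis iotaE : forall P, uabs (iota P) = pgauss rho P.
Local Notation L := (completion F).

Definition Kemb (a : K) : L := ccst (iota a%:P).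

Fact Kemb_zmod : zmod_morphism Kemb.
Proof. by move=> a b; rewrite /Kemb polyCB rmorphB ccstB. Qed.
Fact Kemb_monoid : monoid_morphism Kemb.
Proof. by split=> [|a b]; rewrite /Kemb ?polyCM ?rmorphM ?ccstM// polyC1 rmorph1. Qed.
HB.instance Definition _ := GRing.isZmodMorphism.Build K L Kemb Kemb_zmod.
HB.instance Definition _ := GRing.isMonoidMorphism.Build K L Kemb Kemb_monoid.

Lemma cabs_Kemb a : cabs (Kemb a) = vabs a.
Proof. by rewrite /Kemb cabs_ccst iotaE (pgaussC r0). Qed.

Lemma L_char0 : [pchar L] =i pred0.
Proof.
apply/pcharf0P => n; rewrite -(rmorph_nat Kemb) fmorph_eq0.
exact: ((pcharf0P _).1 (cu_char0 K)).
Qed.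

Lemma L_p_lt1 : cabs (p%:R : L) < 1.
Proof.
have -> : p%:R = Kemb p%:R by rewrite rmorph_nat.
by rewrite cabs_Kemb cu_p_lt1.
Qed.

Definition gauss_cufield : cufield R p :=
  @CUField R p L (@cabs R F) (@cabs_ge0 _ _) (@cabs_eq0 _ _) (@cabsM _ _)
    (@cabsD _ _) (@completion_complete _ _) L_char0 (cu_p_prime K) L_p_lt1.

Definition gauss_extension : cu_extension K :=
  @CUExtension R p K gauss_cufield Kemb cabs_Kemb.

Definition gauss_point : gauss_extension := ccst (iota 'X).

Lemma gauss_point_generic : generic_point (Om := gauss_extension) rho gauss_point.
Proof.
move=> P; transitivity (cabs (ccst (iota P))); last by rewrite cabs_ccst iotaE.
congr cabs; elim/poly_ind: P => [|P c IH].
  by rewrite !rmorph0 horner0.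
rewrite rmorphD rmorphM /= map_polyX map_polyC hornerMXaddC IH.
by rewrite !rmorphD !rmorphM ccstD ccstM.
Qed.

End GaussPoint.

Lemma generic_point_ex (R : realType) (p : nat) (K : cufield R p) (rho : R) : 0 < rho ->
  exists (Om : cu_extension K) (t : Om), generic_point rho t.
Proof.
move=> r0; have [F [iota E]] := gauss_ufield_ex K r0.
by exists (gauss_extension r0 E), (gauss_point r0 E); exact: gauss_point_generic.
Qed.

(** * Radii of convergence *)

Section Liminf.
Variable R : realType.
Implicit Types (a : \bar R) (s : R).

(** This removes the roots from the definition of the radius. Extended values are included: the
    inverse root is [+oo] for a zero norm and 0 for an infinite one. *)
Lemma root_inv_ge a s (k : nat) : (0 <= a)%E -> 0 < s -> (0 < k)%N ->
  (s%:E <= (poweR a (k%:R^-1))^-1)%E = (a <= (s ^- k)%:E)%E.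
Proof.
move=> a0 s0 k0; have kn : (k%:R : R) != 0 by rewrite pnatr_eq0 -lt0n.
have ki : (0 : R) < k%:R^-1 by rewrite invr_gt0 ltr0n.
rewrite inve_pge ?inE ?lee_fin ?(ltW s0) ?poweR_ge0// inver gt_eqF//.
have sE : poweR (s ^- k)%:E k%:R^-1 = (s^-1)%:E.
  rewrite poweR_EFin; congr (_%:E).
  by rewrite -exprVn -powR_mulrn ?invr_ge0 ?(ltW s0)// -powRrM mulfV// powRr1// invr_ge0 ltW.
have aE : poweR (poweR a k%:R^-1) k%:R = a.
  by rewrite -poweRrM mulVf// poweRe1.
have spos : (0 <= s^-1) by rewrite invr_ge0 ltW.
have skpos : (0 <= s ^- k) by rewrite invr_ge0 exprn_ge0// ltW.
apply/idP/idP => H.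
  rewrite -aE; apply: (@le_trans _ _ (poweR (s^-1)%:E k%:R)).
    apply: gt0_ler_poweR => //.
      by rewrite in_itv/= poweR_ge0 leey.
    by rewrite in_itv/= lee_fin spos leey.
  by rewrite poweR_EFin lee_fin powR_mulrn// exprVn.
rewrite -sE; apply: gt0_ler_poweR => //.
  by rewrite in_itv/= a0 leey.
by rewrite in_itv/= lee_fin skpos leey.
Qed.

Lemma limn_einf_gt (u : nat -> \bar R) s : (s%:E < limn_einf u)%E ->
  exists N : nat, forall k, (N <= k)%N -> (s%:E <= u k)%E.
Proof.
rewrite limn_einf_lim (cvg_lim _ (@cvg_einfs_sup R u))// => /ereal_sup_gt[_ [n _ <-]] H.
exists n => k nk; apply: ltW; apply: (lt_le_trans H).
by apply: ereal_inf_lbound; exists k.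
Qed.

Lemma limn_einf_ge (u : nat -> \bar R) s N :
  (forall k, (N <= k)%N -> (s%:E <= u k)%E) -> (s%:E <= limn_einf u)%E.
Proof.
move=> H; rewrite limn_einf_lim (cvg_lim _ (@cvg_einfs_sup R u))//.
apply: (@le_trans _ _ (einfs u N)).
  by apply: le_ereal_inf_tmp => _ [k /= Nk <-]; exact: H.
by apply: ereal_sup_ubound; exists N.
Qed.

End Liminf.

Section MatrixNorm.
Variables (R : realType) (p : nat) (K : cufield R p) (B : germ_kind).
Local Notation G := (germ K B).
Variable n : nat.
Implicit Types (A : 'M[G]_n) (M : nat -> 'M[G]_n) (c : nat -> K) (rho s C : R).

(** Unlike [gle], this does not ask for convergence, which the supremum in [mxnorm] does not see. *)
Definition mle rho A (d : R) : Prop :=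
  forall i j l, vabs (coef (A i j) l) * rho ^ l <= d.

Lemma mxnorm_le rho A d : 0 <= d -> (mxnorm rho A <= d%:E)%E <-> mle rho A d.
Proof.
move=> d0; split=> [H i j l|H].
  rewrite -lee_fin; apply: le_trans H; rewrite /mxnorm.
  apply: (le_trans _ (le_bigmax 0%E (fun i => \big[maxe/0%E]_(j < n) Defs.gnorm rho (A i j)) i)).
  apply: (le_trans _ (le_bigmax 0%E (fun j => Defs.gnorm rho (A i j)) j)).
  by apply: ereal_sup_ubound; exists l.
apply: bigmax_le; rewrite ?lee_fin// => i _; apply: bigmax_le; rewrite ?lee_fin// => j _.
by apply: ge_ereal_sup => _ [l _ <-]; rewrite lee_fin; exact: H.
Qed.

Lemma mxnorm_ge0 rho A : (0 <= mxnorm rho A)%E.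
Proof.
by rewrite /mxnorm; elim/big_ind : _ => // [x y x0 y0|i _]; rewrite ?le_max ?x0//;
  elim/big_ind : _ => // [x y x0 y0|j _]; rewrite ?le_max ?x0//;
  apply: (@le_trans _ _ (vabs (coef (A i j) 0) * rho ^ 0)%:E);
  rewrite ?lee_fin ?mulr_ge0 ?vabs_ge0//; apply: ereal_sup_ubound; exists 0.
Qed.

Section Radius.
Variables (M : nat -> 'M[G]_n) (c : nat -> K) (rho : R).
Hypothesis c0 : forall k, c k != 0.

Lemma rad_term s k : 0 < s -> (0 < k)%N ->
  (s%:E <= (poweR (mxnorm rho (M k) * ((vabs (c k))^-1)%:E) (k%:R^-1))^-1)%E <->
  mle rho (M k) (vabs (c k) / s ^+ k).
Proof.
move=> s0 k0; have v0 := vabs_gt0 (c0 k).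
rewrite root_inv_ge//; last by rewrite mule_ge0 ?mxnorm_ge0// lee_fin invr_ge0 ltW.
rewrite -mxnorm_le; last by rewrite divr_ge0 ?exprn_ge0 ?ltW.
by rewrite muleC EFinM lee_pdivrMl.
Qed.

(** Beyond some index the bound holds with constant 1; [C] absorbs the finitely many earlier terms,
    whose norms are finite by hypothesis. *)
Lemma rad_bound s : 0 < s -> (forall k, exists d, mle rho (M k) d) ->
  (s%:E < rad_liminf M c rho)%E ->
  exists2 C : R, 0 < C & forall k, mle rho (M k) (C * vabs (c k) / s ^+ k).
Proof.
move=> s0 fM /limn_einf_gt[N HN].
have HN' k : (N.+1 <= k)%N -> mle rho (M k) (vabs (c k) / s ^+ k).
  by move=> Nk; apply/rad_term => //; [lia|apply: HN; lia].
have cs k : 0 < vabs (c k) / s ^+ k by rewrite divr_gt0 ?exprn_gt0// vabs_gt0.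
have /choice[d Hd] : forall k, exists d, mle rho (M k) d by [].
pose C := 1 + \sum_(k < N.+1) (`|d k| / (vabs (c k) / s ^+ k)).
have S0 (P : pred 'I_N.+1) : 0 <= \sum_(k < N.+1 | P k) (`|d k| / (vabs (c k) / s ^+ k)).
  by apply: sumr_ge0 => k _; rewrite divr_ge0// ltW.
have C0 : 0 < C by rewrite ltr_wpDr.
exists C => // k i j l; rewrite -mulrA.
have [kN|Nk] := ltnP k N.+1.
  apply: le_trans (Hd k i j l) _; apply: le_trans (ler_norm _) _.
  rewrite -ler_pdivrMr// /C (bigD1 (Ordinal kN))//= addrCA lerDl.
  by rewrite addr_ge0.
apply: le_trans (HN' k Nk i j l) _; rewrite ler_peMl ?(ltW (cs k))//.
by rewrite lerDl; exact: S0 xpredT.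
Qed.

Lemma rad_ge s C : 0 < s -> 0 < C ->
  (forall k, mle rho (M k) (C * vabs (c k) / s ^+ k)) -> (s%:E <= rad_liminf M c rho)%E.
Proof.
move=> s0 C0 H.
(* For [x < s] the constant is absorbed by the decay of [(x / s)^k]; then [x] approaches [s]. *)
have H' (x : R) : 0 < x -> x < s -> (x%:E <= rad_liminf M c rho)%E.
  move=> x0 xs; have xs01 : 0 <= x / s < 1.
    by rewrite divr_ge0 ?ltW//= ltr_pdivrMr// mul1r.
  have [N HN] := geo_small C xs01 ltr01.
  apply: (@limn_einf_ge _ _ _ N.+1) => k Nk; apply/rad_term => //; first lia.
  move=> i j l; apply: le_trans (H k i j l) _.
  have -> : C * vabs (c k) / s ^+ k = C * (x / s) ^+ k * (vabs (c k) / x ^+ k).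
    by rewrite expr_div_n; field; rewrite !expf_neq0// gt_eqF.
  rewrite ler_piMl//; first by rewrite divr_ge0 ?vabs_ge0 ?exprn_ge0// ltW.
  by apply: HN; lia.
move: (rad_liminf M c rho) H' => [y| |] H'; last first.
- have := H' (s / 2) (divr2_gt0 s0); rewrite leNgt ltNyr => h.
  by have : s / 2 < s by [lra]; move/h.
- exact: leey.
rewrite lee_fin leNgt; apply/negP => ys.
have ys2 : s / 2 <= y by rewrite -lee_fin; apply: H'; lra.
by have := H' ((y + s) / 2); rewrite lee_fin => /(_ ltac:(lra) ltac:(lra)); lra.
Qed.

End Radius.
End MatrixNorm.

(** * Extension of the radius condition from 1 to an annulus *)

Section Interpolation.
Variables (R : realType) (p : nat) (K : cufield R p) (B : germ_kind).
Local Notation G := (germ K B).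

(* Log-convexity of [rho |-> |f|_rho], between the radii [1] and [rho1]. *)
Lemma interpolate (f : G) (rho rho1 a b : R) N : 0 < rho -> 0 < rho1 ->
  (rho <= 1 /\ rho1 <= rho ^+ N.+1) \/ (1 <= rho /\ rho ^+ N.+1 <= rho1) ->
  (forall i, vabs (coef f i) * 1 ^ i <= a) -> (forall i, vabs (coef f i) * rho1 ^ i <= b) ->
  forall i, (vabs (coef f i) * rho ^ i) ^+ N.+1 <= Num.max (a ^+ N.+1) (a ^+ N * b).
Proof.
move=> r0 r10 H Ha Hb i; set v := vabs (coef f i); have v0 : 0 <= v := vabs_ge0 _.
have va : v <= a by have := Ha i; rewrite exp1rz mulr1.
have a0 : 0 <= a := le_trans v0 va.
have ri : 0 < rho ^ i by exact: exprz_gt0.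
rewrite le_max; have [le1|gt1] := leP (rho ^ i) 1.
  apply/orP; left; apply: lerXn2r; rewrite ?nnegrE ?mulr_ge0 ?(ltW ri)//.
  by apply: le_trans va; rewrite ler_piMr.
apply/orP; right; rewrite exprMn exprSr -mulrA; apply: ler_pM.
- exact: exprn_ge0.
- by rewrite mulr_ge0// exprn_ge0// ltW.
- by apply: lerXn2r; rewrite ?nnegrE.
apply: le_trans (Hb i); apply: ler_wpM2l => //.
have -> : (rho ^ i) ^+ N.+1 = (rho ^+ N.+1) ^ i by rewrite !exprnP !exprz_exp mulrC.
case: i ri gt1 {Ha Hb va v v0} => n ri gt1.
  rewrite -!exprnP; apply: lerXn2r; rewrite ?nnegrE ?exprn_ge0 ?(ltW r0) ?(ltW r10)//.
  case: H => [[le1 _]|[_ //]]; exfalso; move: gt1; rewrite -exprnP ltNge => /negP; apply.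
  by rewrite exprn_ile1 ?(ltW r0).
rewrite NegzE -!exprnN; rewrite lef_pV2 ?posrE ?exprn_gt0//.
apply: lerXn2r; rewrite ?nnegrE ?exprn_ge0 ?(ltW r0) ?(ltW r10)//.
case: H => [[_ //]|[ge1 _]]; exfalso; move: gt1; rewrite NegzE -exprnN ltNge => /negP; apply.
by rewrite invf_le1 ?exprn_gt0// exprn_ege1.
Qed.

Lemma one_sub_pow (x : R) N : 0 <= x <= 1 -> 1 - N%:R * x <= (1 - x) ^+ N.
Proof.
move=> /andP[x0 x1]; elim: N => [|N IH]; first by rewrite mul0r subr0 expr0.
rewrite exprSr; apply: (@le_trans _ _ ((1 - N%:R * x) * (1 - x))).
  rewrite -natr1; have : 0 <= N%:R * x * x by rewrite !mulr_ge0.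
  by lra.
by apply: ler_wpM2r => //; lra.
Qed.

Lemma near_one_pow (d : R) N : 0 < d < 1 -> exists2 e : R, 0 < e < 1 &
  1 - d <= (1 - e) ^+ N.+1 /\ (1 + e) ^+ N.+1 <= 1 + d.
Proof.
(* The factor [1 / (1 + d)] serves the upper bound: Bernoulli's inequality gives [(1 - e)^(N+1) >= 1
   - d / (1 + d) = 1 / (1 + d)], and [(1 + e) (1 - e) <= 1]. *)
move=> /andP[d0 d1]; pose e := d / (1 + d) / N.+1%:R.
have N1 : (1 : R) <= N.+1%:R by rewrite ler1n.
have N0 : (0 : R) < N.+1%:R by rewrite ltr0n.
have dd0 : 0 < d / (1 + d) by rewrite divr_gt0//; lra.
have dd1 : d / (1 + d) < 1 by rewrite ltr_pdivrMr; lra.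
have ddd : d / (1 + d) <= d by rewrite ler_pdivrMr ?ler_peMr//; lra.
have e0 : 0 < e by rewrite divr_gt0.
have Ne : N.+1%:R * e = d / (1 + d) by rewrite mulrC divfK// gt_eqF.
have e1 : e < 1.
  by apply: le_lt_trans dd1; rewrite -Ne ler_peMl// ltW.
exists e; first by rewrite e0.
have low : 1 - d / (1 + d) <= (1 - e) ^+ N.+1.
  by rewrite -Ne; apply: one_sub_pow; apply/andP; split; lra.
split; first by apply: le_trans low; lra.
have p0 : 0 < (1 - e) ^+ N.+1 by rewrite exprn_gt0//; lra.
rewrite -(ler_pM2r p0) -exprMn; apply: (@le_trans _ _ 1).
  by apply: exprn_ile1; [nra|nra].
apply: (@le_trans _ _ ((1 + d) * (1 - d / (1 + d)))); last by apply: ler_wpM2l => //; lra.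
by rewrite mulrBr mulr1 mulrC divfK; lra.
Qed.

End Interpolation.

Section GoodAnnulus.
Variables (R : realType) (p : nat) (K : cufield R p) (B : germ_kind).
Local Notation G := (germ K B).
Variables (n : nat) (M : nat -> 'M[G]_n) (c : nat -> K).
Variables (eps0 : R) (e001 : 0 < eps0 < 1).
Hypothesis c0 : forall k, c k != 0.
Hypothesis cle : exists2 b : R, 0 < b & forall k, b ^+ k <= vabs (c k).
Hypothesis Mtriv : forall rho, annulus B eps0 rho ->
  exists2 D : R, 0 < D & forall k, mle rho (M k) (D ^+ k).

(* The ratios [w] and [s] are relative to [rho]. *)
Definition good (w rho : R) : Prop := exists C s : R, [/\ 0 < C, w < s <= 1 &
  forall k, mle rho (M k) (C * vabs (c k) / (s * rho) ^+ k)].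

(** At [rho1] only the trivial bound [D^k] is known. Log-convexity gives it the weight [1 / (N + 1)]
    against the good bound at 1, so for large [N] the loss in the ratio is absorbed by passing from
    [s1] to [s2 < s1]. *)
Lemma interpolate_mle (rho1 C1 s1 s2 : R) : annulus B eps0 1 -> annulus B eps0 rho1 ->
  0 < C1 -> 0 < s2 < s1 ->
  (forall k, mle 1 (M k) (C1 * vabs (c k) / s1 ^+ k)) ->
  exists N : nat, forall rho, 0 < rho ->
    (rho <= 1 /\ rho1 <= rho ^+ N.+1) \/ (1 <= rho /\ rho ^+ N.+1 <= rho1) ->
    exists2 C : R, 0 < C & forall k, mle rho (M k) (C * vabs (c k) / s2 ^+ k).
Proof.
move=> I1 I2 C10 /andP[s20 s21] H1; have s10 : 0 < s1 := lt_trans s20 s21.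
have r10 := annulus_gt0 e001 I2.
have [D D0 HD] := Mtriv I2; have [b b0 Hb] := cle.
(* The lower bound [b^k <= |c k|] turns the trivial bound into [|c k| E^k]. *)
pose E := D / b; have E0 : 0 < E by rewrite divr_gt0.
have ss : 0 <= s2 / s1 < 1 by rewrite divr_ge0 ?(ltW s20) ?(ltW s10)//= ltr_pdivrMr// mul1r.
(* [N] is such that [s1 E (s2 / s1)^(N+1) <= 1], the inequality that remains once the powers of [s1]
   and [s2] are collected. *)
have [N HN] := geo_small (s1 * E) ss ltr01.
exists N => rho r0 Hrho; pose C := Num.max C1 1.
have C0 : 0 < C by rewrite lt_max C10.
have C1C : C1 <= C by rewrite le_max lexx.
have oneC : 1 <= C by rewrite le_max lexx orbT.
exists C => // k i j l; have v0 := vabs_gt0 (c0 k).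
have rl : 0 < rho ^ l by exact: exprz_gt0.
have T0 : 0 <= C * vabs (c k) / s2 ^+ k by rewrite divr_ge0 ?mulr_ge0 ?exprn_ge0// ltW.
rewrite -(@ler_pXn2r _ N.+1)// ?nnegrE ?mulr_ge0 ?vabs_ge0 ?(ltW rl)//.
apply: le_trans (interpolate r0 r10 Hrho (H1 k i j) (HD k i j) l) _.
have A0 : 0 < C1 * vabs (c k) / s1 ^+ k by rewrite divr_gt0 ?mulr_gt0 ?exprn_gt0.
have AT : C1 * vabs (c k) / s1 ^+ k <= C * vabs (c k) / s2 ^+ k.
  apply: ler_pM; rewrite ?invr_ge0 ?mulr_ge0 ?exprn_ge0 ?(ltW v0) ?(ltW s10) ?(ltW C10)//.
    by apply: ler_wpM2r => //; exact: ltW.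
  by rewrite lef_pV2 ?posrE ?exprn_gt0//; apply: lerXn2r; rewrite ?nnegrE ?ltW.
rewrite ge_max; apply/andP; split.
  by apply: lerXn2r => //; rewrite nnegrE ltW.
have DE : D ^+ k <= vabs (c k) * E ^+ k.
  rewrite /E expr_div_n mulrCA ler_peMr ?exprn_ge0 ?(ltW D0)//.
  by rewrite ler_pdivlMr ?exprn_gt0// mul1r.
apply: (@le_trans _ _ ((C1 * vabs (c k) / s1 ^+ k) ^+ N * (vabs (c k) * E ^+ k))).
  by apply: ler_wpM2l => //; rewrite exprn_ge0// ltW.
have -> : (C1 * vabs (c k) / s1 ^+ k) ^+ N * (vabs (c k) * E ^+ k) =
    C1 ^+ N * (vabs (c k) ^+ N.+1) * ((s1 * E * (s2 / s1) ^+ N.+1) ^+ k / (s2 ^+ k) ^+ N.+1).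
  have -> : (s1 * E * (s2 / s1) ^+ N.+1) ^+ k = s1 ^+ k * E ^+ k * (s2 ^+ k / s1 ^+ k) ^+ N.+1.
    by rewrite (exprMn k) (exprMn k s1) [((s2 / s1) ^+ _) ^+ k]exprAC (expr_div_n s2).
  move: (s1 ^+ k) (s2 ^+ k) (E ^+ k) (exprn_gt0 k s10) (exprn_gt0 k s20) => x y z x0 y0.
  rewrite expr_div_n (exprMn N) (expr_div_n y) !exprS; field.
  by rewrite !expf_neq0 ?gt_eqF.
have -> : (C * vabs (c k) / s2 ^+ k) ^+ N.+1 = C ^+ N.+1 * vabs (c k) ^+ N.+1 * (1 / (s2 ^+ k) ^+ N.+1).
  by rewrite !exprMn exprVn mul1r.
have CN : C1 ^+ N <= C ^+ N.+1.
  rewrite exprS; apply: (@le_trans _ _ (C ^+ N)).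
    by apply: lerXn2r => //; rewrite nnegrE ltW.
  by rewrite ler_peMl ?exprn_ge0// ltW.
have Z0 : 0 <= s1 * E * (s2 / s1) ^+ N.+1.
  by apply: ltW; rewrite !mulr_gt0 ?exprn_gt0 ?mulr_gt0 ?invr_gt0.
have y0 : 0 < (s2 ^+ k) ^+ N.+1 by rewrite !exprn_gt0.
apply: ler_pM.
- by rewrite mulr_ge0 ?exprn_ge0// ltW.
- by rewrite divr_ge0 ?exprn_ge0// ltW.
- by apply: ler_wpM2r; rewrite ?exprn_ge0// ltW.
apply: ler_wpM2r; first by rewrite invr_ge0 ltW.
by apply: exprn_ile1 => //; apply: HN.
Qed.

End GoodAnnulus.

(** Over the Robba ring the limit at 1 exceeds [w], so the radii near 1 do. Over the overconvergent
    ring only the radius at 1 is known, and the bound is carried to both sides by interpolation with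
    one fixed radius on each side. *)
Lemma good_annulus (R : realType) (p : nat) (K : cufield R p) (B : germ_kind) (n : nat)
  (M : nat -> 'M[germ K B]_n) (c : nat -> K) (eps0 w r : R) :
  0 < eps0 < 1 -> (forall k, c k != 0) ->
  (exists2 b : R, 0 < b & forall k, b ^+ k <= vabs (c k)) ->
  (forall rho, annulus B eps0 rho ->
    exists2 D : R, 0 < D & forall k, mle rho (M k) (D ^+ k)) ->
  0 < w < r -> r <= 1 -> ray_at_one_ge B r (ray M c) ->
  exists2 eps : R, 0 < eps < 1 & annulus B eps `<=` annulus B eps0 /\
    forall rho, annulus B eps rho -> good M c w rho.
Proof.
move=> e001 c0 cle Mtriv /andP[w0 wr] r1; have [e00 e01] := andP e001.
have bnd rho s : 0 < s -> annulus B eps0 rho -> (s%:E < rad_liminf M c rho)%E ->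
    exists2 C : R, 0 < C & forall k, mle rho (M k) (C * vabs (c k) / s ^+ k).
  move=> s0 rI; apply: rad_bound => // k.
  by have [D _ HD] := Mtriv _ rI; exists (D ^+ k).
case: B M Mtriv bnd => M' Mtriv bnd.
  rewrite /ray_at_one_ge => -[l Hl rl].
  have : \forall x \near (1 : R)^'-, (w%:E < ray M' c x)%E.
    have : nbhs l [set y : \bar R | (w%:E < y)%E].
      by apply: open_ereal_gt' => //; apply: lt_le_trans rl; rewrite lte_fin.
    by move=> /Hl.
  rewrite near_withinE => /nbhs_ballP[d /= d0 Hd].
  pose eps := Num.min (eps0) (Num.min d (1 - w)).
  have eps_gt0 : 0 < eps by rewrite !lt_min e00 d0 subr_gt0 (lt_le_trans wr).
  have eps_lt1 : eps < 1 by rewrite gt_min e01.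
  exists eps; first by rewrite eps_gt0.
  have sub : annulus Robba eps `<=` annulus Robba eps0.
    by apply: annulus_le; rewrite ge_min lexx.
  split=> // rho rI; have := rI; rewrite /= in_itv /= => /andP[rho1 rho2].
  have rhod : 1 - d < rho.
    by apply: le_lt_trans rho1; rewrite lerD2l lerN2 /eps !ge_min lexx orbT.
  have r0 : 0 < rho by lra.
  have : (w%:E < ray M' c rho)%E.
    apply: Hd => //; rewrite /ball /= ger0_norm; lra.
  rewrite /ray lt_min lte_fin => /andP[wrho wrad].
  (* [s1] lies above [w] and strictly below the inferior limit, and is capped by [rho] so that the
     relative ratio [s1 / rho] is at most 1. *)
  have [s1 [ws1 s1rho s1rad]] : exists s1, [/\ w < s1, s1 <= rho & (s1%:E < rad_liminf M' c rho)%E].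
    move: wrad; case: (rad_liminf M' c rho) => [y| |] //.
      rewrite lte_fin => wy; exists (Num.min rho ((w + y) / 2)); split.
      - by rewrite lt_min wrho; lra.
      - by rewrite ge_min lexx.
      - by rewrite lte_fin gt_min; apply/orP; right; lra.
    by exists rho; split=> //; exact: ltry.
  have s10 : 0 < s1 := lt_trans w0 ws1.
  have [C C0 HC] := bnd rho s1 s10 (sub _ rI) s1rad.
  exists C, (s1 / rho); split=> //.
    apply/andP; split; last by rewrite ler_pdivrMr// mul1r.
    rewrite ltr_pdivlMr//; apply: le_lt_trans ws1; rewrite ler_piMr ?ltW//.
  by move=> k; rewrite divfK ?gt_eqF//; exact: HC.
rewrite /ray_at_one_ge /ray le_min => /andP[_ rrad].
pose s1 := (w + r) / 2; pose s2 := (w + s1) / 2.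
have ws1 : w < s1 by rewrite /s1; lra.
have s1r : s1 < r by rewrite /s1; lra.
have ws2 : w < s2 by rewrite /s2; lra.
have s21 : s2 < s1 by rewrite /s2; lra.
have s201 : 0 < s2 < s1 by rewrite (lt_trans w0 ws2).
have I1 : annulus Overconvergent eps0 1 by rewrite /= in_itv /=; apply/andP; split; lra.
have [C1 C10 H1] : exists2 C : R, 0 < C & forall k, mle 1 (M' k) (C * vabs (c k) / s1 ^+ k).
  apply: bnd => //; first lra.
  by apply: lt_le_trans rrad; rewrite lte_fin.
pose d := eps0 / 2.
have d01 : 0 < d < 1 by rewrite /d; apply/andP; split; lra.
have Im : annulus Overconvergent eps0 (1 - d) by rewrite /= in_itv /= /d; apply/andP; split; lra.
have Ip : annulus Overconvergent eps0 (1 + d) by rewrite /= in_itv /= /d; apply/andP; split; lra.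
have [N1 HN1] := interpolate_mle e001 c0 cle Mtriv I1 Im C10 s201 H1.
have [N2 HN2] := interpolate_mle e001 c0 cle Mtriv I1 Ip C10 s201 H1.
have [e1 /andP[e10 e11] [He1 _]] := near_one_pow N1 d01.
have [e2 /andP[e20 e21] [_ He2]] := near_one_pow N2 d01.
have s2w : 0 < s2 / w - 1 by rewrite subr_gt0 ltr_pdivlMr// mul1r.
(* [1 - s2] gives [s2 <= rho] and [s2 / w - 1] gives [w * rho < s2], so that [s2 / rho] lies in []w,
   1]]. *)
pose eps := Num.min (Num.min e1 e2) (Num.min (Num.min eps0 (1 - s2)) (s2 / w - 1)).
have eps_gt0 : 0 < eps by rewrite !lt_min e10 e20 e00 s2w andbT /=; lra.
have eps_lt1 : eps < 1 by rewrite !gt_min e11.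
have [E1 E2 E3 E4 E5] : [/\ eps <= e1, eps <= e2, eps <= eps0, eps <= 1 - s2 & eps <= s2 / w - 1].
  by rewrite /eps; split; rewrite !ge_min lexx ?orbT.
exists eps; first by rewrite eps_gt0.
split; first exact: annulus_le.
move=> rho; rewrite /= in_itv /= => /andP[rho1 rho2].
have r0 : 0 < rho by lra.
have [C C0 HC] : exists2 C : R, 0 < C & forall k, mle rho (M' k) (C * vabs (c k) / s2 ^+ k).
  have [le1|/ltW ge1] := leP rho 1.
    apply: HN1 => //; left; split=> //; apply: le_trans He1 _.
    by apply: lerXn2r; rewrite ?nnegrE; lra.
  apply: HN2 => //; right; split=> //; apply: le_trans He2.
  by apply: lerXn2r; rewrite ?nnegrE; lra.
exists C, (s2 / rho); split=> //.
  apply/andP; split; last by rewrite ler_pdivrMr// mul1r; lra.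
  by rewrite ltr_pdivlMr// mulrC -ltr_pdivlMr//; lra.
by move=> k; rewrite divfK ?gt_eqF//; exact: HC.
Qed.

Section NearOne.
Variables (R : realType) (B : germ_kind).

Lemma near_annulus (eps : R) (P : R -> Prop) : 0 < eps < 1 ->
  (forall rho, annulus B eps rho -> P rho) -> \forall rho \near @near_one R B, P rho.
Proof.
move=> /andP[e0 e1]; rewrite /near_one; case: B => /= H.
  rewrite near_withinE; apply/nbhs_ballP; exists eps => //= x; rewrite /ball /= => xe x1.
  apply: H; rewrite in_itv /= x1 andbT; move: xe; rewrite ger0_norm; lra.
apply/nbhs_ballP; exists eps => //= x; rewrite /ball /= => xe.
by apply: H; rewrite in_itv /=; move: xe; rewrite ltr_norml => /andP[? ?]; apply/andP; split; lra.
Qed.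

Lemma near_one_ex (eps : R) (P : R -> Prop) : 0 < eps < 1 ->
  (\forall rho \near @near_one R B, P rho) -> exists2 rho, annulus B eps rho & P rho.
Proof.
move=> /andP[e0 e1]; rewrite /near_one; case: B => /=.
  rewrite near_withinE => /nbhs_ballP[d /= d0 Hd].
  pose m := Num.min eps d; have m0 : 0 < m by rewrite lt_min e0.
  have me : m <= eps by rewrite ge_min lexx.
  have md : m <= d by rewrite ge_min lexx orbT.
  exists (1 - m / 2); first by rewrite in_itv /=; apply/andP; split; lra.
  by apply: Hd; [rewrite /ball /= ger0_norm; lra|lra].
move=> /nbhs_singleton P1; exists 1 => //.
by rewrite in_itv /=; apply/andP; split; lra.
Qed.

Lemma ray_at_one_eq (eps r : R) (F F' : R -> \bar R) : 0 < eps < 1 ->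
  (forall rho, annulus B eps rho -> F rho = F' rho) ->
  ray_at_one_ge B r F -> ray_at_one_ge B r F'.
Proof.
move=> /andP[e0 e1]; rewrite /ray_at_one_ge; case: B => /= H.
  move=> [l Fl rl]; exists l => //; apply: cvg_trans Fl; apply: near_eq_cvg.
  rewrite near_withinE; apply/nbhs_ballP; exists eps => //= x; rewrite /ball /= => xe x1.
  apply: H; rewrite in_itv /= x1 andbT; move: xe; rewrite ger0_norm; lra.
by rewrite H// in_itv /=; apply/andP; split; lra.
Qed.

End NearOne.

(** * Bounds on matrices and comparison of radii *)

Section Bridge.
Variables (R : realType) (p : nat) (K : cufield R p) (B : germ_kind).
Local Notation G := (germ K B).

Lemma mx_fin n (A : 'M[G]_n) : exists2 eps : R, 0 < eps < 1 &
  forall rho, annulus B eps rho -> exists2 c : R, 0 < c & forall i j, gle rho (A i j) c.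
Proof.
have [eps e01 H] := annulus_sub_fin (fun i => annulus_sub_fin (fun j => gfinP (A i j))).
exists eps => // rho rI.
have /choice[c Hc] : forall ij : 'I_n * 'I_n, exists c, gle rho (A ij.1 ij.2) c.
  by move=> [i j]; exact: H.
have c0 ij : 0 <= c ij := gle_ge0 (Hc ij).
exists (1 + \sum_ij c ij); first by rewrite ltr_wpDr// sumr_ge0.
move=> i j; apply: gleW (Hc (i, j)).
by rewrite (bigD1 (i, j))//= addrCA lerDl addr_ge0// sumr_ge0.
Qed.

Lemma gle_mulmx rho n (A A' : 'M[G]_n) (c d : R) : 0 < rho -> 0 <= c -> 0 <= d ->
  (forall i j, gle rho (A i j) c) -> (forall i j, gle rho (A' i j) d) ->
  forall i j, gle rho ((A *m A') i j) (c * d).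
Proof.
move=> r0 c0 d0 HA HA' i j; rewrite mxE.
apply: (nle_sum (gle_ultra K B r0)); first exact: mulr_ge0.
by move=> k _; exact: gleM.
Qed.

Lemma gle_id rho n : 0 < rho -> forall i j, gle rho ((1%:M : 'M[G]_n) i j) 1.
Proof.
by move=> r0 i j; rewrite mxE; case: eqP => _; [exact: gle1|exact: gle0].
Qed.

(** Each step of the recursion costs a fixed factor: the derivation [1 / rho], the matrix [c / rho].
    This weak bound, available wherever the matrix converges, feeds the interpolation. *)
Lemma Gseq_triv n (M : 'M[G]_n) rho c : 0 < rho -> 0 < c ->
  (forall i j, gle rho (M i j) c) ->
  exists2 D : R, 0 < D & forall k i j, gle rho (Gseq M k i j) (D ^+ k).
Proof.
move=> r0 c0 HM; pose D := (1 + c) / rho.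
have ri : 0 < rho^-1 by rewrite invr_gt0.
have D0 : 0 < D by rewrite mulr_gt0// ltr_wpDr// ltW.
exists D => //; elim=> [|k IH] i j; first by rewrite expr0; exact: gle_id.
have DD : 0 <= D ^+ k by rewrite exprn_ge0// ltW.
rewrite exprSr /= mxE; apply: (gleD r0).
  rewrite mxE; apply: gleW (gle_deriv r0 (IH i j)); apply: ler_wpM2l => //.
  by rewrite /D ler_peMl ?(ltW ri)// lerDl ltW.
apply: (gle_mulmx r0 DD (ltW D0) IH) => l m.
rewrite mxE; apply: gleW (gleM r0 (gle_gTinv K B r0) (HM l m)).
by rewrite /D mulrC; apply: ler_wpM2r; [exact: ltW|rewrite lerDr].
Qed.

Lemma Hseq_triv n (q : disk11 K) (A : 'M[G]_n) rho c : 0 < rho -> 0 < c ->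
  (forall i j, gle rho (A i j) c) ->
  exists2 D : R, 0 < D & forall k i j, gle rho (Hseq q A k i j) (D ^+ k).
Proof.
move=> r0 c0 HA.
have ri : 0 < rho^-1 by rewrite invr_gt0.
pose b := vabs ((q : K) - 1)^-1 * rho ^ (-1) * (1 + c).
have vb : 0 <= vabs ((q : K) - 1)^-1 * rho ^ (-1).
  by rewrite mulr_ge0 ?vabs_ge0// ltW// exprz_gt0.
have b0 : 0 <= b by rewrite mulr_ge0// addr_ge0// ltW.
pose D := rho^-1 + b; have D0 : 0 < D by rewrite ltr_wpDr.
exists D => //; elim=> [|k IH] i j; first by rewrite expr0; exact: gle_id.
have DD : 0 <= D ^+ k by rewrite exprn_ge0// ltW.
rewrite exprSr [Hseq q A k.+1]/= mxE; apply: (gleD r0).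
  by rewrite mxE; apply: gleW (gle_dquot q r0 (IH i j)); apply: ler_wpM2l => //; rewrite lerDl.
have Hs l m : gle rho (map_mx (sigma q) (Hseq q A k) l m) (D ^+ k).
  by rewrite mxE; exact: gle_sigma.
apply: (gle_mulmx r0 DD (ltW D0) Hs) => l m.
rewrite mxE; apply: (@gleW _ _ _ _ rho _ b); first by rewrite lerDr ltW.
apply: (gleM r0 (gle_gmono B r0 _ _)); rewrite mxE; apply: (nleD (gle_ultra K B r0)).
  by apply: gleW (HA l m); rewrite lerDr.
have := gle_id r0 l m; rewrite !mxE => /gleW H1.
by apply: (nleN (gle_ultra K B r0)); apply: H1; rewrite lerDl ltW.
Qed.

(** Multiplication by the monomial [c^-1 T^k] scales norms by [rho^k / |c|], which turns a bound
    with ratio [s * rho] into one with the relative ratio [s]. *)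
Lemma mle_bridge n (M : 'M[G]_n) (c : K) (k : nat) (rho C s : R) : 0 < rho -> 0 < s -> c != 0 ->
  (forall i j, cvg_at rho (coef (M i j))) ->
  mle rho M (C * vabs c / (s * rho) ^+ k) <->
  forall i j, gle rho (gmono B c^-1 k%:Z * M i j) (C / s ^+ k).
Proof.
move=> r0 s0 c0 cM; have v0 := vabs_gt0 c0; split=> [H i j|H i j l].
  have Hij : gle rho (M i j) (C * vabs c / (s * rho) ^+ k) by split=> // l; exact: H.
  have := gleM r0 (gle_gmono B r0 c^-1 k%:Z) Hij; rewrite vabsV -exprnP.
  have -> // : (vabs c)^-1 * rho ^+ k * (C * vabs c / (s * rho) ^+ k) = C / s ^+ k.
  by rewrite exprMn; field; rewrite !expf_neq0 ?gt_eqF.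
have := gleM r0 (gle_gmono B r0 c (- k%:Z)) (H i j).
rewrite mulrA gmonoM mulfV// addNr gmono1 mul1r -exprnN => -[_ /(_ l)].
have -> // : vabs c / rho ^+ k * (C / s ^+ k) = C * vabs c / (s * rho) ^+ k.
by rewrite exprMn; field; rewrite !expf_neq0 ?gt_eqF.
Qed.

(** Only relative ratios in []w, 1]] have to be transferred: the first radius is capped by [rho],
    and the ratio supplied by [good] already settles all smaller ones. *)
Lemma ray_le n (M1 M2 : nat -> 'M[G]_n) (c1 c2 : nat -> K) (w rho : R) : 0 < rho -> 0 < w ->
  (forall k, c1 k != 0) -> (forall k, c2 k != 0) ->
  (forall k, exists d, mle rho (M1 k) d) -> good M1 c1 w rho ->
  (forall C s, 0 < C -> w < s <= 1 ->
     (forall k, mle rho (M1 k) (C * vabs (c1 k) / (s * rho) ^+ k)) ->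
     (forall k, mle rho (M2 k) (C * vabs (c2 k) / (s * rho) ^+ k))) ->
  (ray M1 c1 rho <= ray M2 c2 rho)%E.
Proof.
move=> r0 w0 c10 c20 fM [C0 [s0 [C00 /andP[ws0 s01] H0]]] H.
have s00 : 0 < s0 := lt_trans w0 ws0.
have sr0 : 0 < s0 * rho by exact: mulr_gt0.
have low : ((s0 * rho)%:E <= ray M2 c2 rho)%E.
  rewrite /ray le_min lee_fin ler_piMl ?(ltW r0)//=.
  apply: (rad_ge c20 sr0 C00); apply: H => //; exact/andP.
have step y : (y%:E < ray M1 c1 rho)%E -> (y%:E <= ray M2 c2 rho)%E.
  rewrite /ray lt_min lte_fin => /andP[yr yrad].
  have [ys|sy] := leP y (s0 * rho); first by apply: le_trans low; rewrite lee_fin.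
  have y0 : 0 < y := lt_trans sr0 sy.
  have [C C_gt0 HC] := rad_bound c10 y0 fM yrad.
  have yE : y = y / rho * rho by rewrite divfK// gt_eqF.
  rewrite le_min lee_fin (ltW yr) /=; apply: (rad_ge c20 y0 C_gt0).
  rewrite yE; apply: H => //; last by rewrite -yE.
  rewrite ltr_pdivlMr// ler_pdivrMr// mul1r (ltW yr) andbT.
  by apply: le_lt_trans sy; apply: ler_wpM2r; exact: ltW.
rewrite leNgt; apply/negP => lt.
have fin1 : (ray M1 c1 rho <= rho%:E)%E by rewrite /ray ge_min lexx.
move: (ray M1 c1 rho) (ray M2 c2 rho) step low lt fin1 => [a| |] [b| |] // step low lt _.
rewrite lte_fin in lt; have := step ((a + b) / 2); rewrite lte_fin lee_fin.
by move=> /(_ ltac:(lra)); lra.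
Qed.

End Bridge.

Lemma generic_abs (R : realType) (p : nat) (K : cufield R p) (Om : cu_extension K)
  (rho : R) (t : Om) : 0 < rho -> generic_point rho t -> vabs t = rho.
Proof.
move=> r0 /(_ 'X); rewrite map_polyX hornerX => ->.
rewrite size_polyX !big_ord_recl big_ord0 /= !coefX /= vabs0 vabs1 mul0r mul1r expr1.
by rewrite (max_l (ltW r0)) (max_r (ltW r0)).
Qed.

(** * Transport along a connection *)

Section Transport.
Variables (R : realType) (p : nat) (K : cufield R p) (B : germ_kind).
Local Notation G := (germ K B).
Variables (X : lmodType G) (cn : X -> X).
Hypothesis cnD : {morph cn : x y / x + y}.
Hypothesis cnZ : forall f x, cn (f *: x) = delta1 f *: x + f *: cn x.
Variables (n0 : nat) (e : 'I_n0 -> X).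
Hypothesis be : is_basis e.
Local Notation "a %* x" := (gcst B a *: x) (at level 40).
Implicit Types (f g : G) (x S : X) (y : K).

(* [S] is the value at [(1 + y) T] of the Taylor solution applied to [x]. *)
Definition transport y x S : Prop :=
  xlimG e (fun N => \sum_(k < N) y ^+ k %* bin_conn cn k x) S.

Definition conn_good (eps w : R) : Prop := forall rho, annulus B eps rho ->
  exists C s : R, [/\ 0 < C, w < s <= 1 &
    forall k i, xle e rho (bin_conn cn k (e i)) (C / s ^+ k)].

Variables (eps : R) (e01 : 0 < eps < 1) (w : R) (w0 : 0 < w).
Hypothesis Hgood : conn_good eps w.

Lemma bin_conn_geo eps' x : annulus B eps' `<=` annulus B eps -> 0 < eps' < 1 ->
  (forall rho, annulus B eps' rho -> exists c, xle e rho x c) ->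
  geo e (annulus B eps') w (fun k => bin_conn cn k x).
Proof.
move=> sub e01' fx rho rI; have r0 := annulus_gt0 e01' rI.
have [C [s [C0 /andP[ws s1] H]]] := Hgood (sub _ rI).
have [c Hc] := fx _ rI; have [c0 _] := Hc; have s0 := lt_trans w0 ws.
have c1 : 0 < c + 1 by lra.
have Hc1 : xle e rho x (c + 1) by apply: (nleW (xle_ultra be r0)) Hc; lra.
exists ((c + 1) * C), s; split=> //; first exact: mulr_gt0.
have s01 : 0 < s <= 1 by rewrite s0.
exact: (bin_conn_le cnD cnZ be r0 C0 s01 H Hc1).
Qed.

Lemma xfin_sub x : exists2 eps' : R, 0 < eps' < 1 & annulus B eps' `<=` annulus B eps /\
  forall rho, annulus B eps' rho -> exists c, xle e rho x c.
Proof.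
have [e1 e101 H1] := xfinP e x; have [e2 e201 [S1 S2]] := annulus_sub B e01 e101.
by exists e2 => //; split=> // rho /S2; exact: H1.
Qed.

Lemma transport_ex y x : vabs y <= w -> exists S, transport y x S.
Proof.
move=> yw; have [e1 e101 [sub fx]] := xfin_sub x.
have [S HS] : exists S, xsum e (annulus B e1) (fun k => y ^+ k %* bin_conn cn k x) S.
  apply: (geo_sum_ex be e101 w0 (A := 1)); first exact: bin_conn_geo.
  move=> k; rewrite mul1r vabsX; apply: lerXn2r; rewrite ?nnegrE ?vabs_ge0//.
  exact: ltW.
by exists S; exists e1.
Qed.

Definition tr y x : X := xget 0 [set S | transport y x S].

Lemma trP y x : vabs y <= w -> transport y x (tr y x).
Proof.
by move=> /(transport_ex x)[S HS]; apply: (@xgetPex _ 0 [set S | transport y x S]); exists S.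
Qed.

Lemma transport_uniq y x S S' : transport y x S -> transport y x S' -> S = S'.
Proof. exact: xlimG_uniq. Qed.

Lemma trE y x S : vabs y <= w -> transport y x S -> tr y x = S.
Proof. by move=> yw; apply: transport_uniq; exact: trP. Qed.

Section Generic.
Variables (rho C s : R) (r0 : 0 < rho) (C0 : 0 < C) (s01 : 0 < s <= 1) (ws : w < s).
Hypothesis He : forall k i, xle e rho (bin_conn cn k (e i)) (C / s ^+ k).
Variables (Om : cu_extension K) (t : Om) (tr_ : vabs t = rho).

Definition transport_at y x S : Prop :=
  [/\ exists c, xle e rho x c, exists c, xle e rho S c &
      nsum (xle e rho) (fun k => y ^+ k %* bin_conn cn k x) S].

(** The case [z = 0] of [Fev_key], where [Fev] is plain evaluation at [t]. *)
Lemma geval_transport y x S j : vabs y <= w -> transport_at y x S ->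
  geval (ecoord e S 0 j) t = Fev cn e t (ext_emb Om y) x j.
Proof.
move=> yw [fx fS HS]; have s0 : 0 < s := lt_trans w0 ws.
rewrite -(Fev0 cn e t); rewrite (Fev_key cnD cnZ be r0 C0 s01 He tr_ (y := y) (x := x))//.
- by rewrite add0r addr0 mulr1.
- by rewrite vabs0.
exact: le_lt_trans ws.
Qed.

Lemma ecoord_eq (S S' : X) : generic_point rho t ->
  (exists c, xle e rho S c) -> (exists c, xle e rho S' c) ->
  (forall j, geval (ecoord e S 0 j) t = geval (ecoord e S' 0 j) t) -> S = S'.
Proof.
move=> gt [c [_ Hc]] [d [_ Hd]] H; apply/eqP; rewrite -subr_eq0; apply/eqP.
rewrite -(ecoordK be (S - S')) big1// => j _.
rewrite (@geval_generic_eq0 _ _ _ _ _ t rho (ecoord e (S - S') 0 j)) ?scale0r//.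
  rewrite ecoordB// !mxE; have [] : gle rho (ecoord e S 0 j - ecoord e S' 0 j) (Num.max c d) => //.
  apply: (nleB (gle_ultra K B r0)); [apply: gleW (Hc j)|apply: gleW (Hd j)];
    by rewrite le_max lexx ?orbT.
by rewrite ecoordB// !mxE (gevalB r0 tr_) ?H ?subrr//; [case: (Hc j)|case: (Hd j)].
Qed.

End Generic.

Lemma transport_common y x S : transport y x S -> exists2 e1 : R, 0 < e1 < 1 &
  forall rho, annulus B e1 rho -> transport_at rho y x S.
Proof.
move=> [e1 e101 H1]; have [e2 e201 H2] := xfinP e x.
have [e3 e301 [S1 S2]] := annulus_sub B e101 e201.
exists e3 => // rho rI; have [_ fS HS] := H1 _ (S1 _ rI); split=> //.
exact: H2 (S2 _ rI).
Qed.

(** Equality of two module elements can be tested at a single radius; this finds one where all the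
    data converge. *)
Lemma annulus_common (P Q S : R -> Prop) :
  (exists2 d : R, 0 < d < 1 & forall rho, annulus B d rho -> P rho) ->
  (exists2 d : R, 0 < d < 1 & forall rho, annulus B d rho -> Q rho) ->
  (exists2 d : R, 0 < d < 1 & forall rho, annulus B d rho -> S rho) ->
  exists rho, [/\ annulus B eps rho, P rho, Q rho & S rho].
Proof.
move=> [d1 d101 HP] [d2 d201 HQ] [d3 d301 HS].
have [d4 d401 [S1 S2]] := annulus_sub B d101 d201.
have [d5 d501 [S3 S4]] := annulus_sub B d301 e01.
have [d6 d601 [S5 S6]] := annulus_sub B d401 d501.
have [d60 _] := andP d601; have rI := annulus_mem B d60.
exists (1 - d6 / 2); split.
- exact: S4 (S6 _ rI).
- exact: HP (S1 _ (S5 _ rI)).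
- exact: HQ (S2 _ (S5 _ rI)).
exact: HS (S3 _ (S6 _ rI)).
Qed.

Lemma trD y x x' : vabs y <= w -> tr y (x + x') = tr y x + tr y x'.
Proof.
move=> yw; apply: trE => //.
have E : (fun N => \sum_(k < N) y ^+ k %* bin_conn cn k (x + x')) = (fun N =>
    \sum_(k < N) y ^+ k %* bin_conn cn k x + \sum_(k < N) y ^+ k %* bin_conn cn k x').
  apply/funext => N; rewrite -big_split /=; apply: eq_bigr => k _.
  by rewrite bin_connD// scalerDr.
by rewrite /transport E; exact: (xlimGD be (trP x yw) (trP x' yw)).
Qed.

(** At a generic point [t], [FevZ] yields the factor [f(t (1 + (q - 1))) = f(q t)], which is the
    value of [sigma q f] at [t]. *)
Lemma trZ (q : disk11 K) f x : vabs ((q : K) - 1) <= w ->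
  tr ((q : K) - 1) (f *: x) = sigma q f *: tr ((q : K) - 1) x.
Proof.
move=> qw; pose y := (q : K) - 1.
have [rho [rI T1 T2 [c Hc]]] := annulus_common (transport_common (trP x qw))
  (transport_common (trP (f *: x) qw)) (gfinP f).
have r0 := annulus_gt0 e01 rI.
  have [C [s [C0 /andP[ws s1] He]]] := Hgood rI; have s0 := lt_trans w0 ws.
  have s01 : 0 < s <= 1 by rewrite s0.
  have [Om [t gt]] := generic_point_ex K r0; have tt := generic_abs r0 gt.
  have [fx fS _] := T1; have [_ fS' _] := T2; have [cf _] := Hc.
  have cs : cvg_at rho (coef (sigma q f)) by have [] := gle_sigma r0 q Hc.
  apply: (ecoord_eq r0 tt gt fS').
    by apply: (xfinZ be r0) => //; exists c; exact: gle_sigma.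
  move=> j; rewrite (geval_transport r0 C0 s01 ws He tt j qw T2).
  have ys : vabs (ext_emb Om y) < s by rewrite ext_abs; exact: le_lt_trans ws.
  rewrite (FevZ cnD cnZ be r0 C0 s01 He tt ys)//.
  rewrite ecoordZ// mxE (gevalM r0 tt)//; last by have [d [_ /(_ j)[]]] := fS.
  rewrite (geval_transport r0 C0 s01 ws He tt j qw T1); congr (_ * _).
  have -> : t * (1 + ext_emb Om y) = ext_emb Om (q : K) * t.
    by rewrite /y rmorphB rmorph1 addrC subrK mulrC.
  rewrite /geval; congr sumZ; apply/funext => i.
  by rewrite coef_sigma rmorphM expfzMl (fmorphXz) mulrCA mulrA.
Qed.

(** At a generic point, [Fev_key] with [z = y1] combines the two displacements; the total factor is
    [(1 + y1) (1 + y2)]. *)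
Lemma tr_comp y1 y2 x : vabs y1 <= w -> vabs y2 <= w ->
  tr y1 (tr y2 x) = tr (y1 + y2 * (1 + y1)) x.
Proof.
move=> yw1 yw2; set y3 := y1 + _.
have [rho0 [rI0 _ _ _]] := annulus_common (xfinP e 0) (xfinP e 0) (xfinP e 0).
have w1 : w < 1 by have [C [s [_ /andP[/lt_le_trans + s1] _]]] := Hgood rI0; exact.
have yw3 : vabs y3 <= w.
  apply: vabsD_le => //; rewrite vabsM (@vabs_unit _ _ _ (1 + y1)) ?mulr1//.
  by rewrite addrC addKr; exact: le_lt_trans w1.
have [rho [rI T1 T2 T3]] := annulus_common (transport_common (trP x yw2))
  (transport_common (trP (tr y2 x) yw1)) (transport_common (trP x yw3)).
have r0 := annulus_gt0 e01 rI.
  have [C [s [C0 /andP[ws s1] He]]] := Hgood rI; have s0 := lt_trans w0 ws.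
  have s01 : 0 < s <= 1 by rewrite s0.
  have [Om [t gt]] := generic_point_ex K r0; have tt := generic_abs r0 gt.
  have [fx fS HS] := T1; have [_ fS' _] := T2; have [_ fS'' _] := T3.
  apply: (ecoord_eq r0 tt gt fS' fS'') => j.
  rewrite (geval_transport r0 C0 s01 ws He tt j yw1 T2).
  rewrite (geval_transport r0 C0 s01 ws He tt j yw3 T3).
  rewrite (Fev_key cnD cnZ be r0 C0 s01 He tt (y := y2) (x := x))//.
  - by rewrite /y3 rmorphD rmorphM rmorphD rmorph1.
  - by rewrite ext_abs; exact: le_lt_trans ws.
  exact: le_lt_trans ws.
Qed.

Lemma tr_0 x : tr 0 x = x.
Proof.
apply: trE; first by rewrite vabs0 ltW.
have [e1 e101 fx] := xfinP e x; exists e1 => // rho rI; have r0 := annulus_gt0 e101 rI.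
have E N : (0 < N)%N -> \sum_(k < N) (0 : K) ^+ k %* bin_conn cn k x = x.
  case: N => // N _; rewrite big_ord_recl /= expr0 gcst1 scale1r big1 ?addr0// => k _.
  by rewrite expr0n /= gcst0 scale0r.
split; last 2 first.
- exact: fx.
- move=> d d0; exists 1%N => N /E ->; rewrite subrr; apply: (nle0 (xle_ultra be r0)); exact: ltW.
move=> [|N]; last by rewrite E//; exact: fx.
by rewrite big_ord0; exists 0; apply: (nle0 (xle_ultra be r0)).
Qed.

(** The inverse is transport by [q^-1 - 1], which has the same absolute value as [q - 1]. *)
Lemma tr_bij (q : disk11 K) : vabs ((q : K) - 1) <= w -> bijective (tr ((q : K) - 1)).
Proof.
move=> qw; have q0 := disk_neq0 q.
have qi : vabs ((q : K)^-1 - 1) <= w.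
  have -> : (q : K)^-1 - 1 = - ((q : K) - 1) / (q : K) by field.
  by rewrite vabsM vabsN vabsV vabs_disk11 invr1 mulr1.
exists (tr ((q : K)^-1 - 1)) => x.
  rewrite tr_comp//; have -> : (q : K)^-1 - 1 + ((q : K) - 1) * (1 + ((q : K)^-1 - 1)) = 0 by field.
  exact: tr_0.
rewrite tr_comp//; have -> : (q : K) - 1 + ((q : K)^-1 - 1) * (1 + ((q : K) - 1)) = 0 by field.
exact: tr_0.
Qed.

Lemma iter_tr (q : disk11 K) m x : vabs ((q : K) - 1) <= w ->
  iter m (tr ((q : K) - 1)) x = tr ((q : K) ^+ m - 1) x.
Proof.
move=> qw; elim: m => [|m IH]; first by rewrite expr0 subrr tr_0.
have qm : vabs ((q : K) ^+ m - 1) <= w by apply: le_trans qw; exact: (vabs_qnum q m%:Z).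
have E : (q : K) - 1 + ((q : K) ^+ m - 1) * (1 + ((q : K) - 1)) = (q : K) ^+ m.+1 - 1.
  by rewrite exprS; ring.
by rewrite iterS IH tr_comp// E.
Qed.

End Transport.

(** * Comparison of the radii *)

Section Radii.
Variables (R : realType) (p : nat) (K : cufield R p) (B : germ_kind).
Local Notation G := (germ K B).
Variables (X : lmodType G) (n0 : nat) (e : 'I_n0 -> X).
Hypothesis be : is_basis e.

Definition mx_of (phi : X -> X) : 'M[G]_n0 := \matrix_(i, j) ecoord e (phi (e i)) 0 j.

Lemma mx_ofP phi : is_matrix e phi (mx_of phi).
Proof. by move=> i; rewrite -{1}(ecoordK be (phi (e i))); apply: eq_bigr => j _; rewrite mxE. Qed.

Lemma is_matrixE phi A i j : is_matrix e phi A -> ecoord e (phi (e i)) 0 j = A i j.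
Proof.
move=> /(_ i) E; rewrite (ecoord_uniq (c := row i A) be) ?mxE// E.
by apply: eq_bigr => l _; rewrite mxE.
Qed.

Lemma mle_xle (T : nat -> 'I_n0 -> X) (M : nat -> 'M[G]_n0) (c : nat -> K) (rho C s : R) :
  0 < rho -> 0 < C -> 0 < s -> (forall k, c k != 0) ->
  (forall k i j, cvg_at rho (coef (M k i j))) ->
  (forall k i j, ecoord e (T k i) 0 j = gmono B (c k)^-1 k%:Z * M k i j) ->
  (forall k, mle rho (M k) (C * vabs (c k) / (s * rho) ^+ k)) <->
  (forall k i, xle e rho (T k i) (C / s ^+ k)).
Proof.
move=> r0 C0 s0 c0 cM E; split=> H k.
  have /(@mle_bridge R p K B n0 (M k) (c k) k rho C s r0 s0 (c0 k) (cM k)) H' := H k.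
  move=> i; split; first by rewrite divr_ge0 ?exprn_ge0// ltW.
  by move=> j; rewrite E.
apply/(@mle_bridge R p K B n0 (M k) (c k) k rho C s r0 s0 (c0 k) (cM k)) => i j; rewrite -E.
by have [_] := H k i; apply.
Qed.

Section Conn.
Variables (cn : X -> X) (M : 'M[G]_n0).
Hypothesis cnD : {morph cn : x y / x + y}.
Hypothesis cnZ : forall f x, cn (f *: x) = delta1 f *: x + f *: cn x.
Hypothesis eM : is_matrix e cn M.
Local Notation fct := (fun k => k`!%:R : K).

Lemma Gseq_annulus : exists2 eps : R, 0 < eps < 1 & forall rho, annulus B eps rho ->
  exists2 D : R, 0 < D & forall k i j, gle rho (Gseq M k i j) (D ^+ k).
Proof.
have [eps e01 H] := mx_fin M; exists eps => // rho rI.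
have [c c0 Hc] := H _ rI; exact: Gseq_triv (annulus_gt0 e01 rI) c0 Hc.
Qed.

Lemma delta_good (w r : R) : 0 < w < r -> r <= 1 ->
  ray_at_one_ge B r (ray (Gseq M) fct) ->
  exists2 eps : R, 0 < eps < 1 & conn_good cn e eps w.
Proof.
move=> wr r1 Hr; have [e1 e101 He1] := Gseq_annulus; have [w0 _] := andP wr.
have [] := @good_annulus R p K B n0 (Gseq M) fct e1 w r e101 (@fact_neq0 _ _ K) _ _ wr r1 Hr.
- by exists (vabs (p%:R : K)); [exact: vabs_p_gt0|exact: vabs_fact_lower].
- move=> rho /He1[D D0 H]; exists D => // k i j l; exact: (H k i j).2.
move=> eps e01 [sub H]; exists eps => // rho rI; have r0 := annulus_gt0 e01 rI.
have [C [s [C0 /andP[ws s1] HM]]] := H _ rI; have s0 := lt_trans w0 ws.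
have [D D0 HD] := He1 _ (sub _ rI).
exists C, s; rewrite ws s1; split=> //.
apply/(mle_xle (M := Gseq M) (c := fct)) => // [k|k i j|k i j].
- exact: fact_neq0.
- exact: (HD k i j).1.
exact: ecoord_bin_conn.
Qed.

End Conn.

Section Sigma.
Variables (q : disk11 K) (sg : X -> X) (A : 'M[G]_n0).
Hypothesis sgD : {morph sg : x y / x + y}.
Hypothesis sgZ : forall f x, sg (f *: x) = sigma q f *: sg x.
Hypothesis nroot : not_ppower_root p (q : K).
Hypothesis eA : is_matrix e sg A.
Local Notation fct := (qfact (q : K)).

Lemma Hseq_annulus : exists2 eps : R, 0 < eps < 1 & forall rho, annulus B eps rho ->
  exists2 D : R, 0 < D & forall k i j, gle rho (Hseq q A k i j) (D ^+ k).
Proof.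
have [eps e01 H] := mx_fin A; exists eps => // rho rI.
have [c c0 Hc] := H _ rI; exact: Hseq_triv (annulus_gt0 e01 rI) c0 Hc.
Qed.

Definition theta_good (eps w : R) : Prop := forall rho, annulus B eps rho ->
  exists C s : R, [/\ 0 < C, w < s <= 1 &
    forall k i, xle e rho (theta q sg k (e i)) (C / s ^+ k)].

Lemma sigma_good (w r : R) : 0 < w < r -> r <= 1 ->
  ray_at_one_ge B r (ray (Hseq q A) fct) ->
  exists2 eps : R, 0 < eps < 1 & theta_good eps w.
Proof.
move=> wr r1 Hr; have [e1 e101 He1] := Hseq_annulus; have [w0 _] := andP wr.
have f0 := qfact_neq0 (disk_root nroot).
have [] := @good_annulus R p K B n0 (Hseq q A) fct e1 w r e101 f0 _ _ wr r1 Hr.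
- exact: qfact_lower.
- move=> rho /He1[D D0 H]; exists D => // k i j l; exact: (H k i j).2.
move=> eps e01 [sub H]; exists eps => // rho rI; have r0 := annulus_gt0 e01 rI.
have [C [s [C0 /andP[ws s1] HM]]] := H _ rI; have s0 := lt_trans w0 ws.
have [D D0 HD] := He1 _ (sub _ rI).
exists C, s; rewrite ws s1; split=> //.
apply/(mle_xle (M := Hseq q A) (c := fct)) => // [k i j|k i j].
- exact: (HD k i j).1.
exact: (ecoord_theta sgD sgZ (disk_root nroot)).
Qed.

End Sigma.
End Radii.

Lemma pow_bound_le (R : realType) (C D s t : R) k :
  0 <= C -> C <= D -> 0 < t <= s -> C / s ^+ k <= D / t ^+ k.
Proof.
move=> C0 CD /andP[t0 ts]; have s0 := lt_le_trans t0 ts.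
apply: ler_pM => //; first by rewrite invr_ge0 exprn_ge0// ltW.
rewrite lef_pV2 ?posrE ?exprn_gt0//; apply: lerXn2r; rewrite ?nnegrE ?(ltW t0) ?(ltW s0)//.
Qed.

Section Comparison.
Variables (R : realType) (p : nat) (K : cufield R p) (B : germ_kind).
Local Notation G := (germ K B).
Variables (X : lmodType G) (cn : X -> X).
Hypothesis cnD : {morph cn : x y / x + y}.
Hypothesis cnZ : forall f x, cn (f *: x) = delta1 f *: x + f *: cn x.
Variables (n0 : nat) (e : 'I_n0 -> X).
Hypothesis be : is_basis e.
Local Notation "a %* x" := (gcst B a *: x) (at level 40).
Variables (eps : R) (e01 : 0 < eps < 1) (w : R) (w0 : 0 < w).
Hypothesis Hgood : conn_good cn e eps w.

Lemma tr_xsum eps' y x : 0 < eps' < 1 -> annulus B eps' `<=` annulus B eps ->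
  (forall rho, annulus B eps' rho -> exists c, xle e rho x c) -> vabs (y : K) <= w ->
  xsum e (annulus B eps') (fun k => y ^+ k %* bin_conn cn k x) (tr cn e y x).
Proof.
move=> e101 sub fx yw.
have [S HS] : exists S, xsum e (annulus B eps') (fun k => y ^+ k %* bin_conn cn k x) S.
  apply: (geo_sum_ex be e101 w0 (A := 1)).
    exact: (bin_conn_geo cnD cnZ be w0 Hgood sub).
  move=> k; rewrite mul1r vabsX; apply: lerXn2r; rewrite ?nnegrE ?vabs_ge0//.
  exact: ltW.
by rewrite (trE cnD cnZ be e01 w0 Hgood yw (S := S))//; exists eps'.
Qed.

Lemma basis_fin rho i : 0 < rho -> exists c, xle e rho (e i) c.
Proof.
move=> r0; exists 1; split=> // j; rewrite ecoord_basis//.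
by case: (j == i); [exact: gle1|exact: (gle0 K B r0 ler01)].
Qed.

Variables (q : disk11 K) (sg : X -> X).
Hypothesis qw : vabs ((q : K) - 1) <= w.
Hypothesis sgE : forall x, sg x = tr cn e ((q : K) - 1) x.

Lemma sg_trD : {morph sg : x y / x + y}.
Proof. by move=> x y; rewrite !sgE (trD cnD cnZ be e01 w0 Hgood). Qed.

Lemma sg_trZ f x : sg (f *: x) = sigma q f *: sg x.
Proof. by rewrite !sgE (trZ cnD cnZ be e01 w0 Hgood). Qed.

Lemma iter_sg_xsum m i : xsum e (annulus B eps)
  (fun k => qpow q m ^+ k %* bin_conn cn k (e i)) (iter m sg (e i)).
Proof.
have -> : iter m sg (e i) = tr cn e (qpow q m) (e i).
  rewrite -(iter_tr cnD cnZ be e01 w0 Hgood _ _ qw).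
  by elim: m => //= m ->.
apply: tr_xsum => //; first by move=> rho /(annulus_gt0 e01); exact: basis_fin.
exact: qpow_le.
Qed.

Lemma conn_geo i : geo e (annulus B eps) w (fun k => bin_conn cn k (e i)).
Proof.
apply: (bin_conn_geo cnD cnZ be w0 Hgood) => // rho /(annulus_gt0 e01).
exact: basis_fin.
Qed.

Hypothesis nroot : not_ppower_root p (q : K).
Let qroot := disk_root nroot.

Lemma conn_to_theta rho C s : annulus B eps rho -> 0 < C -> w <= s ->
  (forall k i, xle e rho (bin_conn cn k (e i)) (C / s ^+ k)) ->
  forall k i, xle e rho (theta q sg k (e i)) (C / s ^+ k).
Proof.
move=> rI C0 ws H k i.
exact: (theta_le sg_trD sg_trZ qroot be e01 w0 qw (conn_geo i) (iter_sg_xsum ^~ i) rI C0 ws (H ^~ i)).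
Qed.

Lemma conn_theta_good : theta_good e q sg eps w.
Proof.
move=> rho rI; have [C [s [C0 /andP[ws s1] H]]] := Hgood rI.
exists C, s; split=> //; first by rewrite ws.
by apply: conn_to_theta => //; exact: ltW.
Qed.

Lemma theta_good_geo sg' i : theta_good e q sg' eps w ->
  geo e (annulus B eps) w (fun n => theta q sg' n (e i)).
Proof.
by move=> H rho /H[C [s [C0 /andP[ws s1] Hk]]]; exists C, s; split.
Qed.

(** The inverse change of basis bounds the vectors [N i k] obtained from [theta]. These are the
    divided powers of [cn], because both families sum to [sg^(p^j) (e i)] at every [q^(p^j) - 1]. *)
Lemma theta_to_conn rho C s : annulus B eps rho -> 0 < C -> w <= s ->
  (forall k i, xle e rho (theta q sg k (e i)) (C / s ^+ k)) ->
  forall k i, xle e rho (bin_conn cn k (e i)) (C / s ^+ k).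
Proof.
move=> rI C0 ws H k i; have geoth i' := theta_good_geo i' conn_theta_good.
have [N HN] := theta_cols be e01 w0 qw geoth.
suff <- : N i k = bin_conn cn k (e i).
  exact: (N_le be e01 w0 qw HN rI C0 ws (H ^~ i)).
have r0 := annulus_gt0 e01 rI.
have [C1 [s1 [C10 w1 H1]]] := Hgood rI; case/andP: w1 => w1 s11.
have [C2 [s2 [C20 w2 H2]]] := N_geo be e01 w0 qw geoth HN i rI.
pose s3 := Num.min s1 s2; have w3 : w < s3 by rewrite lt_min w1 w2.
have s30 := lt_trans w0 w3.
apply/eqP; rewrite -subr_eq0; apply/eqP.
apply: (@power_series_eq0 _ _ _ _ _ _ _ be rho r0 (C1 + C2) s3 _ s30
  (fun k => N i k - bin_conn cn k (e i)) _ (zp q)) => [||j|||].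
- exact: addr_gt0.
- move=> l; apply: (nleB (xle_ultra be r0)).
    apply: (nleW (xle_ultra be r0)) (H2 l); apply: pow_bound_le => //; first exact: ltW.
      by rewrite lerDr ltW.
    by rewrite s30 ge_min lexx orbT.
  apply: (nleW (xle_ultra be r0)) (H1 l i); apply: pow_bound_le => //; first exact: ltW.
    by rewrite lerDl ltW.
  by rewrite s30 ge_min lexx.
- exact: zp_neq0.
- exact: zp_small.
- by move=> j; apply: le_trans (zp_le_q q j) _; apply: le_trans qw (ltW _).
move=> j; have S1 := xsum_at (iter_sg_xsum (p ^ j) i) rI.
have S2 := xsum_at (N_sum sg_trD sg_trZ nroot be e01 w0 qw geoth HN i (p ^ j)) rI.
have := nsumB (xle_ultra be r0) S2 S1; rewrite subrr.
by apply: eq_nsum => l; rewrite scalerBr.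
Qed.

(** Both changes of basis keep the pair [C], [s], so [ray_le] applies in both directions. *)
Lemma ray_conn_sigma M A : is_matrix e cn M -> is_matrix e sg A ->
  exists2 eps' : R, 0 < eps' < 1 & annulus B eps' `<=` annulus B eps /\
    forall rho, annulus B eps' rho ->
      ray (Gseq M) (fun k => k`!%:R : K) rho = ray (Hseq q A) (qfact (q : K)) rho.
Proof.
move=> eM eA; have [e1 e101 H1] := Gseq_annulus M; have [e2 e201 H2] := Hseq_annulus q A.
have [e3 e301 [S1 S2]] := annulus_sub B e101 e201.
have [e4 e401 [S3 S4]] := annulus_sub B e301 e01.
exists e4 => //; split=> // rho rI; have r0 := annulus_gt0 e401 rI.
have [D1 D10 G1] := H1 _ (S1 _ (S3 _ rI)); have [D2 D20 G2] := H2 _ (S2 _ (S3 _ rI)).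
have rI' := S4 _ rI; have [C [s [C0 ws Hs]]] := Hgood rI'.
have c1 := @fact_neq0 _ _ K; have c2 := qfact_neq0 qroot.
have b1 C' s' (C'0 : 0 < C') (s'0 : 0 < s') := mle_xle (T := fun k i => bin_conn cn k (e i))
  r0 C'0 s'0 c1 (fun k i j => (G1 k i j).1) (ecoord_bin_conn cnD cnZ be eM).
have b2 C' s' (C'0 : 0 < C') (s'0 : 0 < s') := mle_xle (T := fun k i => theta q sg k (e i))
  r0 C'0 s'0 c2 (fun k i j => (G2 k i j).1) (ecoord_theta sg_trD sg_trZ qroot be eA).
have [ws1 s1] := andP ws; have s0 := lt_trans w0 ws1.
apply/eqP; rewrite eq_le; apply/andP; split; apply: (@ray_le R p K B _ _ _ _ _ w rho r0 w0) => //.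
- by move=> k; exists (D1 ^+ k) => i j l; exact: (G1 k i j).2.
- by exists C, s; split=> //; apply/b1.
- move=> C' s' C'0 /andP[ws' s'1]; have s'0 := lt_trans w0 ws'.
  by move=> /b1 H; apply/b2 => //; apply: conn_to_theta (ltW ws') (H _ _).
- by move=> k; exists (D2 ^+ k) => i j l; exact: (G2 k i j).2.
- by exists C, s; split=> //; apply/b2 => //; apply: conn_to_theta (ltW ws1) Hs.
move=> C' s' C'0 /andP[ws' s'1]; have s'0 := lt_trans w0 ws'.
by move=> /b2 H; apply/b1 => //; apply: theta_to_conn (ltW ws') (H _ _).
Qed.

End Comparison.

(** * Generic Taylor solutions *)

Section TaylorSolutions.
Variables (R : realType) (p : nat) (K : cufield R p) (B : germ_kind).
Local Notation G := (germ K B).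
Variables (X : lmodType G) (cn : X -> X).
Hypothesis cnD : {morph cn : x y / x + y}.
Hypothesis cnZ : forall f x, cn (f *: x) = delta1 f *: x + f *: cn x.
Variables (n0 : nat) (e : 'I_n0 -> X).
Hypothesis be : is_basis e.
Variable M : 'M[G]_n0.
Hypothesis eM : is_matrix e cn M.
Local Notation "a %* x" := (gcst B a *: x) (at level 40).
Local Notation fct := (fun k => k`!%:R : K).

(** With the relative displacement [z = (x - t) / t], the factor [t^k] relating [D^k / k!] to
    [bin_conn k] is absorbed into [z^k]. *)
Lemma Taylor_sol_Fev (Om : cu_extension K) (t x : Om) rho i j : 0 < rho -> vabs t = rho ->
  (forall k, cvg_at rho (coef (Gseq M k i j))) ->
  Taylor_sol M x t i j = Fev cn e t ((x - t) / t) (e i) j.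
Proof.
move=> r0 tr cG; rewrite mxE; congr sumN; apply/funext => k.
have t0 : t != 0 by exact: x_neq0 r0 tr.
rewrite (ecoord_bin_conn cnD cnZ be eM) (gevalM r0 tr) //; last exact: cvg_at_lmono.
rewrite geval_gmono expr_div_n fmorphV rmorph_nat -exprnP; field.
by rewrite (@fact_neq0 _ _ Om) expf_neq0.
Qed.

Variables (eps : R) (e01 : 0 < eps < 1) (w : R) (w0 : 0 < w).
Hypothesis Hgood : conn_good cn e eps w.

Lemma ray_gt (rho s : R) C : 0 < rho -> 0 < C -> 0 < s <= 1 ->
  (forall k i j, cvg_at rho (coef (Gseq M k i j))) ->
  (forall k i, xle e rho (bin_conn cn k (e i)) (C / s ^+ k)) ->
  ((s * rho)%:E <= ray (Gseq M) fct rho)%E.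
Proof.
move=> r0 C0 /andP[s0 s1] cG H; rewrite /ray le_min lee_fin; apply/andP; split.
  by rewrite ler_piMl// ltW.
apply: (@rad_ge _ _ _ _ _ _ fct _ (@fact_neq0 _ _ K) _ C) => //; first exact: mulr_gt0.
apply/(mle_xle (T := fun k i => bin_conn cn k (e i))) => //.
- exact: fact_neq0.
exact: ecoord_bin_conn.
Qed.

Lemma ray_bound (rho z C s : R) : 0 < rho -> 0 <= z -> 0 < C -> w < s <= 1 ->
  (forall k, exists2 D : R, 0 < D & forall i j, gle rho (Gseq M k i j) D) ->
  (forall k i, xle e rho (bin_conn cn k (e i)) (C / s ^+ k)) ->
  ((z * rho)%:E < ray (Gseq M) fct rho)%E ->
  exists C' s' : R, [/\ 0 < C', w < s' <= 1, z < s' &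
    forall k i, xle e rho (bin_conn cn k (e i)) (C' / s' ^+ k)].
Proof.
move=> r0 z0 C0 ws bG H zr; have [ws1 s1] := andP ws.
have [zs|sz] := ltP z s; first by exists C, s.
have : exists m : R, ray (Gseq M) fct rho = m%:E.
  move: zr; rewrite /ray; set l := rad_liminf _ _ _ => zr.
  have : (Order.min rho%:E l <= rho%:E)%E by rewrite ge_min lexx.
  by case: (Order.min _ _) zr => [m| |] //; exists m.
move=> [m Em]; move: zr; rewrite Em lte_fin => zm.
have : (m%:E <= rho%:E)%E by rewrite -Em /ray ge_min lexx.
rewrite lee_fin => mr.
have ml : (m%:E <= rad_liminf (Gseq M) fct rho)%E by rewrite -Em /ray ge_min lexx orbT.
(* [m / rho] is the relative radius; any ratio strictly between [z] and it would do. *)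
pose s' := (z + m / rho) / 2.
have zm' : z < m / rho by rewrite ltr_pdivlMr.
have m1 : m / rho <= 1 by rewrite ler_pdivrMr// mul1r.
have zs' : z < s' by rewrite /s'; lra.
have s'm : s' < m / rho by rewrite /s'; lra.
have s'0 : 0 < s' := le_lt_trans z0 zs'.
have [|||C' C'0 HC'] := @rad_bound _ _ _ _ _ (Gseq M) fct rho (@fact_neq0 _ _ K) (s' * rho).
- exact: mulr_gt0.
- by move=> k; have [D D0 HD] := bG k; exists D => i j; exact: (HD i j).2.
- by apply: lt_le_trans ml; rewrite lte_fin -ltr_pdivlMr.
exists C', s'; split=> //.
- by rewrite (lt_le_trans ws1 (le_trans sz (ltW zs'))) (le_trans (ltW s'm)).
apply/(mle_xle (M := Gseq M) (c := fct)) => // [k|k i j|k i j].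
- exact: fact_neq0.
- by have [D _ /(_ i j)[]] := bG k.
exact: ecoord_bin_conn.
Qed.

Variables (q : disk11 K) (sg : X -> X) (A : 'M[G]_n0).
Hypothesis qw : vabs ((q : K) - 1) <= w.
Hypothesis eA : is_matrix e sg A.
Local Notation y := ((q : K) - 1).

Lemma Taylor_shift (Om : cu_extension K) (t x : Om) : t != 0 ->
  (ext_emb Om (q : K) * x - t) / t = (x - t) / t + ext_emb Om y * (1 + (x - t) / t).
Proof. by move=> t0; rewrite rmorphB rmorph1; field. Qed.

Lemma annulus_common_basis (P : 'I_n0 -> R -> Prop) :
  (forall i, exists2 d : R, 0 < d < 1 & forall rho, annulus B d rho -> P i rho) ->
  exists2 d : R, 0 < d < 1 & annulus B d `<=` annulus B eps /\
   forall rho, annulus B d rho -> (forall i, P i rho) /\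
   exists2 D : R, 0 < D & forall k i j, gle rho (Gseq M k i j) (D ^+ k).
Proof.
move=> /(annulus_sub_fin)[d1 d101 H1].
have [e1 e101 H2] := Gseq_annulus M.
have [e3 e301 [S1 S2]] := annulus_sub B e101 d101.
have [e4 e401 [S3 S4]] := annulus_sub B e301 e01.
exists e4 => //; split=> // rho rI; split; first exact: H1 (S2 _ (S3 _ rI)).
exact: H2 (S1 _ (S3 _ rI)).
Qed.

(** In relative displacements, [Taylor_shift] shows that moving from [x] to [q x] is what transport
    by [q - 1] does, so [Fev_key] makes the left side the translation of [sg (e i)]; expanding that
    vector in the basis gives the matrix product. *)
Lemma Taylor_solves :
  (forall i, transport cn e y (e i) (sg (e i))) ->
  \forall rho \near @near_one R B, forall (Om : cu_extension K) (t : Om),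
    generic_point rho t -> Taylor_sol_solves q A M rho t.
Proof.
move=> Hsg; have [d d01 [sub Hd]] := annulus_common_basis (fun i => transport_common (Hsg i)).
apply: (near_annulus d01) => rho rI Om t gt; have r0 := annulus_gt0 d01 rI.
have tr := generic_abs r0 gt; have t0 := x_neq0 r0 tr.
have [T [D D0 HD]] := Hd _ rI; have [C [s [C0 ws H]]] := Hgood (sub _ rI).
move=> x xr; pose z := (x - t) / t.
have xE : x = t * (1 + z) by rewrite /z; field.
have zE : vabs z * rho = vabs (x - t) by rewrite -tr -vabsM /z divfK.
have bG k : exists2 D : R, 0 < D & forall i j, gle rho (Gseq M k i j) D.
  by exists (D ^+ k); [exact: exprn_gt0|exact: HD].
rewrite -zE in xr.
have [C' [s' [C'0 /andP[ws' s'1] zs' H']]] := ray_bound r0 (vabs_ge0 z) C0 ws bG H xr.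
have s'01 : 0 < s' <= 1 by rewrite (lt_trans w0 ws').
have cG i j k : cvg_at rho (coef (Gseq M k i j)) by exact: (HD k i j).1.
apply/matrixP => i j; rewrite (Taylor_sol_Fev _ r0 tr (cG i j)) Taylor_shift// -/z.
have [fx fS HS] := T i.
rewrite -(Fev_key cnD cnZ be r0 C'0 s'01 H' tr j zs' _ fx fS HS); last first.
  exact: le_lt_trans qw ws'.
rewrite (Fev_sum cnD cnZ be r0 C'0 s'01 H' tr zs' j fS) mxE; apply: eq_bigr => l _.
by rewrite (Taylor_sol_Fev _ r0 tr (cG l j)) mxE (is_matrixE be _ _ eA) -xE.
Qed.

Lemma sigma_ext : {morph sg : x y / x + y} -> (forall f x, sg (f *: x) = sigma q f *: sg x) ->
  (forall i, sg (e i) = tr cn e y (e i)) -> forall x, sg x = tr cn e y x.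
Proof.
move=> sgD sgZ E x; pose T := tr cn e y.
rewrite -/(T x) -[in LHS](ecoordK be x) -[in RHS](ecoordK be x).
have TD a b : T (a + b) = T a + T b := trD cnD cnZ be e01 w0 Hgood a b qw.
have T0 : T 0 = 0 by apply: (addrI (T 0)); rewrite -TD !addr0.
rewrite (sg_sum sgD).
rewrite (big_morph T TD T0).
by apply: eq_bigr => i _; rewrite sgZ E /T (trZ cnD cnZ be e01 w0 Hgood).
Qed.

(** At [x = t] the Taylor solution is the identity matrix, so the equation says that the matrices of
    [sg] and of the transport have the same values at a generic point. *)
Lemma sigma_is_transport :
  {morph sg : x y / x + y} -> (forall f x, sg (f *: x) = sigma q f *: sg x) ->
  (\forall rho \near @near_one R B, forall (Om : cu_extension K) (t : Om),
    generic_point rho t -> Taylor_sol_solves q A M rho t) ->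
  forall x, sg x = tr cn e y x.
Proof.
move=> sgD sgZ HT; pose T := tr cn e y.
have trQ x : transport cn e y x (T x) := trP cnD cnZ be e01 w0 Hgood x qw.
have [d d01 [sub Hd]] := annulus_common_basis
  (P := fun i rho => transport_at cn e rho y (e i) (T (e i)) /\
    exists c, xle e rho (sg (e i)) c) (fun i =>
    let: ex_intro2 d1 d101 H1 := transport_common (trQ (e i)) in
    let: ex_intro2 d2 d201 H2 := xfinP e (sg (e i)) in
    let: ex_intro2 d3 d301 (conj S1 S2) := annulus_sub B d101 d201 in
    ex_intro2 _ _ d3 d301 (fun rho rI => conj (H1 _ (S1 _ rI)) (H2 _ (S2 _ rI)))).
have [rho rI HTr] := near_one_ex d01 HT; have r0 := annulus_gt0 d01 rI.
have [Om [t gt]] := generic_point_ex K r0; have tr := generic_abs r0 gt.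
have t0 := x_neq0 r0 tr.
have [TS [D D0 HD]] := Hd _ rI; have [C [s [C0 ws H]]] := Hgood (sub _ rI).
have [ws1 s1] := andP ws; have s0 := lt_trans w0 ws1.
have s01 : 0 < s <= 1 by rewrite s0.
have cG i j k : cvg_at rho (coef (Gseq M k i j)) by exact: (HD k i j).1.
have ET i j : Taylor_sol M t t i j = (i == j)%:R.
  rewrite (Taylor_sol_Fev _ r0 tr (cG i j)) subrr mul0r Fev0 ecoord_basis//.
  have -> : ((j == i)%:R : G) = gcst B (j == i)%:R by rewrite gcst_nat.
  by rewrite geval_gmono expr0z mulr1 rmorph_nat eq_sym.
have E i : sg (e i) = T (e i).
  have [[fe fT HS] fs] := TS i; apply: (ecoord_eq be r0 tr gt fs fT) => j.
  rewrite (geval_transport cnD cnZ be w0 r0 C0 s01 ws1 H tr j qw (TS i).1).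
  have xr : ((vabs (t - t))%:E < ray (Gseq M) fct rho)%E.
    rewrite subrr vabs0; apply: lt_le_trans (ray_gt r0 C0 s01 (fun k i j => cG i j k) H).
    by rewrite lte_fin mulr_gt0.
  have /matrixP/(_ i j) := HTr Om t gt t xr.
  rewrite (Taylor_sol_Fev _ r0 tr (cG i j)) Taylor_shift// subrr mul0r addr0 mulr1 add0r => ->.
  rewrite mxE (bigD1 j)//= ET eqxx mulr1 big1 ?addr0; last first.
    by move=> l lj; rewrite ET (negPf lj) mulr0.
  by rewrite mxE (is_matrixE be _ _ eA).
exact: sigma_ext.
Qed.

End TaylorSolutions.

Section ChangeOfBasis.
Variables (R : realType) (p : nat) (K : cufield R p) (B : germ_kind).
Local Notation G := (germ K B).
Variables (X Y : lmodType G) (n m : nat) (e : 'I_n -> X) (e' : 'I_m -> Y).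
Hypotheses (be : is_basis e) (be' : is_basis e').
Local Notation "a %* x" := (gcst B a *: x) (at level 40).

Lemma transport_lin (cn : X -> X) (cn' : Y -> Y) (f : X -> Y) y x S : linear f ->
  (forall z, f (cn z) = cn' (f z)) -> transport cn e y x S ->
  transport cn' e' y (f x) (f S).
Proof.
move=> lf fc /(lin_xlimG be be' lf); rewrite /transport; congr (xlimG _ _ _).
apply/funext => N; rewrite (lin_sum lf); apply: eq_bigr => k _.
rewrite (linZ lf); congr (_ *: _); elim: (nat_of_ord k) => //= l IH.
by rewrite (linZ lf) (linB lf) fc (linZ lf) IH.
Qed.

Lemma difq_lin (q : disk11 K) (sg : X -> X) (sg' : Y -> Y) (f : X -> Y) x S : linear f ->
  (forall z, f (sg z) = sg' (f z)) -> xlimG e (fun j => difq q sg j x) S ->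
  xlimG e' (fun j => difq q sg' j (f x)) (f S).
Proof.
move=> lf fs /(lin_xlimG be be' lf); congr (xlimG _ _ _).
apply/funext => N; rewrite /difq (linZ lf) (linB lf); congr (_ *: (_ - _)).
by elim: (_ ^ _)%N => //= l IH; rewrite fs IH.
Qed.

End ChangeOfBasis.

(** * The connection as a limit of difference quotients *)

Section Limits.
Variables (R : realType) (p : nat) (K : cufield R p) (B : germ_kind).
Local Notation G := (germ K B).
Variables (q : disk11 K) (X : lmodType G).
Hypothesis nroot : not_ppower_root p (q : K).
Variables (n0 : nat) (e : 'I_n0 -> X).
Hypothesis be : is_basis e.
Local Notation "a %* x" := (gcst B a *: x) (at level 40).
Variables (eps : R) (e01 : 0 < eps < 1) (w : R) (w0 : 0 < w).
Hypothesis qw : vabs ((q : K) - 1) <= w.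

Section Conn.
Variable cn : X -> X.
Hypothesis cnD : {morph cn : x y / x + y}.
Hypothesis cnZ : forall f x, cn (f *: x) = delta1 f *: x + f *: cn x.
Hypothesis Hgood : conn_good cn e eps w.
Variable sg : X -> X.
Hypothesis sgE : forall x, sg x = tr cn e ((q : K) - 1) x.

Lemma bin_conn1 x : bin_conn cn 1 x = cn x.
Proof. by rewrite /= scale0r subr0 invr1 gcst1 scale1r. Qed.

Lemma difq_conn x : xlimG e (fun j => difq q sg j x) (cn x).
Proof.
have sgZ := sg_trZ cnD cnZ be e01 w0 Hgood qw sgE.
have sgD := sg_trD cnD cnZ be e01 w0 Hgood qw sgE.
have fb k i rho : annulus B eps rho -> exists c, xle e rho (bin_conn cn k (e i)) c.
  by move=> /Hgood[C [s [_ _ H]]]; exists (C / s ^+ k).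
have cne i : xlim e (annulus B eps) (fun j => difq q sg j (e i)) (cn (e i)).
  move=> rho rI; have r0 := annulus_gt0 e01 rI; have U := xle_ultra be r0.
  have fx : exists c, xle e rho (e i) c by exact: basis_fin.
  have HS j := iter_sg_xsum cnD cnZ be e01 w0 Hgood qw sgE (p ^ j) i.
  split; last first.
  - have [C [s [C0 /andP[ws s1] H]]] := Hgood rI; have s0 := lt_trans w0 ws.
    have D0 : 0 < C / s ^+ 2 by rewrite divr_gt0// exprn_gt0.
    move=> d d0; have [N HN] := zp_small q (divr_gt0 d0 D0).
    exists N => j /HN zd; have z0 := zp_neq0 nroot j.
    have zs : vabs (zp q j) <= s by apply: le_trans (zp_le_q q j) _; apply: le_trans qw (ltW ws).
    have T := power_tail be r0 C0 s0 (W := fun k => bin_conn cn k (e i)) (H ^~ i) 2 z0 zs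
      (xsum_at (HS j) rI).
    have -> : difq q sg j (e i) - cn (e i) = (zp q j)^-1 %* (iter (p ^ j) sg (e i) -
        \sum_(k < 2) zp q j ^+ k %* bin_conn cn k (e i)).
      rewrite !big_ord_recl big_ord0 /= expr0 expr1 gcst1 !scale1r addr0.
      have := bin_conn1 (e i); rewrite /= => ->.
      have E1 : (zp q j)^-1 %* (zp q j %* cn (e i)) = cn (e i).
        by rewrite scalerA -gcstM mulVf// gcst1 scale1r.
      by rewrite /difq opprD addrA -[in LHS]E1 -scalerBr.
    apply: (nleW U) (xle_gcst be r0 _ T).
    rewrite vabsV mulrA expr2 mulKf ?gt_eqF ?vabs_gt0//.
    by move: zd; rewrite ler_pdivlMr.
  - by have := fb 1%N i rho rI; rewrite bin_conn1.
  move=> j; apply: xfinZ => //; first by exists (vabs (zp q j)^-1); exact: gle_gcst.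
  by apply: xfinD => //; [have [] := HS j _ rI|exact: xfinN].
have [e1 e101 fx] := xfinP e x; have [e2 e201 [S1 S2]] := annulus_sub B e01 e101.
exists e2 => //; apply: (difq_cvg sgD sgZ nroot be e201 cnD cnZ) => [i|rho /S2]; last exact: fx.
exact: xlim_sub S1 (cne i).
Qed.

End Conn.

(** The connection takes the value [N i 1] on [e i]. By [N_bin_conn] its divided powers are the
    [N i k], which inherit the bounds of [theta], and the expansion of the first iterate identifies
    [sg] with the transport. *)
Lemma conn_of_sigma sg : {morph sg : x y / x + y} ->
  (forall f x, sg (f *: x) = sigma q f *: sg x) -> theta_good e q sg eps w ->
  exists cn : X -> X, [/\ {morph cn : x y / x + y},
    forall f x, cn (f *: x) = delta1 f *: x + f *: cn x, conn_good cn e eps w &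
    forall x, sg x = tr cn e ((q : K) - 1) x].
Proof.
move=> sgD sgZ tg; have geoth i := theta_good_geo i tg.
have [N HN] := theta_cols be e01 w0 qw geoth.
have [cn [cnD cnZ cnN]] := conn_exists be N.
have E := N_bin_conn sgD sgZ nroot be e01 w0 qw geoth HN cnD cnZ cnN.
have Hgood : conn_good cn e eps w.
  move=> rho rI; have [C [s [C0 ws H]]] := tg _ rI; exists C, s; split=> // k i.
  rewrite -E; apply: (N_le be e01 w0 qw HN rI C0 _ (H ^~ i)); have [/ltW] := andP ws; exact.
exists cn; split=> //; apply: (sigma_ext cnD cnZ be e01 w0 Hgood qw sgD sgZ) => i.
apply/esym; apply: (trE cnD cnZ be e01 w0 Hgood qw).
exists eps => //; have := N_sum sgD sgZ nroot be e01 w0 qw geoth HN i 1.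
by rewrite /qpow expr1; congr (xlim _ _ _ _); apply/funext => M; apply: eq_bigr => k _; rewrite E.
Qed.

End Limits.

Lemma annulus_defined (R : realType) (B : germ_kind) (eps : R) (P : R -> Prop) :
  0 < eps < 1 -> (forall rho, annulus B eps rho -> P rho) ->
  match B with
  | Robba => \forall rho \near (1 : R)^'-, P rho
  | Overconvergent => P 1
  end.
Proof.
move=> e01 H; have := near_annulus e01 H; case: B H => // H _.
by apply: H; rewrite /= in_itv /=; case/andP: e01 => e0 _; apply/andP; split; lra.
Qed.

(** * Automatic continuity of semilinear maps *)

Section Continuity.
Variables (R : realType) (p : nat) (K : cufield R p) (B : germ_kind).
Local Notation G := (germ K B).

Lemma gnorm_sigma (q : disk11 K) (f : G) rho : Defs.gnorm rho (sigma q f) = Defs.gnorm rho f.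
Proof.
rewrite /Defs.gnorm; congr ereal_sup; apply: eq_imagel => i _.
by rewrite coef_sigma vabsM vabsXz vabs_disk11 exp1rz mul1r.
Qed.

(** Since [|q| = 1], [sigma q] preserves every norm. Along [f |-> f x] the composed seminorm is the
    one attached to [phi x], precomposed with [sigma q], so it satisfies the same bounds. *)
Lemma semilinear_continuous (q : disk11 K) (X : lmodType G) (phi : X -> X) :
  {morph phi : x y / x + y} -> (forall f x, phi (f *: x) = sigma q f *: phi x) ->
  mod_continuous phi.
Proof.
move=> phD phZ s [s0 sD sZ sC]; split=> [x|x y|a x|x].
- exact: s0.
- by rewrite phD.
- by rewrite phZ sigma_gcst.
have [c0 cD cZ cC] := sC (phi x); split=> [f|f g|a f|eps e01].
- by rewrite phZ.
- by rewrite !phZ sigmaD.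
- by rewrite !phZ /gcst sigma_gmonoM expr0z mul1r cZ.
have [C [rhos [H1 H2]]] := cC _ e01; exists C, rhos; split=> // f cf.
have cf' : cvg_on (annulus B eps) (coef (sigma q f)).
  move=> rho rI; apply: cvg_at_le (cf _ rI); first exact: annulus_gt0 rI.
  by move=> i; rewrite coef_sigma vabsM vabsXz vabs_disk11 exp1rz mul1r.
by have [rho rr] := H2 _ cf'; rewrite gnorm_sigma -phZ => H; exists rho.
Qed.

End Continuity.

(** * Structures on a module *)

Section ModuleStructures.
Variables (R : realType) (p : nat) (K : cufield R p) (B : germ_kind).
Local Notation G := (germ K B).
Variables (r : R) (r1 : r <= 1).
Implicit Types (q : disk11 K) (X : lmodType G).
Local Notation fct := (fun k => k`!%:R : K).

Lemma ratio_between q : vabs ((q : K) - 1) < r -> exists2 w : R, 0 < w < r & vabs ((q : K) - 1) <= w.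
Proof.
by move=> qr; exists ((vabs ((q : K) - 1) + r) / 2); have := vabs_ge0 ((q : K) - 1); lra.
Qed.

Lemma transport_basis X (cn : X -> X) n (e : 'I_n -> X) n' (e' : 'I_n' -> X) y x S :
  is_basis e -> is_basis e' -> transport cn e y x S -> transport cn e' y x S.
Proof. by move=> be be'; apply: (transport_lin be be' (f := id)). Qed.

(** The operator is defined by transport in one chosen basis; as transport does not depend on the
    basis, the conditions can be checked in every other one. *)
Lemma Taylor_module q X (cn : X -> X) : vabs ((q : K) - 1) < r ->
  {morph cn : x y / x + y} -> (forall f x, cn (f *: x) = delta1 f *: x + f *: cn x) ->
  (exists n (e : 'I_n -> X), is_basis e) ->
  (forall n (e : 'I_n -> X) M, is_basis e -> is_matrix e cn M ->
    ray_at_one_ge B r (ray (Gseq M) fct)) ->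
  exists s : sigma_delta_module q X, [/\ conn s = cn, sigma_delta_radius_ge r s &
    forall n (e : 'I_n -> X), is_basis e -> forall x, transport cn e ((q : K) - 1) x (sd_sigma s x)].
Proof.
move=> /ratio_between[w wr qw] cnD cnZ free Hray; have [w0 _] := andP wr.
have [n0 [e be]] := free.
have [eps e01 gd] := delta_good be cnD cnZ (mx_ofP be cn) wr r1 (Hray _ _ _ be (mx_ofP be cn)).
pose sg := tr cn e ((q : K) - 1).
have HD : {morph sg : x y / x + y} by move=> x y; exact: (trD cnD cnZ be e01 w0 gd).
have HZ f x : sg (f *: x) = sigma q f *: sg x by exact: (trZ cnD cnZ be e01 w0 gd).
have Hbij : bijective sg by exact: (tr_bij cnD cnZ be e01 w0 gd).
pose s0 := SigmaModule free HD HZ Hbij (semilinear_continuous HD HZ).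
have trs n (e' : 'I_n -> X) : is_basis e' ->
    forall x, transport cn e' ((q : K) - 1) x (sg x).
  move=> be' x; apply: (transport_basis be be').
  exact: (trP cnD cnZ be e01 w0 gd).
exists (SigmaDeltaModule s0 cnD cnZ); split=> //.
move=> n e' A M be' /= eA eM; split; first exact: Hray eM.
have [eps' e01' gd'] := delta_good be' cnD cnZ eM wr r1 (Hray _ _ _ be' eM).
exact: (Taylor_solves cnD cnZ be' eM e01' w0 gd' qw eA (fun i => trs _ _ be' (e' i))).
Qed.

Section SigmaDelta.
Variables (q : disk11 K) (X : lmodType G) (s : sigma_delta_module q X).
Hypothesis Hs : sigma_delta_radius_ge r s.
Hypothesis qr : vabs ((q : K) - 1) < r.
Variables (n : nat) (e : 'I_n -> X) (be : is_basis e).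

Lemma conn_ray M : is_matrix e (conn s) M -> ray_at_one_ge B r (ray (Gseq M) fct).
Proof. by move=> eM; have [] := Hs be (mx_ofP be (sd_sigma s)) eM. Qed.

Lemma conn_goodP w : 0 < w < r -> exists2 eps : R, 0 < eps < 1 & conn_good (conn s) e eps w.
Proof.
move=> wr; have eM := mx_ofP be (conn s).
exact: (delta_good be (@connD _ _ _ _ _ _ s) (@conn_leibniz _ _ _ _ _ _ s) eM wr r1 (conn_ray eM)).
Qed.

Lemma sigma_trE w eps : 0 < w -> vabs ((q : K) - 1) <= w -> 0 < eps < 1 ->
  conn_good (conn s) e eps w -> forall x, sd_sigma s x = tr (conn s) e ((q : K) - 1) x.
Proof.
move=> w0 qw e01 gd; have eM := mx_ofP be (conn s); have eA := mx_ofP be (sd_sigma s).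
apply: (sigma_is_transport (@connD _ _ _ _ _ _ s) (@conn_leibniz _ _ _ _ _ _ s) be eM e01 w0 gd qw eA).
- exact: sgD.
- exact: sgZ.
exact: (Hs be eA eM).2.
Qed.

Lemma sd_transport x : transport (conn s) e ((q : K) - 1) x (sd_sigma s x).
Proof.
have [w wr qw] := ratio_between qr; have [w0 _] := andP wr; have [eps e01 gd] := conn_goodP wr.
rewrite (sigma_trE w0 qw e01 gd).
exact: (trP (@connD _ _ _ _ _ _ s) (@conn_leibniz _ _ _ _ _ _ s) be e01 w0 gd).
Qed.

Hypothesis nroot : not_ppower_root p (q : K).

Lemma sd_difq x : xlimG e (fun j => difq q (sd_sigma s) j x) (conn s x).
Proof.
have [w wr qw] := ratio_between qr; have [w0 _] := andP wr; have [eps e01 gd] := conn_goodP wr.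
exact: (difq_conn nroot be e01 w0 qw (@connD _ _ _ _ _ _ s) (@conn_leibniz _ _ _ _ _ _ s) gd
  (sigma_trE w0 qw e01 gd)).
Qed.

Lemma sd_ray A : is_matrix e (sd_sigma s) A ->
  ray_defined (q : K) (Hseq q A) (qfact (q : K)) /\
  ray_at_one_ge B r (ray (Hseq q A) (qfact (q : K))).
Proof.
move=> eA; have eM := mx_ofP be (conn s).
have [w wr qw] := ratio_between qr; have [w0 _] := andP wr; have [eps e01 gd] := conn_goodP wr.
have cD := @connD _ _ _ _ _ _ s; have cZ := @conn_leibniz _ _ _ _ _ _ s.
have [e1 e101 [S1 E]] := ray_conn_sigma cD cZ be e01 w0 gd qw (sigma_trE w0 qw e01 gd) nroot eM eA.
split; last exact: ray_at_one_eq e101 E (conn_ray eM).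
have [e2 e201 H2] := Gseq_annulus (mx_of e (conn s)).
have [e3 e301 [S3 S4]] := annulus_sub B e101 e201.
(* The ratio [s0] exceeds [w >= |q - 1|], which makes the inequality strict on a whole annulus. *)
have P rho : annulus B e3 rho -> ((vabs ((q : K) - 1) * rho)%R%:E <
    rad_liminf (Hseq q A) (qfact (q : K)) rho)%E.
  move=> rI; have r0 := annulus_gt0 e301 rI; have [D D0 HD] := H2 _ (S4 _ rI).
  have [C [s0 [C0 /andP[ws s1] H]]] := gd _ (S1 _ (S3 _ rI)).
  have s01 : 0 < s0 <= 1 by rewrite (lt_trans w0 ws).
  have := ray_gt cD cZ be eM r0 C0 s01 (fun k i j => (HD k i j).1) H.
  rewrite (E _ (S3 _ rI)) => le1.
  apply: (@lt_le_trans _ _ (s0 * rho)%:E); first by rewrite lte_fin ltr_pM2r// (le_lt_trans qw ws).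
  by apply: le_trans le1 _; rewrite /ray ge_min lexx orbT.
exact: annulus_defined e301 P.
Qed.

End SigmaDelta.

Section Sigma.
Variables (q : disk11 K) (X : lmodType G) (s : sigma_module q X).
Hypothesis Hs : sigma_radius_ge r s.
Hypothesis qr : vabs ((q : K) - 1) < r.
Hypothesis nroot : not_ppower_root p (q : K).

Lemma sigma_theta_good n (e : 'I_n -> X) w : is_basis e -> 0 < w < r ->
  exists2 eps : R, 0 < eps < 1 & theta_good e q s eps w.
Proof.
move=> be wr; have eA := mx_ofP be s.
exact: (sigma_good be (sgD s) (sgZ s) nroot eA wr r1 (Hs be eA).2).
Qed.

Lemma sigma_delta_ex : exists2 t : sigma_delta_module q X, sd_sigma t = s &
  sigma_delta_radius_ge r t.
Proof.
have [w wr qw] := ratio_between qr; have [w0 _] := andP wr; have [n [e be]] := sg_free s.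
have [eps e01 tg] := sigma_theta_good be wr.
have [cn [cnD cnZ gd sE]] := conn_of_sigma nroot be e01 w0 qw (sgD s) (sgZ s) tg.
exists (SigmaDeltaModule s cnD cnZ) => //.
move=> n' e' A M be' /= eA eM.
have [eps' e01' tg'] := sigma_theta_good be' wr.
(* The radius condition quantifies over all bases, while [cn] was built from [e]. Building it again
   from [e'] gives the same operator, since both are limits of the same difference quotients of
   [s]. *)
have [cn' [cnD' cnZ' gd' sE']] := conn_of_sigma nroot be' e01' w0 qw (sgD s) (sgZ s) tg'.
have Ecn : cn' = cn.
  apply/funext => x; apply: (@xlimG_uniq _ _ _ _ _ _ e' be' (fun j => difq q s j x)).
    exact: (difq_conn nroot be' e01' w0 qw cnD' cnZ' gd' sE').
  apply: (difq_lin be be' (f := id)) => //.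
  exact: (difq_conn nroot be e01 w0 qw cnD cnZ gd sE).
rewrite {cnD' cnZ'}Ecn in gd' sE'.
split.
  have [e1 e101 [S1 E]] := ray_conn_sigma cnD cnZ be' e01' w0 gd' qw sE' nroot eM eA.
  by apply: ray_at_one_eq e101 _ (Hs be' eA).2 => rho /E.
apply: (Taylor_solves cnD cnZ be' eM e01' w0 gd' qw eA) => i; rewrite sE'.
exact: (trP cnD cnZ be' e01' w0 gd').
Qed.

End Sigma.
End ModuleStructures.

(** * Transport as the value of a generic Taylor solution *)

Section Series.
Variables (R : realType) (p : nat) (K : cufield R p) (B : germ_kind).
Local Notation G := (germ K B).

Lemma gnorm_cvg0 (u : nat -> G) rho : ncvg (gle rho) u 0 ->
  Defs.gnorm rho (u N) @[N --> \oo] --> (0 : \bar R)%E.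
Proof.
move=> Hu; have ge N : (0 <= Defs.gnorm rho (u N))%E.
  apply: le_trans (ereal_sup_ubound _); last by exists 0.
  by rewrite lee_fin expr0z mulr1 vabs_ge0.
have le (e : R) : 0 < e -> exists N : nat, forall n, (N <= n)%N ->
    (Defs.gnorm rho (u n) <= e%:E)%E.
  move=> e0; have [N HN] := Hu e e0; exists N => n /HN; rewrite subr0 => -[_ H].
  by apply: ge_ereal_sup => _ [i _ <-]; rewrite lee_fin.
apply/fine_cvgP; split.
  have [N HN] := le 1 ltr01; exists N => // n /= /HN H.
  by rewrite ge0_fin_numE// (le_lt_trans H)// ltry.
apply/cvgrPdist_le => e e0; have [N HN] := le e e0; exists N => // n /= /HN H.
rewrite sub0r normrN ger0_norm ?fine_ge0// -lee_fin fineK//.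
by rewrite ge0_fin_numE// (le_lt_trans H)// ltry.
Qed.

Lemma series_of_xlimG (X : lmodType G) n (e : 'I_n -> X) (v : nat -> X) S j : is_basis e ->
  xlimG e (fun N => \sum_(k < N) v k) S ->
  is_series (fun k => ecoord e (v k) 0 j) (ecoord e S 0 j).
Proof.
move=> be [eps e01 H]; exists eps => //; split.
- move=> k rho rI; have r0 := annulus_gt0 e01 rI; have [fU _ _] := H _ rI.
  have -> : v k = \sum_(l < k.+1) v l - \sum_(l < k) v l by rewrite big_ord_recr /= [RHS]addrC addKr.
  have [c [_ Hc]] := xfinD be r0 (fU k.+1) (xfinN be r0 (fU k)).
  by have [] := Hc j.
- by move=> rho /H[_ [c [_ Hc]] _]; have [] := Hc j.
move=> rho rI; have [_ _ HS] := H _ rI.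
apply: (@gnorm_cvg0 (fun N => \sum_(k < N) ecoord e (v k) 0 j - ecoord e S 0 j)) => d d0.
have [N HN] := HS d d0; exists N => m /HN[_ /(_ j)].
by rewrite ecoordB// ecoord_sum// !mxE summxE subr0.
Qed.

End Series.

Section TaylorValues.
Variables (R : realType) (p : nat) (K : cufield R p) (B : germ_kind).
Local Notation G := (germ K B).
Variables (X : lmodType G) (cn : X -> X).
Hypothesis cnD : {morph cn : x y / x + y}.
Hypothesis cnZ : forall f x, cn (f *: x) = delta1 f *: x + f *: cn x.
Variables (n : nat) (e : 'I_n -> X).
Hypothesis be : is_basis e.
Variables (q' : disk11 K) (sg' : X -> X) (S : 'M[G]_n).
Hypothesis eS : is_matrix e sg' S.
Hypothesis Hsg : forall i, transport cn e ((q' : K) - 1) (e i) (sg' (e i)).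

Lemma transport_Taylor_value M : is_matrix e cn M -> Taylor_value q' M S.
Proof.
move=> eM i j; have := series_of_xlimG
  (v := fun k => gcst B (((q' : K) - 1) ^+ k) *: bin_conn cn k (e i)) j be (Hsg i); rewrite (is_matrixE be _ _ eS).
congr (is_series _ _); apply/funext => k.
rewrite ecoordZ// mxE (ecoord_bin_conn cnD cnZ be eM).
have -> : gcst B (q' : K) * gT K B - gT K B = gcst B ((q' : K) - 1) * gT K B.
  by rewrite gcstB mulrBl /gcst mul1r.
rewrite exprMn -gcstX gTX /gcst.
have -> : gmono B (k`!%:R : K)^-1 k%:Z = gmono B (k`!%:R : K)^-1 0 * gmono B (1 : K) k%:Z.
  by rewrite gmonoM mulr1 add0r.
ring.
Qed.

Variables (q : disk11 K) (sg : X -> X) (A : 'M[G]_n).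
Hypothesis nroot : not_ppower_root p (q : K).
Hypothesis eA : is_matrix e sg A.

(** [q' T - q^i T = ((q' - 1) - (q^i - 1)) T]: up to [T^k], q-shifted powers are Newton polynomials
    at the nodes [q^i - 1]. *)
Lemma qshift_newton k : qshift q (gcst B (q' : K) * gT K B) (gT K B) k =
  gcst B (newton (qpow q) k ((q' : K) - 1)) * gT K B ^+ k.
Proof.
have -> : gT K B ^+ k = \prod_(i < k) gT K B by rewrite prodr_const card_ord.
rewrite /qshift /newton gcst_prod -big_split /=.
apply: eq_bigr => i _; rewrite -mulrBl -gcstB; congr (gcst B _ * _); rewrite /qpow; ring.
Qed.

Variables (w eps : R) (w0 : 0 < w) (e01 : 0 < eps < 1).
Hypothesis qw : vabs ((q : K) - 1) <= w.
Hypothesis qw' : vabs ((q' : K) - 1) <= w.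
Hypothesis Hgood : conn_good cn e eps w.
Hypothesis sgE : forall x, sg x = tr cn e ((q : K) - 1) x.

(** By [qTaylor_sum], transport by [q' - 1] along the connection is also the Newton series of
    [theta], whose coordinates are the terms of the q-Taylor solution. *)
Lemma transport_qTaylor_value : qTaylor_value q q' A S.
Proof.
have sgD := sg_trD cnD cnZ be e01 w0 Hgood qw sgE.
have sgZ := sg_trZ cnD cnZ be e01 w0 Hgood qw sgE.
have qroot := disk_root nroot.
move=> i j.
have fe rho : annulus B eps rho -> exists c, xle e rho (e i) c.
  by move=> /(annulus_gt0 e01); exact: basis_fin.
have HS := tr_xsum cnD cnZ be e01 w0 Hgood e01 (fun _ H => H) fe qw'.
rewrite (trE cnD cnZ be e01 w0 Hgood qw' (Hsg i)) in HS.
have HT := qTaylor_sum sgD sgZ qroot be e01 w0 qw (conn_geo cnD cnZ be e01 w0 Hgood i)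
  (fun m => iter_sg_xsum cnD cnZ be e01 w0 Hgood qw sgE m i) qw' HS.
have := series_of_xlimG (v := fun k => gcst B (newton (qpow q) k ((q' : K) - 1)) *: theta q sg k (e i))
  j be (ex_intro2 _ _ eps e01 HT); rewrite (is_matrixE be _ _ eS).
congr (is_series _ _); apply/funext => k.
rewrite ecoordZ// mxE (ecoord_theta sgD sgZ qroot be eA) qshift_newton gTX /gcst.
have -> : gmono B (qfact (q : K) k)^-1 k%:Z = gmono B (qfact (q : K) k)^-1 0 * gmono B (1 : K) k%:Z.
  by rewrite gmonoM mulr1 add0r.
ring.
Qed.

End TaylorValues.

(** * Functors over the category of modules *)

Section OverEquivalence.
Variables (A : nzRingType).
Implicit Types (S T U : modcat A).

Definition over_comp S T U (F : over_functor T U) (F' : over_functor S T) :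
    over_functor S U :=
  OverFunctor (over_str := fun X s => over_str F (over_str F' s))
    (fun X Y s t f lf m => over_mor F lf (over_mor F' lf m)).

Lemma over_nat_iso S T (F : over_functor S T) (F' : over_functor T S) :
  (forall X (s : mstr S X), mmor (over_str F' (over_str F s)) s (fun x => x)) ->
  (forall X (s : mstr S X), mmor s (over_str F' (over_str F s)) (fun x => x)) ->
  nat_iso (functor_comp (functor_of_over F') (functor_of_over F))
    (functor_id (cat_of_modcat S)).
Proof.
move=> H H'; have lid (X : lmodType A) : linear (fun x : X => x) by [].
exists (fun a : mobj S => exist _ (fun x => x) (conj (lid _) (H _ (tagged a))) :
  mhom (over_obj F' (over_obj F a)) a).
split=> [a b f|a]; first exact: mhom_eq.
exists (exist _ (fun x => x) (conj (lid _) (H' _ (tagged a))) :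
  mhom a (over_obj F' (over_obj F a))).
by split; exact: mhom_eq.
Qed.

Lemma over_equiv S T (F : over_functor S T) (F' : over_functor T S) :
  (forall X (s : mstr S X), mmor (over_str F' (over_str F s)) s (fun x => x)) ->
  (forall X (s : mstr S X), mmor s (over_str F' (over_str F s)) (fun x => x)) ->
  (forall X (s : mstr T X), mmor (over_str F (over_str F' s)) s (fun x => x)) ->
  (forall X (s : mstr T X), mmor s (over_str F (over_str F' s)) (fun x => x)) ->
  is_equivalence (functor_of_over F).
Proof. by move=> *; exists (functor_of_over F'); split; exact: over_nat_iso. Qed.

(* The identity of the underlying module is an isomorphism from [F' (F s)] to [s]. *)
Definition over_inv S T (F : over_functor S T) (F' : over_functor T S) : Prop :=
  forall X (s : mstr S X), mmor (over_str F' (over_str F s)) s (fun x => x) /\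
    mmor s (over_str F' (over_str F s)) (fun x => x).

Lemma over_inv_comp S T U (F : over_functor S T) (F' : over_functor T S)
    (H : over_functor T U) (H' : over_functor U T) :
  over_inv F F' -> over_inv H H' -> over_inv (over_comp H F) (over_comp F' H').
Proof.
move=> FF HH X s; have lid : linear (fun x : X => x) by [].
have [h h'] := HH X (over_str F s); have [f f'] := FF X s; split.
  exact: mmor_comp f (over_mor F' lid h).
exact: mmor_comp (over_mor F' lid h') f'.
Qed.

Lemma over_inv_equiv S T (F : over_functor S T) (F' : over_functor T S) :
  over_inv F F' -> over_inv F' F -> is_equivalence (functor_of_over F).
Proof.
by move=> FF FF'; apply: (over_equiv (F' := F')) => X s;
  [have [] := FF X s|have [] := FF X s|have [] := FF' X s|have [] := FF' X s].
Qed.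

End OverEquivalence.

(** * Deformation, forgetting and recovering the connection *)

Section Functors.
Variables (R : realType) (p : nat) (K : cufield R p) (B : germ_kind).
Local Notation G := (germ K B).
Variables (r : R) (r1 : r <= 1).
Implicit Types (q : disk11 K) (X Y : lmodType G).

Section Deformation.
Variables (q q' : disk11 K).
Hypothesis qr' : vabs ((q' : K) - 1) < r.

Lemma def_ex X (s : mstr (sigma_delta_mod B q r) X) :
  exists t : mstr (sigma_delta_mod B q' r) X, conn (sval t) = conn (sval s) /\
    forall n (e : 'I_n -> X), is_basis e -> forall x,
      transport (conn (sval s)) e ((q' : K) - 1) x (sd_sigma (sval t) x).
Proof.
case: s => s Hs /=.
have [t [Et Ht trt]] := @Taylor_module R p K B r r1 q' X (conn s) qr' (@connD _ _ _ _ _ _ s)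
  (@conn_leibniz _ _ _ _ _ _ s) (sg_free (sd_sigma s)) (fun n e M be eM => conn_ray Hs be eM).
by exists (exist _ t Ht).
Qed.

Definition def_str X (s : mstr (sigma_delta_mod B q r) X) : mstr (sigma_delta_mod B q' r) X :=
  projT1 (cid (def_ex s)).

Lemma def_conn X (s : mstr (sigma_delta_mod B q r) X) :
  conn (sval (def_str s)) = conn (sval s).
Proof. exact: (projT2 (cid (def_ex s))).1. Qed.

Lemma def_transport X (s : mstr (sigma_delta_mod B q r) X) n (e : 'I_n -> X) x :
  is_basis e ->
  transport (conn (sval s)) e ((q' : K) - 1) x (sd_sigma (sval (def_str s)) x).
Proof. by move=> be; exact: (projT2 (cid (def_ex s))).2. Qed.

(** A linear map commuting with the connections carries the transport series to the transport series
    term by term, and preserves limits. *)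
Lemma def_mor X Y (s : mstr (sigma_delta_mod B q r) X) (t : mstr (sigma_delta_mod B q r) Y)
  (f : X -> Y) : linear f -> mmor s t f -> mmor (def_str s) (def_str t) f.
Proof.
move=> lf [_ fc]; split=> x; last by rewrite !def_conn; exact: fc.
have [n [e be]] := sg_free (sd_sigma (sval s)).
have [m [e' be']] := sg_free (sd_sigma (sval t)).
apply: (transport_uniq be' (transport_lin be be' lf fc (def_transport s x be))).
exact: def_transport.
Qed.

Definition def_functor : over_functor (sigma_delta_mod B q r) (sigma_delta_mod B q' r) :=
  OverFunctor def_mor.

Lemma def_functorP : is_sigma_delta_DefTay def_functor.
Proof.
move=> X s; split; first exact: def_conn.
move=> n e M S be eM eS.
apply: (transport_Taylor_value (@connD _ _ _ _ _ _ (sval s)) (@conn_leibniz _ _ _ _ _ _ (sval s))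
  be eS _ eM) => i.
exact: def_transport.
Qed.

End Deformation.

(** Deformation keeps the connection, and by [sd_transport] the original operator is the transport
    by [q - 1] along it; deforming back restores exactly this transport. *)
Lemma def_inv q q' (qr : vabs ((q : K) - 1) < r) (qr' : vabs ((q' : K) - 1) < r) :
  over_inv (def_functor q qr') (def_functor q' qr).
Proof.
move=> X s; pose t := def_str qr' s.
have E x : sd_sigma (sval (def_str qr t)) x = sd_sigma (sval s) x.
  have [n [e be]] := sg_free (sd_sigma (sval s)).
  have H1 := def_transport qr t x be; rewrite def_conn in H1.
  exact: (transport_uniq be H1 (sd_transport r1 (svalP s) qr be x)).
by split; split=> x; rewrite /= ?E ?def_conn.
Qed.

Section Forget.
Variable q : disk11 K.
Hypothesis qr : vabs ((q : K) - 1) < r.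
Hypothesis nroot : not_ppower_root p (q : K).

Lemma forget_radius X (s : mstr (sigma_delta_mod B q r) X) :
  sigma_radius_ge r (sd_sigma (sval s)).
Proof. by move=> n e A be eA; exact: (sd_ray r1 (svalP s) qr be nroot eA). Qed.

Definition forget_str X (s : mstr (sigma_delta_mod B q r) X) : mstr (sigma_mod B q r) X :=
  exist _ (sd_sigma (sval s)) (@forget_radius X s).

Definition forget_functor : over_functor (sigma_delta_mod B q r) (sigma_mod B q r) :=
  OverFunctor (over_str := forget_str) (fun X Y s t f lf m => m.1).

Lemma connect_ex X (s : mstr (sigma_mod B q r) X) :
  exists t : mstr (sigma_delta_mod B q r) X, sd_sigma (sval t) = sval s.
Proof.
case: s => s Hs /=; have [t Et Ht] := sigma_delta_ex r1 Hs qr nroot.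
by exists (exist _ t Ht).
Qed.

Definition connect_str X (s : mstr (sigma_mod B q r) X) : mstr (sigma_delta_mod B q r) X :=
  projT1 (cid (connect_ex s)).

Lemma connect_sigma X (s : mstr (sigma_mod B q r) X) : sd_sigma (sval (connect_str s)) = sval s.
Proof. exact: (projT2 (cid (connect_ex s))). Qed.

(* The connection is the limit of [(sigma_q^(p^j) - 1) / (q^(p^j) - 1)], so maps
   which commute with [sigma_q] commute with it. *)
Lemma sigma_mor_conn X Y (s : mstr (sigma_delta_mod B q r) X)
  (t : mstr (sigma_delta_mod B q r) Y) (f : X -> Y) : linear f ->
  (forall x, f (sd_sigma (sval s) x) = sd_sigma (sval t) (f x)) -> mmor s t f.
Proof.
move=> lf fs; split=> // x.
have [n [e be]] := sg_free (sd_sigma (sval s)).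
have [m [e' be']] := sg_free (sd_sigma (sval t)).
apply: (xlimG_uniq be' (difq_lin be be' lf fs (sd_difq r1 (svalP s) qr be nroot x))).
exact: (sd_difq r1 (svalP t) qr be' nroot).
Qed.

Lemma connect_mor X Y (s : mstr (sigma_mod B q r) X) (t : mstr (sigma_mod B q r) Y)
  (f : X -> Y) : linear f -> mmor s t f -> mmor (connect_str s) (connect_str t) f.
Proof. by move=> lf m; apply: sigma_mor_conn => // x; rewrite !connect_sigma; exact: m. Qed.

Definition connect_functor : over_functor (sigma_mod B q r) (sigma_delta_mod B q r) :=
  OverFunctor connect_mor.

Lemma forget_inv : over_inv forget_functor connect_functor.
Proof. by move=> X s; split; apply: sigma_mor_conn => // x; rewrite connect_sigma. Qed.

Lemma connect_inv : over_inv connect_functor forget_functor.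
Proof. by move=> X s; split=> x; rewrite /= connect_sigma. Qed.

End Forget.

Lemma def_sigmaP q q' (qr : vabs ((q : K) - 1) < r) (qr' : vabs ((q' : K) - 1) < r)
  (nroot : not_ppower_root p (q : K)) (nroot' : not_ppower_root p (q' : K)) :
  is_sigma_DefTay (over_comp (forget_functor qr' nroot')
    (over_comp (def_functor q qr') (connect_functor qr nroot))).
Proof.
move=> X s n e A S be eA eS; pose t := connect_str qr nroot s.
(* One [w] above both [|q - 1|] and [|q' - 1|]: the Newton series has its nodes at the [q^n - 1] and
   is evaluated at [q' - 1]. *)
have [w wr qw] : exists2 w : R, 0 < w < r &
    Num.max (vabs ((q : K) - 1)) (vabs ((q' : K) - 1)) <= w.
  pose m := Num.max (vabs ((q : K) - 1)) (vabs ((q' : K) - 1)).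
  have m0 : 0 <= m by rewrite le_max vabs_ge0.
  have mr : m < r by rewrite gt_max qr.
  by exists ((m + r) / 2); rewrite -/m; lra.
have [w0 _] := andP wr; move: qw; rewrite ge_max => /andP[qw qw'].
have [eps e01 gd] := conn_goodP r1 (svalP t) be wr.
have tE := sigma_trE (svalP t) be w0 qw e01 gd.
rewrite -(connect_sigma qr nroot s) in eA.
apply: (transport_qTaylor_value (@connD _ _ _ _ _ _ (sval t)) (@conn_leibniz _ _ _ _ _ _ (sval t))
  be eS _ nroot eA w0 e01 qw qw' gd tE) => i.
exact: def_transport.
Qed.

End Functors.

Theorem corollary7p14 (R : realType) (p : nat) (K : cufield R p)
    (B : germ_kind) (q q' : disk11 K) (r : R) :
  (not_ppower_root p (q : K) -> not_ppower_root p (q' : K) ->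
   Num.max (vabs ((q : K) - 1)) (vabs ((q' : K) - 1)) < r -> r <= 1 ->
   exists F : over_functor (sigma_mod B q r) (sigma_mod B q' r),
     is_sigma_DefTay F /\ is_equivalence (functor_of_over F)) /\
  (Num.max (vabs ((q : K) - 1)) (vabs ((q' : K) - 1)) < r -> r <= 1 ->
   exists F : over_functor (sigma_delta_mod B q r) (sigma_delta_mod B q' r),
     is_sigma_delta_DefTay F /\ is_equivalence (functor_of_over F)) /\
  (not_ppower_root p (q : K) -> vabs ((q : K) - 1) < r -> r <= 1 ->
   exists F : over_functor (sigma_delta_mod B q r) (sigma_mod B q r),
     is_forget_delta F /\ is_equivalence (functor_of_over F)).
Proof.
split=> [nroot nroot'|]; last split=> [|nroot qr r1].
- rewrite gt_max => /andP[qr qr'] r1.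
  exists (over_comp (forget_functor B r1 qr' nroot')
    (over_comp (def_functor B r1 q qr') (connect_functor B r1 qr nroot))).
  split; first exact: def_sigmaP.
  (* The inverse is the same composite with [q] and [q'] exchanged, up to association. *)
  apply: (@over_inv_equiv _ _ _ _ (over_comp (over_comp (forget_functor B r1 qr nroot)
    (def_functor B r1 q' qr)) (connect_functor B r1 qr' nroot'))).
    apply: over_inv_comp; last exact: forget_inv.
    by apply: over_inv_comp; [exact: connect_inv|exact: def_inv].
  apply: over_inv_comp; first exact: connect_inv.
  by apply: over_inv_comp; [exact: def_inv|exact: forget_inv].
- rewrite gt_max => /andP[qr qr'] r1; exists (def_functor B r1 q qr').
  split; first exact: def_functorP.
  by apply: (@over_inv_equiv _ _ _ _ (def_functor B r1 q' qr)); exact: def_inv.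
exists (forget_functor B r1 qr nroot); split=> //.
by apply: (@over_inv_equiv _ _ _ _ (connect_functor B r1 qr nroot)); [exact: forget_inv|exact: connect_inv].
Qed.
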